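(* Consider the stochastic volatility model $X_{it}=\sigma_{it}Z_{it}$ and fix $p\ge1$. Assume: (1) $Z$ is regularly varying with index $\alpha\in(0,4)\setminus\{2\}$ (in the sense $\mathbb P(Z>x)\sim p_+L(x)x^{-\alpha}$, $\mathbb P(Z<-x)\sim p_-L(x)x^{-\alpha}$, $p_++p_-=1$, $L$ slowly varying); (2) the $\mathbb R^p$-valued sequence $((\sigma_{1t},\dots,\sigma_{pt}))_{t=1,2,\dots}$ is strongly mixing with rate function $(\alpha_h)$ such that $\sum_{h=0}^\infty \alpha_h^{\delta/(2+\delta)}<\infty$ for some $\delta>0$; (3) $\mathbb E[\sigma^{2\max(2+\delta,\alpha+\epsilon)}]<\infty$ for the same $\delta$ and some $\epsilon>0$. Then $$a_n^{-2}\big(S_1-c_n,\dots,S_p-c_n\big)\xrightarrow{d}(\xi_{1,\alpha/2},\dots,\xi_{p,\alpha/2}),$$ where $\xi_{1,\alpha/2},\dots,\xi_{p,\alpha/2}$ are iid $\alpha/2$-stable random variables totally skewed to the right, $c_n=0$ if $\alpha\in(0,2)$ and $c_n=n\,\mathbb E[X^2]$ if $\alpha\in(2,4)$, and $(a_n)$ satisfies $n\,\mathbb P(|X|>a_n)\to1$.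
   Context: Stochastic volatility model: $X_{it}=\sigma_{it}Z_{it}$, $i,t\in\mathbb Z$, with $(Z_{it})$ an iid random field independent of a strictly stationary ergodic field $(\sigma_{it})$ of non-negative random variables; $Z,\sigma,X$ denote generic elements. For $n\ge1$, $S_{ij}=\sum_{t=1}^n X_{it}X_{jt}$ and $S_i=S_{ii}$, $1\le i,j\le p$ (entries of the non-normalized sample covariance matrix $\mathbf X^n(\mathbf X^n)'$ where $\mathbf X^n=(X_{it})_{1\le i\le p,1\le t\le n}$). *)

(* Defs.v *)
From HB Require Import structures.
From mathcomp Require Import all_boot all_order all_algebra.
From mathcomp Require Import all_classical all_reals all_analysis.
Set Implicit Arguments. Unset Strict Implicit. Unset Printing Implicit Defensive.
Import Order.TTheory GRing.Theory Num.Theory.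
Import numFieldNormedType.Exports.
Local Open Scope classical_set_scope.
Local Open Scope ring_scope.

Section SV.
Context {d : measure_display} {T : measurableType d} {R : realType}
  (P : probability T R).

Definition path (s : int -> int -> T -> R) (w : T) : int -> int -> R :=
  fun i t => s i t w.

Definition cylinders : set (set (int -> int -> R)) :=
  [set A | exists i t (B : set R), measurable B /\ A = [set f | B (f i t)]].

Definition path_measurable (A : set (int -> int -> R)) : Prop := <<s cylinders >> A.

Definition shift_i (f : int -> int -> R) : int -> int -> R := fun i t => f (i + 1) t.
Definition shift_t (f : int -> int -> R) : int -> int -> R := fun i t => f i (t + 1).

Definition strictly_stationary (s : int -> int -> T -> R) : Prop :=
  forall (h1 h2 : int) (A : set (int -> int -> R)), path_measurable A ->
    P (path s @^-1` A) = P ((fun w i t => s (i + h1) (t + h2) w) @^-1` A).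

Definition ergodic (s : int -> int -> T -> R) : Prop :=
  forall A : set (int -> int -> R), path_measurable A ->
    shift_i @^-1` A = A -> shift_t @^-1` A = A ->
    P (path s @^-1` A) = 0%E \/ P (path s @^-1` A) = 1%E.

Definition iid_indep_of (Z s : int -> int -> T -> R) : Prop :=
  forall (l : seq (int * int)) (B : int * int -> set R),
    uniq l -> (forall k, measurable (B k)) ->
    forall A : set (int -> int -> R), path_measurable A ->
      fine (P ((\bigcap_(k in [set k | k \in l]) (Z k.1 k.2 @^-1` B k))
               `&` (path s @^-1` A))) =
      (\prod_(k <- l) fine (P (Z 0 0 @^-1` B k))) * fine (P (path s @^-1` A)).

Definition slowly_varying (L : R -> R) : Prop :=
  measurable_fun setT L /\ (\forall x \near +oo, 0 < L x) /\
  forall c : R, 0 < c -> (fun x => L (c * x) / L x) @ +oo --> (1 : R).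

Definition regularly_varying (Y : T -> R) (alpha : R) : Prop :=
  exists (pp pm : R) (L : R -> R),
    0 <= pp /\ 0 <= pm /\ pp + pm = 1 /\ slowly_varying L /\
    (fun x => fine (P [set w | x < Y w]) / (L x * x `^ (- alpha))) @ +oo --> pp /\
    (fun x => fine (P [set w | Y w < - x]) / (L x * x `^ (- alpha))) @ +oo --> pm.

Definition gen_sigma (s : int -> int -> T -> R) (p : nat) (J : set int) : set (set T) :=
  <<s [set E | exists (i t : int) (B : set R),
         (1 <= i <= p%:Z) /\ J t /\ measurable B /\ E = s i t @^-1` B] >>.

Definition strongly_mixing_rate (s : int -> int -> T -> R) (p : nat) (a : nat -> R) : Prop :=
  (forall h, 0 <= a h) /\
  forall (k h : nat) (E F : set T), (1 <= k)%N ->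
    gen_sigma s p [set t | 1 <= t <= k%:Z] E ->
    gen_sigma s p [set t | (k + h)%:Z <= t] F ->
    `| fine (P (E `&` F)) - fine (P E) * fine (P F) | <= a h.

(** Characteristic-function description of a beta-stable law totally skewed to the
    right (beta <> 1), with scale parameter c = gamma^beta > 0 and location mu:
    E exp(i t Y) = exp(i mu t - c |t|^beta (1 - i sgn(t) tan(pi beta / 2))),
    written out as real and imaginary parts. *)
Definition stable_right_chf {d' : measure_display} {T' : measurableType d'}
    (Q : probability T' R) (Y : T' -> R) (beta c mu : R) : Prop :=
  forall t : R,
    let th := mu * t + c * (Num.sg t * `|t| `^ beta) * tan (pi * beta / 2) in
    Rintegral Q setT (fun w => cos (t * Y w)) = expR (- c * `|t| `^ beta) * cos th /\
    Rintegral Q setT (fun w => sin (t * Y w)) = expR (- c * `|t| `^ beta) * sin th.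

Definition iid_stable_right {d' : measure_display} {T' : measurableType d'}
    (Q : probability T' R) (p : nat) (xi : 'I_p -> T' -> R) (beta : R) : Prop :=
  (forall i, measurable_fun setT (xi i)) /\
  (forall B : 'I_p -> set R, (forall i, measurable (B i)) ->
     fine (Q (\bigcap_(i in setT) (xi i @^-1` B i))) =
     \prod_(i < p) fine (Q (xi i @^-1` B i))) /\
  exists c mu : R, 0 < c /\ forall i, stable_right_chf Q (xi i) beta c mu.

Definition cvg_in_distribution {d' : measure_display} {T' : measurableType d'}
    (Q : probability T' R) (p : nat) (Y : nat -> T -> 'rV[R]_p) (xi : 'I_p -> T' -> R) : Prop :=
  forall f : 'rV[R]_p -> R, continuous f -> (exists M, forall v, `|f v| <= M) ->
    (fun n => Rintegral P setT (fun w => f (Y n w))) @ \oo -->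
      Rintegral Q setT (fun w => f (\row_i xi i w)).

End SV.

(* Main.v *)
(** Given the volatilities, the squares [X_it^2 = sigma_it^2 Z_it^2] are independent, so
    the joint characteristic function of the normalized sums is the mean of a product of
    factors [q_n (theta_i sigma_it^2)], where [q_n v] is the characteristic function of
    [v Z^2 / a_n^2] (centred when [alpha > 2]). By regular variation, Potter bounds and
    Breiman's lemma, [n (1 - q_n v)] tends to the exponent [K v] of a totally skewed
    [alpha/2]-stable law, the constant being a Gamma integral along a rotated half-line.
    Hence the product is close to the exponential of
    [- sum_i K theta_i (n^-1 sum_t sigma_it^alpha)], and strong mixing provides the law of
    large numbers for [sigma_it^alpha] in mean square. For [alpha > 2], replacing the
    conditional centring by [n E X^2] costs [a_n^-2 sum_t (sigma_it^2 - E sigma^2) E Z^2],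
    which vanishes in mean square because [n = o(a_n^4)].

    The stable law is the limit of the marginal distribution functions along an
    ultrafilter, tightness being read off the characteristic functions. Convergence in
    distribution follows since, on a large cube, a bounded continuous function is close to
    a trigonometric polynomial with the same bound: a multivariate Bernstein polynomial in
    the variables [(1 + sin (x_i / B)) / 2]. *)

Require Import Defs.
From HB Require Import structures.
From mathcomp Require Import all_boot all_order all_algebra.
From mathcomp Require Import all_classical all_reals all_analysis.
From mathcomp Require Import measurable_realfun ring lra.
From mathcomp Require Import complex.

Set Implicit Arguments.
Unset Strict Implicit.
Unset Printing Implicit Defensive.
Import Order.TTheory GRing.Theory Num.Theory.
Import numFieldNormedType.Exports.
Local Open Scope classical_set_scope.
Local Open Scope ring_scope.

(** * Expectations of bounded functions *)

(** The position of beta = alpha / 2 relative to 1 governs the analysis. For beta < 1 the integrals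
    of sine and cosine against x^(-beta) converge only conditionally at infinity, so limits pass
    through a truncation of the variable; for beta > 1 the sine is replaced by x - sin x and all
    integrals converge absolutely. An exponent slack [e] in Potter's bounds gives majorants
    separating scale from level; the scale part is integrated against the law of sigma^2, and there
    the moment assumption enters. Covariances under mixing are bounded by truncation at M: at most
    M^2 r for the bounded parts and O(M^(2-q)) for the rest, where q is the order of a finite
    moment. Balancing gives r^(1 - 2/q). For sigma^2 one takes q = 2 + delta, so that the exponent
    is the one in the summability condition and the variance of the sum is O(n). For sigma^alpha, q
    = 2 (alpha + eps) / alpha may give a power that is not summable, but after division by n it is
    enough that its Cesaro means tend to 0. The limit variables and their probability space have to
    be constructed from the limiting characteristic function. *)

Section expectation_calculus.
Context d (T : measurableType d) (R : realType) (mu : {measure set T -> \bar R}).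
Variables (D : set T) (mD : measurable D).
Implicit Types f g h : T -> R.

Local Notation intg f := (mu.-integrable D (EFin \o f)).

Lemma rintD f g : intg f -> intg g -> intg (fun x => f x + g x).
Proof. move=> If Ig; exact: (integrableD mD If Ig). Qed.

Lemma rintB f g : intg f -> intg g -> intg (fun x => f x - g x).
Proof. move=> If Ig; exact: (integrableB mD If Ig). Qed.

Lemma rintZ (k : R) f : intg f -> intg (fun x => k * f x).
Proof. move=> If; exact: (integrableZl mD k If). Qed.

Lemma rint_sum (I : Type) (s : seq I) (h : I -> T -> R) :
  (forall i, intg (h i)) -> intg (fun x => \sum_(i <- s) h i x).
Proof.
move=> Ih; elim: s => [|i s IHs].
  rewrite (_ : (fun _ => _) = cst 0); last by apply/funext => x; rewrite big_nil.
  exact: integrable0.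
rewrite (_ : (fun _ => _) = (fun x => h i x + \sum_(j <- s) h j x)).
  exact: rintD.
by apply/funext => x; rewrite big_cons.
Qed.

Lemma Rintegral_sum (I : Type) (s : seq I) (h : I -> T -> R) :
  (forall i, intg (h i)) ->
  \int[mu]_(x in D) (\sum_(i <- s) h i x) = \sum_(i <- s) \int[mu]_(x in D) h i x.
Proof.
move=> Ih; elim: s => [|i s IHs].
  rewrite big_nil (_ : (fun _ => _) = cst 0); last first.
    by apply/funext => x; rewrite big_nil.
  by rewrite /Rintegral integral0.
rewrite big_cons -IHs -RintegralD //; last exact: rint_sum.
by apply: eq_Rintegral => x _; rewrite big_cons.
Qed.

Lemma rint_le f g : measurable_fun D f -> (forall x, D x -> `|f x| <= g x) ->
  intg g -> intg f.
Proof.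
move=> mf fg Ig; apply: (le_integrable mD _ _ Ig).
  exact/measurable_EFinP.
move=> x Dx /=; rewrite lee_fin (le_trans (fg x Dx))//; exact: ler_norm.
Qed.

Lemma norm_Rintegral_le f g : intg f -> intg g ->
  (forall x, D x -> `|f x| <= g x) ->
  `|\int[mu]_(x in D) f x| <= \int[mu]_(x in D) g x.
Proof.
move=> If Ig fg; apply: (le_trans (le_normr_Rintegral mD If)).
apply: le_Rintegral => //.
by have := integrable_abse If.
Qed.

Lemma dist_Rintegral_le f g h : intg f -> intg g -> intg h ->
  (forall x, D x -> `|f x - g x| <= h x) ->
  `|\int[mu]_(x in D) f x - \int[mu]_(x in D) g x| <= \int[mu]_(x in D) h x.
Proof.
move=> If Ig Ih fgh; rewrite -RintegralB //.
by apply: norm_Rintegral_le => //; exact: rintB.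
Qed.

(** Dominated convergence with a majorant valid only for large [n], as the tail bounds below
    provide; the sequence is shifted past the threshold [N]. *)
Lemma Rintegral_dct (f_ : nat -> T -> R) f g :
  (forall n, measurable_fun D (f_ n)) -> measurable_fun D f ->
  (forall x, D x -> f_ ^~ x @ \oo --> f x) -> intg g ->
  (\forall n \near \oo, forall x, D x -> `|f_ n x| <= g x) ->
  intg f /\ (fun n => \int[mu]_(x in D) f_ n x) @ \oo --> \int[mu]_(x in D) f x.
Proof.
move=> mf_ mf cf Ig [N _ fg].
have [] := @dominated_convergence _ _ _ mu D mD (fun n => EFin \o f_ (n + N)%N)
  (EFin \o f) (EFin \o g).
- by move=> n; exact/measurable_EFinP.
- exact/measurable_EFinP.
- apply: aeW => x Dx; apply: cvg_EFin; first by near=> n.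
  by rewrite -/(comp _ _) (cvg_shiftn N (fun n => f_ n x)); exact: cf.
- exact: Ig.
- by apply: aeW => x n Dx /=; rewrite lee_fin fg//= leq_addl.
- move=> If _ c; split => //.
  rewrite -(cvg_shiftn N).
  by apply: fine_cvg; rewrite fineK //; exact: integrable_fin_num.
Unshelve. all: by end_near.
Qed.

End expectation_calculus.

Section bounded_measurable.
Context d (T : measurableType d) (R : realType).
Implicit Types f g : T -> R.

(** The class on which integrability against any finite measure is automatic ([bmf_int]) and which
    is stable under all operations used below. *)
Definition bmf f := measurable_fun [set: T] f /\ exists M, forall w, `|f w| <= M.

Lemma bmf_cst (k : R) : bmf (fun=> k).
Proof. by split; [exact: measurable_cst|exists `|k|]. Qed.

Lemma bmfD f g : bmf f -> bmf g -> bmf (fun x => f x + g x).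
Proof.
move=> [mf [M fM]] [mg [N gN]]; split; first exact: measurable_funD.
by exists (M + N) => w; rewrite (le_trans (ler_normD _ _))// lerD.
Qed.

Lemma bmfM f g : bmf f -> bmf g -> bmf (fun x => f x * g x).
Proof.
move=> [mf [M fM]] [mg [N gN]]; split; first exact: measurable_funM.
by exists (M * N) => w; rewrite normrM ler_pM.
Qed.

Lemma bmfN f : bmf f -> bmf (fun x => - f x).
Proof.
move=> [mf [M fM]]; split; last by exists M => w; rewrite normrN.
exact: measurable_funN.
Qed.

Lemma bmfB f g : bmf f -> bmf g -> bmf (fun x => f x - g x).
Proof. by move=> bf bg; apply: bmfD => //; exact: bmfN. Qed.

Lemma bmf_sum (I : Type) (s : seq I) (h : I -> T -> R) :
  (forall i, bmf (h i)) -> bmf (fun x => \sum_(i <- s) h i x).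
Proof.
move=> bh; elim: s => [|i s IHs].
  rewrite (_ : (fun _ => _) = (fun=> 0)); first exact: bmf_cst.
  by apply/funext => x; rewrite big_nil.
rewrite (_ : (fun _ => _) = (fun x => h i x + \sum_(j <- s) h j x)).
  exact: bmfD.
by apply/funext => x; rewrite big_cons.
Qed.

Lemma bmf_cos f : measurable_fun setT f -> bmf (fun x => cos (f x)).
Proof.
move=> mf; split; last by exists 1 => w; rewrite ler_norml cos_geN1 cos_le1.
apply: (measurableT_comp _ mf); apply: continuous_measurable_fun.
exact: continuous_cos.
Qed.

Lemma bmf_sin f : measurable_fun setT f -> bmf (fun x => sin (f x)).
Proof.
move=> mf; split; last by exists 1 => w; rewrite ler_norml sin_geN1 sin_le1.
apply: (measurableT_comp _ mf); apply: continuous_measurable_fun.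
exact: continuous_sin.
Qed.

Lemma bmf_indic (A : set T) : measurable A -> bmf (\1_A : T -> R).
Proof.
move=> mA; split; first exact: measurable_indic.
by exists 1 => w; rewrite indicE; case: (_ \in _); rewrite ?normr1 ?normr0.
Qed.

Lemma bmf_int (P : {finite_measure set T -> \bar R}) f :
  bmf f -> P.-integrable setT (EFin \o f).
Proof.
move=> [mf [M fM]]; apply: (@rint_le _ _ _ _ _ measurableT f (fun=> M)) => //.
exact: finite_measure_integrable_cst.
Qed.

Lemma Rintegral_cstT (P : probability T R) (k : R) : \int[P]_w k = k.
Proof. by rewrite Rintegral_cst //= -[RHS]mulr1; congr (_ * _); rewrite probability_setT. Qed.

Lemma Rintegral_indicT (P : probability T R) (A : set T) : measurable A ->
  \int[P]_w \1_A w = fine (P A).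
Proof. by move=> mA; rewrite /Rintegral integral_indic // setIT. Qed.

End bounded_measurable.

Section same_law.
Context d (T : measurableType d) (R : realType) (P : probability T R).
Context d2 (T2 : measurableType d2).

(** Change of variables through the two image measures, which coincide. Nonnegative integrands come
    first, so that integrability is transferred before the signed integrals are compared. *)
Lemma same_law_integral (X Y : T -> T2) (f : T2 -> R) :
  measurable_fun setT X -> measurable_fun setT Y ->
  (forall B, measurable B -> P (X @^-1` B) = P (Y @^-1` B)) ->
  measurable_fun setT f -> P.-integrable setT (EFin \o (f \o X)) ->
  P.-integrable setT (EFin \o (f \o Y)) /\
  \int[P]_w f (X w) = \int[P]_w f (Y w).
Proof.
move=> mX mY XY mf If.
have mEf : measurable_fun setT (EFin \o f) by exact/measurable_EFinP.
have e g : measurable_fun setT g -> (forall y, 0%E <= g y)%E ->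
    (\int[P]_w g (X w) = \int[P]_w g (Y w))%E.
  move=> mg g0.
  have := @ge0_integral_pushforward _ _ _ _ R X mX P setT g measurableT mg (fun y _ => g0 y).
  have := @ge0_integral_pushforward _ _ _ _ R Y mY P setT g measurableT mg (fun y _ => g0 y).
  rewrite !preimage_setT => <- <-.
  by apply: eq_measure_integral => A mA _; exact: XY.
have IY : P.-integrable setT (EFin \o (f \o Y)).
  apply/integrableP; split.
    exact: (measurableT_comp mEf).
  have /integrableP[_] := If; congr (_ < _)%E.
  apply: (e (fun y => `|(EFin \o f) y|%E)) => //.
  exact: measurableT_comp.
split=> //; rewrite /Rintegral; congr fine.
have := @integral_pushforward _ _ _ _ R X mX P setT (EFin \o f) mEf.
rewrite preimage_setT => /(_ If measurableT) <-.
have := @integral_pushforward _ _ _ _ R Y mY P setT (EFin \o f) mEf.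
rewrite preimage_setT => /(_ IY measurableT) <-.
by apply: eq_measure_integral => A mA _; exact: XY.
Qed.

End same_law.

Section product_probability.
Context d1 d2 (T1 : measurableType d1) (T2 : measurableType d2) (R : realType).
Variables (P1 : probability T1 R) (P2 : probability T2 R).

Lemma product_probability_setT : (P1 \x P2)%E [set: T1 * T2] = 1%E.
Proof.
transitivity (P1 setT * P2 setT)%E; first by rewrite -setXTT product_measure1E.
by rewrite !probability_setT mule1.
Qed.

HB.instance Definition _ := Measure_isProbability.Build _ _ _ (P1 \x P2)%E
  product_probability_setT.

End product_probability.

(** * Substitution of an independent variable *)

Section freezing.
Context d (T : measurableType d) (R : realType) (P : probability T R).
Context d2 (T2 : measurableType d2).
Variables (G : set (set T)) (Z : T -> T2).
Hypotheses (Gm : G `<=` measurable) (GI : setI_closed G) (GT : G setT).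
Hypothesis mZ : measurable_fun setT Z.
Hypothesis indep : forall E B, G E -> measurable B ->
  P (E `&` Z @^-1` B) = (P (Z @^-1` B) * P E)%E.

Let mZB B : measurable B -> measurable (Z @^-1` B).
Proof. by move=> mB; rewrite -[X in measurable X]setTI; exact: mZ. Qed.

Lemma indep_sigma E B : <<s G >> E -> measurable B ->
  P (E `&` Z @^-1` B) = (P (Z @^-1` B) * P E)%E.
Proof.
move=> GE mB.
have r0 : (0 <= fine (P (Z @^-1` B)))%R by exact: fine_ge0.
pose m1 : {measure set T -> \bar R} := mrestr P (mZB mB).
pose m2 : {measure set T -> \bar R} := mscale (NngNum r0) P.
have -> : (P (Z @^-1` B) * P E)%E = m2 E.
  by rewrite /m2 /= /mscale /= fineK // fin_num_measure //; exact: mZB.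
have -> : P (E `&` Z @^-1` B) = m1 E by [].
apply: (g_sigma_algebra_measure_unique G Gm (fun=> setT)) => //.
- by rewrite bigcup_const.
- move=> A GA; rewrite /m1 /m2 /= /mscale /mrestr /= fineK ?indep//.
  by rewrite fin_num_measure //; exact: mZB.
- move=> _; rewrite /m1 /= /mrestr setTI.
  by rewrite (le_lt_trans (probability_le1 _ _)) ?ltry //; exact: mZB.
Qed.

(** The same carrier with the smaller sigma-algebra. Measurability on [U] expresses dependence on
    the conditioning information alone, and the identity [iU] is the variable carrying that
    information. *)
Let U := g_sigma_algebraType G.
Let iU : T -> U := id.

Let miU : measurable_fun setT iU.
Proof.
move=> _ A mA; rewrite setTI preimage_id.
exact: (smallest_sub (@sigma_algebra_measurable _ T) Gm).
Qed.

HB.instance Definition _ := isMeasurableFun.Build _ _ _ _ iU miU.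
HB.instance Definition _ := isMeasurableFun.Build _ _ _ _ Z mZ.

Let iUZ : T -> U * T2 := fun w => (iU w, Z w).
Let miUZ : measurable_fun setT iUZ. Proof. exact: measurable_fun_pair. Qed.
HB.instance Definition _ := isMeasurableFun.Build _ _ _ _ iUZ miUZ.

(** By independence the joint law of the pair ([iU], [Z]) is the product of its marginals, so Fubini
    integrates the second coordinate with the first one frozen. This plays the role of conditional
    expectation throughout. *)
Lemma freezing (F : T -> T2 -> R) :
  measurable_fun [set: U * T2] (fun p => F p.1 p.2) ->
  (exists M, forall w z, `|F w z| <= M) ->
  \int[P]_w F w (Z w) = \int[P]_w \int[P]_w' F w (Z w').
Proof.
move=> mF [M FM].
pose PU : probability U R := distribution P iU.
pose PZ : probability T2 R := distribution P Z.
pose PUZ : probability (U * T2)%type R := distribution P iUZ.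
pose f : U * T2 -> \bar R := fun p => (F p.1 p.2)%:E.
have mf : measurable_fun setT f by exact/measurable_EFinP.
have If : (PU \x PZ)%E.-integrable setT f.
  pose PP : probability (U * T2)%type R := (PU \x PZ)%E.
  have bF : bmf (fun p : U * T2 => F p.1 p.2).
    by split => //; exists M => -[w z]; exact: FM.
  exact: (bmf_int PP bF).
have E1 : (\int[PUZ]_p f p = \int[P]_w f (iUZ w))%E.
  have := @integral_distribution _ _ _ _ _ P iUZ f mf; apply.
  apply: (@bmf_int _ _ _ P (fun w => F w (Z w))); split; last by exists M.
  exact: (measurableT_comp mF miUZ).
have E2 : (\int[PUZ]_p f p = \int[PU \x PZ]_p f p)%E.
  apply: eq_measure_integral => A mA _; apply/esym.
  apply: product_measure_unique => //= E B mE mB.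
  rewrite /distribution /pushforward /= muleC.
  exact: indep_sigma.
have bw (w : U) : bmf (fun w' => F w (Z w')).
  split; last by exists M.
  exact: (measurableT_comp (measurable_fun_pair2 w mF) mZ).
have E3 w : (fubini_F PZ f w = \int[P]_w' (F w (Z w'))%:E)%E.
  rewrite /fubini_F.
  have := @integral_distribution _ _ _ _ _ P Z (fun y => f (w, y)); apply.
    exact: measurable_fun_pair2.
  exact: (bmf_int P (bw w)).
have IF := integrable_fubini_F If.
rewrite /Rintegral -[(\int[P]_w (F w (Z w))%:E)%E]/((\int[P]_w f (iUZ w))%E).
rewrite -E1 E2 -(integral12_prod_meas1 If); congr fine.
have IF' : P.-integrable setT ((fubini_F PZ f) \o iU).
  apply/integrableP; split.
    by apply: (measurableT_comp _ miU); case/integrableP: IF.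
  have /integrableP[mIF] := IF; congr (_ < _)%E.
  by rewrite ge0_integral_distribution //; exact: measurableT_comp.
have := @integral_distribution _ _ _ _ _ P iU (fubini_F PZ f).
move=> ->//; last by case/integrableP: IF.
apply: eq_integral => w _ /=; rewrite E3 fineK //.
apply: integrable_fin_num => //.
exact: (bmf_int P (bw w)).
Qed.

End freezing.

(** * Complex-valued expectations and conditioning *)

Section complex_modulus.
Local Open Scope complex_scope.
Variable R : realType.
Implicit Types (z u : R[i]) (x y : R).

(** Real-valued modulus; the generic norm on [R[i]] takes its values in [R[i]]. *)
Definition cm z : R := Normc.normc z.

Lemma cmE z : cm z = Num.sqrt (complex.Re z ^+ 2 + complex.Im z ^+ 2).
Proof. by case: z. Qed.

Lemma cm_ge0 z : 0 <= cm z. Proof. by rewrite cmE sqrtr_ge0. Qed.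

Lemma cmM z u : cm (z * u) = cm z * cm u. Proof. exact: Normc.normcM. Qed.

Lemma cmD z u : cm (z + u) <= cm z + cm u. Proof. exact: le_normcD. Qed.

Lemma cmN z : cm (- z) = cm z. Proof. exact: normcN. Qed.

Lemma cm1 : cm 1 = 1. Proof. by rewrite cmE /= expr0n /= addr0 expr1n sqrtr1. Qed.

Lemma cmB z u : cm (z - u) <= cm z + cm u.
Proof. by rewrite -(cmN u); exact: cmD. Qed.

Lemma ReB z u : complex.Re (z - u) = complex.Re z - complex.Re u.
Proof. by case: z; case: u. Qed.

Lemma ImB z u : complex.Im (z - u) = complex.Im z - complex.Im u.
Proof. by case: z; case: u. Qed.

Lemma ReM z u : complex.Re (z * u) =
  complex.Re z * complex.Re u - complex.Im z * complex.Im u.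
Proof. by case: z; case: u. Qed.

Lemma ImM z u : complex.Im (z * u) =
  complex.Re z * complex.Im u + complex.Im z * complex.Re u.
Proof. by case: z; case: u. Qed.

Lemma complex_ext z u : complex.Re z = complex.Re u ->
  complex.Im z = complex.Im u -> z = u.
Proof. by case: z => a b; case: u => c d /= -> ->. Qed.

Lemma Re_le_cm z : `|complex.Re z| <= cm z.
Proof. by rewrite cmE -sqrtr_sqr ler_wsqrtr // lerDl sqr_ge0. Qed.

Lemma Im_le_cm z : `|complex.Im z| <= cm z.
Proof. by rewrite cmE -sqrtr_sqr ler_wsqrtr // lerDr sqr_ge0. Qed.

Lemma cm_le z : cm z <= `|complex.Re z| + `|complex.Im z|.
Proof.
rewrite cmE -[leRHS]ger0_norm ?addr_ge0 // -sqrtr_sqr ler_wsqrtr //.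
by rewrite sqrrD !real_normK ?num_real // -addrA lerD2l lerDr mulrn_wge0 // mulr_ge0.
Qed.

Lemma cm_sum (I : Type) (s : seq I) (f : I -> R[i]) :
  cm (\sum_(i <- s) f i) <= \sum_(i <- s) cm (f i).
Proof.
elim: s => [|i s IH]; first by rewrite !big_nil cmE /= expr0n /= addr0 sqrtr0.
by rewrite !big_cons (le_trans (cmD _ _))// lerD2l.
Qed.

Lemma cm_prod_le1 (I : Type) (s : seq I) (f : I -> R[i]) :
  (forall i, cm (f i) <= 1) -> cm (\prod_(i <- s) f i) <= 1.
Proof.
move=> f1; elim: s => [|i s IH]; first by rewrite big_nil cm1.
by rewrite big_cons cmM mulr_ile1 ?cm_ge0.
Qed.

(** Telescoping: the factors are exchanged one at a time while the others have modulus at most 1. It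
    converts small errors per observation into their sum. *)
Lemma cm_prodB (I : Type) (s : seq I) (f g : I -> R[i]) :
  (forall i, cm (f i) <= 1) -> (forall i, cm (g i) <= 1) ->
  cm (\prod_(i <- s) f i - \prod_(i <- s) g i) <= \sum_(i <- s) cm (f i - g i).
Proof.
move=> f1 g1; elim: s => [|i s IH]; first by rewrite !big_nil subrr cmE /= expr0n /= addr0 sqrtr0.
rewrite !big_cons.
set p := \prod_(j <- s) f j; set q := \prod_(j <- s) g j.
rewrite (_ : f i * p - g i * q = (f i - g i) * p + g i * (p - q)); last by ring.
rewrite (le_trans (cmD _ _))// !cmM lerD //.
  by rewrite ler_piMr ?cm_ge0 // cm_prod_le1.
by rewrite (le_trans _ IH)// ler_piMl ?cm_ge0.
Qed.

Definition cis y : R[i] := cos y +i* sin y.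

Lemma cis0 : cis 0 = 1. Proof. by rewrite /cis cos0 sin0. Qed.

Lemma cisD x y : cis (x + y) = cis x * cis y.
Proof. by rewrite /cis cosD sinD; apply: complex_ext => //=; rewrite addrC [cos x * _]mulrC. Qed.

Lemma cm_cis y : cm (cis y) = 1.
Proof. by rewrite cmE /= cos2Dsin2 sqrtr1. Qed.

Lemma cis_sum (I : Type) (s : seq I) (f : I -> R) :
  cis (\sum_(i <- s) f i) = \prod_(i <- s) cis (f i).
Proof.
elim: s => [|i s IH]; first by rewrite !big_nil cis0.
by rewrite !big_cons cisD IH.
Qed.

End complex_modulus.

Section complex_expectation.
Local Open Scope complex_scope.
Context d (T : measurableType d) (R : realType).
Implicit Types f g : T -> R[i].

Definition cbmf f := bmf (fun w => complex.Re (f w)) /\ bmf (fun w => complex.Im (f w)).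

Definition cE (P : probability T R) f : R[i] :=
  (\int[P]_w complex.Re (f w)) +i* (\int[P]_w complex.Im (f w)).

Lemma cbmf_cst z : cbmf (fun=> z). Proof. by split; exact: bmf_cst. Qed.

Lemma cbmf_cis (a : T -> R) : measurable_fun setT a -> cbmf (fun w => cis (a w)).
Proof. by move=> ma; split; [exact: bmf_cos|exact: bmf_sin]. Qed.

Lemma cbmfM f g : cbmf f -> cbmf g -> cbmf (fun w => f w * g w).
Proof.
move=> [f1 f2] [g1 g2]; split.
- rewrite (_ : (fun _ => _) = (fun w => complex.Re (f w) * complex.Re (g w) -
    complex.Im (f w) * complex.Im (g w))); last by apply/funext => w; rewrite ReM.
  by apply: bmfB; exact: bmfM.
- rewrite (_ : (fun _ => _) = (fun w => complex.Re (f w) * complex.Im (g w) +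
    complex.Im (f w) * complex.Re (g w))); last by apply/funext => w; rewrite ImM.
  by apply: bmfD; exact: bmfM.
Qed.

Lemma cbmfB f g : cbmf f -> cbmf g -> cbmf (fun w => f w - g w).
Proof.
move=> [f1 f2] [g1 g2]; split.
- rewrite (_ : (fun _ => _) = (fun w => complex.Re (f w) - complex.Re (g w))).
    exact: bmfB.
  by apply/funext => w; rewrite ReB.
- rewrite (_ : (fun _ => _) = (fun w => complex.Im (f w) - complex.Im (g w))).
    exact: bmfB.
  by apply/funext => w; rewrite ImB.
Qed.

Lemma cbmf_prod (I : Type) (s : seq I) (h : I -> T -> R[i]) :
  (forall i, cbmf (h i)) -> cbmf (fun w => \prod_(i <- s) h i w).
Proof.
move=> bh; elim: s => [|i s IH].
  rewrite (_ : (fun _ => _) = (fun=> 1)); first exact: cbmf_cst.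
  by apply/funext => x; rewrite big_nil.
rewrite (_ : (fun _ => _) = (fun x => h i x * \prod_(j <- s) h j x)).
  exact: cbmfM.
by apply/funext => x; rewrite big_cons.
Qed.

Lemma cbmf_comp d1 (U : measurableType d1) (g : U -> T) f :
  measurable_fun setT g -> cbmf f ->
  bmf (fun u => complex.Re (f (g u))) /\ bmf (fun u => complex.Im (f (g u))).
Proof.
move=> mg [[m1 [M1 b1]] [m2 [M2 b2]]]; split; split.
- exact: (measurableT_comp m1).
- by exists M1.
- exact: (measurableT_comp m2).
- by exists M2.
Qed.

Lemma eq_cE (P : probability T R) f g : f =1 g -> cE P f = cE P g.
Proof. by move=> fg; rewrite (_ : f = g) //; exact/funext. Qed.

Lemma cE_cst (P : probability T R) z : cE P (fun=> z) = z.
Proof. by apply: complex_ext; rewrite /= Rintegral_cstT. Qed.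

Lemma cEB (P : probability T R) f g : cbmf f -> cbmf g ->
  cE P (fun w => f w - g w) = cE P f - cE P g.
Proof.
move=> [f1 f2] [g1 g2]; apply: complex_ext; rewrite ?ReB ?ImB /=.
- rewrite -RintegralB //; [|exact: bmf_int..].
  by apply: eq_Rintegral => w _; rewrite ReB.
- rewrite -RintegralB //; [|exact: bmf_int..].
  by apply: eq_Rintegral => w _; rewrite ImB.
Qed.

Lemma cEZ (P : probability T R) z f : cbmf f ->
  cE P (fun w => z * f w) = z * cE P f.
Proof.
move=> [f1 f2]; apply: complex_ext; rewrite ?ReM ?ImM /=.
- rewrite -!RintegralZl //; [|exact: bmf_int..].
  rewrite -RintegralB //; [|by apply: rintZ => //; exact: bmf_int..].
  by apply: eq_Rintegral => w _; rewrite ReM.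
- rewrite -!RintegralZl //; [|exact: bmf_int..].
  rewrite -RintegralD //; [|by apply: rintZ => //; exact: bmf_int..].
  by apply: eq_Rintegral => w _; rewrite ImM.
Qed.

(** The factor 2 comes from bounding real and imaginary parts separately; the bound serves only to
    prove convergence to 0. *)
Lemma cm_cE_le (P : probability T R) f (h : T -> R) : cbmf f ->
  P.-integrable setT (EFin \o h) -> (forall w, cm (f w) <= h w) ->
  cm (cE P f) <= 2 * \int[P]_w h w.
Proof.
move=> [f1 f2] Ih fh; rewrite (le_trans (cm_le _))//= mulr_natl mulr2n lerD //.
  apply: norm_Rintegral_le => //; first exact: bmf_int.
  by move=> w _; rewrite (le_trans (Re_le_cm _)).
apply: norm_Rintegral_le => //; first exact: bmf_int.
by move=> w _; rewrite (le_trans (Im_le_cm _)).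
Qed.

Lemma cm_cE_dist (P : probability T R) f g (h : T -> R) : cbmf f -> cbmf g ->
  P.-integrable setT (EFin \o h) -> (forall w, cm (f w - g w) <= h w) ->
  cm (cE P f - cE P g) <= 2 * \int[P]_w h w.
Proof.
by move=> bf bg Ih fgh; rewrite -cEB //; apply: cm_cE_le => //; exact: cbmfB.
Qed.

(* [|E f| <= 1] via rotation: [|E f|^2 = Re (conj (E f) * E f) = E Re (conj (E f) * f)]. *)
Lemma cm_cE_le1 (P : probability T R) f : cbmf f -> (forall w, cm (f w) <= 1) ->
  cm (cE P f) <= 1.
Proof.
move=> bf f1.
pose u : R[i] := complex.Re (cE P f) -i* complex.Im (cE P f).
have cu : cm u = cm (cE P f) by rewrite !cmE /= sqrrN.
have e : complex.Re (cE P (fun w => u * f w)) = cm (cE P f) ^+ 2.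
  rewrite cEZ // {cu}/u; case: (cE P f) => a b.
  by rewrite ReM cmE /= mulNr opprK sqr_sqrtr ?addr_ge0 ?sqr_ge0 // !expr2.
have : cm (cE P f) ^+ 2 <= cm (cE P f).
{ have [b1 _] := cbmfM (cbmf_cst u) bf.
  rewrite -e /= (le_trans (ler_norm _))//.
  rewrite -[leRHS](Rintegral_cstT P); apply: norm_Rintegral_le => //.
  - exact: bmf_int.
  - by apply: bmf_int; exact: bmf_cst.
  - move=> w _; rewrite (le_trans (Re_le_cm _))// cmM cu ler_piMr ?cm_ge0 //.
}
have := cm_ge0 (cE P f); rewrite le_eqVlt => /predU1P[<- _|c0]; first exact: ler01.
by rewrite expr2 ger_pMr.
Qed.

End complex_expectation.

Section parametrized_integral.
Context d1 (U : measurableType d1) d (T : measurableType d) (R : realType).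
Variable P : probability T R.

(** Adding the bound [M] makes the integrand nonnegative, so that Tonelli's theorem gives
    measurability; the constant is then subtracted. *)
Lemma measurable_Rintegral_param (F : U -> T -> R) :
  measurable_fun [set: U * T] (fun p => F p.1 p.2) ->
  (exists M, forall u w, `|F u w| <= M) ->
  measurable_fun [set: U] (fun u => \int[P]_w F u w).
Proof.
move=> mF [M FM].
have bF u : bmf (F u).
  by split; [exact: (measurable_fun_pair2 u mF)|exists M].
have mFM : measurable_fun [set: U * T] (fun p => (F p.1 p.2 + M)%:E).
  by apply/measurable_EFinP/measurable_funD.
have F0 (p : U * T) : (0 <= (F p.1 p.2 + M)%:E)%E.
  by rewrite lee_fin -lerBlDr sub0r; have := FM p.1 p.2; rewrite ler_norml => /andP[].
have m0 := measurable_fun_fubini_tonelli_F (m2 := P) _ mFM F0.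
have m1 := measurableT_comp (fine_measurable measurableT) m0.
rewrite (_ : (fun _ => _) = (fun u => fine (\int[P]_w (F u w + M)%:E) - M)).
  by apply: measurable_funB => //; exact: measurable_cst.
apply/funext => u; rewrite -[fine _]/(\int[P]_w (F u w + M)) RintegralD //.
- by rewrite Rintegral_cstT addrK.
- exact: bmf_int.
- by apply: bmf_int; exact: bmf_cst.
Qed.

End parametrized_integral.

Section generated_sub_sigma.
Context d (T : measurableType d) (R : realType).

Lemma gmeas_mono (G H : set (set T)) (f : T -> R) : G `<=` <<s H >> ->
  measurable_fun [set: g_sigma_algebraType G] (f : g_sigma_algebraType G -> R) ->
  measurable_fun [set: g_sigma_algebraType H] (f : g_sigma_algebraType H -> R).
Proof.
move=> GH mf _ B mB; have := mf measurableT B mB.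
by apply: (smallest_sub (@sigma_algebra_measurable _ (g_sigma_algebraType H)) GH).
Qed.

End generated_sub_sigma.

(** * Conditioning independent factors on a sigma-algebra *)

Section conditional_characteristic_function.
Local Open Scope complex_scope.
Context d (T : measurableType d) (R : realType) (P : probability T R).
Variables (I : eqType) (Z : I -> T -> R) (S : set (set T)).
Hypothesis mZ : forall k, measurable_fun setT (Z k).
Hypotheses (Sm : S `<=` measurable) (SI : setI_closed S) (ST : S setT).
Hypothesis indep : forall (l : seq I) (B : I -> set R) E, uniq l ->
  (forall k, measurable (B k)) -> S E ->
  fine (P ((\bigcap_(k in [set k | k \in l]) (Z k @^-1` B k)) `&` E)) =
  (\prod_(k <- l) fine (P (Z k @^-1` B k))) * fine (P E).

(** A pi-system generating the information in [S] together with the variables [Z k] for [k] in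
    [l]. *)
Let cyl (l : seq I) : set (set T) := [set E | exists (B : I -> set R) A,
  (forall k, measurable (B k)) /\ S A /\
  E = (\bigcap_(k in [set k | k \in l]) (Z k @^-1` B k)) `&` A].

Let mcap (l : seq I) (B : I -> set R) : (forall k, measurable (B k)) ->
  measurable (\bigcap_(k in [set k | k \in l]) (Z k @^-1` B k)).
Proof.
move=> mB; apply: fin_bigcap_measurable => [|k _]; first exact: finite_seq.
by rewrite -[X in measurable X]setTI; exact: mZ.
Qed.

Let cyl_meas l : cyl l `<=` measurable.
Proof.
move=> _ [B [A [mB [SA ->]]]]; apply: measurableI; first exact: mcap.
exact: Sm.
Qed.

Let cyl_setI l : setI_closed (cyl l).
Proof.
move=> _ _ [B [A [mB [SA ->]]]] [C [D [mC [SD ->]]]].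
exists (fun k => B k `&` C k), (A `&` D); split.
  by move=> k; exact: measurableI.
split; first exact: SI.
rewrite setIACA; congr (_ `&` _); rewrite -bigcapI.
by apply: eq_bigcapr => k _; rewrite preimage_setI.
Qed.

Let S_cyl l : S `<=` cyl l.
Proof.
move=> A SA; exists (fun=> setT), A; split => //; split => //.
rewrite (_ : \bigcap_(_ in _) _ = setT) ?setTI //.
by rewrite -subTset => w _ k _.
Qed.

(** Adding the constraint on [Z k0] to a cylinder over [l] gives a cylinder over [k0 :: l].
    Factorizing over both lists isolates the factor of [k0], which differs from all members of
    [l]. *)
Let cyl_indep k0 l E B : uniq (k0 :: l) -> cyl l E -> measurable B ->
  P (E `&` Z k0 @^-1` B) = (P (Z k0 @^-1` B) * P E)%E.
Proof.
move=> /= /andP[k0l ul] [C [A [mC [SA ->]]]] mB.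
have mZB : measurable (Z k0 @^-1` B).
  by rewrite -[X in measurable X]setTI; exact: mZ.
have mA : measurable A by exact: Sm.
have mcl := mcap l mC.
rewrite -[LHS]fineK; last by rewrite fin_num_measure //; do 2?apply: measurableI.
rewrite -[P (Z k0 @^-1` B)]fineK ?fin_num_measure //.
rewrite -[P (_ `&` A)]fineK; last by rewrite fin_num_measure //; apply: measurableI.
rewrite -EFinM; congr EFin.
pose C' k := if k == k0 then B else C k.
have mC' k : measurable (C' k) by rewrite /C'; case: ifP.
have := @indep (k0 :: l) C' A; rewrite /= k0l ul => /(_ isT mC' SA).
rewrite big_cons {2}/C' eqxx.
have -> : \prod_(j <- l) fine (P (Z j @^-1` C' j)) =
          \prod_(j <- l) fine (P (Z j @^-1` C j)).
  rewrite !big_seq; apply: eq_bigr => j jl; rewrite /C'; case: eqP => // jk.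
  by rewrite -jk jl in k0l.
rewrite -mulrA -indep // => <-; congr (fine (P _)).
rewrite setIAC; congr (_ `&` _); apply/seteqP; split => w /=.
- move=> [h1 h2] k; rewrite /= in_cons /C'; case: eqP => [-> _ //|_ /= kl].
  exact: h1.
- move=> h; split.
    move=> k kl; have := h k; rewrite /= in_cons kl orbT /C' => /(_ isT).
    by case: eqP => // kk; rewrite -kk kl in k0l.
  by have := h k0; rewrite /= in_cons eqxx /C' eqxx; exact.
Qed.

Let Z_cyl l k : k \in l ->
  measurable_fun [set: g_sigma_algebraType (cyl l)] (Z k : g_sigma_algebraType (cyl l) -> R).
Proof.
move=> kl _ B mB; rewrite setTI; apply: sub_sigma_algebra.
exists (fun j => if j == k then B else setT), setT; split.
  by move=> j; case: ifP.
split => //; rewrite setIT; apply/seteqP; split => w /=.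
- by move=> h j _ /=; case: eqP => // ->.
- by move=> /(_ k kl); rewrite /= eqxx.
Qed.

Variable e : I -> T -> R -> R.
Hypothesis me : forall k,
  measurable_fun [set: g_sigma_algebraType S * R] (fun p => e k p.1 p.2).

(** Induction on the list: with all else frozen, integrating over [Z k0] replaces its factor by the
    mean [q], a function measurable for [S]. This mean is absorbed into [H], which is why the
    statement carries a general factor of that kind. *)
Lemma conditional_chf (l : seq I) (H : T -> R[i]) : uniq l ->
  cbmf (H : g_sigma_algebraType S -> R[i]) ->
  cE P (fun w => H w * \prod_(k <- l) cis (e k w (Z k w))) =
  cE P (fun w => H w * \prod_(k <- l) cE P (fun w' => cis (e k w (Z k w')))).
Proof.
elim: l H => [|k0 l IH] H ul bH; first by apply: eq_cE => w; rewrite !big_nil.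
pose U := g_sigma_algebraType (cyl l).
pose K (w : U) := H w * \prod_(k <- l) cis (e k w (Z k w)).
have SU : S `<=` <<s cyl l >>.
  by move=> A SA; apply: sub_sigma_algebra; exact: S_cyl.
have bHU : cbmf (H : U -> R[i]).
  case: bH => -[m1 b1] [m2 b2]; split; split => //.
    exact: (gmeas_mono SU m1).
  exact: (gmeas_mono SU m2).
have meU k : measurable_fun [set: U * R] (fun p => e k p.1 p.2).
  have mi : measurable_fun [set: U * R] (fun p => ((p.1 : g_sigma_algebraType S), p.2)).
    apply: measurable_fun_pair; last exact: measurable_snd.
    move=> _ B mB; rewrite setTI.
    have : measurable (B : set U).
      by apply: (smallest_sub (@sigma_algebra_measurable _ U) SU).
    by move=> mBU; rewrite -[X in measurable X]setTI; exact: measurable_fst.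
  exact: (measurableT_comp (me k) mi).
have bK : cbmf K.
  (* Trivial factors are put off [l], because [Z k] is measurable for [U] only when [k] belongs to
     [l]. *)
  have -> : K = (fun w => H w * \prod_(k <- l) if k \in l then cis (e k w (Z k w)) else 1).
    apply/funext => w; rewrite /K; congr (_ * _); rewrite big_seq [RHS]big_seq.
    by apply: eq_bigr => k ->.
  apply: cbmfM => //; apply: cbmf_prod => k; case: (boolP (k \in l)) => kl; last exact: cbmf_cst.
  apply: cbmf_cis.
  have mp : measurable_fun [set: U] (fun w : U => (w, Z k w)).
    by apply: measurable_fun_pair => //; exact: Z_cyl.
  exact: (measurableT_comp (meU k) mp).
pose q w := cE P (fun w' => cis (e k0 w (Z k0 w'))).
have bq : cbmf (q : g_sigma_algebraType S -> R[i]).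
{
  have mi : measurable_fun [set: g_sigma_algebraType S * T] (fun p => e k0 p.1 (Z k0 p.2)).
    have mp : measurable_fun [set: g_sigma_algebraType S * T] (fun p => (p.1, Z k0 p.2)).
      apply: measurable_fun_pair; first exact: measurable_fst.
      by apply: measurableT_comp => //; exact: measurable_snd.
    exact: (measurableT_comp (me k0) mp).
  have bc w : cbmf (fun w' => cis (e k0 w (Z k0 w'))).
    by apply: cbmf_cis; exact: (measurable_fun_pair2 (w : g_sigma_algebraType S) mi).
  have cq w : cm (q w) <= 1.
    by apply: cm_cE_le1 => // w'; rewrite cm_cis.
  split; split.
  - apply: (@measurable_Rintegral_param _ _ _ T R P (fun (w : g_sigma_algebraType S) w' => cos (e k0 w (Z k0 w')))).
      by have [] := bmf_cos mi.
    by exists 1 => w w'; rewrite ler_norml cos_geN1 cos_le1.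
  - by exists 1 => w; rewrite (le_trans (Re_le_cm _)).
  - apply: (@measurable_Rintegral_param _ _ _ T R P (fun (w : g_sigma_algebraType S) w' => sin (e k0 w (Z k0 w')))).
      by have [] := bmf_sin mi.
    by exists 1 => w w'; rewrite ler_norml sin_geN1 sin_le1.
  - by exists 1 => w; rewrite (le_trans (Im_le_cm _)).
}
have bc w : cbmf (fun w' => cis (e k0 w (Z k0 w'))).
  apply: cbmf_cis.
  apply: (measurableT_comp (measurable_fun_pair2 (w : U) (meU k0))).
  exact: mZ.
have [[mF1 [M1 bF1]] [mF2 [M2 bF2]]] :
    cbmf (fun p : U * R => K p.1 * cis (e k0 p.1 p.2)).
  apply: cbmfM; last exact: cbmf_cis.
  exact: (cbmf_comp (@measurable_fst _ _ U R)).
have freeze := @freezing _ T R P _ _ (cyl l) (Z k0) (@cyl_meas l) (@cyl_setI l)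
  (@S_cyl l _ ST) (mZ k0) (fun E B => @cyl_indep k0 l E B ul).
have step : cE P (fun w => K w * cis (e k0 w (Z k0 w))) = cE P (fun w => K w * q w).
{ apply: complex_ext => /=.
  - rewrite (freeze (fun w z => complex.Re (K w * cis (e k0 w z))) mF1); last first.
      by exists M1 => w z; exact: (bF1 (w, z)).
    by apply: eq_Rintegral => w _; rewrite -cEZ.
  - rewrite (freeze (fun w z => complex.Im (K w * cis (e k0 w z))) mF2); last first.
      by exists M2 => w z; exact: (bF2 (w, z)).
    by apply: eq_Rintegral => w _; rewrite -cEZ.
}
transitivity (cE P (fun w => K w * cis (e k0 w (Z k0 w)))).
  by apply: eq_cE => w; rewrite big_cons /K mulrA mulrAC.
rewrite step.
transitivity (cE P (fun w => (H w * q w) * \prod_(k <- l) cis (e k w (Z k w)))).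
  by apply: eq_cE => w; rewrite /K mulrAC.
rewrite IH; [|by case/andP: ul|exact: cbmfM].
by apply: eq_cE => w; rewrite big_cons mulrA.
Qed.

End conditional_characteristic_function.

(** * Real integrals *)

Section real_integrals.
Variable R : realType.
Let leb : {measure set (measurableTypeR R) -> \bar R} := @lebesgue_measure R.
Implicit Types (f F : R -> R) (a b x M : R).

Lemma FTC_is_derive f F a b : a < b ->
  (forall x, a <= x <= b -> is_derive x 1 F (f x)) ->
  (forall x, a <= x <= b -> {for x, continuous f}) ->
  leb.-integrable `[a, b] (EFin \o f) /\
  \int[leb]_(x in `[a, b]) f x = F b - F a.
Proof.
move=> ab dF cf.
have cfw : {within `[a, b], continuous f}.
  apply/subspace_continuousP => x /=; rewrite in_itv /= => xab.
  by apply: cvg_within_filter; exact: cf.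
have cF x : a <= x <= b -> F @ x --> F x.
  move=> /dF dFx; apply: differentiable_continuous; apply/derivable1_diffP.
  exact: ex_derive.
split.
  by apply: continuous_compact_integrable => //; exact: segment_compact.
rewrite /Rintegral (@continuous_FTC2 _ f F a b ab cfw) //.
- split.
  + move=> x; rewrite in_itv /= => /andP[ax xb].
    by apply: (@ex_derive _ _ _ _ _ _ (f x)); apply: dF; rewrite !ltW.
  + by apply: cvg_at_right_filter; apply: cF; rewrite lexx ltW.
  + by apply: cvg_at_left_filter; apply: cF; rewrite lexx ltW.
- move=> x; rewrite in_itv /= => /andP[ax xb]; rewrite derive1E.
  by apply: (@derive_val _ _ _ _ _ _ (f x)); apply: dF; rewrite !ltW.
Qed.

(** Monotone convergence: the integrals over the increasing sets stay below [K], hence so does the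
    integral over their union. *)
Lemma integrable_bounded_exhaustion (A : nat -> set R) f (K : R) :
  nondecreasing_seq A -> (forall n, measurable (A n)) ->
  measurable_fun (\bigcup_n A n) f ->
  (forall x, (\bigcup_n A n) x -> 0 <= f x) ->
  (forall n, leb.-integrable (A n) (EFin \o f)) ->
  (forall n, \int[leb]_(x in A n) f x <= K) ->
  leb.-integrable (\bigcup_n A n) (EFin \o f).
Proof.
move=> ndA mA mf f0 If fK; apply/integrableP; split.
  exact/measurable_EFinP.
have mU : measurable (\bigcup_n A n) by exact: bigcupT_measurable.
rewrite (@le_lt_trans _ _ K%:E) ?ltry //.
have -> : (\int[leb]_(x in \bigcup_n A n) `|(EFin \o f) x| =
    \int[leb]_(x in \bigcup_n A n) (f x)%:E)%E.
  by apply: eq_integral => x /[!inE] Ax /=; rewrite ger0_norm ?f0.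
have c : (\int[leb]_(x in A i) (f x)%:E @[i --> \oo] -->
    \int[leb]_(x in \bigcup_i A i) (f x)%:E)%E.
  apply: ge0_nondecreasing_set_cvg_integral => // [i|i x Aix].
    by case/integrableP : (If i).
  by rewrite lee_fin f0 //; exists i.
rewrite -(cvg_lim _ c) //; apply: lime_le.
  by apply/cvg_ex; eexists; exact: c.
apply: nearW => n; rewrite -[leLHS]fineK; last first.
  by apply: integrable_fin_num; [exact: mA|exact: If].
by rewrite lee_fin; exact: fK.
Qed.

Lemma powR_continuous_gt0 (s : R) x : 0 < x -> {for x, continuous (fun y : R => y `^ s)}.
Proof.
move=> x0; apply: differentiable_continuous; apply/derivable1_diffP.
exact: (@ex_derive _ _ _ _ _ _ _ (is_derive1_powR s x0)).
Qed.

Lemma integral_powR (s a b : R) : 0 < a -> a < b -> s != 1 ->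
  leb.-integrable `[a, b] (EFin \o (fun x => x `^ (- s))) /\
  \int[leb]_(x in `[a, b]) x `^ (- s) = (b `^ (1 - s) - a `^ (1 - s)) / (1 - s).
Proof.
move=> a0 ab s1.
have s10 : 1 - s != 0 by rewrite subr_eq0 eq_sym.
have [|x /andP[ax _]|I ->] := @FTC_is_derive (fun x => x `^ (- s))
    (fun x => (1 - s)^-1 * x `^ (1 - s)) a b ab.
- move=> x /andP[ax _]; have x0 := lt_le_trans a0 ax.
  have /is_deriveZ h := is_derive1_powR (1 - s) x0.
  apply: (@is_derive_eq _ _ _ _ _ _ _ _ (h (1 - s)^-1)).
  by rewrite /GRing.scale /= mulrA mulVf // mul1r; congr (_ `^ _); lra.
- by apply: powR_continuous_gt0; exact: lt_le_trans ax.
- by split => //; rewrite -mulrBr mulrC.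
Qed.

Lemma integrable_powR_near0 (s M : R) : s < 1 -> 0 < M ->
  leb.-integrable `]0, M] (EFin \o (fun x => x `^ (- s))).
Proof.
move=> s1 M0.
pose A n : set R := `[M / n.+2%:R, M]%classic.
have lt n : M / n.+2%:R < M by rewrite ltr_pdivrMr ?ltr0n // ltr_pMr // ltr1n.
have -> : `]0, M]%classic = \bigcup_n A n.
  apply/seteqP; split => x /=; rewrite !in_itv /=.
    move=> /andP[x0 xM]; exists (Num.truncn (M / x)) => //; rewrite /A /= in_itv /= xM andbT.
    rewrite ler_pdivrMr ?ltr0n // mulrC -ler_pdivrMr // ltW //.
    rewrite (lt_le_trans (truncnS_gt _)) // ler_nat //.
  move=> [n _]; rewrite /A /= in_itv /= => /andP[xn ->]; rewrite andbT.
  by rewrite (lt_le_trans _ xn)// divr_gt0 // ltr0n.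
apply: (@integrable_bounded_exhaustion _ _ (M `^ (1 - s) / (1 - s))).
- apply/nondecreasing_seqP => n; apply/subsetPset => x /=.
  rewrite /A /= !in_itv /= => /andP[xn ->]; rewrite andbT (le_trans _ xn)//.
  by rewrite ler_pM2l // lef_pV2 ?posrE ?ltr0n // ler_nat.
- by move=> n; exact: measurable_itv.
- by apply: measurable_funTS; exact: measurable_powR.
- by move=> x _; exact: powR_ge0.
- move=> n; have [] := @integral_powR s (M / n.+2%:R) M _ (lt n); last by [].
    by rewrite divr_gt0 // ltr0n.
  by rewrite lt_eqF.
- move=> n; have [||_ ->] := @integral_powR s (M / n.+2%:R) M _ (lt n).
  + by rewrite divr_gt0 // ltr0n.
  + by rewrite lt_eqF.
  + by rewrite ler_pM2r ?invr_gt0 ?subr_gt0 // gerBl powR_ge0.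
Qed.

Lemma integrable_powR_infty (s M : R) : 1 < s -> 0 < M ->
  leb.-integrable `[M, +oo[ (EFin \o (fun x => x `^ (- s))).
Proof.
move=> s1 M0.
pose A n : set R := `[M, M * n.+2%:R]%classic.
have lt n : M < M * n.+2%:R by rewrite ltr_pMr // ltr1n.
have -> : `[M, +oo[%classic = \bigcup_n A n.
  apply/seteqP; split => x /=; rewrite !in_itv /= ?andbT.
    move=> xM; exists (Num.truncn (x / M)) => //; rewrite /A /= in_itv /= xM /=.
    rewrite mulrC -ler_pdivrMr // ltW //.
    by rewrite (lt_le_trans (truncnS_gt _)) // ler_nat.
  by move=> [n _]; rewrite /A /= in_itv /= => /andP[].
apply: (@integrable_bounded_exhaustion _ _ (M `^ (1 - s) / (s - 1))).
- apply/nondecreasing_seqP => n; apply/subsetPset => x /=.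
  rewrite /A /= !in_itv /= => /andP[-> xn] /=; rewrite (le_trans xn)//.
  by rewrite ler_pM2l // ler_nat.
- by move=> n; exact: measurable_itv.
- by apply: measurable_funTS; exact: measurable_powR.
- by move=> x _; exact: powR_ge0.
- by move=> n; have [] := @integral_powR s M (M * n.+2%:R) M0 (lt n); rewrite ?gt_eqF.
- move=> n; have [|_ ->] := @integral_powR s M (M * n.+2%:R) M0 (lt n); first by rewrite gt_eqF.
  rewrite -[1 - s]opprB invrN mulrN -mulNr opprB ler_pM2r ?invr_gt0 ?subr_gt0 //.
  by rewrite opprB gerBl powR_ge0.
Qed.

End real_integrals.

(** * The layer-cake formula *)

Section layer_cake.
Context d (T : measurableType d) (R : realType) (P : probability T R).
Let leb : {sigma_finite_measure set (measurableTypeR R) -> \bar R} := @lebesgue_measure R.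
Variables (Y : T -> R) (f : R -> R).
Hypotheses (mY : measurable_fun setT Y) (mf : measurable_fun setT f).
Hypothesis fint : forall y, leb.-integrable `]0, y[ (EFin \o f).
Hypothesis If : leb.-integrable `]0, +oo[
  (EFin \o (fun x => f x * fine (P [set w | x < Y w]))).

Let h (p : T * measurableTypeR R) : R :=
  if (0 < p.2) && (p.2 < Y p.1) then f p.2 else 0.

Let mh : measurable_fun setT h.
Proof.
apply: measurable_fun_ifT.
- apply: measurable_and.
  + by apply: measurable_fun_ltr; [exact: measurable_cst|exact: measurable_snd].
  + apply: measurable_fun_ltr; first exact: measurable_snd.
    by apply: (measurableT_comp mY); exact: measurable_fst.
- by apply: (measurableT_comp mf); exact: measurable_snd.
- exact: measurable_cst.
Qed.

Let mYgt x : measurable [set w | x < Y w].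
Proof.
have := measurable_fun_ltr (measurable_cst x) mY measurableT (Y := [set true]) I.
by rewrite setTI.
Qed.

Let hE x w : h (w, x) = ((fun x => f x * \1_[set w | x < Y w] w) \_ (`]0, +oo[ : set R)) x.
Proof.
rewrite /h /= patchE mem_setE in_itv /= andbT; case: ifP => /=.
  move=> /andP[-> xY]; rewrite indicE mem_set ?mulr1 //.
case: (0 < x) => //= /negbT xY; rewrite indicE memNset ?mulr0 //.
exact/negP.
Qed.

Let hE2 w x : h (w, x) = (f \_ (`]0, Y w[ : set R)) x.
Proof. by rewrite /h /= patchE mem_setE in_itv. Qed.

(** Fubini for f(x) on the region 0 < x < Y(w) of the product of [P] with Lebesgue measure. Since
    [f] is signed, absolute integrability is checked first; it follows from [If]. *)
Lemma layer_cake :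
  P.-integrable setT (EFin \o (fun w => \int[leb]_(x in `]0, Y w[) f x)) /\
  \int[P]_w (\int[leb]_(x in `]0, Y w[) f x) =
  \int[leb]_(x in `]0, +oo[) (f x * fine (P [set w | x < Y w])).
Proof.
have mhE : measurable_fun setT (EFin \o h) by exact/measurable_EFinP.
have inner (g : R -> R) x : (\int[P]_w (g x * \1_[set w | x < Y w] w)%:E =
    (g x * fine (P [set w | x < Y w]))%:E)%E.
  under eq_integral do rewrite EFinM.
  rewrite integralZl //; last exact: integrable_indic.
  by rewrite integral_indic // setIT EFinM fineK // fin_num_measure.
have innerh x : (\int[P]_w (h (w, x))%:E =
   (((fun x => f x * fine (P [set w | x < Y w])) \_ (`]0, +oo[ : set R)) x)%:E)%E.
  under eq_integral do rewrite hE patchE.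
  rewrite patchE; case: ifP => _; first exact: inner.
  by rewrite integral0.
have innernh x : (\int[P]_w `|(h (w, x))%:E| =
   `|((fun x => f x * fine (P [set w | x < Y w])) \_ (`]0, +oo[ : set R)) x|%:E)%E.
  under eq_integral do rewrite hE patchE.
  rewrite patchE; case: ifP => _; last first.
    transitivity (\int[P]_w (0 : \bar R))%E.
      by apply: eq_integral => w _; exact: (congr1 EFin (normr0 R)).
    by rewrite integral0; exact: (esym (congr1 EFin (normr0 R))).
  rewrite normrM (ger0_norm (fine_ge0 (measure_ge0 _ _))) -(inner (fun x => `|f x|)).
  by apply: eq_integral => w _ /=; rewrite normrM (ger0_norm (_ : 0 <= \1__ w)) // indicE.
have Ih : (P \x leb)%E.-integrable setT (EFin \o h).
  apply: (proj2 (@integrable21ltyP _ _ _ _ _ P leb _ mhE)).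
  have /integrable_mkcond : measurable (`]0, +oo[%classic : set (measurableTypeR R)).
    exact: measurable_itv.
  move=> /(_ _ leb (EFin \o (fun x => f x * fine (P [set w | x < Y w])))) [/(_ If)].
  move=> /integrableP[_ + _]; congr (_ < _)%E.
  apply: eq_integral => x _; rewrite innernh !patchE /=; case: ifP => //.
have Fw w : fubini_F leb (EFin \o h) w = (\int[leb]_(x in `]0, Y w[) f x)%:E.
  rewrite /fubini_F /Rintegral fineK; last first.
    by apply: integrable_fin_num => //; exact: fint.
  rewrite [RHS]integral_mkcond; apply: eq_integral => x _ /=.
  by rewrite hE2 !patchE; case: ifP.
have IF := integrable_fubini_F Ih.
split.
  by move: IF; congr (P.-integrable _ _); apply/funext => w; rewrite Fw.
rewrite /Rintegral; congr fine.
transitivity (\int[P]_w fubini_F leb (EFin \o h) w)%E.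
  by apply: eq_integral => w _; rewrite Fw.
rewrite /fubini_F (Fubini Ih) [RHS]integral_mkcond.
apply: eq_integral => x _ /=; rewrite innerh !patchE; case: ifP => //.
Qed.

End layer_cake.

(** * Gamma integrals along rotated half-lines *)

Section pointwise_derivatives.
Variable R : realType.
Implicit Types (f g : R -> R) (x df dg k : R).

(** Derivative rules for explicit lambda terms: derivatives are assembled as terms, and the expected
    form is reached at the end with [is_derive_eq]. *)
Lemma isd_id x : is_derive x (1 : R) (fun y : R => y) 1. Proof. exact: is_derive_id. Qed.
Lemma isd_cst k x : is_derive x (1 : R) (fun=> k) 0. Proof. exact: is_derive_cst. Qed.
Lemma isdD f g x df dg : is_derive x (1 : R) f df -> is_derive x (1 : R) g dg ->
  is_derive x (1 : R) (fun y => f y + g y) (df + dg).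
Proof. by move=> hf hg; exact: is_deriveD. Qed.
Lemma isdN f x df : is_derive x (1 : R) f df -> is_derive x (1 : R) (fun y => - f y) (- df).
Proof. by move=> hf; exact: is_deriveN. Qed.
Lemma isdB f g x df dg : is_derive x (1 : R) f df -> is_derive x (1 : R) g dg ->
  is_derive x (1 : R) (fun y => f y - g y) (df - dg).
Proof. by move=> hf hg; exact: is_deriveB. Qed.
Lemma isdM f g x df dg : is_derive x (1 : R) f df -> is_derive x (1 : R) g dg ->
  is_derive x (1 : R) (fun y => f y * g y) (f x * dg + g x * df).
Proof. by move=> hf hg; exact: is_deriveM. Qed.
Lemma isdZ k f x df : is_derive x (1 : R) f df -> is_derive x (1 : R) (fun y => k * f y) (k * df).
Proof. by move=> hf; exact: is_deriveZ. Qed.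
Lemma isdMr k f x df : is_derive x (1 : R) f df -> is_derive x (1 : R) (fun y => f y * k) (k * df).
Proof.
move=> hf; rewrite (_ : (fun y => f y * k) = (fun y => k * f y)); first exact: isdZ.
by apply/funext => y; rewrite mulrC.
Qed.
Lemma isd_cos f x df : is_derive x (1 : R) f df ->
  is_derive x (1 : R) (fun y => cos (f y)) (- sin (f x) * df).
Proof. by move=> hf; apply: (is_derive_eq (is_derive1_comp _ hf)); rewrite mulrC. Qed.
Lemma isd_sin f x df : is_derive x (1 : R) f df ->
  is_derive x (1 : R) (fun y => sin (f y)) (cos (f x) * df).
Proof. by move=> hf; apply: (is_derive_eq (is_derive1_comp _ hf)); rewrite mulrC. Qed.
Lemma isd_expR f x df : is_derive x (1 : R) f df ->
  is_derive x (1 : R) (fun y => expR (f y)) (expR (f x) * df).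
Proof. by move=> hf; apply: (is_derive_eq (is_derive1_comp _ hf)); rewrite mulrC. Qed.

End pointwise_derivatives.

Section elementary_bounds.
Variable R : realType.
Implicit Types x y : R.

Lemma lipschitz_of_derive (f df : R -> R) (K : R) :
  (forall x, is_derive x 1 f (df x)) -> (forall x, `|df x| <= K) ->
  forall x y, `|f x - f y| <= K * `|x - y|.
Proof.
move=> fdf dfK x y; wlog xy : x y / y <= x.
  move=> H; have [/H//|/ltW/H] := leP y x.
  by rewrite distrC [`|y - x|]distrC.
have [|c _ ->] := @MVT_segment R f df y x xy (fun z _ => fdf z).
  by apply: derivable_within_continuous => z _; exact: ex_derive.
by rewrite normrM ler_wpM2r.
Qed.

Lemma cos_lip x y : `|cos x - cos y| <= `|x - y|.
Proof.
rewrite -[leRHS]mul1r; apply: (@lipschitz_of_derive _ (fun z => - sin z)).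
by move=> z; rewrite normrN ler_norml sin_geN1 sin_le1.
Qed.

Lemma sin_lip x y : `|sin x - sin y| <= `|x - y|.
Proof.
rewrite -[leRHS]mul1r; apply: (@lipschitz_of_derive _ cos).
by move=> z; rewrite ler_norml cos_geN1 cos_le1.
Qed.

Lemma norm_sin_le x : `|sin x| <= `|x|.
Proof. by have := sin_lip x 0; rewrite sin0 !subr0. Qed.

Lemma norm_1mcos_le x : `|1 - cos x| <= `|x|.
Proof. by have := cos_lip 0 x; rewrite cos0 sub0r normrN. Qed.

Lemma norm_1mcos_le2 x : `|1 - cos x| <= 2.
Proof. by have := cos_geN1 x; have := cos_le1 x; rewrite ler_norml; lra. Qed.

Lemma onem_expRN_le x : 1 - expR (- x) <= x.
Proof. by have := expR_ge1Dx (- x); lra. Qed.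

Lemma expRN_le1 x : 0 <= x -> expR (- x) <= 1.
Proof. by move=> x0; rewrite -[leRHS]expR0 ler_expR oppr_le0. Qed.

(** By the mean value theorem, [phi + F] and [phi - F] do not decrease from [a] to [b]. *)
Lemma derive_comparison (F dF phi dphi : R -> R) (a b : R) : a <= b ->
  (forall x, is_derive x 1 F (dF x)) -> (forall x, is_derive x 1 phi (dphi x)) ->
  (forall x, a <= x <= b -> `|dF x| <= dphi x) ->
  `|F b - F a| <= phi b - phi a.
Proof.
move=> ab hF hphi dd.
have key (g dg : R -> R) : (forall x, is_derive x 1 g (dg x)) ->
    (forall x, a <= x <= b -> 0 <= dg x) -> g a <= g b.
  move=> hg dg0; have [|c cab e] := @MVT_segment R g dg a b ab (fun z _ => hg z).
    by apply: derivable_within_continuous => z _; exact: ex_derive.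
  rewrite -subr_ge0 e mulr_ge0 ?subr_ge0 //; apply: dg0.
  by move: cab; rewrite in_itv.
rewrite ler_norml; apply/andP; split.
- have := key (fun x => phi x + F x) (fun x => dphi x + dF x) _ _.
  move=> /(_ (fun x => is_deriveD (hphi x) (hF x))) => H.
  have : phi a + F a <= phi b + F b.
    by apply: H => x /dd; rewrite ler_norml => /andP[h _]; lra.
  lra.
- have := key (fun x => phi x - F x) (fun x => dphi x - dF x) _ _.
  move=> /(_ (fun x => is_deriveB (hphi x) (hF x))) => H.
  have : phi a - F a <= phi b - F b.
    by apply: H => x /dd; rewrite ler_norml => /andP[_ h]; lra.
  lra.
Qed.

(** The square is 1 + 2 sin x cos x. The bound serves to split N exp(-N cos x) into the derivative
    of exp(-N cos x) and a term at most 1. *)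
Lemma sinDcos_ge1 x : 0 <= x <= pi / 2 -> 1 <= sin x + cos x.
Proof.
move=> /andP[x0 x1].
have s0 : 0 <= sin x by apply: sin_ge0_pi; rewrite x0 /=; have := pi_gt0 R; lra.
have c0 : 0 <= cos x by apply: cos_ge0_pihalf; apply/andP; split; have := pi_gt0 R; lra.
have : 1 <= (sin x + cos x) ^+ 2.
  by rewrite sqrrD addrAC [sin x ^+ 2 + _]addrC cos2Dsin2 lerDl mulrn_wge0 // mulr_ge0.
by rewrite -{1}(expr1n _ 2) ler_pXn2r // ?nnegrE ?addr_ge0.
Qed.

Lemma mulr_expRN_le1 x : x * expR (- x) <= 1.
Proof.
rewrite expRN ler_pdivrMr ?expR_gt0 // mul1r.
by have := expR_ge1Dx x; lra.
Qed.

End elementary_bounds.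

Section half_line_integrals.
Variable R : realType.
Let leb : {measure set (measurableTypeR R) -> \bar R} := @lebesgue_measure R.
Implicit Types (f : R -> R) (p q C : R).

Lemma integrable_half_line f p q C : measurable_fun setT f -> p < 1 -> 1 < q ->
  (forall x, 0 < x <= 1 -> `|f x| <= C * x `^ (- p)) ->
  (forall x, 1 <= x -> `|f x| <= C * x `^ (- q)) ->
  leb.-integrable `]0, +oo[ (EFin \o f).
Proof.
move=> mf p1 q1 fp fq.
have -> : `]0, +oo[%classic = `]0, 1]%classic `|` `]1, +oo[%classic :> set R.
  apply/seteqP; split => x /=; rewrite !in_itv /= ?andbT.
    by move=> x0; have [x1|x1] := leP x 1; [left; rewrite x0|right].
  by move=> [/andP[]//|]; apply: lt_trans.
suff [/integrableP[_ I1] /integrableP[_ I2]] :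
    leb.-integrable `]0, 1] (EFin \o f) /\ leb.-integrable `]1, +oo[ (EFin \o f).
{  apply/integrableP; split; first exact/measurable_EFinP/measurable_funTS.
  rewrite ge0_integral_setU //=.
  - by rewrite lte_add_pinfty.
  - by apply/measurable_EFinP/measurable_funTS; exact: measurableT_comp.
  - apply/disj_setPS => x /= []; rewrite !in_itv /= andbT => /andP[_ x1].
    by rewrite ltNge x1.
}
split.
- have m1 : measurable (`]0, 1]%classic : set (measurableTypeR R)) by exact: measurable_itv.
  apply: (rint_le m1 (g := fun x => C * x `^ (- p))).
  + exact: measurable_funTS.
  + by move=> x /=; rewrite in_itv /= => /fp.
  + by apply: (rintZ m1); exact: integrable_powR_near0.
- have m1 : measurable (`]1, +oo[%classic : set (measurableTypeR R)) by exact: measurable_itv.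
  apply: (rint_le m1 (g := fun x => C * x `^ (- q))).
  + exact: measurable_funTS.
  + by move=> x /=; rewrite in_itv /= andbT => /ltW/fq.
  + apply: (rintZ m1); apply: (integrableS _ _ _ (integrable_powR_infty q1 ltr01)) => //.
    by move=> x /=; rewrite !in_itv /= !andbT; exact: ltW.
Qed.

(** The trigonometric integrals may converge only conditionally, so they are treated as limits along
    these compact intervals. The shift by 2 keeps 1 strictly between the endpoints. *)
Definition exhaust (n : nat) : set R := `[n.+2%:R^-1, n.+2%:R]%classic.

Lemma exhaust_cvg f : leb.-integrable `]0, +oo[ (EFin \o f) -> measurable_fun setT f ->
  \int[leb]_(x in exhaust n) f x @[n --> \oo] --> \int[leb]_(x in `]0, +oo[) f x.
Proof.
move=> If mf.
have mD : measurable (`]0, +oo[%classic : set (measurableTypeR R)) by exact: measurable_itv.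
have mE n : measurable (exhaust n : set (measurableTypeR R)) by exact: measurable_itv.
have sE n : exhaust n `<=` `]0, +oo[%classic.
  move=> x; rewrite /exhaust /= !in_itv /= andbT => /andP[h _].
  by rewrite (lt_le_trans _ h) // invr_gt0 ltr0n.
have -> : (fun n => \int[leb]_(x in exhaust n) f x) =
    (fun n => \int[leb]_(x in `]0, +oo[) (f \_ (exhaust n)) x).
  apply/funext => n; rewrite -Rintegral_mkcondr; congr Rintegral.
  by apply/esym/setIidPr.
have [] // := @Rintegral_dct _ _ R leb _ mD (fun n => f \_ (exhaust n)) f (fun x => `|f x|).
- move=> n; apply/measurable_restrict => //; exact: measurable_funTS.
- exact: measurable_funTS.
- move=> x /=; rewrite in_itv /= andbT => x0.
  apply: cvg_near_cst; near=> n; rewrite patchE mem_set // /exhaust /= in_itv /=.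
  apply/andP; split.
    rewrite -[leRHS]invrK lef_pV2 ?posrE ?invr_gt0 ?ltr0n //.
    near: n; exists (Num.truncn x^-1) => // n /= nx.
    by rewrite ltW // (lt_le_trans (truncnS_gt _)) // ler_nat ltnW // ltnS ltnS.
  near: n; exists (Num.truncn x) => // n /= nx.
  by rewrite ltW // (lt_le_trans (truncnS_gt _)) // ler_nat ltnW // ltnS ltnS.
- exact: (integrable_abse If).
- apply: nearW => n x _; rewrite patchE; case: ifP => // _.
  by rewrite normr0.
Unshelve. all: by end_near.
Qed.

End half_line_integrals.

(** * Differentiation with respect to the angle of rotation *)

Section rotation.
Variable R : realType.
Let leb : {measure set (measurableTypeR R) -> \bar R} := @lebesgue_measure R.
Variables (s a b : R).

(* Real and imaginary parts of [x^(r-1) * exp(i s eta) * (a + b exp(- x exp(i eta)))]. *)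
Definition rotRe (r eta x : R) : R :=
  x `^ r * (a * cos (s * eta) + b * (expR (- (x * cos eta)) * cos (s * eta - x * sin eta))).
Definition rotIm (r eta x : R) : R :=
  x `^ r * (a * sin (s * eta) + b * (expR (- (x * cos eta)) * sin (s * eta - x * sin eta))).


(** With z = x e^(i eta), the functions [rotRe (s - 1)] and [rotIm (s - 1)] are the components of
    z^(s-1) (a + b e^(-z)) dz/dx along the ray, and [rotRe s] and [rotIm s] those of z^s (a + b
    e^(-z)). The angular derivative of the former is i times the [x]-derivative of the latter. *)
Definition rotRe_deta (eta x : R) : R :=
  x `^ (s - 1) * (- (s * (a * sin (s * eta) + b * (expR (- (x * cos eta)) * sin (s * eta - x * sin eta))))
  + b * (x * (expR (- (x * cos eta)) * (sin eta * cos (s * eta - x * sin eta) + cos eta * sin (s * eta - x * sin eta))))).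
Definition rotIm_deta (eta x : R) : R :=
  x `^ (s - 1) * (s * (a * cos (s * eta) + b * (expR (- (x * cos eta)) * cos (s * eta - x * sin eta)))
  + b * (x * (expR (- (x * cos eta)) * (sin eta * sin (s * eta - x * sin eta) - cos eta * cos (s * eta - x * sin eta))))).

Let d_exp (eta x : R) := isd_expR (isdN (isdZ x (isd_cos (isd_id eta)))).
Let d_ang (eta x : R) := isdB (isdZ s (isd_id eta)) (isdZ x (isd_sin (isd_id eta))).

Lemma is_derive_rotRe_eta (eta x : R) :
  is_derive eta (1 : R) (fun e : R => rotRe (s - 1) e x) (rotRe_deta eta x).
Proof.
have h := isdZ (x `^ (s - 1)) (isdD (isdZ a (isd_cos (isdZ s (isd_id eta))))
  (isdZ b (isdM (d_exp eta x) (isd_cos (d_ang eta x))))).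
by apply: (is_derive_eq h); rewrite /rotRe_deta; ring.
Qed.

Lemma is_derive_rotIm_eta (eta x : R) :
  is_derive eta (1 : R) (fun e : R => rotIm (s - 1) e x) (rotIm_deta eta x).
Proof.
have h := isdZ (x `^ (s - 1)) (isdD (isdZ a (isd_sin (isdZ s (isd_id eta))))
  (isdZ b (isdM (d_exp eta x) (isd_sin (d_ang eta x))))).
by apply: (is_derive_eq h); rewrite /rotIm_deta; ring.
Qed.

Let d_expx (eta x : R) := isd_expR (isdN (isdMr (cos eta) (isd_id x))).
Let d_angx (eta x : R) := isdB (isd_cst (s * eta) x) (isdMr (sin eta) (isd_id x)).

Let powRS (x : R) : 0 < x -> x `^ s = x * x `^ (s - 1).
Proof.
move=> x0; rewrite -{2}(powRr1 (ltW x0)) -powRD; last by rewrite (gt_eqF x0) implybT.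
by congr (_ `^ _); lra.
Qed.

Lemma is_derive_rotIm_x (eta x : R) : 0 < x ->
  is_derive x (1 : R) (fun y : R => rotIm s eta y) (- rotRe_deta eta x).
Proof.
move=> x0.
have h := isdM (is_derive1_powR s x0) (isdD (isd_cst (a * sin (s * eta)) x)
  (isdZ b (isdM (d_expx eta x) (isd_sin (d_angx eta x))))).
by apply: (is_derive_eq h); rewrite /rotRe_deta (powRS x0); ring.
Qed.

Lemma is_derive_rotRe_x (eta x : R) : 0 < x ->
  is_derive x (1 : R) (fun y : R => rotRe s eta y) (rotIm_deta eta x).
Proof.
move=> x0.
have h := isdM (is_derive1_powR s x0) (isdD (isd_cst (a * cos (s * eta)) x)
  (isdZ b (isdM (d_expx eta x) (isd_cos (d_angx eta x))))).
by apply: (is_derive_eq h); rewrite /rotIm_deta (powRS x0); ring.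
Qed.

Let cont_deriv (f : R -> R) (x df : R) : is_derive x (1 : R) f df -> {for x, continuous f}.
Proof.
move=> h; apply: differentiable_continuous; apply/derivable1_diffP.
exact: (@ex_derive _ _ _ _ _ _ _ h).
Qed.

Let cont_angle (eta x : R) : {for x, continuous (fun y : R => cos (s * eta - y * sin eta))} /\
  {for x, continuous (fun y : R => sin (s * eta - y * sin eta))} /\
  {for x, continuous (fun y : R => expR (- (y * cos eta)))}.
Proof.
split; first exact: (cont_deriv (isd_cos (d_angx eta x))).
split; first exact: (cont_deriv (isd_sin (d_angx eta x))).
exact: (cont_deriv (d_expx eta x)).
Qed.

Lemma rotRe_deta_cont (eta x : R) : 0 < x -> {for x, continuous (rotRe_deta eta)}.
Proof.
move=> x0; have [c1 [c2 c3]] := cont_angle eta x.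
have c0 := @powR_continuous_gt0 R (s - 1) x x0.
rewrite /rotRe_deta; apply: cvgM => //; apply: cvgD.
  apply: cvgN; apply: cvgM; first exact: cvg_cst.
  apply: cvgD; first exact: cvg_cst.
  by apply: cvgM; [exact: cvg_cst|exact: cvgM].
apply: cvgM; first exact: cvg_cst.
apply: cvgM; first exact: cvg_id.
by apply: cvgM => //; apply: cvgD; apply: cvgM => //; exact: cvg_cst.
Qed.

Lemma rotIm_deta_cont (eta x : R) : 0 < x -> {for x, continuous (rotIm_deta eta)}.
Proof.
move=> x0; have [c1 [c2 c3]] := cont_angle eta x.
have c0 := @powR_continuous_gt0 R (s - 1) x x0.
rewrite /rotIm_deta; apply: cvgM => //; apply: cvgD.
  apply: cvgM; first exact: cvg_cst.
  apply: cvgD; first exact: cvg_cst.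
  by apply: cvgM; [exact: cvg_cst|exact: cvgM].
apply: cvgM; first exact: cvg_cst.
apply: cvgM; first exact: cvg_id.
by apply: cvgM => //; apply: cvgB; apply: cvgM => //; exact: cvg_cst.
Qed.

Lemma rotRe_cont (r eta x : R) : 0 < x -> {for x, continuous (rotRe r eta)}.
Proof.
move=> x0; have [c1 [c2 c3]] := cont_angle eta x.
have c0 := @powR_continuous_gt0 R r x x0.
rewrite /rotRe; apply: cvgM => //; apply: cvgD; first exact: cvg_cst.
by apply: cvgM; [exact: cvg_cst|exact: cvgM].
Qed.

Lemma rotIm_cont (r eta x : R) : 0 < x -> {for x, continuous (rotIm r eta)}.
Proof.
move=> x0; have [c1 [c2 c3]] := cont_angle eta x.
have c0 := @powR_continuous_gt0 R r x x0.
rewrite /rotIm; apply: cvgM => //; apply: cvgD; first exact: cvg_cst.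
by apply: cvgM; [exact: cvg_cst|exact: cvgM].
Qed.

(** A bound on the angular derivatives that is uniform in the angle, as differentiation under the
    integral requires; exp(x) dominates exp(-x cos eta) at every angle. *)
Let K (x : R) : R := x `^ (s - 1) * (`|s| * (`|a| + `|b| * expR x) + `|b| * (x * (expR x * 2))).

Let expR_le (eta x : R) : 0 < x -> expR (- (x * cos eta)) <= expR x.
Proof.
move=> x0; rewrite ler_expR -mulrN; apply: ler_piMr; first exact: ltW.
by have := cos_geN1 eta; lra.
Qed.

Let K_bound (p c1 c2 c3 c4 c5 x E : R) : 0 < x -> 0 <= p -> 0 < E -> E <= expR x ->
  `|c1| <= 1 -> `|c2| <= 1 -> `|c3| <= 1 -> `|c4| <= 1 -> `|c5| <= 1 ->
  `|p * (s * (a * c1 + b * (E * c2)) + b * (x * (E * (c3 * c4 + c5 * c2))))| <=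
  p * (`|s| * (`|a| + `|b| * expR x) + `|b| * (x * (expR x * 2))).
Proof.
move=> x0 p0 E0 Ex h1 h2 h3 h4 h5.
rewrite normrM (ger0_norm p0) ler_wpM2l // (le_trans (ler_normD _ _)) // lerD //.
  rewrite normrM ler_wpM2l // (le_trans (ler_normD _ _)) // lerD //.
    by rewrite normrM ler_piMr.
  rewrite normrM ler_wpM2l // normrM (gtr0_norm E0) (le_trans _ Ex) //.
  by rewrite ler_piMr // ltW.
rewrite normrM ler_wpM2l // normrM (gtr0_norm x0) ler_wpM2l ?(ltW x0) //.
rewrite normrM (gtr0_norm E0); apply: ler_pM => //; first exact: ltW.
rewrite (le_trans (ler_normD _ _)) //.
have := mulr_ile1 (normr_ge0 _) (normr_ge0 _) h3 h4.
have := mulr_ile1 (normr_ge0 _) (normr_ge0 _) h5 h2.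
by rewrite -!normrM; lra.
Qed.

Let trig1 (y : R) : `|cos y| <= 1. Proof. by rewrite ler_norml cos_geN1 cos_le1. Qed.
Let trig2 (y : R) : `|sin y| <= 1. Proof. by rewrite ler_norml sin_geN1 sin_le1. Qed.

Lemma rotRe_deta_le (eta x : R) : 0 < x -> `|rotRe_deta eta x| <= K x.
Proof.
move=> x0; rewrite /rotRe_deta /K.
set E := expR (- (x * cos eta)).
rewrite (_ : _ * _ = x `^ (s - 1) * (s * (a * (- sin (s * eta)) + b * (E * (- sin (s * eta - x * sin eta)))) +
  b * (x * (E * (sin eta * cos (s * eta - x * sin eta) + (- cos eta) * (- sin (s * eta - x * sin eta))))))); last by ring.
by apply: K_bound; rewrite ?normrN ?powR_ge0 ?expR_gt0 ?expR_le.
Qed.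

Lemma rotIm_deta_le (eta x : R) : 0 < x -> `|rotIm_deta eta x| <= K x.
Proof.
move=> x0; rewrite /rotIm_deta /K.
set E := expR (- (x * cos eta)).
rewrite (_ : _ * _ = x `^ (s - 1) * (s * (a * cos (s * eta) + b * (E * cos (s * eta - x * sin eta))) +
  b * (x * (E * (sin eta * sin (s * eta - x * sin eta) + (- cos eta) * cos (s * eta - x * sin eta)))))); last by ring.
by apply: K_bound; rewrite ?normrN ?powR_ge0 ?expR_gt0 ?expR_le.
Qed.

Let K_cont (x : R) : 0 < x -> {for x, continuous K}.
Proof.
move=> x0; have c0 := @powR_continuous_gt0 R (s - 1) x x0.
have ce : {for x, continuous (@expR R)} by exact: continuous_expR.
rewrite /K; apply: cvgM => //; apply: cvgD.
  apply: cvgM; first exact: cvg_cst.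
  by apply: cvgD; [exact: cvg_cst|apply: cvgM => //; exact: cvg_cst].
apply: cvgM; first exact: cvg_cst.
apply: cvgM; first exact: cvg_id.
by apply: cvgM => //; exact: cvg_cst.
Qed.

Let cont_int (f : R -> R) (A B : R) : 0 < A -> (forall x, 0 < x -> {for x, continuous f}) ->
  leb.-integrable `[A, B] (EFin \o f).
Proof.
move=> A0 cf; apply: continuous_compact_integrable; first exact: segment_compact.
apply/subspace_continuousP => x /=; rewrite in_itv /= => /andP[Ax _].
by apply: cvg_within_filter; apply: cf; exact: lt_le_trans Ax.
Qed.

(* Differentiating in the angle moves the derivative to [x] (Cauchy-Riemann in polar
   coordinates), so only boundary terms survive. *)
Let is_derive_rot (u du F : R -> R -> R) (A B : R) : 0 < A -> A < B ->
  (forall eta x : R, is_derive eta (1 : R) (u ^~ x) (du eta x)) ->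
  (forall eta x : R, 0 < x -> is_derive x (1 : R) (F eta) (du eta x)) ->
  (forall eta x : R, 0 < x -> {for x, continuous (u eta)}) ->
  (forall eta x : R, 0 < x -> {for x, continuous (du eta)}) ->
  (forall eta x : R, 0 < x -> `|du eta x| <= K x) ->
  forall eta : R, is_derive eta (1 : R) (fun e : R => \int[leb]_(x in `[A, B]) u e x)
    (F eta B - F eta A).
Proof.
move=> A0 AB hu hF cu cdu duK eta.
have mAB : measurable (`[A, B]%classic : set (measurableTypeR R)) by exact: measurable_itv.
have pos x : `[A, B]%classic x -> 0 < x.
  by rewrite /= in_itv /= => /andP[Ax _]; exact: lt_le_trans Ax.
have Ieta : `]eta - 1, eta + 1[%classic eta by rewrite /= in_itv /=; apply/andP; split; lra.
have d1 e x : partial1of2 u e x = du e x.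
  by rewrite /partial1of2 derive1E; exact: (@derive_val _ _ _ _ _ _ _ (hu e x)).
have K0 x : 0 < x -> 0 <= K x by move=> x0; exact: le_trans (duK 0 x x0).
pose G (x : R) := `|K x|.
have IK : leb.-integrable `[A, B] (EFin \o G).
  by have := integrable_abse (cont_int B A0 (fun x => @K_cont x)).
have h1 (x : R) : `]eta - 1, eta + 1[%classic x -> leb.-integrable `[A, B] (EFin \o u x).
  by move=> _; apply: cont_int => // y y0; exact: cu.
have h2 (x y : R) : `]eta - 1, eta + 1[%classic x -> `[A, B]%classic y -> derivable (u ^~ y) x 1.
  by move=> _ _; exact: (@ex_derive _ _ _ _ _ _ _ (hu x y)).
have h3 (x y : R) : `]eta - 1, eta + 1[%classic x -> `[A, B]%classic y -> `|partial1of2 u x y| <= G y.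
  by move=> _ /pos y0; rewrite d1 (le_trans (duK _ _ y0)) // ler_norm.
have := derivable_under_integral mAB Ieta h1 h2 (fun y => normr_ge0 (K y)) IK h3.
have := differentiation_under_integral mAB Ieta h1 h2 (fun y => normr_ge0 (K y)) IK h3.
move=> e1 e2; apply: DeriveDef; first exact: e2.
rewrite -derive1E e1.
have [||_ <-] := @FTC_is_derive R (du eta) (F eta) A B AB.
- by move=> x /andP[Ax _]; apply: hF; exact: lt_le_trans Ax.
- by move=> x /andP[Ax _]; apply: cdu; exact: lt_le_trans Ax.
- by apply: eq_Rintegral => x _; exact: d1.
Qed.

Lemma is_derive_int_rotRe (A B eta : R) : 0 < A -> A < B ->
  is_derive eta (1 : R) (fun e : R => \int[leb]_(x in `[A, B]) rotRe (s - 1) e x)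
    (rotIm s eta A - rotIm s eta B).
Proof.
move=> A0 AB.
have := @is_derive_rot (rotRe (s - 1)) rotRe_deta (fun e x => - rotIm s e x) A B A0 AB.
move=> /(_ is_derive_rotRe_eta _ (@rotRe_cont (s - 1)) rotRe_deta_cont rotRe_deta_le) H.
rewrite (_ : rotIm s eta A - rotIm s eta B = - rotIm s eta B - - rotIm s eta A); last by ring.
apply: H => e x x0; apply: (is_derive_eq (isdN (is_derive_rotIm_x e x0))).
by rewrite opprK.
Qed.

Lemma is_derive_int_rotIm (A B eta : R) : 0 < A -> A < B ->
  is_derive eta (1 : R) (fun e : R => \int[leb]_(x in `[A, B]) rotIm (s - 1) e x)
    (rotRe s eta B - rotRe s eta A).
Proof.
move=> A0 AB.
exact: (@is_derive_rot (rotIm (s - 1)) rotIm_deta (fun e x => rotRe s e x) A B A0 AB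
  is_derive_rotIm_eta is_derive_rotRe_x (@rotIm_cont (s - 1)) rotIm_deta_cont rotIm_deta_le).
Qed.

End rotation.

Section rotation_limits.
Variable R : realType.
Let leb : {measure set (measurableTypeR R) -> \bar R} := @lebesgue_measure R.
Local Notation contpos f := (forall x : R, 0 < x -> {for x, continuous f}).

Let I (f : R -> R) n : R := \int[leb]_(x in @exhaust R n) f x.

Let ex_lo n : 0 < n.+2%:R^-1 :> R. Proof. by rewrite invr_gt0 ltr0n. Qed.
Let ex_lt n : n.+2%:R^-1 < n.+2%:R :> R.
Proof. by rewrite (@lt_trans _ _ 1) // ?ltr1n // invf_lt1 ?ltr0n // ltr1n. Qed.
Let ex_meas n : measurable (@exhaust R n : set (measurableTypeR R)).
Proof. exact: measurable_itv. Qed.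

Let ex_int (f : R -> R) n : contpos f -> leb.-integrable (@exhaust R n) (EFin \o f).
Proof.
move=> cf; apply: continuous_compact_integrable; first exact: segment_compact.
apply/subspace_continuousP => x; rewrite /exhaust /= in_itv /= => /andP[Ax _].
by apply: cvg_within_filter; apply: cf; exact: lt_le_trans Ax.
Qed.

Let I_lin (c d : R) (f g : R -> R) n : contpos f -> contpos g ->
  I (fun x => c * f x + d * g x) n = c * I f n + d * I g n.
Proof.
move=> cf cg; rewrite /I RintegralD //.
- by rewrite !RintegralZl //; exact: ex_int.
- by apply: rintZ => //; exact: ex_int.
- by apply: rintZ => //; exact: ex_int.
Qed.

Let eqI (f g : R -> R) n : (forall x, 0 < x -> f x = g x) -> I f n = I g n.
Proof.
move=> fg; apply: eq_Rintegral => x; rewrite inE /exhaust /= in_itv /= => /andP[h _].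
by apply: fg; exact: lt_le_trans h.
Qed.

Lemma cvg_powRN_nat (p : R) : 0 < p -> (n.+2%:R `^ (- p) : R) @[n --> \oo] --> (0 : R).
Proof.
move=> p0.
have -> : (fun n : nat => n.+2%:R `^ (- p) : R) = (fun n : nat => (n.+2%:R^-1) `^ p).
  apply/funext => n; rewrite -[X in X `^ p]powR_inv1 ?ler0n // -powRrM mulN1r //.
have /cvg_at_rightP := @powR_cvg0 R p p0; apply; split; first exact: ex_lo.
apply/cvgrPdist_lt => e e0; near=> n.
rewrite sub0r normrN gtr0_norm //.
near: n; exists (Num.truncn e^-1) => // n /= ne.
rewrite invf_plt ?posrE ?ltr0n // (lt_le_trans (truncnS_gt _)) // ler_nat ltnW // ltnS ltnS //.
Unshelve. all: by end_near.
Qed.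

Let cosN (alpha : R) : contpos (fun x => cos (alpha - x)).
Proof.
move=> x _; apply: differentiable_continuous; apply/derivable1_diffP.
exact: (@ex_derive _ _ _ _ _ _ _ (isd_cos (isdB (isd_cst alpha x) (isd_id x)))).
Qed.
Let sinN (alpha : R) : contpos (fun x => sin (alpha - x)).
Proof.
move=> x _; apply: differentiable_continuous; apply/derivable1_diffP.
exact: (@ex_derive _ _ _ _ _ _ _ (isd_sin (isdB (isd_cst alpha x) (isd_id x)))).
Qed.
Let expN : contpos (fun x : R => expR (- x)).
Proof.
move=> x _; apply: differentiable_continuous; apply/derivable1_diffP.
exact: (@ex_derive _ _ _ _ _ _ _ (isd_expR (isdN (isd_id x)))).
Qed.
Let cmul (f g : R -> R) : contpos f -> contpos g -> contpos (fun x => f x * g x).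
Proof. by move=> cf cg x x0; apply: cvgM; [exact: cf|exact: cg]. Qed.
Let cpow (r : R) : contpos (fun x : R => x `^ r).
Proof. by move=> x x0; exact: powR_continuous_gt0. Qed.

Section general.
Variables (s a b : R).

Let cR (eta : R) : contpos (rotRe s a b (s - 1) eta). Proof. by move=> x; exact: rotRe_cont. Qed.
Let cI (eta : R) : contpos (rotIm s a b (s - 1) eta). Proof. by move=> x; exact: rotIm_cont. Qed.

(** The angular derivative of the integral over [exhaust n] consists of the boundary terms at the
    two endpoints, and [phi n] is a primitive of a bound for them. If its increment over a quarter
    turn tends to 0, the rotated integrals inherit the limits at angle 0, where the imaginary part
    vanishes. *)
Lemma rotation_cvg (phi dphi : nat -> R -> R) :
  (forall n (x : R), is_derive x (1 : R) (phi n) (dphi n x)) ->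
  (forall n x, 0 <= x <= pi / 2 ->
     `|rotRe s a b s x n.+2%:R| + `|rotRe s a b s x n.+2%:R^-1| <= dphi n x) ->
  (forall n x, 0 <= x <= pi / 2 ->
     `|rotIm s a b s x n.+2%:R| + `|rotIm s a b s x n.+2%:R^-1| <= dphi n x) ->
  (fun n => phi n (pi / 2) - phi n 0) @ \oo --> (0 : R) ->
  forall G : R, (fun n => I (rotRe s a b (s - 1) 0) n) @ \oo --> G ->
  (fun n => I (rotRe s a b (s - 1) (pi / 2)) n) @ \oo --> G /\
  (fun n => I (rotIm s a b (s - 1) (pi / 2)) n) @ \oo --> (0 : R).
Proof.
move=> hphi bR bI phi0 G cG.
have pi20 : 0 <= pi / 2 :> R by have := pi_gt0 R; lra.
have dR n : `|I (rotRe s a b (s - 1) (pi / 2)) n - I (rotRe s a b (s - 1) 0) n| <=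
    phi n (pi / 2) - phi n 0.
  apply: (derive_comparison pi20 (F := fun e => I (rotRe s a b (s - 1) e) n)
    (fun x => is_derive_int_rotRe s a b x (ex_lo n) (ex_lt n)) (hphi n)).
  by move=> x hx; rewrite (le_trans (ler_normB _ _)) // addrC bI.
have dI n : `|I (rotIm s a b (s - 1) (pi / 2)) n - I (rotIm s a b (s - 1) 0) n| <=
    phi n (pi / 2) - phi n 0.
  apply: (derive_comparison pi20 (F := fun e => I (rotIm s a b (s - 1) e) n)
    (fun x => is_derive_int_rotIm s a b x (ex_lo n) (ex_lt n)) (hphi n)).
  move=> x hx; apply: le_trans (bR n x hx).
  exact: ler_normB.
have I0 n : I (rotIm s a b (s - 1) 0) n = 0.
  rewrite -[RHS](_ : I (fun=> 0) n = 0); last by rewrite /I /Rintegral integral0.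
  by apply: eqI => x _; rewrite /rotIm !mulr0 !sin0 !mulr0 subr0 !sin0 !mulr0 addr0 mulr0.
split.
- have : I (rotRe s a b (s - 1) (pi / 2)) n - I (rotRe s a b (s - 1) 0) n @[n --> \oo] --> (0 : R).
    apply/norm_cvg0P; apply: (squeeze_cvgr _ (cvg_cst 0) phi0).
    by apply: nearW => n; rewrite normr_ge0 dR.
  move=> /cvgD/(_ cG); rewrite add0r; apply: cvg_trans; apply: near_eq_cvg.
  by apply: nearW => n /=; rewrite subrK.
- apply/norm_cvg0P; apply: (squeeze_cvgr _ (cvg_cst 0) phi0).
  by apply: nearW => n; rewrite normr_ge0 /=; have := dI n; rewrite I0 subr0.
Qed.

End general.

Lemma cos_rotation (alpha x : R) :
  cos x = cos alpha * cos (alpha - x) + sin alpha * sin (alpha - x).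
Proof. by rewrite -cosB opprB addrC subrK. Qed.

Lemma sin_rotation (alpha x : R) :
  sin x = sin alpha * cos (alpha - x) - cos alpha * sin (alpha - x).
Proof. by rewrite -sinB opprB addrC subrK. Qed.

(** The minimum of [f] over [[1, 2]] is positive and bounds the integral from below. *)
Lemma Rintegral_gt0 (f : R -> R) : (forall x, 0 < x -> 0 < f x) -> contpos f ->
  leb.-integrable `]0, +oo[ (EFin \o f) -> 0 < \int[leb]_(x in `]0, +oo[) f x.
Proof.
move=> f0 cf If.
have mD : measurable (`]0, +oo[%classic : set (measurableTypeR R)) by exact: measurable_itv.
have mA : measurable (`[1, 2]%classic : set (measurableTypeR R)) by exact: measurable_itv.
have cw : {within `[(1 : R), 2], continuous f}.
  apply/subspace_continuousP => x /=; rewrite in_itv /= => /andP[x1 _].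
  by apply: cvg_within_filter; apply: cf; exact: lt_le_trans x1.
have [c c12 fc] := EVT_min (ler1n R 2) cw.
have c0 : 0 < c by move: c12; rewrite in_itv /= => /andP[c1 _]; exact: lt_le_trans c1.
pose g := (fun=> f c : R) \_ (`[1, 2] : set R).
have gf x : `]0, +oo[%classic x -> `|g x| <= f x.
  rewrite /= in_itv /= andbT => x0; rewrite /g patchE mem_setE; case: ifP => x12.
    by rewrite gtr0_norm ?f0 // fc.
  by rewrite normr0 ltW // f0.
have mg : measurable_fun (`]0, +oo[ : set (measurableTypeR R)) g.
  by apply: measurable_funTS; apply: (proj1 (measurable_restrictT _ mA)); exact: measurable_cst.
have Ig : leb.-integrable `]0, +oo[ (EFin \o g) by exact: (rint_le mD mg gf).
apply: (@lt_le_trans _ _ (\int[leb]_(x in `]0, +oo[) g x)); last first.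
  by apply: le_Rintegral => // x xD; rewrite (le_trans (ler_norm _)) // gf.
rewrite /g -Rintegral_mkcondr (_ : _ `&` _ = `[1, 2]%classic); last first.
  apply/setIidPr => x /=; rewrite !in_itv /= andbT => /andP[x1 _].
  exact: lt_le_trans x1.
rewrite Rintegral_cst // mulr_gt0 ?f0 //.
have -> : leb `[(1 : R), 2]%classic = ((2 : R)%:E - (1 : R)%:E)%E.
  by rewrite -[leb _]/(lebesgue_measure `[(1 : R), 2]%classic) lebesgue_measure_itv /= lte_fin ltr1n.
by rewrite /=; lra.
Qed.

(** [G] is Gamma(s). After a quarter turn x^(s-1) e^(-x) becomes x^(s-1) e^(i (al - x)) with al = s
    pi / 2, and undoing the phase recovers cosine and sine of x. *)
Lemma rotated_gamma_lt1 (s : R) : 0 < s < 1 -> exists2 G : R, 0 < G &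
  I (fun x => x `^ (s - 1) * cos x) n @[n --> \oo] --> G * cos (s * (pi / 2)) /\
  I (fun x => x `^ (s - 1) * sin x) n @[n --> \oo] --> G * sin (s * (pi / 2)).
Proof.
move=> /andP[s0 s1].
pose g (x : R) := x `^ (s - 1) * expR (- x).
have cg : contpos g by exact: (cmul (@cpow (s - 1)) expN).
have mg : measurable_fun setT g.
  apply: measurable_funM; first exact: measurable_powR.
  by apply: measurableT_comp => //; exact: oppr_measurable.
have Ig : leb.-integrable `]0, +oo[ (EFin \o g).
{
  apply: (@integrable_half_line _ g (1 - s) 2 4) => //; [lra|lra| |].
  - move=> x /andP[x0 x1]; rewrite ger0_norm ?mulr_ge0 ?powR_ge0 ?expR_ge0 //.
    rewrite opprB mulrC ler_pM ?powR_ge0 ?expR_ge0 //.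
    by rewrite (le_trans (expRN_le1 (ltW x0))) // ler1n.
  - move=> x x1; have x0 : 0 < x by exact: lt_le_trans x1.
    rewrite ger0_norm ?mulr_ge0 ?powR_ge0 ?expR_ge0 //.
    rewrite powRN -[2]/(2%:R) (powR_mulrn 2 (ltW x0)).
    have h1 : x `^ (s - 1) <= 1.
      by rewrite -[leRHS](powRr0 x); apply: ler_powR => //; lra.
    (* From e^x = (e^(x/2))^2 and e^(x/2) >= x/2. *)
    have h2 : expR (- x) <= 4 / x ^+ 2.
      rewrite expRN -[leRHS]invrK lef_pV2 ?posrE ?expR_gt0 ?invr_gt0 ?divr_gt0 ?exprn_gt0 //.
      rewrite invf_div (_ : x = x / 2 + x / 2); last by lra.
      rewrite expRD -(_ : x = x / 2 + x / 2); last by lra.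
      have := expR_ge1Dx (x / 2) => h.
      have : (x / 2) * (x / 2) <= expR (x / 2) * expR (x / 2).
        by apply: ler_pM; lra.
      by rewrite expr2; lra.
    by rewrite -[leRHS]mul1r ler_pM ?powR_ge0 ?expR_ge0.
}
pose G := \int[leb]_(x in `]0, +oo[) g x.
have G0 : 0 < G.
  by apply: Rintegral_gt0 => // x x0; rewrite mulr_gt0 ?powR_gt0 ?expR_gt0.
exists G => //.
have cG : I (rotRe s 0 1 (s - 1) 0) n @[n --> \oo] --> G.
  have := exhaust_cvg Ig mg; apply: cvg_trans; apply: near_eq_cvg; apply: nearW => n.
  apply: eqI => x x0; rewrite /rotRe mul0r add0r mul1r mulr0 cos0 sin0 !mulr0 subr0 cos0.
  by rewrite !mulr1.
(* With N = n + 2, the outer boundary term is at most N^s exp(-N cos e). As sin e + cos e >= 1, this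
   is at most N^(s-1) times the derivative of exp(-N cos e) plus 1, because y e^(-y) <= 1. The inner
   endpoint contributes at most N^(-s). *)
pose phi n e : R := n.+2%:R `^ (s - 1) * (expR (- (n.+2%:R * cos e)) + e) + n.+2%:R^-1 `^ s * e.
pose dphi n e : R := n.+2%:R `^ (s - 1) * (expR (- (n.+2%:R * cos e)) * (n.+2%:R * sin e) + 1) + n.+2%:R^-1 `^ s.
have hphi n (e : R) : is_derive e (1 : R) (phi n) (dphi n e).
  have h := isdD (isdZ (n.+2%:R `^ (s - 1)) (isdD (isd_expR (isdN (isdZ n.+2%:R (isd_cos (isd_id e))))) (isd_id e)))
    (isdZ (n.+2%:R^-1 `^ s) (isd_id e)).
  by apply: (is_derive_eq h); rewrite /dphi; ring.
have B0 n : 0 < n.+2%:R :> R by rewrite ltr0n.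
have powB n : n.+2%:R `^ s = n.+2%:R `^ (s - 1) * n.+2%:R :> R.
  rewrite -[X in _ * X](powRr1 (ltW (B0 n))) -powRD; last by rewrite (gt_eqF (B0 n)) implybT.
  by congr (_ `^ _); lra.
have key n e (t : R) : 0 <= e <= pi / 2 -> `|t| <= 1 -> forall t' : R, `|t'| <= 1 ->
    `|n.+2%:R `^ s * (expR (- (n.+2%:R * cos e)) * t)| +
    `|n.+2%:R^-1 `^ s * (expR (- (n.+2%:R^-1 * cos e)) * t')| <= dphi n e.
  move=> he t1 t' t'1.
  have ce : 0 <= cos e.
    by apply: cos_ge0_pihalf; case/andP: he => h1 h2; apply/andP; split; have := pi_gt0 R; lra.
  rewrite /dphi; apply: lerD.
    rewrite normrM (ger0_norm (powR_ge0 _ _)) powB -mulrA ler_wpM2l ?powR_ge0 //.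
    rewrite normrM (gtr0_norm (expR_gt0 _)).
    set E := expR _.
    have h1 : n.+2%:R * (E * `|t|) <= n.+2%:R * E.
      by rewrite ler_wpM2l ?ler0n // ler_piMr // expR_ge0.
    have h2 : n.+2%:R * E <= n.+2%:R * E * (sin e + cos e).
      by rewrite ler_peMr ?sinDcos_ge1 // mulr_ge0 ?expR_ge0 // ler0n.
    have h3 := mulr_expRN_le1 (n.+2%:R * cos e).
    rewrite -/E in h3; lra.
  rewrite normrM (ger0_norm (powR_ge0 _ _)) ler_piMr ?powR_ge0 //.
  rewrite normrM (gtr0_norm (expR_gt0 _)) mulr_ile1 ?expR_ge0 //.
  by rewrite expRN_le1 // mulr_ge0 // invr_ge0 ler0n.
have trig1 (y : R) : `|cos y| <= 1 by rewrite ler_norml cos_geN1 cos_le1.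
have trig2 (y : R) : `|sin y| <= 1 by rewrite ler_norml sin_geN1 sin_le1.
have [||| cR cI] := @rotation_cvg s 0 1 phi dphi hphi _ _ _ G cG.
- by move=> n e he; rewrite /rotRe !mul0r !add0r !mul1r; exact: key.
- by move=> n e he; rewrite /rotIm !mul0r !add0r !mul1r; exact: key.
- have c1 : n.+2%:R `^ (s - 1) @[n --> \oo] --> (0 : R).
    by rewrite -opprB; apply: cvg_powRN_nat; lra.
  have c2 : n.+2%:R^-1 `^ s @[n --> \oo] --> (0 : R).
    have := cvg_powRN_nat s0; apply: cvg_trans; apply: near_eq_cvg; apply: nearW => n.
    by rewrite -[X in X `^ s]powR_inv1 ?ler0n // -powRrM mulN1r.
  apply/norm_cvg0P.
  have c3 : n.+2%:R `^ (s - 1) * (2 + pi / 2) + n.+2%:R^-1 `^ s * (pi / 2) @[n --> \oo] --> (0 : R).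
    rewrite -[X in _ --> X](_ : 0 * (2 + pi / 2) + 0 * (pi / 2) = 0 :> R); last by ring.
    by apply: cvgD; apply: cvgM => //; exact: cvg_cst.
  apply: (squeeze_cvgr _ (cvg_cst 0) c3); apply: nearW => n /=; rewrite normr_ge0 /=.
  have pi0 := pi_gt0 R.
  rewrite /phi cos_pihalf cos0 mulr0 oppr0 expR0 mulr1 !addr0 mulr0 addr0.
  rewrite addrAC -mulrBr (le_trans (ler_normD _ _)) // lerD //.
    rewrite normrM (ger0_norm (powR_ge0 _ _)) ler_wpM2l ?powR_ge0 //.
    have := expRN_le1 (ler0n R n.+2); have := expR_gt0 (- (n.+2%:R : R)) => e1 e2.
    by rewrite ler_norml; lra.
  by rewrite ger0_norm // mulr_ge0 ?powR_ge0 //; lra.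
- have pwc r : contpos (fun x : R => x `^ r) by exact: cpow.
  set al := s * (pi / 2).
  have eR n : I (rotRe s 0 1 (s - 1) (pi / 2)) n = I (fun x => x `^ (s - 1) * cos (al - x)) n.
    apply: eqI => x _; rewrite /rotRe !mul0r !add0r !mul1r cos_pihalf sin_pihalf.
    by rewrite mulr0 oppr0 expR0 mul1r mulr1.
  have eI n : I (rotIm s 0 1 (s - 1) (pi / 2)) n = I (fun x => x `^ (s - 1) * sin (al - x)) n.
    apply: eqI => x _; rewrite /rotIm !mul0r !add0r !mul1r cos_pihalf sin_pihalf.
    by rewrite mulr0 oppr0 expR0 mul1r mulr1.
  have {}cR : I (fun x => x `^ (s - 1) * cos (al - x)) n @[n --> \oo] --> G.
    by move: cR; apply: cvg_trans; apply: near_eq_cvg; apply: nearW => n; rewrite eR.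
  have {}cI : I (fun x => x `^ (s - 1) * sin (al - x)) n @[n --> \oo] --> (0 : R).
    by move: cI; apply: cvg_trans; apply: near_eq_cvg; apply: nearW => n; rewrite eI.
  have lim (c d : R) (f : R -> R) : (forall x, f x = c * cos (al - x) + d * sin (al - x)) ->
      I (fun x => x `^ (s - 1) * f x) n @[n --> \oo] --> G * c.
    move=> fE; rewrite (_ : G * c = c * G + d * 0); last by ring.
    have : c * I (fun x => x `^ (s - 1) * cos (al - x)) n +
           d * I (fun x => x `^ (s - 1) * sin (al - x)) n @[n --> \oo] --> c * G + d * 0.
      by apply: cvgD; apply: cvgM => //; exact: cvg_cst.
    apply: cvg_trans; apply: near_eq_cvg; apply: nearW => n.
    rewrite -I_lin; [|exact: (cmul (@cpow (s - 1)) (@cosN al))|exact: (cmul (@cpow (s - 1)) (@sinN al))].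
    by apply: eqI => x _; rewrite fE; ring.
  split.
    by apply: (lim _ (sin al)) => x; exact: cos_rotation.
  by apply: (lim _ (- cos al)) => x; rewrite mulNr; exact: sin_rotation.
Qed.

(** Since x^(s-1) e^(-x) is not integrable at 0 for negative s, the integrand x^(s-1) (1 - e^(-x))
    is rotated instead, that is a = 1 and b = -1; then [G] is -Gamma(s), a positive number. *)
Lemma rotated_gamma_neg (s : R) : -1 < s < 0 -> exists2 G : R, 0 < G &
  I (fun x => x `^ (s - 1) * (1 - cos x)) n @[n --> \oo] --> G * cos (s * (pi / 2)) /\
  I (fun x => x `^ (s - 1) * sin x) n @[n --> \oo] --> - (G * sin (s * (pi / 2))).
Proof.
move=> /andP[s0 s1].
pose g (x : R) := x `^ (s - 1) * (1 - expR (- x)).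
have cg : contpos g.
  apply: (cmul (@cpow (s - 1))) => x x0.
  by apply: cvgB; [exact: cvg_cst|exact: expN].
have mg : measurable_fun setT g.
  apply: measurable_funM; first exact: measurable_powR.
  apply: measurable_funB; first exact: measurable_cst.
  by apply: measurableT_comp => //; exact: oppr_measurable.
have powM r (x : R) : 0 < x -> x `^ r = x `^ (r - 1) * x.
  move=> x0; rewrite -[X in _ * X](powRr1 (ltW x0)) -powRD; last by rewrite (gt_eqF x0) implybT.
  by congr (_ `^ _); lra.
have onem0 (x : R) : 0 < x -> 0 < 1 - expR (- x).
  by move=> x0; rewrite subr_gt0 -[ltRHS]expR0 ltr_expR oppr_lt0.
have Ig : leb.-integrable `]0, +oo[ (EFin \o g).
{
  apply: (@integrable_half_line _ g (- s) (1 - s) 1) => //; [lra|lra| |].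
  - move=> x /andP[x0 x1]; have h := onem0 x x0.
    rewrite ger0_norm ?(mulr_ge0 (powR_ge0 _ _) (ltW h)) // opprK mul1r (powM s) //.
    by rewrite ler_wpM2l ?powR_ge0 // onem_expRN_le.
  - move=> x x1; have x0 : 0 < x by exact: lt_le_trans x1.
    have h := onem0 x x0.
    rewrite ger0_norm ?(mulr_ge0 (powR_ge0 _ _) (ltW h)) // opprB mul1r ler_piMr ?powR_ge0 //.
}
pose G := \int[leb]_(x in `]0, +oo[) g x.
have G0 : 0 < G.
  by apply: Rintegral_gt0 => // x x0; rewrite mulr_gt0 ?powR_gt0 ?onem0.
exists G => //.
have cG : I (rotRe s 1 (-1) (s - 1) 0) n @[n --> \oo] --> G.
  have := exhaust_cvg Ig mg; apply: cvg_trans; apply: near_eq_cvg; apply: nearW => n.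
  apply: eqI => x x0; rewrite /rotRe mulr0 cos0 sin0 !mulr0 subr0 cos0.
  by rewrite !mulr1 mulN1r.
(* The outer boundary term is at most 2 N^s. At the inner endpoint x = 1/N the bracket is at most 2
   x: one x from shifting the phase, one from 1 - exp(-x cos e). *)
pose c n : R := 2 * n.+2%:R `^ s + 2 * (n.+2%:R^-1 `^ s * n.+2%:R^-1).
pose phi n (e : R) : R := c n * e.
have hphi n (e : R) : is_derive e (1 : R) (phi n) (c n).
  by apply: (is_derive_eq (isdZ (c n) (isd_id e))); rewrite mulr1.
have key (f : R -> R) n e : (forall x, `|f x| <= 1) ->
    (forall x y, `|f x - f y| <= `|x - y|) -> 0 <= e <= pi / 2 ->
    `|n.+2%:R `^ s * (1 * f (s * e) + (-1) * (expR (- (n.+2%:R * cos e)) * f (s * e - n.+2%:R * sin e)))| +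
    `|n.+2%:R^-1 `^ s * (1 * f (s * e) + (-1) * (expR (- (n.+2%:R^-1 * cos e)) * f (s * e - n.+2%:R^-1 * sin e)))| <= c n.
  move=> f1 flip he.
  have ce : 0 <= cos e <= 1.
    rewrite cos_le1 andbT.
    by apply: cos_ge0_pihalf; case/andP: he => h1 h2; apply/andP; split; have := pi_gt0 R; lra.
  have se : `|sin e| <= 1 by rewrite ler_norml sin_geN1 sin_le1.
  have E1 (x : R) : 0 <= x -> 0 < expR (- (x * cos e)) <= 1.
    by move=> x0; rewrite expR_gt0 expRN_le1 // mulr_ge0 //; case/andP: ce.
  rewrite /c; apply: lerD.
    rewrite mulrC normrM (ger0_norm (powR_ge0 _ _)) ler_wpM2r ?powR_ge0 //.
    have /andP[e0 e1] := E1 n.+2%:R (ler0n _ _).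
    rewrite mul1r mulN1r (le_trans (ler_normB _ _)) // normrM (gtr0_norm e0).
    have := f1 (s * e); have : expR (- (n.+2%:R * cos e)) * `|f (s * e - n.+2%:R * sin e)| <= 1.
      by rewrite mulr_ile1 // ltW.
    lra.
  set x := n.+2%:R^-1; have x0 : 0 < x by exact: ex_lo.
  rewrite [leRHS]mulrCA normrM (ger0_norm (powR_ge0 _ _)) ler_wpM2l ?powR_ge0 //.
  have /andP[e0 e1] := E1 x (ltW x0).
  set E := expR _ in e0 e1 *.
  rewrite (_ : _ + _ = (f (s * e) - f (s * e - x * sin e)) + (1 - E) * f (s * e - x * sin e)); last by ring.
  rewrite (le_trans (ler_normD _ _)) //.
  have h1 : `|f (s * e) - f (s * e - x * sin e)| <= x.
    rewrite (le_trans (flip _ _)) // opprB addrC subrK normrM (gtr0_norm x0).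
    by rewrite ler_piMr // ltW.
  have h2 : `|(1 - E) * f (s * e - x * sin e)| <= x.
    rewrite normrM ger0_norm; last by lra.
    have h3 : 1 - E <= x.
      rewrite (le_trans (onem_expRN_le _)) // ler_piMr ?(ltW x0) //.
    by rewrite (le_trans _ h3) // ler_piMr // subr_ge0.
  by lra.
have [||| cR cI] := @rotation_cvg s 1 (-1) phi (fun n _ => c n) hphi _ _ _ G cG.
- by move=> n e he; apply: key => // [x|x y]; [rewrite ler_norml cos_geN1 cos_le1|exact: cos_lip].
- by move=> n e he; apply: key => // [x|x y]; [rewrite ler_norml sin_geN1 sin_le1|exact: sin_lip].
- have c1 : n.+2%:R `^ s @[n --> \oo] --> (0 : R).
    by rewrite -[s]opprK; apply: cvg_powRN_nat; lra.
  have c2 : n.+2%:R^-1 `^ s * n.+2%:R^-1 @[n --> \oo] --> (0 : R).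
    have s10 : 0 < s + 1 by lra.
    have := cvg_powRN_nat s10; apply: cvg_trans; apply: near_eq_cvg; apply: nearW => n.
    rewrite -[in RHS](addrK 1 s) -powM // -[X in X `^ (s + 1)]powR_inv1 ?ler0n //.
    by rewrite -powRrM mulN1r.
  rewrite -[X in _ --> X](_ : (2 * 0 + 2 * 0) * (pi / 2) = 0 :> R); last by ring.
  have : c n * (pi / 2) @[n --> \oo] --> (2 * 0 + 2 * 0) * (pi / 2 : R).
    by apply: cvgM; [apply: cvgD; apply: cvgM => //; exact: cvg_cst|exact: cvg_cst].
  by apply: cvg_trans; apply: near_eq_cvg; apply: nearW => n; rewrite /phi mulr0 subr0.
- set al := s * (pi / 2).
  pose u (x : R) := cos al - cos (al - x); pose v (x : R) := sin al - sin (al - x).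
  have cu : contpos u by move=> x x0; apply: cvgB; [exact: cvg_cst|exact: cosN].
  have cv : contpos v by move=> x x0; apply: cvgB; [exact: cvg_cst|exact: sinN].
  have eR n : I (rotRe s 1 (-1) (s - 1) (pi / 2)) n = I (fun x => x `^ (s - 1) * u x) n.
    apply: eqI => x _; rewrite /rotRe cos_pihalf sin_pihalf.
    by rewrite mulr0 oppr0 expR0 !mul1r mulr1 mulN1r.
  have eI n : I (rotIm s 1 (-1) (s - 1) (pi / 2)) n = I (fun x => x `^ (s - 1) * v x) n.
    apply: eqI => x _; rewrite /rotIm cos_pihalf sin_pihalf.
    by rewrite mulr0 oppr0 expR0 !mul1r mulr1 mulN1r.
  have {}cR : I (fun x => x `^ (s - 1) * u x) n @[n --> \oo] --> G.
    by move: cR; apply: cvg_trans; apply: near_eq_cvg; apply: nearW => n; rewrite eR.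
  have {}cI : I (fun x => x `^ (s - 1) * v x) n @[n --> \oo] --> (0 : R).
    by move: cI; apply: cvg_trans; apply: near_eq_cvg; apply: nearW => n; rewrite eI.
  have lim (k d : R) (f : R -> R) : (forall x, f x = k * u x + d * v x) ->
      I (fun x => x `^ (s - 1) * f x) n @[n --> \oo] --> G * k.
    move=> fE; rewrite (_ : G * k = k * G + d * 0); last by ring.
    have : k * I (fun x => x `^ (s - 1) * u x) n +
           d * I (fun x => x `^ (s - 1) * v x) n @[n --> \oo] --> k * G + d * 0.
      by apply: cvgD; apply: cvgM => //; exact: cvg_cst.
    apply: cvg_trans; apply: near_eq_cvg; apply: nearW => n.
    rewrite -I_lin; [|exact: (cmul (@cpow (s - 1)) cu)|exact: (cmul (@cpow (s - 1)) cv)].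
    by apply: eqI => x _; rewrite fE; ring.
  split.
    apply: (lim _ (sin al)) => x; rewrite /u /v [cos x](cos_rotation al).
    by rewrite -(cos2Dsin2 al); ring.
  rewrite -mulrN; apply: (lim _ (cos al)) => x; rewrite /u /v [sin x](sin_rotation al).
  by ring.
Qed.

End rotation_limits.

(** * Regularly varying tails *)

Section regular_variation.
Variable R : realType.
Variables (H : R -> R) (beta : R).
Hypothesis Hdec : forall x y, x <= y -> H y <= H x.
Hypothesis Hpos : forall x, 0 < H x.
Hypothesis H1 : forall x, H x <= 1.
Hypothesis HRV : forall c : R, 0 < c -> (fun x => H (c * x) / H x) @ +oo --> c `^ (- beta).

Section exponent.
Variable e : R.
Hypothesis ebeta : 0 < e < beta.

(** Regular variation used at the single ratio 2, with the exponent relaxed by [e] in both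
    directions; monotonicity will fill in the other ratios. *)
Lemma potter_doubling : exists2 x0 : R, 0 < x0 & forall x, x0 <= x ->
  H (2 * x) <= 2 `^ (- (beta - e)) * H x /\ H x <= 2 `^ (beta + e) * H (2 * x).
Proof.
case/andP: ebeta => e0 eb.
have c2 := HRV (ltr0n R 2).
have l1 : 2 `^ (- beta) < 2 `^ (- (beta - e)) :> R.
  by rewrite /powR pnatr_eq0 /= ltr_expR ltr_pM2r ?ln_gt0 ?ltr1n //; lra.
have l2 : 2 `^ (- (beta + e)) < 2 `^ (- beta) :> R.
  by rewrite /powR pnatr_eq0 /= ltr_expR ltr_pM2r ?ln_gt0 ?ltr1n //; lra.
have [M1 [_ h1]] := cvgr_lt _ c2 _ l1.
have [M2 [_ h2]] := cvgr_gt _ c2 _ l2.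
exists (`|M1| + `|M2| + 1); first by rewrite ltr_wpDl ?addr_ge0.
move=> x hx; have := ler_norm M1; have := ler_norm M2 => n2 n1.
have x1 : M1 < x by have := normr_ge0 M2; lra.
have x2 : M2 < x by have := normr_ge0 M1; lra.
split.
- by rewrite -ler_pdivrMr // ltW // h1.
- rewrite -ler_pdivrMl ?powR_gt0 // -powRN -ler_pdivlMr // ltW // h2 //.
Qed.

(** Potter's bound: the doubling estimates are iterated and monotonicity interpolates between powers
    of 2. When [c * x] falls below the threshold, [H <= 1] is used instead, so that the estimate
    covers every positive [c]. *)
Lemma potter_upper : exists C x0 : R, 0 < C /\ 0 < x0 /\ forall x c, x0 <= x -> 0 < c ->
  H (c * x) <= C * (c `^ (- (beta + e)) + c `^ (- (beta - e))) * H x.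
Proof.
case/andP: ebeta => e0 eb.
have [x0 x00 dbl] := potter_doubling.
pose q : R := 2 `^ (- (beta - e)); pose Q : R := 2 `^ (beta + e).
have q0 : 0 < q by rewrite powR_gt0.
have Q0 : 0 < Q by rewrite powR_gt0.
have up k x : x0 <= x -> H (2 ^+ k * x) <= q ^+ k * H x.
  move=> hx; elim: k => [|k IH]; first by rewrite !expr0 !mul1r.
  have hk : x0 <= 2 ^+ k * x.
    by rewrite (le_trans hx) // ler_peMl ?(le_trans (ltW x00)) // exprn_ege1 // ler1n.
  rewrite exprS -mulrA (le_trans (dbl _ hk).1) // -/q exprS -mulrA ler_wpM2l //.
  exact: ltW.
have low k x : x0 <= x -> H x <= Q ^+ k * H (2 ^+ k * x).
  move=> hx; elim: k => [|k IH]; first by rewrite !expr0 !mul1r.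
  have hk : x0 <= 2 ^+ k * x.
    by rewrite (le_trans hx) // ler_peMl ?(le_trans (ltW x00)) // exprn_ege1 // ler1n.
  rewrite (le_trans IH) // exprSr -mulrA ler_wpM2l ?exprn_ge0 ?(ltW Q0) //.
  by rewrite exprS -mulrA; exact: (dbl _ hk).2.
have dyadic (c : R) : 1 <= c -> exists k, 2 ^+ k <= c < 2 ^+ k.+1.
  move=> c1.
  have ex : exists n, c < 2 ^+ n.
    exists (Num.truncn c).+1; rewrite (lt_trans (truncnS_gt _)) // -natrX ltr_nat.
    exact: ltn_expl.
  case: (ex_minnP ex) => -[|k] ck min; first by rewrite expr0 in ck; lra.
  exists k; rewrite ck andbT leNgt; apply/negP => /min.
  by rewrite ltnn.
have pw (r : R) k : (2 ^+ k : R) `^ r = (2 `^ r) ^+ k.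
  elim: k => [|k IH]; first by rewrite !expr0 powR1.
  by rewrite !exprS powRM ?exprn_ge0 // IH.
have lowc y x c : x0 <= y -> y <= x -> x <= c * y -> 1 <= c -> H y <= Q * c `^ (beta + e) * H x.
  move=> hy yx xc c1; have [k /andP[k1 k2]] := dyadic c c1.
  have y0 : 0 < y by exact: lt_le_trans hy.
  rewrite (le_trans (low k.+1 y hy)) // ler_pM ?exprn_ge0 ?(ltW Q0) ?(ltW (Hpos _)) //.
    rewrite exprS ler_wpM2l ?(ltW Q0) // /Q -pw ge0_ler_powR ?nnegrE //; first lra.
    by rewrite (le_trans _ c1).
  by apply: Hdec; rewrite (le_trans xc) // ler_wpM2r // ltW.
(* One term for each regime: c >= 1; c < 1 with c x above the threshold; c x below it. *)
pose C := q^-1 + Q + Q / H x0.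
have QH : 0 < Q / H x0 by rewrite divr_gt0.
have C0 : 0 < C by rewrite !addr_gt0 ?invr_gt0.
exists C, x0; split => //; split => // x c hx c0.
have x00' : 0 < x by exact: lt_le_trans hx.
have P1 : 0 <= c `^ (- (beta + e)) by exact: powR_ge0.
have P2 : 0 <= c `^ (- (beta - e)) by exact: powR_ge0.
have fin K p : 0 <= p -> K <= C -> 0 <= K -> p <= c `^ (- (beta + e)) + c `^ (- (beta - e)) ->
    K * p * H x <= C * (c `^ (- (beta + e)) + c `^ (- (beta - e))) * H x.
  by move=> p0 KC K0 pp; rewrite ler_wpM2r ?(ltW (Hpos _)) // ler_pM.
have iq : 0 < q^-1 by rewrite invr_gt0.
have [c1|c1] := leP 1 c.
  have [k /andP[k1 k2]] := dyadic c c1.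
  apply: le_trans (fin q^-1 (c `^ (- (beta - e))) _ _ _ _) => //; [|rewrite /C; lra|exact: ltW|lra].
  have h : H (c * x) <= H (2 ^+ k * x) by apply: Hdec; rewrite ler_wpM2r // ltW.
  rewrite (le_trans h) // (le_trans (up k x hx)) // ler_wpM2r ?(ltW (Hpos _)) //.
  rewrite mulrC ler_pdivlMr // -exprSr /q -pw.
  rewrite !powRN lef_pV2 ?posrE ?powR_gt0 ?exprn_gt0 //.
  by rewrite ge0_ler_powR ?nnegrE ?exprn_ge0 ?ltW //; lra.
have ic1 : 1 <= c^-1 by rewrite invf_ge1 // ltW.
have icp : c^-1 `^ (beta + e) = c `^ (- (beta + e)).
  by rewrite -[X in X `^ _]powR_inv1 ?ltW // -powRrM mulN1r.
have [cx|cx] := leP x0 (c * x).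
  apply: le_trans (fin Q (c `^ (- (beta + e))) _ _ _ _) => //; [|rewrite /C; lra|exact: ltW|lra].
  rewrite -icp; apply: lowc => //.
    by rewrite ler_piMl // ltW.
  by rewrite mulrA mulVf ?gt_eqF // mul1r.
apply: le_trans (fin (Q / H x0) (c `^ (- (beta + e))) _ _ _ _) => //; [|rewrite /C; lra|exact: ltW|lra].
rewrite (le_trans (H1 _)) // -icp.
have h : H x0 <= Q * c^-1 `^ (beta + e) * H x.
  by apply: lowc => //; rewrite mulrC ler_pdivlMr // mulrC ltW.
rewrite (_ : _ * H x = Q * c^-1 `^ (beta + e) * H x / H x0); last by ring.
by rewrite ler_pdivlMr // mul1r.
Qed.

End exponent.

Section along_sequence.
Variables (b : nat -> R) (kappa : R).
Hypotheses (b_oo : b @ \oo --> +oo) (bH : (fun n => n%:R * H (b n)) @ \oo --> kappa).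
Hypothesis kappa0 : 0 < kappa.

Lemma b_near (M : R) : \forall n \near \oo, M <= b n.
Proof. by move/cvgryPge : b_oo; apply. Qed.

Lemma tail_cvg (x : R) : 0 < x -> (fun n => n%:R * H (b n * x)) @ \oo --> kappa * x `^ (- beta).
Proof.
move=> x0; have h : (fun n => H (x * b n) / H (b n)) @ \oo --> x `^ (- beta).
  by apply: cvg_comp (HRV x0); exact: b_oo.
rewrite (_ : (fun n => _) = (fun n => (n%:R * H (b n)) * (H (x * b n) / H (b n)))).
  exact: cvgM.
apply/funext => n; have := Hpos (b n) => Hb; rewrite [x * _]mulrC; field.
by rewrite gt_eqF.
Qed.

(** Potter's bound at the ratio [x / v]. The majorant separates the variables: [v] will be
    integrated against the law of the volatility, [x] against Lebesgue measure. *)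
Lemma tail_dom e : 0 < e < beta -> exists2 C : R, 0 < C &
  \forall n \near \oo, forall v x, 0 < v -> 0 < x ->
    n%:R * H (b n / v * x) <=
    C * (v `^ (beta + e) + v `^ (beta - e)) * (x `^ (- (beta + e)) + x `^ (- (beta - e))).
Proof.
move=> ebeta; have [C [x0 [C0 [x00 pot]]]] := potter_upper ebeta.
exists (C * (kappa + 1)); first by rewrite mulr_gt0 // addr_gt0.
have nk : \forall n \near \oo, n%:R * H (b n) < kappa + 1.
  by apply: (cvgr_lt _ bH); rewrite ltrDl.
near=> n => v x v0 x0'.
have hb : x0 <= b n by near: n; exact: b_near.
have hk : n%:R * H (b n) < kappa + 1 by near: n.
have xv : 0 < x / v by rewrite divr_gt0.
rewrite (_ : b n / v * x = x / v * b n); last by ring.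
rewrite (le_trans (ler_wpM2l (ler0n _ n) (pot _ _ hb xv))) //.
have pe r : (x / v) `^ (- r) = x `^ (- r) * v `^ r.
  rewrite powRM ?ltW ?invr_gt0 //; congr (_ * _).
  by rewrite -[X in X `^ _]powR_inv1 ?ltW // -powRrM mulN1r opprK.
rewrite !pe.
set A := x `^ _; set B := x `^ _; set D := v `^ _; set E := v `^ _.
have A0 : 0 <= A by exact: powR_ge0. have B0 : 0 <= B by exact: powR_ge0.
have D0 : 0 <= D by exact: powR_ge0. have E0 : 0 <= E by exact: powR_ge0.
apply: (@le_trans _ _ (C * (n%:R * H (b n)) * (A * D + B * E))).
  by rewrite le_eqVlt; apply/orP; left; apply/eqP; ring.
rewrite -[leRHS]mulrA ler_pM //.
- by rewrite !mulr_ge0 ?ler0n ?(ltW (Hpos _)) // ltW.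
- by rewrite addr_ge0 ?mulr_ge0.
- by rewrite ler_wpM2l ?(ltW C0) // ltW.
- rewrite mulrDl !mulrDr; have := mulr_ge0 D0 B0; have := mulr_ge0 E0 A0; lra.
Unshelve. all: by end_near.
Qed.

End along_sequence.
End regular_variation.

Section survival.
Context d (T : measurableType d) (R : realType) (P : probability T R).
Variables (Y : T -> R).
Hypothesis mY : measurable_fun setT Y.

Lemma gt_measurable x : measurable [set w | x < Y w].
Proof.
have := measurable_fun_ltr (measurable_cst x) mY measurableT (Y := [set true]) I.
by rewrite setTI.
Qed.

Lemma survival_ge0 x : 0 <= fine (P [set w | x < Y w]). Proof. exact: fine_ge0. Qed.

Lemma survival_le1 x : fine (P [set w | x < Y w]) <= 1.
Proof.
rewrite -[leRHS]/(fine 1%E) fine_le ?fin_num_measure //.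
  exact: gt_measurable.
by apply: probability_le1; exact: gt_measurable.
Qed.

Lemma survival_nonincreasing x y : x <= y ->
  fine (P [set w | y < Y w]) <= fine (P [set w | x < Y w]).
Proof.
move=> xy; rewrite fine_le ?fin_num_measure //; try exact: gt_measurable.
by rewrite le_measure ?inE //; [exact: gt_measurable|exact: gt_measurable|move=> w /=; exact: le_lt_trans].
Qed.

Lemma survival_measurable : measurable_fun setT (fun x : R => fine (P [set w | x < Y w])).
Proof. by apply: nonincreasing_measurable => // x y; exact: survival_nonincreasing. Qed.

End survival.

(** * Expectations of differentiable functions through tails *)

Section layer_cake_derivative.
Context d (T : measurableType d) (R : realType) (P : probability T R).
Let leb : {measure set (measurableTypeR R) -> \bar R} := @lebesgue_measure R.
Variables (Y : T -> R) (g f : R -> R).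
Hypotheses (mY : measurable_fun setT Y) (Y0 : forall w, 0 <= Y w).
Hypothesis gf : forall x : R, is_derive x (1 : R) g (f x).
Hypothesis cf : continuous f.

Let mf : measurable_fun setT f. Proof. exact: continuous_measurable_fun. Qed.

Let int_f (y : R) : 0 <= y -> leb.-integrable `]0, y[ (EFin \o f) /\
  \int[leb]_(x in `]0, y[) f x = g y - g 0.
Proof.
rewrite le_eqVlt => /predU1P[<-|y0].
  have -> : `](0 : R), 0[%classic = set0.
    by apply/seteqP; split => // x /=; rewrite in_itv /= => /andP[h /(lt_trans h)]; rewrite ltxx.
  by rewrite subrr Rintegral_set0; split => //; exact: integrable_set0.
have [I <-] := @FTC_is_derive R f g 0 y y0 (fun x _ => gf x) (fun x _ => @cf x).
have I1 : leb.-integrable `[0, y[ (EFin \o f).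
  by apply: (integrableS _ _ _ I) => // x /=; rewrite !in_itv /= => /andP[-> /ltW].
have I2 : leb.-integrable `]0, y[ (EFin \o f).
  by apply: (integrableS _ _ _ I) => // x /=; rewrite !in_itv /= => /andP[/ltW -> /ltW].
split => //.
by rewrite -(Rintegral_itv_bndo_bndc I1) -(Rintegral_itv_obnd_cbnd I2).
Qed.

Lemma layer_cake_derive :
  leb.-integrable `]0, +oo[ (EFin \o (fun x => f x * fine (P [set w | x < Y w]))) ->
  P.-integrable setT (EFin \o (fun w => g (Y w))) /\
  \int[P]_w g (Y w) - g 0 = \int[leb]_(x in `]0, +oo[) (f x * fine (P [set w | x < Y w])).
Proof.
move=> If.
have fint y : leb.-integrable `]0, y[ (EFin \o f).
  have [y0|y0] := leP 0 y; first by have [] := int_f y0.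
  have -> : `](0 : R), y[%classic = set0.
    apply/seteqP; split => // x /=; rewrite in_itv /= => /andP[h /(lt_trans h)].
    by move=> /(lt_trans y0); rewrite ltxx.
  exact: integrable_set0.
have [IY <-] := layer_cake mY mf fint If.
have e : (fun w => g (Y w)) = (fun w => \int[leb]_(x in `]0, Y w[) f x + g 0).
  by apply/funext => w; rewrite (int_f (Y0 w)).2 subrK.
have Ic : P.-integrable setT (EFin \o (fun _ : T => g 0)).
  by apply: bmf_int; exact: bmf_cst.
rewrite e; split; first exact: rintD.
by rewrite RintegralD // Rintegral_cstT addrK.
Qed.

(** Stopping [Y] at [M] restricts [f] to a bounded interval, where it is bounded. For index below 1
    the integral of [f] against the limiting tail x^(-beta) may converge only conditionally, and the
    limit has to be taken through [M]. *)
Lemma layer_cake_derive_min (M : R) : 0 < M ->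
  P.-integrable setT (EFin \o (fun w => g (Num.min (Y w) M))) /\
  \int[P]_w g (Num.min (Y w) M) - g 0 =
  \int[leb]_(x in `]0, +oo[) ((f \_ (`]0, M] : set R)) x * fine (P [set w | x < Y w])).
Proof.
move=> M0.
have mA : measurable (`]0, M]%classic : set (measurableTypeR R)) by exact: measurable_itv.
have mD : measurable (`]0, +oo[%classic : set (measurableTypeR R)) by exact: measurable_itv.
have mfM : measurable_fun setT (f \_ (`]0, M] : set R)).
  apply: (proj1 (measurable_restrictT _ mA)); exact: measurable_funTS.
have cw : {within `[0, M], continuous f}.
  by apply: continuous_subspaceT => x; exact: cf.
have [B fB] : exists B, forall x, 0 <= x <= M -> `|f x| <= B.
  have [c1 _ h1] := EVT_max (ltW M0) cw; have [c2 _ h2] := EVT_min (ltW M0) cw.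
  exists (`|f c1| + `|f c2|) => x xM; have := h1 x; have := h2 x.
  rewrite in_itv /= xM => /(_ isT) a1 /(_ isT) a2.
  have := ler_norm (f c1); have := ler_norm (- f c2); rewrite normrN => b1 b2.
  by rewrite ler_norml; have := normr_ge0 (f c1); have := normr_ge0 (f c2); lra.
have IB : leb.-integrable `]0, M] (EFin \o (fun=> `|B|)).
{
  apply: (integrableS _ _ _ (@FTC_is_derive R (fun=> `|B|) (fun x => `|B| * x) 0 M M0 _ _).1) => //.
  - by move=> x /=; rewrite !in_itv /= => /andP[/ltW -> ->].
  - by move=> x _; apply: (is_derive_eq (isdZ `|B| (isd_id x))); rewrite mulr1.
  - by move=> x _; exact: cst_continuous.
}
have fM x : `|(f \_ (`]0, M] : set R)) x| <= ((fun=> `|B|) \_ (`]0, M] : set R)) x.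
  rewrite !patchE mem_setE; case: ifP => //; last by rewrite normr0.
  by rewrite in_itv /= => /andP[/ltW x0 xM]; rewrite (le_trans (fB x _)) ?x0 // ler_norm.
have IBT : leb.-integrable setT (EFin \o ((fun=> `|B|) \_ (`]0, M] : set R))).
  by rewrite -restrict_EFin; apply/(integrable_mkcond _ mA).
have fint y : leb.-integrable `]0, y[ (EFin \o (f \_ (`]0, M] : set R))).
  apply: (integrableS measurableT) => //.
  have mT : measurable (setT : set (measurableTypeR R)) by [].
  exact: (rint_le mT mfM (fun x _ => fM x) IBT).
have If : leb.-integrable `]0, +oo[ (EFin \o (fun x => (f \_ (`]0, M] : set R)) x * fine (P [set w | x < Y w]))).
{
  apply: (rint_le mD (g := (fun=> `|B|) \_ (`]0, M] : set R))).
  - apply: measurable_funTS; apply: measurable_funM => //.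
    exact: survival_measurable.
  - move=> x _; rewrite normrM (le_trans _ (fM x)) // ler_piMr //.
    by rewrite ger0_norm ?survival_ge0 // survival_le1.
  - by apply: (integrableS measurableT).
}
have [IY <-] := layer_cake mY mfM fint If.
have e : (fun w => g (Num.min (Y w) M)) = (fun w => \int[leb]_(x in `]0, Y w[) (f \_ (`]0, M] : set R)) x + g 0).
  apply/funext => w; rewrite -Rintegral_mkcondr.
  have [YM|MY] := ltP (Y w) M.
    rewrite (_ : _ `&` _ = `]0, Y w[%classic) ?(int_f (Y0 w)).2 ?subrK //.
    apply/setIidPl => x /=; rewrite !in_itv /= => /andP[-> xY].
    by rewrite ltW // (lt_trans xY).
  have [->|nMY] := eqVneq (Y w) M.
    rewrite (_ : _ `&` _ = `]0, M[%classic) ?(int_f (ltW M0)).2 ?subrK //.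
    by apply/setIidPl => x /=; rewrite !in_itv /= => /andP[-> /ltW].
  rewrite (_ : _ `&` _ = `]0, M]%classic); last first.
    apply/setIidPr => x /=; rewrite !in_itv /= => /andP[-> xM] /=.
    by rewrite (le_lt_trans xM) // lt_neqAle eq_sym nMY.
  by rewrite -(Rintegral_itv_bndo_bndc (int_f (ltW M0)).1) (int_f (ltW M0)).2 subrK.
have Ic : P.-integrable setT (EFin \o (fun _ : T => g 0)).
  by apply: bmf_int; exact: bmf_cst.
rewrite e; split; first exact: rintD.
by rewrite RintegralD // Rintegral_cstT addrK.
Qed.

End layer_cake_derivative.

Section limit_interchange.
Variable R : realType.

Lemma powRV (x r : R) : 0 <= x -> x^-1 `^ r = x `^ (- r).
Proof. by move=> x0; rewrite -[X in X `^ _]powR_inv1 // -powRrM mulN1r. Qed.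

(** A three-epsilon argument; the approximation at level [m] need only hold for [n] large depending
    on [m]. *)
Lemma cvg_interchange (a : nat -> R) (A : nat -> nat -> R) (L r : nat -> R) (l : R) :
  (forall m, A m @ \oo --> L m) -> L @ \oo --> l -> r @ \oo --> 0 ->
  (forall m, \forall n \near \oo, `|a n - A m n| <= r m) -> a @ \oo --> l.
Proof.
move=> AL Ll r0 aA; apply/cvgrPdist_lt => e e0.
have e3 : 0 < e / 3 by lra.
have [N1 _ h1] := (cvgrPdist_lt _ _).1 Ll _ e3.
have [N2 _ h2] := (cvgrPdist_lt _ _).1 r0 _ e3.
pose m := maxn N1 N2.
have hm1 := h1 m (leq_maxl _ _); have hm2 := h2 m (leq_maxr _ _).
have h3 := (cvgrPdist_lt _ _).1 (AL m) _ e3.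
near=> n.
have hn1 : `|a n - A m n| <= r m by near: n; exact: aA.
have hn2 : `|L m - A m n| < e / 3 by near: n; exact: h3.
rewrite /= in hm1 hm2; rewrite sub0r normrN in hm2; have := ler_norm (r m) => rm.
rewrite (_ : l - a n = (l - L m) + (L m - A m n) - (a n - A m n)); last by ring.
rewrite (le_lt_trans (ler_normB _ _)) // (le_lt_trans (lerD (ler_normD _ _) (lexx _))) //.
by lra.
Unshelve. all: by end_near.
Qed.

Lemma cvg_powRN_oo (b : nat -> R) (p : R) : 0 < p -> b @ \oo --> +oo ->
  (fun n => b n `^ (- p)) @ \oo --> 0.
Proof.
move=> p0 boo; apply/cvgrPdist_le => e e0; near=> n.
have hb : e `^ (- p^-1) <= b n by near: n; move/cvgryPge : boo; apply.
have K0 : 0 < e `^ (- p^-1) by rewrite powR_gt0.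
rewrite sub0r normrN ger0_norm ?powR_ge0 //.
set K := e `^ _ in hb K0 *.
have eK : K `^ (- p) = e by rewrite /K -powRrM mulrNN mulVf ?gt_eqF // powRr1 // ltW.
have b0 : 0 < b n by exact: lt_le_trans hb.
rewrite -eK !powRN lef_pV2 ?posrE ?powR_gt0 //.
by rewrite ge0_ler_powR ?nnegrE // ltW.
Unshelve. all: by end_near.
Qed.

End limit_interchange.

(** * Limits of rescaled tail expectations *)

Section tail_limit.
Context d (T : measurableType d) (R : realType) (P : probability T R).
Let leb : {measure set (measurableTypeR R) -> \bar R} := @lebesgue_measure R.
Variables (W : T -> R) (beta : R).
Hypotheses (mW : measurable_fun setT W) (W0 : forall w, 0 <= W w).
Let H (x : R) := fine (P [set w | x < W w]).
Hypothesis Hpos : forall x, 0 < H x.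
Hypothesis HRV : forall c : R, 0 < c -> (fun x => H (c * x) / H x) @ +oo --> c `^ (- beta).
Variables (b : nat -> R) (kappa : R).
Hypotheses (b_oo : b @ \oo --> +oo) (bH : (fun n => n%:R * H (b n)) @ \oo --> kappa).
Hypothesis kappa0 : 0 < kappa.

Let Y (v : R) n w : R := v / b n * W w.
(** [n] times the tail of [Y v n] at [x], once [v] and [b n] are positive. Its limit kappa v^beta
    x^(-beta) is the tail of the Levy measure of the limiting stable law. *)
Let N (v : R) n (x : R) : R := n%:R * H (b n / v * x).

Let mD : measurable (`]0, +oo[%classic : set (measurableTypeR R)). Proof. exact: measurable_itv. Qed.
Let posD x : `]0, +oo[%classic x -> 0 < x :> R. Proof. by rewrite /= in_itv /= andbT. Qed.

Let mY v n : measurable_fun setT (Y v n). Proof. exact: measurable_funM. Qed.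
Let Y0 v n w : 0 < v -> 0 < b n -> 0 <= Y v n w.
Proof. by move=> v0 b0; rewrite mulr_ge0 // divr_ge0 // ltW. Qed.

Let Y_tail v n x : 0 < v -> 0 < b n -> fine (P [set w | x < Y v n w]) = H (b n / v * x).
Proof.
move=> v0 b0; rewrite /H; congr (fine (P _)); apply/seteqP; split => w /=.
  rewrite /Y -ltr_pdivrMl ?divr_gt0 // invf_div; done.
by rewrite /Y -ltr_pdivrMl ?divr_gt0 // invf_div.
Qed.

Let b0 : \forall n \near \oo, 0 < b n.
Proof. by near=> n; apply: (lt_le_trans ltr01); near: n; exact: b_near. Unshelve. all: by end_near. Qed.

Let H_measurable v n : measurable_fun setT (fun x : R => H (b n / v * x)).
Proof. by apply: (measurableT_comp (survival_measurable P mW)); exact: mulrl_measurable. Qed.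

Let N_cvg v x : 0 < v -> 0 < x -> (fun n => N v n x) @ \oo --> kappa * v `^ beta * x `^ (- beta).
Proof.
move=> v0 x0; have xv : 0 < x / v by rewrite divr_gt0.
have -> : kappa * v `^ beta * x `^ (- beta) = kappa * (x / v) `^ (- beta).
  by rewrite powRM ?(ltW x0) ?invr_ge0 ?(ltW v0) // powRV ?(ltW v0) // opprK; ring.
have := tail_cvg Hpos HRV b_oo bH xv; apply: cvg_trans; apply: near_eq_cvg.
by apply: nearW => n; rewrite /N; congr (_ * H _); ring.
Qed.

Variable e : R.
Hypothesis ebeta : 0 < e < beta.
(** [growth] and [decay] are the two factors of Potter's majorant, for the scale and for the level;
    the exponents above and below beta cover both large and small arguments. *)
Definition growth (v : R) : R := v `^ (beta + e) + v `^ (beta - e).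
Definition decay (x : R) : R := x `^ (- (beta + e)) + x `^ (- (beta - e)).

Let growth_ge0 v : 0 <= growth v. Proof. by rewrite addr_ge0 ?powR_ge0. Qed.
Let decay_ge0 v : 0 <= decay v. Proof. by rewrite addr_ge0 ?powR_ge0. Qed.
Let decay_measurable : measurable_fun setT decay.
Proof. by apply: measurable_funD; exact: measurable_powR. Qed.

Let Hdom : exists2 C : R, 0 < C & \forall n \near \oo, forall v x, 0 < v -> 0 < x ->
    N v n x <= C * growth v * decay x.
Proof.
exact: (tail_dom (survival_nonincreasing P mW) Hpos (survival_le1 P mW) HRV b_oo bH kappa0 ebeta).
Qed.

Let N_ge0 v n x : 0 <= N v n x. Proof. by rewrite mulr_ge0 ?ler0n ?survival_ge0. Qed.

(** Dominated convergence under the separated majorant. The accompanying bound by [growth v],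
    uniform in large [n], will dominate a second integral, over the law of the volatility. *)
Let weighted_tail (F : R -> R) : measurable_fun setT F ->
  leb.-integrable `]0, +oo[ (EFin \o (fun x => `|F x| * decay x)) ->
  (forall v, 0 < v -> (fun n => \int[leb]_(x in `]0, +oo[) (F x * N v n x)) @ \oo -->
     kappa * v `^ beta * \int[leb]_(x in `]0, +oo[) (F x * x `^ (- beta))) /\
  (exists2 C : R, 0 < C & \forall n \near \oo, forall v, 0 < v ->
     leb.-integrable `]0, +oo[ (EFin \o (fun x => F x * H (b n / v * x))) /\
     `|\int[leb]_(x in `]0, +oo[) (F x * N v n x)| <= C * growth v).
Proof.
move=> mF IF; have [C C0 dom] := Hdom.
have mFN v n : measurable_fun setT (fun x => F x * N v n x).
  by apply: measurable_funM => //; apply: measurable_funM => //; exact: H_measurable.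
have mFH v n : measurable_fun setT (fun x => F x * H (b n / v * x)).
  by apply: measurable_funM => //; exact: H_measurable.
have mFND v n : measurable_fun (`]0, +oo[ : set (measurableTypeR R)) (fun x => F x * N v n x).
  by apply: measurable_funTS; exact: mFN.
have mFHD v n : measurable_fun (`]0, +oo[ : set (measurableTypeR R)) (fun x => F x * H (b n / v * x)).
  by apply: measurable_funTS; exact: mFH.
have IG v : leb.-integrable `]0, +oo[ (EFin \o (fun x => C * growth v * (`|F x| * decay x))).
  exact: (rintZ mD).
split.
- move=> v v0.
  have mxb : measurable_fun setT (fun x : R => x `^ (- beta)) by exact: measurable_powR.
  have [] := @Rintegral_dct _ _ R leb _ mD (fun n x => F x * N v n x)
     (fun x => F x * (kappa * v `^ beta * x `^ (- beta))) (fun x => C * growth v * (`|F x| * decay x)).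
  + by move=> n; exact: mFND.
  + by apply: measurable_funTS; apply: measurable_funM => //; apply: measurable_funM.
  + move=> x /posD x0; apply: cvgM; first exact: cvg_cst.
    exact: N_cvg.
  + exact: IG.
  + near=> n => x /posD x0; rewrite normrM (ger0_norm (N_ge0 _ _ _)) [leRHS]mulrCA ler_wpM2l //.
    by apply: (near dom n).
  + move=> I1 c; rewrite -RintegralZl //.
    * move: c; congr (_ --> _); apply: eq_Rintegral => x _; ring.
    * have [kv|kv] := eqVneq (kappa * v `^ beta) 0.
        by move/eqP: kv; rewrite mulf_eq0 (gt_eqF kappa0) powR_eq0 (gt_eqF v0).
      have := rintZ mD (kappa * v `^ beta)^-1 I1; congr (leb.-integrable _ _).
      by apply/funext => x /=; congr EFin; rewrite mulrCA mulKf.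
- exists (C * \int[leb]_(x in `]0, +oo[) (`|F x| * decay x) + 1).
    rewrite ltr_wpDl // mulr_ge0 ?(ltW C0) //; apply: Rintegral_ge0 => x _.
    by rewrite mulr_ge0.
  near=> n => v v0.
  have n0 : 1 <= n%:R :> R by rewrite ler1n; near: n; exists 1%N.
  have bnd x : `]0, +oo[%classic x -> `|F x * N v n x| <= C * growth v * (`|F x| * decay x).
    move=> /posD x0; rewrite normrM (ger0_norm (N_ge0 _ _ _)) [leRHS]mulrCA ler_wpM2l //.
    by apply: (near dom n).
  have bnd2 x : `]0, +oo[%classic x -> `|F x * H (b n / v * x)| <= C * growth v * (`|F x| * decay x).
    move=> xD; rewrite (le_trans _ (bnd x xD)) // !normrM ler_wpM2l //.
    by rewrite ler_peMl // ger0_norm // ler0n.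
  split; first exact: (rint_le mD (mFHD _ _) bnd2 (IG v)).
  apply: (@le_trans _ _ (\int[leb]_(x in `]0, +oo[) (C * growth v * (`|F x| * decay x)))).
    apply: norm_Rintegral_le => //.
    exact: (rint_le mD (mFND _ _) bnd (IG v)).
  rewrite RintegralZl // mulrDl mul1r mulrAC lerDl; exact: growth_ge0.
Unshelve. all: by end_near.
Qed.

Let tailE (F : R -> R) v n : 0 < v -> 0 < b n ->
  leb.-integrable `]0, +oo[ (EFin \o (fun x => F x * H (b n / v * x))) ->
  n%:R * \int[leb]_(x in `]0, +oo[) (F x * fine (P [set w | x < Y v n w])) =
  \int[leb]_(x in `]0, +oo[) (F x * N v n x).
Proof.
move=> v0 bn0 I; rewrite (_ : (fun x => _) = (fun x => F x * H (b n / v * x))); last first.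
  by apply/funext => x; rewrite Y_tail.
by rewrite -RintegralZl //; apply: eq_Rintegral => x _; rewrite /N; ring.
Qed.

Let decay_small x : 0 < x <= 1 -> decay x <= 2 * x `^ (- (beta + e)).
Proof.
move=> /andP[x0 x1]; rewrite /decay mulr_natl mulr2n lerD2l.
by apply: ger_powR; rewrite ?x0 //; case/andP: ebeta => *; lra.
Qed.

Let decay_large x : 1 <= x -> decay x <= 2 * x `^ (- (beta - e)).
Proof.
move=> x1; rewrite /decay mulr_natl mulr2n lerD2r.
by apply: ler_powR => //; case/andP: ebeta => *; lra.
Qed.

Let le_decay x : 0 < x -> x `^ (- beta) <= decay x.
Proof.
move=> x0; case/andP: ebeta => e0 eb; have [x1|x1] := leP x 1.
  rewrite /decay -[leLHS]addr0 lerD ?powR_ge0 //.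
  by apply: ger_powR; rewrite ?x0 //; lra.
rewrite /decay -[leLHS]add0r lerD ?powR_ge0 //.
by apply: ler_powR; [exact: ltW|lra].
Qed.

Section small_index.
Hypothesis beta1 : beta + e < 1.
Variables (g f : R -> R).
Hypotheses (gf : forall x : R, is_derive x (1 : R) g (f x)) (cf : continuous f).
Hypotheses (f1 : forall x, `|f x| <= 1) (g1 : forall x, `|g x| <= 1).

Let mg : measurable_fun setT g.
Proof.
by apply: continuous_measurable_fun => x; apply: differentiable_continuous; apply/derivable1_diffP; exact: ex_derive.
Qed.

Let trunc (M : R) (h : R -> R) := h \_ (`]0, M] : set R).

Let truncM (M : R) (h : R -> R) : 0 < M -> continuous h -> (forall x, `|h x| <= 1) ->
  measurable_fun setT (trunc M h) /\
  leb.-integrable `]0, +oo[ (EFin \o (fun x => `|trunc M h x| * decay x)).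
Proof.
move=> M0 ch h1.
have mA : measurable (`]0, M]%classic : set (measurableTypeR R)) by exact: measurable_itv.
have mt : measurable_fun setT (trunc M h).
  apply: (proj1 (measurable_restrictT _ mA)); apply: measurable_funTS.
  exact: continuous_measurable_fun.
have t1 x : `|trunc M h x| <= 1.
  by rewrite /trunc patchE; case: ifP => // _; rewrite normr0.
split => //; apply: (@integrable_half_line _ _ (beta + e) 2 (2 + 2 * M ^+ 2)) => //.
- apply: measurable_funM; last exact: decay_measurable.
  exact: measurableT_comp.
- by lra.
- move=> x x01; rewrite ger0_norm ?mulr_ge0 // mulrDl.
  rewrite (@le_trans _ _ (2 * x `^ (- (beta + e)))) //; last first.
    by rewrite lerDl !mulr_ge0 ?powR_ge0 ?exprn_ge0 // ltW.
  by rewrite (le_trans _ (decay_small x01)) // ler_piMl.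
- move=> x x1; have x0 : 0 < x by exact: lt_le_trans x1.
  rewrite ger0_norm ?mulr_ge0 //; rewrite powRN -[2]/(2%:R) (powR_mulrn 2 (ltW x0)).
  have [xM|Mx] := leP x M; last first.
    rewrite /trunc patchE mem_setE in_itv /= x0 /= (lt_geF Mx) normr0 mul0r.
    by rewrite divr_ge0 ?exprn_ge0 ?addr_ge0 ?mulr_ge0 ?exprn_ge0 // ltW.
  have d2 : decay x <= 2.
    rewrite (le_trans (decay_large x1)) // ler_piMr // -[leRHS](powRr0 x).
    by apply: ler_powR => //; case/andP: ebeta => *; lra.
  rewrite (@le_trans _ _ 2) //.
    by rewrite (le_trans _ d2) // ler_piMl.
  rewrite ler_pdivlMr ?exprn_gt0 // mulrDl.
  have : x ^+ 2 <= M ^+ 2 by rewrite ler_pXn2r ?nnegrE // ltW.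
  by have := sqr_ge0 x; lra.
Qed.

(** As [f] and [g] are bounded by 1, the increment of [g] from 0 to y is at most min(y, 2), whose
    expectation is a truncated layer-cake integral with derivative 1. *)
Lemma tail_limit_small_dom : exists2 C : R, 0 < C & \forall n \near \oo, forall v, 0 < v ->
  `|n%:R * (\int[P]_w g (v / b n * W w) - g 0)| <= C * growth v.
Proof.
have c1 : continuous (fun _ : R => 1 : R) by move=> x; exact: cst_continuous.
have h1 (x : R) : `|1 : R| <= 1 by rewrite normr1.
have [m1 I1] := truncM (ltr0n R 2) c1 h1.
have [_ [C C0 dom]] := weighted_tail m1 I1.
exists C => //; apply: filterS2 dom b0 => n dom bn0 v v0; have [I3 bnd] := dom _ v0.
have Yn0 w : 0 <= Y v n w by exact: Y0.
have [I2] := layer_cake_derive_min P (mY v n) Yn0 (@isd_id R) c1 (ltr0n R 2).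
rewrite subr0 => E2.
have g2 y : 0 <= y -> `|g y - g 0| <= Num.min y 2.
{
  move=> y0; rewrite le_min; apply/andP; split; last first.
    by rewrite (le_trans (ler_normB _ _)) // -[2]/(1 + 1) lerD.
  have := lipschitz_of_derive gf f1 y 0.
  by rewrite subr0 (ger0_norm y0) mul1r.
}
have Ig : P.-integrable setT (EFin \o (fun w => g (Y v n w))).
  apply: bmf_int; split; first exact: measurableT_comp.
  by exists 1.
have -> : \int[P]_w g (v / b n * W w) - g 0 = \int[P]_w (g (Y v n w) - g 0).
  by rewrite RintegralB ?Rintegral_cstT //; apply: bmf_int; exact: bmf_cst.
rewrite normrM ger0_norm ?ler0n //.
apply: (@le_trans _ _ (n%:R * \int[P]_w Num.min (Y v n w) 2)).
- rewrite ler_wpM2l ?ler0n // norm_Rintegral_le // => [|w _].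
  + by apply: rintB => //; apply: bmf_int; exact: bmf_cst.
  + exact: g2.
- by apply: le_trans bnd; apply: le_trans (ler_norm _); rewrite E2 tailE.
Qed.


(** Outside [exhaust m] the function truncated at m + 2 coincides with the one truncated at 1: both
    keep the part near 0 and vanish beyond m + 2. That contribution is the remainder of an
    absolutely convergent integral. *)
Let exhausted (Gam : R) : (fun m => \int[leb]_(x in exhaust m) (x `^ (- beta) * f x)) @ \oo --> Gam ->
  (fun m => \int[leb]_(x in `]0, +oo[) (trunc m.+2%:R f x * x `^ (- beta))) @ \oo --> Gam.
Proof.
move=> cG.
have mxb : measurable_fun setT (fun x : R => x `^ (- beta)) by exact: measurable_powR.
pose u (M x : R) := trunc M f x * x `^ (- beta).
have mu M : 0 < M -> measurable_fun setT (u M).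
  by move=> M0; apply: measurable_funM => //; have [] := truncM M0 cf f1.
have Iu M : 0 < M -> leb.-integrable `]0, +oo[ (EFin \o u M).
{
  move=> M0; have [_ I] := truncM M0 cf f1.
  apply: (rint_le mD _ _ I); first by apply: measurable_funTS; exact: mu.
  move=> x /posD x0; rewrite normrM (ger0_norm (powR_ge0 _ _)) ler_wpM2l //.
  exact: le_decay.
}
have mE n : measurable (@exhaust R n : set (measurableTypeR R)) by exact: measurable_itv.
have sE n : @exhaust R n `<=` `]0, +oo[%classic.
  move=> x; rewrite /exhaust /= !in_itv /= andbT => /andP[h _].
  by rewrite (lt_le_trans _ h) // invr_gt0 ltr0n.
have split_ M n : 0 < M -> \int[leb]_(x in `]0, +oo[) u M x =
    \int[leb]_(x in exhaust n) u M x + \int[leb]_(x in `]0, +oo[ `\` exhaust n) u M x.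
{
  move=> M0; rewrite -Rintegral_setU ?setDUK //.
  - exact: measurableD.
  - exact: Iu.
  - by apply/disj_setPS => x [? []].
}
have e1 m : \int[leb]_(x in exhaust m) (x `^ (- beta) * f x) = \int[leb]_(x in exhaust m) u m.+2%:R x.
  apply: eq_Rintegral => x; rewrite inE /exhaust /= in_itv /= => /andP[h1 h2].
  rewrite /u /trunc patchE mem_setE in_itv /= h2 (lt_le_trans _ h1) ?invr_gt0 ?ltr0n //=.
  exact: mulrC.
have e2 m : \int[leb]_(x in `]0, +oo[ `\` exhaust m) u m.+2%:R x =
            \int[leb]_(x in `]0, +oo[ `\` exhaust m) u 1 x.
  apply: eq_Rintegral => x; rewrite inE => -[/posD x0]; rewrite /exhaust /= in_itv /= => /negP h.
  rewrite /u /trunc !patchE !mem_setE !in_itv /= x0 /=; congr (_ * _).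
  have m1 : m.+2%:R^-1 <= 1 :> R by rewrite invf_le1 ?ltr0n // ler1n.
  have m2 : 1 <= m.+2%:R :> R by rewrite ler1n.
  move: h; rewrite negb_and -!ltNge => /orP[h|h].
    have x1 : x <= 1 by rewrite (ltW (lt_le_trans h m1)).
    by rewrite x1 (le_trans x1 m2).
  by rewrite (lt_geF h) (lt_geF (le_lt_trans m2 h)).
have -> : (fun m => \int[leb]_(x in `]0, +oo[) (trunc m.+2%:R f x * x `^ (- beta))) =
  (fun m => \int[leb]_(x in exhaust m) (x `^ (- beta) * f x) +
     (\int[leb]_(x in `]0, +oo[) u 1 x - \int[leb]_(x in exhaust m) u 1 x)).
  apply/funext => m; rewrite -/(u m.+2%:R _) (split_ m.+2%:R m) ?ltr0n // e1 e2 (split_ 1 m) //.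
  by ring.
rewrite -[X in _ --> X]addr0; apply: cvgD => //.
rewrite -[X in _ --> X](subrr (\int[leb]_(x in `]0, +oo[) u 1 x)); apply: cvgB; first exact: cvg_cst.
by apply: exhaust_cvg; [exact: Iu|exact: mu].
Qed.

(** At a fixed truncation level M = m + 2 dominated convergence applies. Truncating costs at most 2
    n P(Y > M), which Potter's bound makes small in M uniformly in large [n]. *)
Lemma tail_limit_small (Gam : R) :
  (fun m => \int[leb]_(x in exhaust m) (x `^ (- beta) * f x)) @ \oo --> Gam ->
  forall v, 0 < v -> (fun n => n%:R * (\int[P]_w g (v / b n * W w) - g 0)) @ \oo -->
    kappa * v `^ beta * Gam.
Proof.
move=> /exhausted cG v v0; have [C C0 dom] := Hdom.
apply: (cvg_interchange
  (A := fun m n => n%:R * (\int[P]_w g (Num.min (Y v n w) m.+2%:R) - g 0))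
  (L := fun m => kappa * v `^ beta * \int[leb]_(x in `]0, +oo[) (trunc m.+2%:R f x * x `^ (- beta)))
  (r := fun m => 2 * C * growth v * decay m.+2%:R)).
- move=> m; have M0 : 0 < m.+2%:R :> R by rewrite ltr0n.
  have [mt It] := truncM M0 cf f1.
  have [lim [C' _ dom']] := weighted_tail mt It.
  have := lim v v0; apply: cvg_trans; apply: near_eq_cvg; apply: filterS2 dom' b0 => n dom' bn0.
  have Yn0 w : 0 <= Y v n w by exact: Y0.
  have [_ ->] := layer_cake_derive_min P (mY v n) Yn0 gf cf M0.
  by rewrite -(tailE v0 bn0 (dom' _ v0).1).
- by apply: cvgM => //; exact: cvg_cst.
- have -> : 0 = 2 * C * growth v * 0 :> R by rewrite mulr0.
  apply: cvgM; first exact: cvg_cst.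
  have moo : (fun m => m.+2%:R : R) @ \oo --> +oo.
    apply/cvgryPge => A; near=> m.
    rewrite (le_trans (ltW (truncnS_gt A))) // ler_nat; near: m.
    by exists (Num.truncn A) => // m /= Am; rewrite ltnS (leq_trans Am).
  rewrite -[X in _ --> X]addr0; case/andP: ebeta => e0 eb.
  by apply: cvgD; apply: cvg_powRN_oo => //; lra.
- move=> m; have M0 : 0 < m.+2%:R :> R by rewrite ltr0n.
  apply: filterS2 dom b0 => n dom bn0; rewrite -mulrBr normrM ger0_norm ?ler0n //.
  pose M := m.+2%:R : R; rewrite -/M in M0 *.
  have mmin : measurable_fun setT (fun w => Num.min (Y v n w) M) by exact: measurable_minr.
  have bg (h : T -> R) : measurable_fun setT h -> bmf (g \o h).
    by move=> mh; split; [exact: measurableT_comp|exists 1 => w; exact: g1].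
  have bY := bg _ (mY v n); have bM := bg _ mmin.
  rewrite (_ : _ - _ = \int[P]_w (g (Y v n w) - g (Num.min (Y v n w) M))); last first.
    by rewrite RintegralB //; [rewrite /Y; ring|exact: bmf_int bY|exact: bmf_int bM].
  have mS : measurable [set w | M < Y v n w] by exact: gt_measurable.
  apply: (@le_trans _ _ (n%:R * (2 * H (b n / v * M)))).
  { rewrite ler_wpM2l ?ler0n //.
    rewrite -(Y_tail _ v0 bn0) -(Rintegral_indicT P mS) -RintegralZl //; last first.
      by apply: bmf_int; exact: bmf_indic.
    apply: norm_Rintegral_le => //.
    + by apply: bmf_int; exact: (bmfB bY bM).
    + by apply: rintZ => //; apply: bmf_int; exact: bmf_indic.
    + move=> w _; rewrite indicE; have [YM|MY] := leP (Y v n w) M.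
        by rewrite subrr normr0 mulr_ge0 // ler0n.
      rewrite mem_set // mulr1 (le_trans (ler_normB _ _)) // -[2]/(1 + 1) lerD //. }
  have := dom v M v0 M0; rewrite /N => h.
  have -> : n%:R * (2 * H (b n / v * M)) = 2 * (n%:R * H (b n / v * M)) by ring.
  have -> : 2 * C * growth v * decay M = 2 * (C * growth v * decay M) by ring.
  by rewrite ler_wpM2l.
Unshelve. all: by end_near.
Qed.


End small_index.

Section large_index.
Hypotheses (beta1 : 1 < beta - e) (beta2 : beta + e < 2).
Variables (g f : R -> R).
Hypotheses (gf : forall x : R, is_derive x (1 : R) g (f x)) (cf : continuous f).
Hypotheses (f2 : forall x, `|f x| <= 2) (fx : forall x, `|f x| <= `|x|).

Let mf : measurable_fun setT f. Proof. exact: continuous_measurable_fun. Qed.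

(** The bound [|f x| <= |x|] gains one power at 0, and beta - e > 1 gives integrability at infinity,
    so the limit can be taken with no truncation. *)
Let If : leb.-integrable `]0, +oo[ (EFin \o (fun x => `|f x| * decay x)).
Proof.
apply: (@integrable_half_line _ _ (beta + e - 1) (beta - e) 4) => //.
- apply: measurable_funM; last exact: decay_measurable.
  exact: measurableT_comp.
- by rewrite ltrBlDr; exact: beta2.
- move=> x x01; case/andP: (x01) => x0 x1; rewrite ger0_norm ?mulr_ge0 //.
  have h := fx x; rewrite (ger0_norm (ltW x0)) in h.
  apply: (@le_trans _ _ (x * (2 * x `^ (- (beta + e))))).
    by rewrite ler_pM // decay_small.
  have -> : - (beta + e - 1) = 1 + - (beta + e) by ring.
  have -> : x `^ (1 - (beta + e)) = x * x `^ (- (beta + e)).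
    rewrite powRD; last by rewrite (gt_eqF x0) implybT.
    by rewrite (powRr1 (ltW x0)).
  by rewrite mulrCA ler_wpM2r ?mulr_ge0 ?powR_ge0 ?(ltW x0) // ler_nat.
- move=> x x1; rewrite ger0_norm ?mulr_ge0 // (_ : 4 = 2 * 2); last by rewrite -natrM.
  rewrite -mulrA.
  by rewrite ler_pM // decay_large.
Qed.

Lemma tail_limit_large_dom : exists2 C : R, 0 < C & \forall n \near \oo, forall v, 0 < v ->
  P.-integrable setT (EFin \o (fun w => g (v / b n * W w))) /\
  `|n%:R * (\int[P]_w g (v / b n * W w) - g 0)| <= C * growth v.
Proof.
have [_ [C C0 dom]] := weighted_tail mf If.
exists C => //; apply: filterS2 dom b0 => n dom bn0 v v0.
have Yn0 w : 0 <= Y v n w by exact: Y0.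
have [I3 bnd] := dom _ v0.
have [|I2 E2] := layer_cake_derive (P := P) (mY v n) Yn0 gf cf.
  move: I3; congr (leb.-integrable _ (EFin \o _)); apply/funext => x.
  by rewrite Y_tail.
by split => //; rewrite E2 tailE.
Qed.

Lemma tail_limit_large (Gam : R) :
  (fun m => \int[leb]_(x in exhaust m) (x `^ (- beta) * f x)) @ \oo --> Gam ->
  forall v, 0 < v -> (fun n => n%:R * (\int[P]_w g (v / b n * W w) - g 0)) @ \oo -->
    kappa * v `^ beta * Gam.
Proof.
move=> cG v v0; have [lim [C C0 dom]] := weighted_tail mf If.
have mxb : measurable_fun setT (fun x : R => x `^ (- beta)) by exact: measurable_powR.
have <- : \int[leb]_(x in `]0, +oo[) (f x * x `^ (- beta)) = Gam.
  apply: cvg_unique cG; first exact: Rhausdorff.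
  have -> : (fun m => \int[leb]_(x in exhaust m) (x `^ (- beta) * f x)) =
            (fun m => \int[leb]_(x in exhaust m) (f x * x `^ (- beta))).
    by apply/funext => m; apply: eq_Rintegral => x _; exact: mulrC.
  have mfb : measurable_fun setT (fun x => f x * x `^ (- beta)) by exact: measurable_funM.
  apply: exhaust_cvg => //; apply: (rint_le mD _ _ If); first exact: measurable_funTS.
  move=> x /posD x0; rewrite normrM (ger0_norm (powR_ge0 _ _)) ler_wpM2l //.
  exact: le_decay.
have := lim v v0; apply: cvg_trans; apply: near_eq_cvg.
apply: filterS2 dom b0 => n dom bn0.
have Yn0 w : 0 <= Y v n w by exact: Y0.
have [I3 bnd] := dom _ v0.
have [|I2 E2] := layer_cake_derive (P := P) (mY v n) Yn0 gf cf.
  move: I3; congr (leb.-integrable _ (EFin \o _)); apply/funext => x.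
  by rewrite Y_tail.
by rewrite E2 tailE.
Qed.

End large_index.
End tail_limit.

(** * Expansion of the scaled characteristic function *)

Section second_order.
Variable R : realType.

Lemma norm_sinB_le (u : R) : `|sin u - u| <= u ^+ 2.
Proof.
wlog u0 : u / 0 <= u.
  move=> h; have [u0|u0] := leP 0 u; first exact: h.
  have := h (- u); rewrite sinN sqrrN -opprD normrN; apply.
  by rewrite oppr_ge0 ltW.
have := @derive_comparison R (fun x => sin x - x) (fun x => cos x - 1) (fun x => x ^+ 2 / 2) (fun x => x) 0 u u0.
rewrite sin0 expr0n /= mul0r !subr0; move=> h; apply: le_trans (h _ _ _) _.
- move=> x; rewrite (_ : (fun y => _) = (fun y : R => 2^-1 * (y * y))); last first.
    by apply/funext => y; rewrite expr2 mulrC.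
  by apply: (is_derive_eq (isdZ _ (isdM (isd_id x) (isd_id x)))); lra.
- by move=> x /andP[x0 _]; rewrite distrC (le_trans (norm_1mcos_le x)) // ger0_norm.
- by have := sqr_ge0 u; lra.
Qed.

Lemma norm_1mcos_sqr (u : R) : `|1 - cos u| <= u ^+ 2.
Proof.
wlog u0 : u / 0 <= u.
  move=> h; have [u0|u0] := leP 0 u; first exact: h.
  by have := h (- u); rewrite cosN sqrrN; apply; rewrite oppr_ge0 ltW.
have := @derive_comparison R (fun x => 1 - cos x) (fun x => sin x) (fun x => x ^+ 2 / 2) (fun x => x) 0 u u0.
rewrite cos0 subrr expr0n /= mul0r !subr0; move=> h; apply: le_trans (h _ _ _) _.
- move=> x; apply: (is_derive_eq (isdB (isd_cst 1 x) (isd_cos (isd_id x)))).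
  by rewrite mulr1 sub0r opprK.
- move=> x; rewrite (_ : (fun y => _) = (fun y : R => 2^-1 * (y * y))); last first.
    by apply/funext => y; rewrite expr2 mulrC.
  by apply: (is_derive_eq (isdZ _ (isdM (isd_id x) (isd_id x)))); lra.
- by move=> x /andP[x0 _]; rewrite (le_trans (norm_sin_le x)) // ger0_norm.
- by have := sqr_ge0 u; lra.
Qed.

Local Open Scope complex_scope.

Lemma cm_cisB1_le (u : R) : cm (cis u - 1) <= 2 * `|u|.
Proof.
rewrite (le_trans (cm_le _)) // ReB ImB /= subr0 mulr_natl mulr2n lerD //.
  by rewrite distrC norm_1mcos_le.
exact: norm_sin_le.
Qed.

Lemma cm_cis_sub1i (u : R) : cm (cis u - (1 +i* u)) <= 2 * u ^+ 2.
Proof.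
rewrite (le_trans (cm_le _)) // ReB ImB /= mulr_natl mulr2n lerD //.
  by rewrite distrC norm_1mcos_sqr.
exact: norm_sinB_le.
Qed.

End second_order.

Lemma cvgn_ext (R : realType) (u v : nat -> R) (l : R) : u =1 v -> u @ \oo --> l -> v @ \oo --> l.
Proof. by move=> /funext ->. Qed.

Section trigonometric_tail.
Context d (T : measurableType d) (R : realType) (P : probability T R).
Variables (W : T -> R) (beta : R).
Hypotheses (mW : measurable_fun setT W) (W0 : forall w, 0 <= W w).
Let H (x : R) := fine (P [set w | x < W w]).
Hypothesis Hpos : forall x, 0 < H x.
Hypothesis HRV : forall c : R, 0 < c -> (fun x => H (c * x) / H x) @ +oo --> c `^ (- beta).
Variables (b : nat -> R) (kappa : R).
Hypotheses (b_oo : b @ \oo --> +oo) (bH : (fun n => n%:R * H (b n)) @ \oo --> kappa).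
Hypothesis kappa0 : 0 < kappa.
Variable e : R.
Hypothesis ebeta : 0 < e < beta.
Hypothesis beta_range : beta + e < 1 \/ (1 < beta - e /\ beta + e < 2).

(** The test [beta < 1] mirrors the two cases of the centring sequence; for beta > 1 the mean is
    finite by [centering_integrable]. *)
Definition centering : R := if beta < 1 then 0 else \int[P]_w W w.

Let b0 : \forall n \near \oo, 0 < b n.
Proof. by near=> n; apply: (lt_le_trans ltr01); near: n; exact: b_near. Unshelve. all: by end_near. Qed.

(** [trc] and [trs] are [n] times the real and imaginary parts of E exp(i v W / b n) - 1 - i (v / b
    n) [centering]. *)
Let trc v n : R := n%:R * (\int[P]_w cos (v / b n * W w) - 1).
Let trs v n : R := n%:R * (\int[P]_w sin (v / b n * W w) - v / b n * centering).

Let dcos (x : R) : is_derive x (1 : R) (fun y => - cos y) (sin x).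
Proof. by apply: (is_derive_eq (isdN (isd_cos (isd_id x)))); rewrite mulr1 opprK. Qed.

Let dsin (x : R) : is_derive x (1 : R) (fun y => sin y) (cos x).
Proof. by apply: (is_derive_eq (isd_sin (isd_id x))); rewrite mulr1. Qed.

Let dxsin (x : R) : is_derive x (1 : R) (fun y => y - sin y) (1 - cos x).
Proof. by apply: (isdB (isd_id x)); exact: dsin. Qed.

Let cont1 : continuous (fun x : R => 1 - cos x).
Proof. by move=> x; apply: cvgB; [exact: cvg_cst|exact: continuous_cos]. Qed.

Let bcos v n : bmf (fun w => cos (v / b n * W w)).
Proof. by apply: bmf_cos; exact: measurable_funM. Qed.

Let bsin v n : bmf (fun w => sin (v / b n * W w)).
Proof. by apply: bmf_sin; exact: measurable_funM. Qed.

Let Rint_Ncos v n : \int[P]_w (- cos (v / b n * W w)) - - cos 0 = - (\int[P]_w cos (v / b n * W w) - 1).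
Proof.
rewrite cos0; under eq_Rintegral do rewrite -mulN1r.
by rewrite RintegralZl //; [ring|apply: bmf_int; exact: bcos].
Qed.

(** Write x = (x - sin x) + sin x: the first part is integrable by the tail bound, taken at
    [v = b N] so that the scale is 1, and the second is bounded. *)
Lemma centering_integrable : 1 < beta - e -> P.-integrable setT (EFin \o W).
Proof.
move=> b1; have b2 : beta + e < 2 by case: beta_range => [|[]] *; lra.
have [C C0 h] := tail_limit_large_dom mW W0 Hpos HRV b_oo bH kappa0 ebeta b1 b2 dxsin cont1 (@norm_1mcos_le2 R) (@norm_1mcos_le R).
have [N _ hN] := filterI h b0; have [h1 bN] := hN N (leqnn N).
have [Ig _] := h1 _ bN.
have Is : P.-integrable setT (EFin \o (fun w => sin (b N / b N * W w))) by apply: bmf_int; exact: bsin.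
have := rintD measurableT Ig Is; congr (P.-integrable _ (EFin \o _)); apply/funext => w.
by rewrite subrK divff ?gt_eqF // mul1r.
Qed.

Let tanE : tan (pi * beta / 2) = cos ((1 - beta) * (pi / 2)) / sin ((1 - beta) * (pi / 2)).
Proof.
have -> : (1 - beta) * (pi / 2) = - (pi * beta / 2 - pi / 2) by ring.
by rewrite cosN sinN cosBpihalf sinBpihalf opprK.
Qed.

Let trig_tail : exists2 c0 : R, 0 < c0 &
  (forall v, 0 < v -> trc v @ \oo --> - (kappa * v `^ beta * c0) /\
                      trs v @ \oo --> kappa * v `^ beta * c0 * tan (pi * beta / 2)) /\
  exists2 C : R, 0 < C & \forall n \near \oo, forall v, 0 < v ->
    `|trc v n| <= C * growth beta e v /\ `|trs v n| <= C * growth beta e v.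
Proof.
case/andP: ebeta => e0 eb; have pi0 := @pi_gt0 R.
have s1 : - beta = (1 - beta) - 1 by ring.
have comb (C1 C2 : R) (A B : R -> nat -> R) : 0 < C1 -> 0 < C2 ->
    (\forall n \near \oo, forall v, 0 < v -> `|A v n| <= C1 * growth beta e v) ->
    (\forall n \near \oo, forall v, 0 < v -> `|B v n| <= C2 * growth beta e v) ->
    exists2 C : R, 0 < C & \forall n \near \oo, forall v, 0 < v ->
      `|A v n| <= C * growth beta e v /\ `|B v n| <= C * growth beta e v.
  move=> C10 C20 hA hB; exists (C1 + C2); first exact: addr_gt0.
  have g0 v : 0 <= growth beta e v by rewrite addr_ge0 ?powR_ge0.
  apply: filterS2 hA hB => n hA hB v v0; split.
    by rewrite (le_trans (hA v v0)) // ler_wpM2r // lerDl ltW.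
  by rewrite (le_trans (hB v v0)) // ler_wpM2r // lerDr ltW.
case: beta_range => [b1|[b1 b2]].
- have sr : 0 < 1 - beta < 1 by lra.
  have [G G0 [Gc Gs]] := @rotated_gamma_lt1 R (1 - beta) sr; rewrite -s1 in Gc Gs.
  have spos : 0 < sin ((1 - beta) * (pi / 2)).
    by apply: sin_gt0_pihalf; apply/andP; split; [rewrite mulr_gt0; lra|rewrite gtr_pMl; lra].
  have cent v n : v / b n * centering = 0 by rewrite /centering ifT ?mulr0 //; lra.
  have sin1 (x : R) : `|sin x| <= 1 by rewrite ler_norml sin_geN1 sin_le1.
  have cos1 (x : R) : `|cos x| <= 1 by rewrite ler_norml cos_geN1 cos_le1.
  have cosN1 (x : R) : `|- cos x| <= 1 by rewrite normrN.
  exists (G * sin ((1 - beta) * (pi / 2))); first exact: mulr_gt0.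
  split; last first.
    have [C1 C10 h1] := tail_limit_small_dom mW W0 Hpos HRV b_oo bH kappa0 ebeta b1 dcos sin1 cosN1.
    have [C2 C20 h2] := tail_limit_small_dom mW W0 Hpos HRV b_oo bH kappa0 ebeta b1 dsin cos1 sin1.
    apply: (comb _ _ _ _ C10 C20).
      apply: filterS h1 => n h v v0; have := h v v0.
      by rewrite Rint_Ncos mulrN normrN.
    apply: filterS h2 => n h v v0; have := h v v0.
    by rewrite /trs cent sin0.
  have tE : G * sin ((1 - beta) * (pi / 2)) * tan (pi * beta / 2) = G * cos ((1 - beta) * (pi / 2)).
    by rewrite tanE; field; rewrite gt_eqF.
  move=> v v0; split.
  + have := tail_limit_small mW W0 Hpos HRV b_oo bH kappa0 ebeta b1 dcos (@continuous_sin R) sin1 cosN1.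
    move=> /(_ _ Gs _ v0) /cvgN; apply: cvgn_ext => n /=.
    by rewrite /trc fctE Rint_Ncos; ring.
  + rewrite -mulrA tE.
    have := tail_limit_small mW W0 Hpos HRV b_oo bH kappa0 ebeta b1 dsin (@continuous_cos R) cos1 sin1.
    move=> /(_ _ Gc _ v0); apply: cvgn_ext => n /=.
    by rewrite /trs cent sin0.
- have sr : -1 < 1 - beta < 0 by apply/andP; split; lra.
  have [G G0 [Gc Gs]] := @rotated_gamma_neg R (1 - beta) sr; rewrite -s1 in Gc Gs.
  have spos : sin ((1 - beta) * (pi / 2)) < 0.
    rewrite (_ : _ * _ = - ((beta - 1) * (pi / 2))); last by ring.
    rewrite sinN oppr_lt0; apply: sin_gt0_pihalf.
    by apply/andP; split; [rewrite mulr_gt0; lra|rewrite gtr_pMl; lra].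
  have cent : centering = \int[P]_w W w by rewrite /centering ifF //; apply/negbTE; rewrite -leNgt; lra.
  have sin2 (x : R) : `|sin x| <= 2.
    by rewrite (@le_trans _ _ 1) ?ler1n // ler_norml sin_geN1 sin_le1.
  have IW := centering_integrable b1.
  have Esin v n : \int[P]_w (v / b n * W w - sin (v / b n * W w)) - (0 - sin 0) =
      - (\int[P]_w sin (v / b n * W w) - v / b n * centering).
    rewrite RintegralB //; [|exact: rintZ|by apply: bmf_int; exact: bsin].
    by rewrite RintegralZl // sin0 cent; ring.
  exists (- (G * sin ((1 - beta) * (pi / 2)))).
    by rewrite oppr_gt0 pmulr_rlt0.
  split; last first.
    have [C1 C10 h1] := tail_limit_large_dom mW W0 Hpos HRV b_oo bH kappa0 ebeta b1 b2 dcos (@continuous_sin R) sin2 (@norm_sin_le R).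
    have [C2 C20 h2] := tail_limit_large_dom mW W0 Hpos HRV b_oo bH kappa0 ebeta b1 b2 dxsin cont1 (@norm_1mcos_le2 R) (@norm_1mcos_le R).
    apply: (comb _ _ _ _ C10 C20).
      apply: filterS h1 => n h v v0; have [_] := h v v0.
      by rewrite Rint_Ncos mulrN normrN.
    apply: filterS h2 => n h v v0; have [_] := h v v0.
    by rewrite Esin mulrN normrN.
  have tE : G * sin ((1 - beta) * (pi / 2)) * tan (pi * beta / 2) = G * cos ((1 - beta) * (pi / 2)).
    by rewrite tanE; field; rewrite lt_eqF.
  move=> v v0; split.
  + have := tail_limit_large mW W0 Hpos HRV b_oo bH kappa0 ebeta b1 b2 dcos (@continuous_sin R) sin2 (@norm_sin_le R).
    move=> /(_ _ Gs _ v0) /cvgN ; apply: cvgn_ext => n /=.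
    by rewrite /trc fctE Rint_Ncos; ring.
  + rewrite -mulrA mulNr tE mulrN.
    have := tail_limit_large mW W0 Hpos HRV b_oo bH kappa0 ebeta b1 b2 dxsin cont1 (@norm_1mcos_le2 R) (@norm_1mcos_le R).
    move=> /(_ _ Gc _ v0) /cvgN ; apply: cvgn_ext => n /=.
    by rewrite /trs fctE Esin; ring.
Qed.

(** Potter's bound at v = b n and x = 1 gives n H(1) = O((b n)^(beta + e)), and beta + e < 2. *)
Lemma index_lt2_ratio : 1 < beta - e -> (fun n => n%:R / b n ^+ 2) @ \oo --> (0 : R).
Proof.
move=> b1; case/andP: ebeta => e0 eb.
have b2 : beta + e < 2 by case: beta_range => [|[]] *; lra.
have [C C0 h] := tail_dom (survival_nonincreasing P mW) Hpos (survival_le1 P mW) HRV b_oo bH kappa0 ebeta.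
pose K := C * 2 * 2 / H 1.
have lim : (fun n => K * b n `^ (- (2 - (beta + e)))) @ \oo --> (0 : R).
  rewrite -[X in _ --> X](mulr0 K); apply: cvgM; first exact: cvg_cst.
  by apply: cvg_powRN_oo => //; rewrite subr_gt0.
apply: (@squeeze_cvgr _ _ _ _ (fun=> 0) (fun n => K * b n `^ (- (2 - (beta + e))))) => //; last exact: cvg_cst.
near=> n.
have bn1 : 1 <= b n by near: n; exact: b_near.
have bn0 : 0 < b n by exact: lt_le_trans bn1.
rewrite divr_ge0 ?ler0n ?exprn_ge0 ?(ltW bn0) //=.
have hn : n%:R * H 1 <= C * (b n `^ (beta + e) + b n `^ (beta - e)) * 2.
  have hh : forall v x, 0 < v -> 0 < x -> n%:R * fine (P [set w | b n / v * x < W w]) <=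
     C * (v `^ (beta + e) + v `^ (beta - e)) * (x `^ (- (beta + e)) + x `^ (- (beta - e))).
    by near: n; exact: h.
  by have := hh _ _ bn0 ltr01; rewrite divff ?gt_eqF // mulr1 !powR1.
have le : b n `^ (beta - e) <= b n `^ (beta + e) by apply: ler_powR => //; lra.
have K0 : 0 <= K by rewrite /K !mulr_ge0 ?invr_ge0 ?(ltW C0) ?(ltW (Hpos _)).
have hn2 : n%:R <= K * b n `^ (beta + e).
  rewrite /K mulrAC ler_pdivlMr ?Hpos // (le_trans hn) //.
  rewrite -!mulrA ler_wpM2l ?(ltW C0) //; lra.
rewrite ler_pdivrMr ?exprn_gt0 //; apply: le_trans hn2 _; clearbody K.
rewrite -mulrA; apply: ler_wpM2l => //.
rewrite -powR_mulrn ?(ltW bn0) // -powRD; last by rewrite (gt_eqF bn0) implybT.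
by apply: ler_powR => //; lra.
Unshelve. all: by end_near.
Qed.

Local Open Scope complex_scope.

Definition scaled_chf (v : R) (n : nat) : R[i] :=
  cE P (fun w => cis (v / b n * W w - v / b n * centering)).

(** The function K for which exp(-K(v)) is the characteristic function of the stable law totally
    skewed to the right, with scale [c0] and location 0. *)
Definition stable_exponent (c0 v : R) : R[i] :=
  (c0 * `|v| `^ beta) +i* - (c0 * (Num.sg v * `|v| `^ beta) * tan (pi * beta / 2)).

Let cmR0 (x : R) : cm (x +i* 0) = `|x|.
Proof. by rewrite cmE /= expr0n /= addr0 sqrtr_sqr. Qed.

Lemma scaled_chfN v n : scaled_chf (- v) n = conjc (scaled_chf v n).
Proof.
have ev (w : T) : - v / b n * W w - - v / b n * centering = - (v / b n * W w - v / b n * centering) by ring.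
rewrite /scaled_chf; apply: complex_ext => /=; under eq_Rintegral do rewrite ev.
  by under eq_Rintegral do rewrite cosN.
have bs : bmf (fun w => sin (v / b n * W w - v / b n * centering)).
  by apply: bmf_sin; apply: measurable_funB => //; exact: measurable_funM.
under eq_Rintegral do rewrite sinN -[- sin _]mulN1r.
by rewrite RintegralZl ?mulN1r //; apply: bmf_int.
Qed.

Lemma scaled_chf0 n : scaled_chf 0 n = 1.
Proof.
rewrite /scaled_chf (@eq_cE _ _ _ _ _ (fun=> 1)) ?cE_cst // => w.
by rewrite !mul0r subrr cis0.
Qed.

Lemma stable_exponentN c0 v : stable_exponent c0 (- v) = conjc (stable_exponent c0 v).
Proof. by apply: complex_ext; rewrite /= normrN // sgrN; ring. Qed.

Lemma stable_exponent0 c0 : 0 < beta -> stable_exponent c0 0 = 0.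
Proof. by move=> b1; apply: complex_ext; rewrite /= normr0 powR0 ?gt_eqF // !(mulr0, mul0r) ?oppr0. Qed.

Let cm_conj (z : R[i]) : cm (conjc z) = cm z.
Proof. by case: z => x y; rewrite !cmE /= sqrrN. Qed.

(** Centring multiplies the characteristic function by exp(-i u) with u = v [centering] / b n. The
    resulting error n (1 - exp(-i u) (1 + i u)) is O(n u^2) and vanishes because n = o((b n)^2) when
    the centring is present. Negative arguments follow by conjugation. *)
Lemma scaled_chf_expansion : exists2 c0 : R, 0 < c0 &
  (forall v, (fun n => cm (n%:R%:C * (1 - scaled_chf v n) - kappa%:C * stable_exponent c0 v)) @ \oo --> (0 : R)) /\
  exists2 C : R, 0 < C & \forall n \near \oo, forall v,
    cm (n%:R%:C * (1 - scaled_chf v n)) <= C * (1 + growth beta e `|v| + v ^+ 2).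
Proof.
have [c0 c00 [lim [C C0 dom]]] := trig_tail; case/andP: (ebeta) => e0 eb.
have beta0 : 0 < beta by lra.
pose A v n : R[i] := trc v n +i* trs v n.
pose u v n : R := v / b n * centering.
pose rem v n : R[i] := n%:R%:C * (1 - cis (- u v n) * (1 +i* u v n)).
have chfE v n : scaled_chf v n = cis (- u v n) * cE P (fun w => cis (v / b n * W w)).
  rewrite /scaled_chf -cEZ; last by apply: cbmf_cis; exact: measurable_funM.
  by apply: eq_cE => w; rewrite -cisD addrC.
have expE v n : n%:R%:C * (1 - scaled_chf v n) = rem v n - cis (- u v n) * A v n.
  have -> : A v n = n%:R%:C * (cE P (fun w => cis (v / b n * W w)) - (1 +i* u v n)).
    by apply: complex_ext; rewrite ?ReM ?ImM ?ReB ?ImB /= mul0r ?subr0 ?addr0.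
  by rewrite chfE /rem; ring.
have cmrem v n : cm (rem v n) <= 2 * (n%:R / b n ^+ 2 * (v * centering) ^+ 2).
  rewrite cmM cmR0 ger0_norm ?ler0n //.
  rewrite (_ : 1 - _ = cis (- u v n) * (cis (u v n) - (1 +i* u v n))); last first.
    by rewrite mulrBr -cisD [- _ + _]addrC subrr cis0.
  rewrite cmM cm_cis mul1r (le_trans (ler_wpM2l (ler0n _ n) (cm_cis_sub1i _))) //.
  by rewrite /u !expr2 invfM le_eqVlt; apply/orP; left; apply/eqP; ring.
have ratio : (fun n => n%:R / b n ^+ 2 * centering ^+ 2) @ \oo --> (0 : R).
  have [b1|b1] := boolP (beta < 1).
    by rewrite /centering b1 expr0n /=; under eq_fun do rewrite mulr0; exact: cvg_cst.
  rewrite -[X in _ --> X](mul0r (centering ^+ 2)); apply: cvgM; last exact: cvg_cst.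
  by apply: index_lt2_ratio; case: beta_range => [|[]] *; lra.
exists c0 => //; split.
- have pos v : 0 < v -> (fun n => cm (n%:R%:C * (1 - scaled_chf v n) - kappa%:C * stable_exponent c0 v)) @ \oo --> (0 : R).
  {
    move=> v0; have [lim1 lim2] := lim v v0.
    pose L := kappa%:C * stable_exponent c0 v.
    have AL : (fun n => `|trc v n + kappa * v `^ beta * c0| +
                        `|trs v n - kappa * v `^ beta * c0 * tan (pi * beta / 2)|) @ \oo --> (0 : R).
      have -> : 0 = `|0 : R| + `|0 : R| :> R by rewrite normr0 addr0.
      apply: cvgD; apply: cvg_norm.
        by rewrite -[X in _ --> X](addNr (kappa * v `^ beta * c0)); apply: cvgD => //; exact: cvg_cst.
      rewrite -[X in _ --> X](subrr (kappa * v `^ beta * c0 * tan (pi * beta / 2))).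
      by apply: cvgB => //; exact: cvg_cst.
    have uL : (fun n => 2 * `|- u v n| * cm L) @ \oo --> (0 : R).
      have iv : (fun n => (b n)^-1) @ \oo --> (0 : R).
        have := cvg_powRN_oo ltr01 b_oo; apply: cvg_trans; apply: near_eq_cvg; apply: filterS b0 => n bn0.
        by rewrite powR_inv1 // ltW.
      have -> : 0 = 2 * `|- (v * 0 * centering)| * cm L by rewrite mulr0 mul0r oppr0 normr0 mulr0 mul0r.
      apply: cvgM; last exact: cvg_cst.
      apply: cvgM; first exact: cvg_cst.
      apply: cvg_norm; apply: cvgN; apply: cvgM; last exact: cvg_cst.
      by apply: cvgM => //; exact: cvg_cst.
    have bound : (fun n => 2 * (n%:R / b n ^+ 2 * centering ^+ 2 * v ^+ 2) +
        (`|trc v n + kappa * v `^ beta * c0| +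
         `|trs v n - kappa * v `^ beta * c0 * tan (pi * beta / 2)|) + 2 * `|- u v n| * cm L) @ \oo --> (0 : R).
      have -> : 0 = 2 * (0 * v ^+ 2) + 0 + 0 :> R by rewrite mul0r mulr0 !addr0.
      apply: cvgD => //; apply: cvgD => //; apply: cvgM; first exact: cvg_cst.
      by apply: cvgM => //; exact: cvg_cst.
    apply: (squeeze_cvgr _ (@cvg_cst _ 0 _ _ _) bound).
    apply: nearW => n; apply/andP; split; first exact: cm_ge0.
    rewrite expE -/L.
    rewrite (_ : _ - L = rem v n - cis (- u v n) * (A v n + L) + (cis (- u v n) - 1) * L); last by ring.
    apply: le_trans (cmD _ _) _; apply: lerD.
      apply: le_trans (cmB _ _) _; apply: lerD.
        rewrite (le_trans (cmrem v n)) // exprMn le_eqVlt; apply/orP; left; apply/eqP; ring.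
      rewrite cmM cm_cis mul1r (le_trans (cm_le _)) // /L /stable_exponent (gtr0_norm v0) (gtr0_sg v0) /A /=.
      by rewrite le_eqVlt; apply/orP; left; apply/eqP; congr +%R; congr Num.norm; ring.
    by rewrite cmM ler_wpM2r ?cm_ge0 // cm_cisB1_le.
  }
  move=> v; have [v0|v0|<-] := ltgtP 0 v; first exact: pos.
  + rewrite -oppr_gt0 in v0; have := pos _ v0; apply: cvgn_ext => n.
    rewrite scaled_chfN stable_exponentN -cm_conj; congr cm.
    case: (scaled_chf v n) => x y; case: (stable_exponent c0 v) => x' y'.
    by apply: complex_ext; rewrite ?ReB ?ImB ?ReM ?ImM /=; ring.
  + apply: (cvgn_ext _ (@cvg_cst _ 0 _ _ _)) => n.
    by rewrite scaled_chf0 stable_exponent0 // subrr !mulr0 subrr cmE /= expr0n /= addr0 sqrtr0.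
- have [N1 _ hN1] := cvgr_lt _ ratio _ ltr01.
  exists (2 + 2 * C); first by rewrite addr_gt0 // mulr_gt0.
  near=> n.
  have hn : n%:R / b n ^+ 2 * centering ^+ 2 <= 1 by apply: ltW; apply: hN1; near: n; exists N1.
  have domn : forall v, 0 < v -> `|trc v n| <= C * growth beta e v /\ `|trs v n| <= C * growth beta e v.
    by near: n; exact: dom.
  have g0 v : 0 <= growth beta e v by rewrite addr_ge0 ?powR_ge0.
  have pos v : 0 < v -> cm (n%:R%:C * (1 - scaled_chf v n)) <= (2 + 2 * C) * (1 + growth beta e v + v ^+ 2).
  {
    move=> v0; have [h1 h2] := domn v v0; rewrite expE.
    apply: (@le_trans _ _ (2 * v ^+ 2 + 2 * C * growth beta e v)).
      apply: le_trans (cmB _ _) _; apply: lerD.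
        rewrite (le_trans (cmrem v n)) // ler_wpM2l // exprMn mulrCA ler_piMr ?sqr_ge0 //.
      rewrite cmM cm_cis mul1r (le_trans (cm_le _)) //= (le_trans (lerD h1 h2)) //; lra.
    have := sqr_ge0 v; have := g0 v => p1 p2.
    have := mulr_ge0 (ltW C0) p2; have := mulr_ge0 (ltW C0) p1; lra.
  }
  move=> v; have [v0|v0|<-] := ltgtP 0 v; first by rewrite gtr0_norm //; exact: pos.
  + rewrite -oppr_gt0 in v0; have := pos _ v0.
    rewrite (ltr0_norm (_ : v < 0)) -?oppr_gt0 // sqrrN; apply: le_trans.
    rewrite le_eqVlt; apply/orP; left; apply/eqP; rewrite scaled_chfN !cmM; congr (_ * _).
    by rewrite -cm_conj rmorphB rmorph1 /= .
  + rewrite scaled_chf0 subrr mulr0 cmE /= expr0n /= addr0 sqrtr0.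
    by rewrite mulr_ge0 ?addr_ge0 ?mulr_ge0 ?(ltW C0) // -expr2 sqr_ge0.
Unshelve. all: by end_near.
Qed.

End trigonometric_tail.

(** * Breiman's lemma and the normalizing sequence *)

Lemma cvgn_near (R : realType) (u v : nat -> R) (l : R) :
  (\forall n \near \oo, u n = v n) -> u @ \oo --> l -> v @ \oo --> l.
Proof. by move=> uv; apply: cvg_trans; apply: near_eq_cvg. Qed.

Lemma measurable_fun_powR d (T : measurableType d) (R : realType) (f : T -> R) (p : R) :
  measurable_fun setT f -> measurable_fun setT (fun w => f w `^ p).
Proof. by move=> mf; exact: (measurableT_comp (@measurable_powR R p) mf). Qed.

Section square_tail.
Context d (T : measurableType d) (R : realType) (P : probability T R).
Variables (Y : T -> R) (alpha : R).
Hypothesis mY : measurable_fun setT Y.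
Hypothesis RV : regularly_varying P Y alpha.

Let H (x : R) := fine (P [set w | x < Y w ^+ 2]).
Let G (x : R) := fine (P [set w | x < Y w]) + fine (P [set w | Y w < - x]).

Let mY2 : measurable_fun setT (fun w => Y w ^+ 2). Proof. exact: measurable_funX. Qed.

Let lt_meas x : measurable [set w | Y w < x].
Proof.
have := measurable_fun_ltr mY (measurable_cst x) measurableT (Y := [set true]) I.
by rewrite setTI.
Qed.

Let HG x : 0 <= x -> H x = G (Num.sqrt x).
Proof.
move=> x0; have sx := sqrtr_ge0 x.
have mA := gt_measurable mY (Num.sqrt x); have mB := lt_meas (- Num.sqrt x).
rewrite /G -fineD ?fin_num_measure // -measureU //.
  congr (fine (P _)); apply/seteqP; split => w /=.
    rewrite -{1}(sqr_sqrtr x0) -(ger0_norm sx) -[Y w ^+ 2]real_normK ?num_real // -[X in X ^+ 2 < _]ger0_norm //.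
    rewrite ltr_pXn2r ?nnegrE // normr_id (ger0_norm sx) lter_normr => /orP[]; first by left.
    by rewrite ltrNr; right.
  move=> h; rewrite -(sqr_sqrtr x0) -[Y w ^+ 2]real_normK ?num_real // ltr_pXn2r ?nnegrE //.
  by rewrite lter_normr; apply/orP; case: h => h; [left|right; rewrite ltrNr].
by apply/seteqP; split => // w /= [h1 h2]; have := lt_trans h1 h2; rewrite ltNge ge0_cp.
Qed.

Let G_equiv : exists L : R -> R, slowly_varying L /\
  (fun x => G x / (L x * x `^ (- alpha))) @ +oo --> (1 : R).
Proof.
have [pp [pm [L [_ [_ [<- [sL [c1 c2]]]]]]]] := RV; exists L; split => //.
rewrite (_ : (fun x => _) = (fun x => fine (P [set w | x < Y w]) / (L x * x `^ (- alpha)) +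
   fine (P [set w | Y w < - x]) / (L x * x `^ (- alpha)))); first exact: cvgD.
by apply/funext => x; rewrite -mulrDl.
Qed.

Let G_near : exists M : R, forall x, M < x -> 0 < G x.
Proof.
have [L [[_ [L0 _]] c1]] := G_equiv; have [M1 [_ h1]] := L0.
have [M2 [_ h2]] := cvgr_gt _ c1 _ (ltr01 : 0 < 1 :> R).
exists (`|M1| + `|M2|) => x hx; have := ler_norm M1; have := ler_norm M2 => n2 n1.
have p1 := normr_ge0 M1; have p2 := normr_ge0 M2.
have x0 : 0 < x by lra.
have := h2 x; rewrite pmulr_lgt0; first by apply; lra.
by rewrite invr_gt0 mulr_gt0 ?powR_gt0 //; apply: h1; lra.
Qed.

(** Regular variation makes the tail positive at large arguments, and monotonicity carries this to
    all others. *)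
Lemma square_tail_gt0 x : 0 < H x.
Proof.
have [M hM] := G_near; pose z := `|x| + `|M| + 1.
have p1 := normr_ge0 x; have p2 := normr_ge0 M; have := ler_norm x; have := ler_norm M => n1 n2.
have z1 : 1 <= z by rewrite /z; lra.
apply: (lt_le_trans (_ : 0 < H (z ^+ 2))).
  rewrite HG ?sqr_ge0 // sqrtr_sqr ger0_norm; last by lra.
  by apply: hM; rewrite /z; lra.
apply: survival_nonincreasing => //; rewrite (@le_trans _ _ z) ?ler_eXnr //.
by rewrite /z; lra.
Qed.

(** The square exceeds x exactly when [|Y|] exceeds the root of x, so slow variation is used at the
    ratio sqrt c and the index is halved. The two tails add up because [pp + pm = 1]. *)
Lemma square_tail_RV (c : R) : 0 < c -> (fun x => H (c * x) / H x) @ +oo --> c `^ (- (alpha / 2)).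
Proof.
move=> c0; have [L [[_ [L0 LV]] c1]] := G_equiv.
have s0 : 0 < Num.sqrt c by rewrite sqrtr_gt0.
pose r x := G x / (L x * x `^ (- alpha)).
have coo (k : R) : 0 < k -> (fun x => k * x) @ +oo --> +oo.
  move=> k0; apply/cvgryPge => A; exists (A / k); split; first exact: num_real.
  by move=> x /ltW; rewrite ler_pdivrMr // mulrC.
have soo : (fun x : R => Num.sqrt x) @ +oo --> +oo.
  apply/cvgryPge => A; exists (`|A| ^+ 2); split; first exact: num_real.
  move=> x /ltW hx; rewrite (le_trans (ler_norm A)) // -[leLHS]ger0_norm // -sqrtr_sqr.
  by rewrite ler_wsqrtr.
have key : (fun y => G (Num.sqrt c * y) / G y) @ +oo --> c `^ (- (alpha / 2)).
  have -> : c `^ (- (alpha / 2)) = 1 / 1 * 1 * Num.sqrt c `^ (- alpha).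
    rewrite divr1 !mul1r -powR12_sqrt ?(ltW c0) // -powRrM; congr (_ `^ _); by field.
  have lim : (fun y => r (Num.sqrt c * y) / r y * (L (Num.sqrt c * y) / L y) * Num.sqrt c `^ (- alpha)) @ +oo
      --> (1 / 1 * 1 * Num.sqrt c `^ (- alpha) : R).
    apply: cvgM; last exact: cvg_cst.
    apply: cvgM; last exact: LV.
    apply: cvgM; last by apply: cvgV => //; exact: oner_neq0.
    by apply: cvg_comp c1; exact: coo.
  apply: cvg_trans lim; apply: near_eq_cvg; near=> y.
  have y0 : 0 < y by near: y; exact: nbhs_pinfty_gt.
  have Ly : 0 < L y by near: y.
  have Lcy : 0 < L (Num.sqrt c * y) by near: y; exact: (coo _ s0 _ L0).
  have Gy : 0 < G y.
    by near: y; have [M hM] := G_near; exists M; split => //; exact: num_real.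
  rewrite /r powRM ?(ltW s0) ?(ltW y0) //.
  have := powR_gt0 (- alpha) y0; have := powR_gt0 (- alpha) s0 => p1 p2.
  by field; rewrite !gt_eqF // mulr_gt0.
have := cvg_comp _ _ soo key; apply: cvg_trans; apply: near_eq_cvg; near=> x.
have x0 : 0 < x by near: x; exact: nbhs_pinfty_gt.
by rewrite /= !HG ?sqrtrM ?mulr_ge0 ?(ltW c0) ?(ltW x0).
Unshelve. all: by end_near.
Qed.

End square_tail.

Section product_tail.
Context d (T : measurableType d) (R : realType) (P : probability T R).
Variables (V W : T -> R).
Hypotheses (mV : measurable_fun setT V) (mW : measurable_fun setT W).
Hypothesis V0 : forall w, 0 <= V w.
Hypothesis indepVW : forall A B, measurable A -> measurable B ->
  fine (P (W @^-1` B `&` V @^-1` A)) = fine (P (W @^-1` B)) * fine (P (V @^-1` A)).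
Let H (x : R) := fine (P [set w | x < W w]).

Let G : set (set T) := [set E | exists2 A, measurable A & E = V @^-1` A].

Let mpre (X : T -> R) A : measurable_fun setT X -> measurable A -> measurable (X @^-1` A).
Proof. by move=> mX mA; rewrite -[X in measurable X]setTI; exact: mX. Qed.

(** [W] is integrated with [V] frozen; where [V] vanishes the event is empty because [x >= 0]. *)
Lemma product_tail x : 0 <= x ->
  fine (P [set w | x < V w * W w]) =
  \int[P]_w (if 0 < V w then H (x / V w) else 0) /\
  measurable_fun setT (fun w => if 0 < V w then H (x / V w) else 0 : R).
Proof.
move=> x0.
have Gm : G `<=` measurable by move=> _ [A mA ->]; exact: mpre.
have GI : setI_closed G.
  by move=> _ _ [A mA ->] [B mB ->]; exists (A `&` B); [exact: measurableI|rewrite preimage_setI].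
have GT : G setT by exists setT.
have ind E B : G E -> measurable B -> P (E `&` W @^-1` B) = (P (W @^-1` B) * P E)%E.
  move=> [A mA ->] mB; have m1 := mpre mV mA; have m2 := mpre mW mB.
  rewrite setIC -[LHS]fineK ?fin_num_measure //; last exact: measurableI.
  rewrite -[P (W @^-1` B)]fineK ?fin_num_measure // -[P (V @^-1` A)]fineK ?fin_num_measure //.
  by rewrite -EFinM indepVW.
pose F w z : R := \1_([set y : R | x < y]) (V w * z).
have mVG : measurable_fun [set: g_sigma_algebraType G] (V : g_sigma_algebraType G -> R).
  by move=> _ B mB; rewrite setTI; apply: sub_sigma_algebra; exists B.
have mgt : measurable [set y : R | x < y].
  by rewrite (_ : [set _ | _] = `]x, +oo[%classic); [exact: measurable_itv|apply/seteqP; split => y /=; rewrite in_itv /= andbT].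
have mF : measurable_fun [set: g_sigma_algebraType G * R] (fun p => F p.1 p.2).
  apply: (measurableT_comp (measurable_indic mgt)); apply: measurable_funM => //.
  exact: measurableT_comp.
have bF : exists M, forall w z, `|F w z| <= M.
  by exists 1 => w z; rewrite /F indicE; case: (_ \in _); rewrite ?normr1 ?normr0.
have inner w : \int[P]_w' F w (W w') = if 0 < V w then H (x / V w) else 0.
  have mFw : measurable [set w' | x < V w * W w'].
    by apply: gt_measurable; exact: measurable_funM.
  have -> : \int[P]_w' F w (W w') = fine (P [set w' | x < V w * W w']).
    rewrite -(Rintegral_indicT P mFw); apply: eq_Rintegral => w' _.
    by rewrite /F !indicE; congr (_%:R); apply/idP/idP; rewrite !inE.
  have [Vw|] := ltP 0 (V w).
    by rewrite /H; congr (fine (P _)); apply/seteqP; split => w' /=; rewrite ltr_pdivrMr // mulrC.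
  move=> Vw; have Vw0 : V w = 0 by apply/eqP; rewrite eq_le Vw V0.
  rewrite (_ : [set _ | _] = set0) ?measure0 //; apply/seteqP; split => w' //=.
  by rewrite Vw0 mul0r ltNge x0.
have mP : measurable [set w | x < V w * W w] by apply: gt_measurable; exact: measurable_funM.
split.
- rewrite -(Rintegral_indicT P mP).
  transitivity (\int[P]_w F w (W w)).
    by apply: eq_Rintegral => w _; rewrite /F !indicE; congr (_%:R); apply/idP/idP; rewrite !inE.
  rewrite (freezing Gm GI GT mW ind mF bF).
  by apply: eq_Rintegral => w _; exact: inner.
- rewrite (_ : (fun w => _) = (fun w => \int[P]_w' F w (W w'))); last exact/funext.
  have mF2 : measurable_fun [set: T * T] (fun p => F p.1 (W p.2)).
    apply: (measurableT_comp (measurable_indic mgt)); apply: measurable_funM => //; exact: measurableT_comp.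
  apply: measurable_Rintegral_param => //.
  by case: bF => M hM; exists M => u w; exact: hM.
Qed.

Variables (beta e : R).
Hypothesis Hpos : forall x, 0 < H x.
Hypothesis HRV : forall c : R, 0 < c -> (fun x => H (c * x) / H x) @ +oo --> c `^ (- beta).
Hypothesis ebeta : 0 < e < beta.
Hypothesis IV : P.-integrable setT (EFin \o (fun w => growth beta e (V w))).
Variable b : nat -> R.
Hypothesis b_oo : b @ \oo --> +oo.

Lemma breiman : (fun n => fine (P [set w | b n < V w * W w]) / H (b n)) @ \oo -->
  \int[P]_w (V w `^ beta).
Proof.
case/andP: (ebeta) => e0 eb.
have [C [x0 [C0 [x00 pot]]]] := potter_upper (survival_nonincreasing P mW) Hpos (survival_le1 P mW) HRV ebeta.
(* The default value 0 for negative [b n] makes every [f n] measurable; only large [n] count. *)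
pose f n w : R := if 0 <= b n then (if 0 < V w then H (b n / V w) else 0) / H (b n) else 0.
have mf n : measurable_fun setT (f n).
  rewrite /f; have [bn|bn] := boolP (0 <= b n); last exact: measurable_cst.
  have [_ m] := product_tail bn.
  exact: measurable_funM.
have mVb : measurable_fun setT (fun w => V w `^ beta) by exact: measurable_fun_powR.
have IG : P.-integrable setT (EFin \o (fun w => C * growth beta e (V w))) by exact: rintZ.
have b0 : \forall n \near \oo, 0 <= b n by exact: b_near.
have [] := @Rintegral_dct _ _ _ P _ measurableT f (fun w => V w `^ beta) (fun w => C * growth beta e (V w)) mf mVb _ IG.
- move=> w _; have [Vw|] := ltP 0 (V w).
    have -> : V w `^ beta = (V w)^-1 `^ (- beta) by rewrite powRV ?V0 // opprK.
    have iV : 0 < (V w)^-1 by rewrite invr_gt0.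
    have := cvg_comp _ _ b_oo (HRV iV); apply: cvg_trans; apply: near_eq_cvg.
    by apply: filterS b0 => n bn; rewrite /= /f bn Vw [_^-1 * _]mulrC.
  move=> Vw; have Vw0 : V w = 0 by apply/eqP; rewrite eq_le Vw V0.
  have -> : V w `^ beta = 0 by rewrite Vw0 powR0 // gt_eqF //; lra.
  apply: (cvgn_ext _ (@cvg_cst _ 0 _ _ _)) => n.
  by rewrite /f Vw0 ltxx mul0r; case: ifP.
- near=> n => w _.
  have bn : x0 <= b n by near: n; exact: b_near.
  have bn0 : 0 <= b n by rewrite ltW // (lt_le_trans x00).
  have g0 v : 0 <= growth beta e v by rewrite addr_ge0 ?powR_ge0.
  rewrite /f bn0; case: ifP => Vw; last by rewrite mul0r normr0 mulr_ge0 // ltW.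
  rewrite ger0_norm ?divr_ge0 ?(ltW (Hpos _)) // ler_pdivrMr //.
  have iV : 0 < (V w)^-1 by rewrite invr_gt0.
  by have := pot _ _ bn iV; rewrite !powRV ?V0 // !opprK [_^-1 * _]mulrC.
- move=> _; apply: cvg_trans; apply: near_eq_cvg; apply: filterS b0 => n bn.
  rewrite /f bn; have [-> m] := product_tail bn.
  under eq_Rintegral do rewrite mulrC.
  rewrite RintegralZl //; first by rewrite mulrC.
  apply: bmf_int; split => //; exists 1 => w; case: ifP => _; last by rewrite normr0.
  by rewrite ger0_norm ?survival_ge0 ?survival_le1.
Unshelve. all: by end_near.
Qed.

End product_tail.

(** * The normalizing sequence *)

Section normalization.
Context d (T : measurableType d) (R : realType) (P : probability T R).
Variables (s Z : T -> R) (alpha : R) (a : nat -> R).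
Hypotheses (ms : measurable_fun setT s) (mZ : measurable_fun setT Z).
Hypothesis s0 : forall w, 0 <= s w.
Hypothesis indep : forall A B, measurable A -> measurable B ->
  fine (P (Z @^-1` B `&` s @^-1` A)) = fine (P (Z @^-1` B)) * fine (P (s @^-1` A)).
Hypothesis RV : regularly_varying P Z alpha.
Hypothesis na : (fun n => n%:R * fine (P [set w | a n < `|s w * Z w|])) @ \oo --> (1 : R).
Variable e : R.
Hypothesis ealpha : 0 < e < alpha / 2.
Hypothesis Is : P.-integrable setT (EFin \o (fun w => growth (alpha / 2) e (s w ^+ 2))).

Let mX : measurable_fun setT (fun w => `|s w * Z w|).
Proof. by apply: measurableT_comp => //; exact: measurable_funM. Qed.

(** If sigma vanished almost surely, each tail probability would be 0 or 1, and [n] times it could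
    not tend to 1. *)
Let s_pos : P [set w | 0 < s w] <> 0%E.
Proof.
move=> s00.
have m0 : measurable [set w | 0 < s w] by exact: gt_measurable.
have cst_tail n : fine (P [set w | a n < `|s w * Z w|]) = (a n < 0)%R%:R :> R.
  have [an|an] := ltP (a n) 0.
    rewrite (_ : [set _ | _] = setT) ?probability_setT //.
    by apply/seteqP; split => // w _ /=; rewrite (lt_le_trans an).
  rewrite (_ : P _ = 0%E) //; apply/eqP; rewrite eq_le measure_ge0 andbT -s00.
  rewrite le_measure ?inE //; first exact: gt_measurable.
  move=> w /= h; rewrite lt_neqAle s0 andbT; apply: contraTneq h => <-.
  by rewrite mul0r normr0 -leNgt.
have [N _ hN] := (cvgrPdist_lt _ _).1 na _ (ltr01 : 0 < 1 :> R).
(* The index is at least 2, so both possible values, 0 and N + 2, lie at distance at least 1 from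
   the limit. *)
have := hN N.+2; rewrite /= => /(_ (leqW (leqnSn N))); rewrite cst_tail.
case: (a N.+2 < 0)%R; last by rewrite mulr0 subr0 normr1 ltxx.
rewrite mulr1 distrC ger0_norm; last by rewrite subr_ge0 ler1n.
by rewrite ltrBlDr -[1 + 1]/(2%:R) ltr_nat.
Qed.

(** A zero integral would force [f] to vanish almost surely, whereas it is positive on the event
    that sigma is positive, which is not null. *)
Let integral_pos (f : T -> R) : P.-integrable setT (EFin \o f) -> (forall w, 0 <= f w) ->
  (forall w, 0 < s w -> 0 < f w) -> 0 < \int[P]_w f w.
Proof.
move=> If f0 sf; have mf : measurable_fun setT (EFin \o f) by case/integrableP: If.
have h0 : (0 <= \int[P]_w (f w)%:E)%E by apply: integral_ge0 => w _; rewrite lee_fin.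
have fin : (\int[P]_w (f w)%:E)%E \is a fin_num by exact: integrable_fin_num.
rewrite /Rintegral lt_neqAle fine_ge0 // andbT eq_sym fine_eq0 //; apply/eqP => I0.
have [] := (ae_eq_integral_abs P measurableT mf).1.
  rewrite -[RHS]I0; apply: eq_integral => w _ /=.
  by rewrite ger0_norm.
move=> A [mA A0 sA]; apply: s_pos; apply/eqP; rewrite eq_le measure_ge0 andbT -A0.
rewrite le_measure ?inE //; first exact: gt_measurable.
move=> w /= sw; apply: sA => /= /(_ I) [] f00; have := sf w sw.
by rewrite f00 ltxx.
Qed.

Let V w := s w ^+ 2.
Let W w := Z w ^+ 2.
Let mV : measurable_fun setT V. Proof. exact: measurable_funX. Qed.
Let mW : measurable_fun setT W. Proof. exact: measurable_funX. Qed.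
Let V0 w : 0 <= V w. Proof. exact: sqr_ge0. Qed.
Let msq : measurable_fun setT (fun x : R => x ^+ 2).
Proof. by apply: measurable_funX; exact: measurable_id. Qed.

Let indepVW A B : measurable A -> measurable B ->
  fine (P (W @^-1` B `&` V @^-1` A)) = fine (P (W @^-1` B)) * fine (P (V @^-1` A)).
Proof.
move=> mA mB; apply: (@indep ((fun x => x ^+ 2) @^-1` A) ((fun x => x ^+ 2) @^-1` B));
  rewrite -[X in measurable X]setTI; exact: msq.
Qed.

Let tailE x : 0 <= x -> [set w | x < `|s w * Z w|] = [set w | x ^+ 2 < V w * W w].
Proof.
move=> x0; apply/seteqP; split => w /=; rewrite /V /W -exprMn -[(_ * _) ^+ 2]real_normK ?num_real //;
  by rewrite ltr_pXn2r ?nnegrE.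
Qed.

Let tail_pos x : 0 <= x -> 0 < fine (P [set w | x < `|s w * Z w|]).
Proof.
move=> x0; rewrite tailE //; have [-> m] := product_tail mV mW V0 indepVW (sqr_ge0 x).
apply: integral_pos.
- apply: bmf_int; split => //; exists 1 => w; case: ifP => _; last by rewrite normr0.
  by rewrite ger0_norm ?survival_ge0 ?survival_le1.
- by move=> w; case: ifP => // _; exact: survival_ge0.
- move=> w sw; rewrite ifT; first exact: (square_tail_gt0 mZ RV).
  by rewrite exprn_gt0.
Qed.

(** Every fixed level has positive tail probability, so [n] times that probability eventually
    exceeds 2; terms of [a] below the level would then contradict the normalization. *)
Let a_oo : a @ \oo --> +oo.
Proof.
apply/cvgryPge => A; have e0 := tail_pos (normr_ge0 A); set ep := fine _ in e0.
have lt2 : 1 < 2 :> R by rewrite ltr1n.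
near=> n.
have h1 : n%:R * fine (P [set w | a n < `|s w * Z w|]) < 2 by near: n; exact: (cvgr_lt _ na).
have h2 : 2 <= n%:R * ep.
  rewrite -ler_pdivrMr //; near: n; exists (Num.truncn (2 / ep)).+1 => // n /= hn.
  by rewrite (le_trans (ltW (truncnS_gt _))) // ler_nat.
rewrite leNgt; apply/negP => an; suff : n%:R * ep <= n%:R * fine (P [set w | a n < `|s w * Z w|]) by lra.
rewrite ler_wpM2l ?ler0n //; apply: survival_nonincreasing => //.
by rewrite (le_trans (ltW an)) // ler_norm.
Unshelve. all: by end_near.
Qed.

(** Breiman's lemma compares the tails of X^2 and Z^2, so that [kappa] is the inverse of E
    sigma^alpha. *)
Lemma normalization : exists2 kappa : R, 0 < kappa &
  0 < \int[P]_w ((s w ^+ 2) `^ (alpha / 2)) /\ ((fun n => a n ^+ 2) @ \oo --> +oo) /\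
  (fun n => n%:R * fine (P [set w | a n ^+ 2 < Z w ^+ 2])) @ \oo --> kappa.
Proof.
have a2 : (fun n => a n ^+ 2) @ \oo --> +oo.
  apply/cvgryPge => A; near=> n.
  have a1 : 1 <= a n by near: n; exact: b_near.
  have aA : A <= a n by near: n; exact: b_near.
  by rewrite (le_trans aA) // ler_eXnr.
have mVb : measurable_fun setT (fun w => V w `^ (alpha / 2)) by exact: measurable_fun_powR.
have IVb : P.-integrable setT (EFin \o (fun w => V w `^ (alpha / 2))).
{
  apply: (rint_le measurableT (g := fun w => growth (alpha / 2) e (V w))) => // w _.
  rewrite ger0_norm ?powR_ge0 // /growth; case/andP: ealpha => e0 ea.
  have [V1|V1] := leP 1 (V w).
    by rewrite -[leLHS]addr0 lerD ?powR_ge0 //; apply: ler_powR => //; lra.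
  have [Vw0|Vw] := eqVneq (V w) 0; first by rewrite Vw0 !powR0 ?addr0 // gt_eqF //; lra.
  rewrite -[leLHS]add0r lerD ?powR_ge0 //; apply: ger_powR; last lra.
  by rewrite lt_neqAle eq_sym Vw V0 ltW.
}
have m0 : 0 < \int[P]_w (V w `^ (alpha / 2)).
  apply: integral_pos => //; first by move=> w; exact: powR_ge0.
  by move=> w sw; rewrite powR_gt0 // exprn_gt0.
exists (\int[P]_w (V w `^ (alpha / 2)))^-1; first by rewrite invr_gt0.
split => //; split => //.
have br := breiman mV mW V0 indepVW (square_tail_gt0 mZ RV) (square_tail_RV mZ RV) ealpha Is a2.
rewrite -[X in _ --> X]mul1r.
apply: (cvgn_near _ (cvgM na (cvgV (lt0r_neq0 m0) br))); near=> n.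
have a0 : 0 <= a n by near: n; exact: b_near.
have p0 := tail_pos a0.
have Hn := square_tail_gt0 mZ RV (a n ^+ 2).
rewrite tailE // in p0; rewrite -[LHS]/(n%:R * fine (P [set w | a n < `|s w * Z w|]) *
  (fine (P [set w | a n ^+ 2 < V w * W w]) / fine (P [set w | a n ^+ 2 < Z w ^+ 2]))^-1) tailE //.
by field; rewrite (gt_eqF p0) (gt_eqF Hn).
Unshelve. all: by end_near.
Qed.

End normalization.

(** * Variance bounds under strong mixing *)

Section staircase.
Variable R : realType.
Variable delta : R.
Hypothesis delta0 : 0 < delta.

(** Approximates min(x, k delta) within delta by indicators of upper half-lines, the only events to
    which the covariance hypothesis refers. *)
Definition staircase (k : nat) (x : R) : R :=
  \sum_(j < k) delta * \1_[set y : R | j%:R * delta < y] x.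

Lemma staircase_bounds k x : 0 <= x ->
  Num.min x (k%:R * delta) <= staircase k x <= Num.min (x + delta) (k%:R * delta).
Proof.
move=> x0; elim: k => [|k IH].
  by rewrite /staircase big_ord0 mul0r min_r // min_r ?lexx // addr_ge0 // ltW.
have kk : k.+1%:R * delta = k%:R * delta + delta by rewrite -natr1 mulrDl mul1r.
rewrite /staircase big_ord_recr /= -/(staircase k x) indicE kk.
have [kx|xk] := ltP (k%:R * delta) x.
  move: IH; rewrite (min_r (ltW kx)) min_r; last by rewrite (le_trans (ltW kx)) // lerDl ltW.
  rewrite mem_set //= mulr1 => /le_anti <-.
  by rewrite ge_min lexx orbT /= le_min lexx andbT lerD2r ltW.
rewrite memNset /=; last by apply/negP; rewrite -leNgt.
rewrite mulr0 addr0; move: IH; rewrite (min_l xk) le_min => /and3P[h1 h2 h3].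
by rewrite ge_min h1 /= le_min h2 (le_trans h3) // lerDl ltW.
Qed.

Lemma staircase_near k x : 0 <= x -> `|Num.min x (k%:R * delta) - staircase k x| <= delta.
Proof.
move=> x0; have /andP[] := staircase_bounds k x0.
move: (k%:R * delta) => m.
rewrite le_min => + /andP[h2 h3]; have [h|h] := lerP x m => h1.
  by rewrite ler_norml; apply/andP; split; lra.
by rewrite (@le_anti _ _ (staircase k x) m) ?h3 ?h1 // subrr normr0 ltW.
Qed.

Lemma staircase_ge0 k x : 0 <= staircase k x.
Proof.
by apply: sumr_ge0 => j _; rewrite mulr_ge0 ?(ltW delta0) // indicE.
Qed.

Lemma staircase_le k x : 0 <= x -> staircase k x <= k%:R * delta.
Proof. by move=> /(staircase_bounds k) /andP[_]; rewrite le_min => /andP[]. Qed.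

End staircase.

Section covariance.
Context d (T : measurableType d) (R : realType) (P : probability T R).
Variables (U V : T -> R) (r : R).
Hypotheses (mU : measurable_fun setT U) (mV : measurable_fun setT V).
Hypotheses (U0 : forall w, 0 <= U w) (V0 : forall w, 0 <= V w).
Hypothesis mix : forall x y : R,
  `|fine (P ([set w | x < U w] `&` [set w | y < V w])) -
    fine (P [set w | x < U w]) * fine (P [set w | y < V w])| <= r.

Let cov (f g : T -> R) := \int[P]_w (f w * g w) - (\int[P]_w f w) * (\int[P]_w g w).

Let stair_sum (D : R) k (X : T -> R) w : staircase D k (X w) =
  \sum_(j < k) D * \1_[set w | j%:R * D < X w] w.
Proof. by apply: eq_bigr => j _; rewrite !indicE; congr (_ * (_%:R)); apply/idP/idP; rewrite !inE. Qed.

Let bstair D k (X : T -> R) : measurable_fun setT X -> bmf (fun w => staircase D k (X w)).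
Proof.
move=> mX; rewrite (_ : (fun w => _) = (fun w => \sum_(j < k) D * \1_[set w | j%:R * D < X w] w)); last first.
  by apply/funext => w; rewrite stair_sum.
apply: bmf_sum => j; apply: bmfM; first exact: bmf_cst.
by apply: bmf_indic; exact: gt_measurable.
Qed.

Let stair_int D k (X : T -> R) : measurable_fun setT X -> \int[P]_w staircase D k (X w) =
  \sum_(j < k) D * fine (P [set w | j%:R * D < X w]).
Proof.
move=> mX; under eq_Rintegral do rewrite stair_sum.
have I (j : 'I_k) : P.-integrable setT (EFin \o (fun w => D * \1_[set w | j%:R * D < X w] w)).
  by apply: bmf_int; apply: bmfM; [exact: bmf_cst|apply: bmf_indic; exact: gt_measurable].
rewrite Rintegral_sum //; apply: eq_bigr => j _.
rewrite RintegralZl //; first by rewrite Rintegral_indicT //; exact: gt_measurable.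
by apply: bmf_int; apply: bmf_indic; exact: gt_measurable.
Qed.

Let cov_stair D k : 0 < D ->
  `|cov (fun w => staircase D k (U w)) (fun w => staircase D k (V w))| <= (k%:R * D) ^+ 2 * r.
Proof.
move=> D0; rewrite /cov !stair_int //.
pose A j := [set w | j%:R * D < U w]; pose B j := [set w | j%:R * D < V w].
have mA j : measurable (A j) by exact: gt_measurable.
have mB j : measurable (B j) by exact: gt_measurable.
have I i j : P.-integrable setT (EFin \o (fun w => D ^+ 2 * \1_(A i `&` B j) w)).
  by apply: bmf_int; apply: bmfM; [exact: bmf_cst|apply: bmf_indic; exact: measurableI].
have -> : \int[P]_w (staircase D k (U w) * staircase D k (V w)) =
    \sum_(i < k) \sum_(j < k) D ^+ 2 * fine (P (A i `&` B j)).
  transitivity (\int[P]_w \sum_(i < k) \sum_(j < k) D ^+ 2 * \1_(A i `&` B j) w).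
    apply: eq_Rintegral => w _; rewrite !stair_sum mulr_suml; apply: eq_bigr => i _.
    rewrite mulr_sumr; apply: eq_bigr => j _; rewrite indicI /=; ring.
  rewrite Rintegral_sum //; last by move=> i; exact: rint_sum.
  apply: eq_bigr => i _; rewrite Rintegral_sum //; apply: eq_bigr => j _.
  rewrite RintegralZl //; first by rewrite Rintegral_indicT //; exact: measurableI.
  by apply: bmf_int; apply: bmf_indic; exact: measurableI.
have -> : (\sum_(j < k) D * fine (P (A j))) * (\sum_(j < k) D * fine (P (B j))) =
    \sum_(i < k) \sum_(j < k) D ^+ 2 * (fine (P (A i)) * fine (P (B j))).
  by rewrite mulr_suml; apply: eq_bigr => i _; rewrite mulr_sumr; apply: eq_bigr => j _; ring.
rewrite -sumrB (le_trans (ler_norm_sum _ _ _)) //.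
apply: (@le_trans _ _ (\sum_(i < k) \sum_(j < k) D ^+ 2 * r)).
  apply: ler_sum => i _; rewrite -sumrB (le_trans (ler_norm_sum _ _ _)) //.
  apply: ler_sum => j _; rewrite -mulrBr normrM ger0_norm ?sqr_ge0 // ler_wpM2l ?sqr_ge0 //.
  exact: mix.
by rewrite !sumr_const !card_ord -[_ *+ k *+ k]mulr_natr -[_ * r *+ k]mulr_natr le_eqVlt; apply/orP; left; apply/eqP; ring.
Qed.

Let bmin (M : R) (X : T -> R) : measurable_fun setT X -> (forall w, 0 <= X w) -> 0 < M ->
  bmf (fun w => Num.min (X w) M).
Proof.
move=> mX X0 M0; split; first exact: measurable_minr.
by exists M => w; rewrite ger0_norm ?ge_min ?lexx ?orbT // le_min X0 ltW.
Qed.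

Let E1 f (K : R) : bmf f -> (forall w, `|f w| <= K) -> `|\int[P]_w f w| <= K.
Proof.
move=> bf fK; rewrite -[leRHS](Rintegral_cstT P); apply: norm_Rintegral_le => //.
  exact: bmf_int.
by apply: bmf_int; exact: bmf_cst.
Qed.

Let cov_near f g f' g' (M D : R) : 0 <= M -> bmf f -> bmf g -> bmf f' -> bmf g' ->
  (forall w, `|f' w| <= M) -> (forall w, `|g w| <= M) ->
  (forall w, `|f w - f' w| <= D) -> (forall w, `|g w - g' w| <= D) ->
  `|cov f g| <= `|cov f' g'| + 4 * (M * D).
Proof.
move=> M0 bf bg bf' bg' f'M gM ff gg.
have D0 : 0 <= D by exact: le_trans (ff point).
have i f0 := @bmf_int _ T R P f0.
have h1 : `|\int[P]_w (f w * g w) - \int[P]_w (f' w * g' w)| <= 2 * (M * D).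
  rewrite -RintegralB //; [|by apply: i; exact: bmfM..].
  apply: E1; first by apply: bmfB; exact: bmfM.
  move=> w; rewrite (_ : _ - _ = (f w - f' w) * g w + f' w * (g w - g' w)); last by ring.
  rewrite (le_trans (ler_normD _ _)) // !normrM mulr_natl mulr2n lerD //.
    by rewrite mulrC ler_pM.
  by rewrite ler_pM.
have h2 : `|(\int[P]_w f w) * (\int[P]_w g w) - (\int[P]_w f' w) * (\int[P]_w g' w)| <= 2 * (M * D).
  set a := \int[P]_w f w; set b := \int[P]_w g w; set a' := \int[P]_w f' w; set b' := \int[P]_w g' w.
  rewrite (_ : _ - _ = (a - a') * b + a' * (b - b')); last by ring.
  rewrite (le_trans (ler_normD _ _)) // !normrM mulr_natl mulr2n lerD //.
    rewrite mulrC ler_pM //; first exact: E1.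
    by rewrite -RintegralB //; [apply: E1 => //; exact: bmfB|exact: i|exact: i].
  rewrite ler_pM //; first exact: E1.
  by rewrite -RintegralB //; [apply: E1 => //; exact: bmfB|exact: i|exact: i].
rewrite /cov; move: h1 h2; set A := \int[P]_w (f w * g w); set B := \int[P]_w (f' w * g' w).
set a := (\int[P]_w f w) * _; set b := (\int[P]_w f' w) * _; move: A B a b => A B a b h1 h2.
have -> : A - a = (B - b) + ((A - B) - (a - b)) by ring.
rewrite (le_trans (ler_normD _ _)) // lerD2l (le_trans (ler_normB _ _)) //; lra.
Qed.

(** Staircases of mesh M / N reaching M have covariance at most M^2 r, and replacing the truncated
    variables by them costs 4 M^2 / N, which is below any [eta]. *)
Lemma cov_min_le (M : R) : 0 < M ->
  `|cov (fun w => Num.min (U w) M) (fun w => Num.min (V w) M)| <= M ^+ 2 * r.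
Proof.
move=> M0; apply/ler_addgt0Pl => eta eta0.
pose N := (Num.truncn (4 * M ^+ 2 / eta)).+1; pose D := M / N%:R.
have N0 : 0 < N%:R :> R by rewrite ltr0n.
have D0 : 0 < D by rewrite divr_gt0.
have ND : N%:R * D = M by rewrite /D mulrC divfK // gt_eqF.
have bM (X : T -> R) : measurable_fun setT X -> (forall w, 0 <= X w) ->
    forall w, `|Num.min (X w) M - staircase D N (X w)| <= D.
  by move=> mX X0 w; have := staircase_near D0 N (X0 w); rewrite ND.
have sM (X : T -> R) : (forall w, 0 <= X w) -> forall w, `|staircase D N (X w)| <= M.
  move=> X0 w; rewrite ger0_norm ?staircase_ge0 // -[leRHS]ND; exact: staircase_le.
have mM (X : T -> R) : (forall w, 0 <= X w) -> forall w, `|Num.min (X w) M| <= M.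
  by move=> X0 w; rewrite ger0_norm ?ge_min ?lexx ?orbT // le_min X0 ltW.
apply: le_trans (cov_near (ltW M0) (bmin mU U0 M0) (bmin mV V0 M0) (bstair D N mU) (bstair D N mV)
  (sM U U0) (mM V V0) (bM U mU U0) (bM V mV V0)) _.
rewrite addrC lerD //; last by rewrite -[in leRHS]ND; exact: cov_stair.
rewrite (_ : 4 * (M * D) = 4 * M ^+ 2 / N%:R); last by rewrite /D; ring.
by rewrite ler_pdivrMr // -ler_pdivrMl // [_^-1 * _]mulrC ltW // truncnS_gt.
Qed.

Variable q : R.
Hypothesis q2 : 2 < q.
Variables (mu mq : R).
Hypotheses (IU : P.-integrable setT (EFin \o (fun w => U w `^ q))) (IV : P.-integrable setT (EFin \o (fun w => V w `^ q))).
Hypotheses (EU : \int[P]_w (U w) = mu) (EV : \int[P]_w (V w) = mu).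
Hypotheses (EUq : \int[P]_w (U w `^ q) = mq) (EVq : \int[P]_w (V w `^ q) = mq).

(** Where one variable exceeds [M], the product is at most the square of the larger one, hence at
    most M^(2-q) times its q-th power. Truncated means are treated likewise. *)
Lemma cov_le (M : R) : 1 <= M ->
  `|\int[P]_w (U w * V w) - mu ^+ 2| <= M ^+ 2 * r + M `^ (2 - q) * (2 * mq * (1 + mu)).
Proof.
move=> M1; have M0 : 0 < M by exact: lt_le_trans M1.
have Mq0 := powR_ge0 M (2 - q).
have powq (x : R) : 0 < x -> M <= x -> x ^+ 2 <= M `^ (2 - q) * x `^ q.
  move=> x0 Mx; have -> : x ^+ 2 = x `^ (2 - q) * x `^ q.
    rewrite -powRD; last by rewrite (gt_eqF x0) implybT.
    by rewrite subrK powR_mulrn ?(ltW x0).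
  rewrite ler_wpM2r ?powR_ge0 // (_ : 2 - q = - (q - 2)); last by ring.
  by rewrite !powRN lef_pV2 ?posrE ?powR_gt0 // ge0_ler_powR ?nnegrE ?(ltW M0) ?(ltW x0) // subr_ge0 ltW.
have le1q (x : R) : 0 <= x -> x <= 1 + x `^ q.
  move=> x0; have [x1|x1] := leP x 1; first by rewrite -[leLHS]addr0 lerD ?powR_ge0.
  rewrite -[leLHS]add0r lerD // -[leLHS]powRr1 //.
  by apply: ler_powR; [exact: ltW|have := q2; lra].
have int1 (X : T -> R) : measurable_fun setT X -> (forall w, 0 <= X w) ->
    P.-integrable setT (EFin \o (fun w => X w `^ q)) -> P.-integrable setT (EFin \o X).
  move=> mX X0 IX; apply: (rint_le measurableT (g := fun w => 1 + X w `^ q)) => //.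
    by move=> w _; rewrite ger0_norm // le1q.
  by apply: rintD => //; apply: bmf_int; exact: bmf_cst.
have IU1 := int1 U mU U0 IU; have IV1 := int1 V mV V0 IV.
pose a w := Num.min (U w) M; pose b w := Num.min (V w) M.
have ba : bmf a by exact: bmin. have bb : bmf b by exact: bmin.
have a0 w : 0 <= a w by rewrite /a le_min U0 ltW.
have b0 w : 0 <= b w by rewrite /b le_min V0 ltW.
have aU w : a w <= U w by rewrite /a ge_min lexx.
have bV w : b w <= V w by rewrite /b ge_min lexx.
pose h w := M `^ (2 - q) * (U w `^ q + V w `^ q).
have Ih : P.-integrable setT (EFin \o h) by apply: rintZ => //; exact: rintD.
have Eh : \int[P]_w h w = M `^ (2 - q) * (2 * mq).
  by rewrite /h RintegralZl //; [rewrite RintegralD // EUq EVq; ring|exact: rintD].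
have UV w : `|U w * V w - a w * b w| <= h w.
{
  have Uq := powR_ge0 (U w) q; have Vq := powR_ge0 (V w) q.
  rewrite ger0_norm; last by rewrite subr_ge0 ler_pM.
  apply: (@le_trans _ _ (if (U w <= M) && (V w <= M) then 0 else U w * V w)).
    case: ifP => [/andP[u v]|_]; first by rewrite /a /b !min_l // subrr.
    by rewrite gerBl mulr_ge0.
  case: ifP => [_|/negbT]; first by rewrite mulr_ge0 // addr_ge0.
  rewrite negb_and -!ltNge => hM.
  have [uv|vu] := leP (U w) (V w).
    have MV : M < V w by case/orP: hM => // /lt_le_trans; apply.
    rewrite (@le_trans _ _ (V w ^+ 2)) //; first by rewrite expr2 ler_wpM2r.
    rewrite (le_trans (powq _ _ (ltW MV))) ?(lt_trans M0) // ler_wpM2l //; lra.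
  have MU : M < U w by case/orP: hM => // /lt_trans; apply.
  rewrite (@le_trans _ _ (U w ^+ 2)) //; first by rewrite expr2 ler_wpM2l // ltW.
  rewrite (le_trans (powq _ _ (ltW MU))) ?(lt_trans M0) // ler_wpM2l //; lra.
}
have IUV : P.-integrable setT (EFin \o (fun w => U w * V w)).
{
  apply: (rint_le measurableT (g := fun w => h w + a w * b w)).
  - exact: measurable_funM.
  - move=> w _; have := UV w; rewrite ler_norml => /andP[_]; rewrite ger0_norm ?mulr_ge0 //; lra.
  - by apply: rintD => //; apply: bmf_int; exact: bmfM.
}
have e1 : `|\int[P]_w (U w * V w) - \int[P]_w (a w * b w)| <= M `^ (2 - q) * (2 * mq).
  by rewrite -Eh; apply: dist_Rintegral_le => //; apply: bmf_int; exact: bmfM.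
have mq0 : 0 <= mq by rewrite -EUq; apply: Rintegral_ge0 => w _; exact: powR_ge0.
have mu0 : 0 <= mu by rewrite -EU; apply: Rintegral_ge0.
have near1 (X c : T -> R) : (forall w, 0 <= X w) -> P.-integrable setT (EFin \o X) ->
    P.-integrable setT (EFin \o (fun w => X w `^ q)) -> \int[P]_w X w = mu -> \int[P]_w (X w `^ q) = mq ->
    bmf c -> (forall w, c w = Num.min (X w) M) ->
    `|mu - \int[P]_w c w| <= M `^ (2 - q) * mq /\ 0 <= \int[P]_w c w <= mu.
{
  move=> X0 IX IXq EX EXq bc cX; split; last first.
    rewrite Rintegral_ge0 /=; last by move=> w _; rewrite cX le_min X0 ltW.
    rewrite -EX; apply: le_Rintegral => //; first exact: bmf_int.
    by move=> w _; rewrite cX ge_min lexx.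
  rewrite -EX -EXq -RintegralZl //; apply: dist_Rintegral_le => //.
  - exact: bmf_int.
  - exact: rintZ.
  - move=> w _; rewrite cX; have [XM|MX] := leP (X w) M; first by rewrite subrr normr0 mulr_ge0 ?powR_ge0.
    rewrite ger0_norm ?subr_ge0 ?(ltW MX) //.
    rewrite (le_trans _ (powq _ _ (ltW MX))) ?(lt_trans M0) //.
    have X1 : 1 <= X w by rewrite (le_trans M1) // ltW.
    by rewrite (@le_trans _ _ (X w)) ?ler_eXnr // gerBl ltW.
}
have [na /andP[a1 a2]] := near1 U a U0 IU1 IU EU EUq ba (fun=> erefl).
have [nb /andP[b1 b2]] := near1 V b V0 IV1 IV EV EVq bb (fun=> erefl).
have e2 : `|mu ^+ 2 - (\int[P]_w a w) * (\int[P]_w b w)| <= M `^ (2 - q) * (2 * mq * mu).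
  set x := \int[P]_w a w in na a1 a2 *; set y := \int[P]_w b w in nb b1 b2 *.
  rewrite (_ : _ - _ = (mu - x) * mu + x * (mu - y)); last by ring.
  rewrite (le_trans (ler_normD _ _)) // !normrM (ger0_norm mu0) (ger0_norm a1).
  rewrite (_ : M `^ (2 - q) * (2 * mq * mu) = M `^ (2 - q) * mq * mu + mu * (M `^ (2 - q) * mq)); last by ring.
  by rewrite lerD ?ler_pM // ler_wpM2r.
have e3 := cov_min_le M0; rewrite /cov -/(a _) -/(b _) in e3.
have -> : \int[P]_w (U w * V w) - mu ^+ 2 =
   (\int[P]_w (a w * b w) - (\int[P]_w a w) * (\int[P]_w b w)) +
   ((\int[P]_w (U w * V w) - \int[P]_w (a w * b w)) - (mu ^+ 2 - (\int[P]_w a w) * (\int[P]_w b w))) by ring.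
rewrite (le_trans (ler_normD _ _)) // lerD // (le_trans (ler_normB _ _)) //.
rewrite (_ : _ * (2 * mq * (1 + mu)) = M `^ (2 - q) * (2 * mq) + M `^ (2 - q) * (2 * mq * mu)); last by ring.
exact: lerD.
Qed.

Lemma cov_rate (r' : R) : r <= r' -> 0 < r' <= 1 ->
  `|\int[P]_w (U w * V w) - mu ^+ 2| <= (1 + 2 * mq * (1 + mu)) * r' `^ (1 - 2 / q).
Proof.
move=> rr' /andP[r0 r1]; have q0 : 0 < q by have := q2; lra.
pose M := r' `^ (- q^-1).
have M1 : 1 <= M.
  rewrite /M -powRV ?(ltW r0) // -[leLHS](powRr0 r'^-1).
  by apply: ler_powR; [rewrite invf_ge1|rewrite invr_ge0 ltW].
have MM : M `^ (2 - q) = r' `^ (1 - 2 / q).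
  by rewrite /M -powRrM; congr (_ `^ _); field; rewrite gt_eqF.
have Mr : M ^+ 2 * r' = r' `^ (1 - 2 / q).
  rewrite -powR_mulrn ?powR_ge0 // /M -powRrM -{2}(powRr1 (ltW r0)) -powRD; last by rewrite (gt_eqF r0) implybT.
  by congr (_ `^ _); field; rewrite gt_eqF.
apply: (le_trans (cov_le M1)); rewrite MM [leRHS]mulrDl mul1r.
apply: lerD; last by rewrite mulrC.
by rewrite -Mr ler_wpM2l ?sqr_ge0.
Qed.

End covariance.

(** Letting [r] tend to 0; this settles the case of a mixing coefficient equal to 0. *)
Lemma le_powR_limit (R : realType) (c C p : R) : 0 < p -> 0 <= C ->
  (forall r, 0 < r <= 1 -> c <= C * r `^ p) -> c <= 0.
Proof.
move=> p0 C0 h; rewrite leNgt; apply/negP => c0.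
have C1 : 0 < C by have := h 1; rewrite powR1 mulr1 ltr01 lexx => /(_ isT); exact: lt_le_trans.
have d0 : 0 < c / (2 * C) by rewrite divr_gt0 // mulr_gt0.
pose r := Num.min 1 ((c / (2 * C)) `^ p^-1).
have r0 : 0 < r by rewrite lt_min ltr01 powR_gt0.
have := h r; rewrite r0 ge_min lexx => /(_ isT).
have : r `^ p <= c / (2 * C).
  rewrite -[leRHS]powRr1 ?(ltW d0) // -[X in _ <= _ `^ X](mulVf (lt0r_neq0 p0)) powRrM.
  by rewrite ge0_ler_powR ?nnegrE ?(ltW p0) ?(ltW r0) ?powR_ge0 // ge_min lexx orbT.
move=> /(ler_wpM2l C0) h1 /le_trans /(_ h1).
rewrite (_ : C * (c / (2 * C)) = c / 2); first by lra.
by field; rewrite gt_eqF.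
Qed.

(** * Mean-square law of large numbers *)

Section sum_shifts.
Variable R : realType.
Implicit Type f : nat -> R.

Lemma sum_ord_le f m n : (forall h, 0 <= f h) -> (m <= n)%N -> \sum_(h < m) f h <= \sum_(h < n) f h.
Proof.
move=> f0 /subnKC <-; elim: (n - m)%N => [|k IH]; first by rewrite addn0.
by rewrite addnS big_ord_recr /= (le_trans IH) // lerDl.
Qed.

(** Subtraction on naturals is truncated, hence the indicator. In a row of the double sum over
    times, each lag occurs at most once to the right of the diagonal. *)
Lemma shift_sum_le f n s : (forall h, 0 <= f h) ->
  \sum_(t < n) f (t - s)%N * (s <= t)%N%:R <= \sum_(h < n) f h.
Proof.
move=> f0; elim: n s => [|n IH] [|s].
- by rewrite !big_ord0.
- by rewrite !big_ord0.
- by apply: ler_sum => t _; rewrite subn0 leq0n mulr1.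
- rewrite big_ord_recl mulr0 add0r; apply: le_trans (sum_ord_le f0 (leqnSn n)).
  exact: IH.
Qed.

Lemma reverse_shift_sum_le f n s : (forall h, 0 <= f h) ->
  \sum_(t < n) f (s - t)%N * (t < s)%N%:R <= \sum_(h < s.+1) f h.
Proof.
move=> f0; elim: s n => [|s IH] n.
  by rewrite big1 ?sumr_ge0 // => t _; rewrite ltn0 mulr0.
case: n => [|n]; first by rewrite big_ord0 sumr_ge0.
rewrite big_ord_recl [leRHS]big_ord_recr /= subn0 mulr1 [leRHS]addrC.
by apply: lerD => //; exact: IH.
Qed.

End sum_shifts.

Section mixing_lln.
Context d (T : measurableType d) (R : realType) (P : probability T R).
Variables (V : nat -> T -> R) (r : nat -> R) (q : R).
Hypothesis mV : forall t, measurable_fun setT (V t).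
Hypothesis V0 : forall t w, 0 <= V t w.
Hypothesis same : forall t B, measurable B -> P (V t @^-1` B) = P (V 0%N @^-1` B).
Hypothesis r0 : forall h, 0 <= r h.
Hypothesis mix : forall s h (x y : R),
  `|fine (P ([set w | x < V s w] `&` [set w | y < V (s + h)%N w])) -
    fine (P [set w | x < V s w]) * fine (P [set w | y < V (s + h)%N w])| <= r h.
Hypothesis q2 : 2 < q.
Hypothesis IVq : P.-integrable setT (EFin \o (fun w => V 0%N w `^ q)).

Let mu := \int[P]_w V 0%N w.
Let mq := \int[P]_w (V 0%N w `^ q).
Let p := 1 - 2 / q.
Let C := 1 + 2 * mq * (1 + mu).

Let p0 : 0 < p. Proof. have h := q2; by rewrite subr_gt0 ltr_pdivrMr ?mul1r //; lra. Qed.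

Let law (f : R -> R) t : measurable_fun setT f ->
  P.-integrable setT (EFin \o (fun w => f (V 0%N w))) ->
  P.-integrable setT (EFin \o (fun w => f (V t w))) /\ \int[P]_w f (V t w) = \int[P]_w f (V 0%N w).
Proof.
move=> mf I0; have [] := same_law_integral (mV 0%N) (mV t) (fun B mB => esym (same t mB)) mf I0.
by move=> I1 ->.
Qed.

Let mpow : measurable_fun setT (fun x : R => x `^ q). Proof. exact: measurable_powR. Qed.

Let le_pow (x : R) : 0 <= x -> x <= 1 + x `^ q /\ x ^+ 2 <= 1 + x `^ q.
Proof.
move=> x0; have [x1|x1] := leP x 1.
  by rewrite -[x in x <= _]addr0 -[x ^+ 2]addr0 !lerD ?powR_ge0 // exprn_ile1.
split; rewrite -[leLHS]add0r lerD //.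
  by rewrite -[leLHS]powRr1 //; apply: ler_powR; [exact: ltW|have := q2; lra].
by rewrite -powR_mulrn //; apply: ler_powR; exact: ltW.
Qed.

Let I0q : P.-integrable setT (EFin \o (fun w => 1 + V 0%N w `^ q)).
Proof. by apply: rintD => //; apply: bmf_int; exact: bmf_cst. Qed.

Let IV t : P.-integrable setT (EFin \o V t) /\ \int[P]_w V t w = mu.
Proof.
apply: (@law id) => //.
by apply: (rint_le measurableT _ _ I0q) => // w _; rewrite ger0_norm // (le_pow _).1.
Qed.

Let IV2 t : P.-integrable setT (EFin \o (fun w => V t w ^+ 2)).
Proof.
apply: (@law (fun x => x ^+ 2) t _ _).1.
  by apply: measurable_funX; exact: measurable_id.
apply: (rint_le measurableT _ _ I0q); first exact: measurable_funX.
by move=> w _; rewrite ger0_norm ?sqr_ge0 // (le_pow _).2.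
Qed.

Let IVV s t : P.-integrable setT (EFin \o (fun w => V s w * V t w)).
Proof.
apply: (rint_le measurableT (g := fun w => V s w ^+ 2 + V t w ^+ 2)).
- exact: measurable_funM.
- move=> w _; rewrite ger0_norm ?mulr_ge0 //; have := sqr_ge0 (V s w - V t w).
  rewrite sqrrB; have := mulr_ge0 (V0 s w) (V0 t w); lra.
- exact: rintD.
Qed.

Let C0 : 0 <= C.
Proof.
have h1 : 0 <= mu by apply: Rintegral_ge0.
have h2 : 0 <= mq by apply: Rintegral_ge0 => w _; exact: powR_ge0.
by rewrite /C !(addr_ge0, mulr_ge0).
Qed.

Let mix1 s h (x y : R) : `|fine (P ([set w | x < V s w] `&` [set w | y < V (s + h)%N w])) -
  fine (P [set w | x < V s w]) * fine (P [set w | y < V (s + h)%N w])| <= 1.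
Proof.
have mA := gt_measurable (mV s) x; have mB := gt_measurable (mV (s + h)%N) y.
set A := [set w | _] in mA *; set B := [set w | _] in mB *.
have := survival_le1 P (mV s) x; have := survival_le1 P (mV (s + h)%N) y.
have := survival_ge0 P (V s) x; have := survival_ge0 P (V (s + h)%N) y; rewrite -/A -/B => a0 b0 a1 b1.
have c0 : 0 <= fine (P (A `&` B)) by exact: fine_ge0.
have c1 : fine (P (A `&` B)) <= 1.
  have mAB : measurable (A `&` B) by exact: measurableI.
  by rewrite -[leRHS]/(fine 1%E) fine_le ?fin_num_measure ?probability_le1.
have := mulr_ge0 a0 b0 => p0'; have p1' : fine (P A) * fine (P B) <= 1 by rewrite mulr_ile1.
rewrite ler_norml; apply/andP; split; lra.
Qed.

(** Three cases for the coefficient: above 1 the trivial bound [mix1] is used, in ]0, 1] it is its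
    own majorant, and at 0 all positive majorants are available. *)
Let cov_V s h : `|\int[P]_w (V s w * V (s + h)%N w) - mu ^+ 2| <= C * r h `^ p.
Proof.
have [_ E1] := IV s; have [_ E2] := IV (s + h)%N.
have [I1 F1] := law s mpow IVq; have [I2 F2] := law (s + h)%N mpow IVq.
have key r' := @cov_rate _ _ _ P _ _ _ (mV s) (mV (s + h)%N) (V0 s) (V0 (s + h)%N) (mix s h) q q2 mu mq
  I1 I2 E1 E2 F1 F2 r'.
have [r1|r1] := ltP 1 (r h).
  have := @cov_rate _ _ _ P _ _ _ (mV s) (mV (s + h)%N) (V0 s) (V0 (s + h)%N) (mix1 s h) q q2 mu mq
  I1 I2 E1 E2 F1 F2 1 (lexx _); rewrite ltr01 lexx => /(_ isT) h1.
  apply: (le_trans h1); apply: ler_wpM2l; first exact: C0.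
  rewrite powR1 -[leLHS](powRr0 (r h)).
  by apply: ler_powR; [exact: ltW r1|exact: ltW p0].
have := r0 h; rewrite le_eqVlt => /predU1P[r00|rp]; last first.
  by apply: (key _ (lexx _)); rewrite rp r1.
rewrite -r00 powR0; last by rewrite gt_eqF.
rewrite mulr0; apply: (le_powR_limit p0 C0) => r' hr'.
have r'0 : r h <= r' by rewrite -r00; case/andP: hr' => /ltW.
exact: (key _ r'0 hr').
Qed.

(** After expansion of the square, each of the [n] rows meets every lag at most once on either side
    of the diagonal, hence the factor 2. *)
Lemma mixing_variance n :
  P.-integrable setT (EFin \o (fun w => (\sum_(t < n) (V t w - mu)) ^+ 2)) /\
  \int[P]_w (\sum_(t < n) (V t w - mu)) ^+ 2 <= 2 * C * n%:R * \sum_(h < n) r h `^ p.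
Proof.
have Ic : P.-integrable setT (EFin \o (fun _ : T => mu ^+ 2)) by apply: bmf_int; exact: bmf_cst.
have Is (s t : nat) : P.-integrable setT (EFin \o (fun w => (V s w - mu) * (V t w - mu))).
  have e w : (V s w - mu) * (V t w - mu) = V s w * V t w - mu * (V s w + V t w) + mu ^+ 2 by ring.
  rewrite (_ : (fun w => _) = (fun w => V s w * V t w - mu * (V s w + V t w) + mu ^+ 2)); last exact/funext.
  apply: rintD => //; apply: rintB => //; apply: rintZ => //.
  by apply: rintD => //; [exact: (IV s).1|exact: (IV t).1].
have cst s h : `|\int[P]_w ((V s w - mu) * (V (s + h)%N w - mu))| <= C * r h `^ p.
{
  have e w : (V s w - mu) * (V (s + h)%N w - mu) = V s w * V (s + h)%N w - mu * (V s w + V (s + h)%N w) + mu ^+ 2 by ring.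
  under eq_Rintegral do rewrite e.
  have [I1 E1] := IV s; have [I2 E2] := IV (s + h)%N.
  have I3 : P.-integrable setT (EFin \o (fun w => V s w + V (s + h)%N w)) by exact: rintD.
  rewrite RintegralD //; last by apply: rintB => //; exact: rintZ.
  rewrite RintegralB //; last exact: rintZ.
  rewrite RintegralZl // RintegralD // E1 E2 Rintegral_cstT.
  rewrite (_ : _ + mu ^+ 2 = \int[P]_w (V s w * V (s + h)%N w) - mu ^+ 2); last by ring.
  exact: cov_V.
}
have e w : (\sum_(t < n) (V t w - mu)) ^+ 2 = \sum_(s < n) \sum_(t < n) (V s w - mu) * (V t w - mu).
  by rewrite expr2 mulr_suml; apply: eq_bigr => s _; rewrite mulr_sumr.
under eq_Rintegral do rewrite e.
rewrite (_ : (fun w => (\sum_(t < n) (V t w - mu)) ^+ 2) = (fun w => \sum_(s < n) \sum_(t < n) (V s w - mu) * (V t w - mu))); last exact/funext.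
have mT : measurable [set: T] by [].
split; first by apply: (rint_sum mT) => s; exact: (rint_sum mT).
rewrite Rintegral_sum //; last by move=> s; exact: rint_sum.
pose G := \sum_(h < n) r h `^ p.
have rp0 h : 0 <= C * r h `^ p by rewrite mulr_ge0 ?powR_ge0.
have row (s : 'I_n) : \int[P]_w \sum_(t < n) (V s w - mu) * (V t w - mu) <= 2 * (C * G).
{
  rewrite Rintegral_sum //.
  apply: (@le_trans _ _ (\sum_(t < n) C * (r (t - s)%N `^ p * (s <= t)%N%:R + r (s - t)%N `^ p * (t < s)%N%:R))).
    apply: ler_sum => t _; rewrite (le_trans (ler_norm _)) //.
    have [st|ts] := leqP s t.
      by rewrite mulr1 mulr0 addr0 -{1}(subnKC st); exact: cst.
    rewrite mulr0 add0r mulr1 -{1}(subnKC (ltnW ts)).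
    by under eq_Rintegral do rewrite mulrC; exact: cst.
  rewrite -mulr_sumr mulrCA ler_wpM2l // mulr_natl mulr2n big_split /= lerD //.
    rewrite /G; have := @shift_sum_le _ (fun h => r h `^ p) n s (fun h => powR_ge0 _ _); apply: le_trans.
    by apply: ler_sum.
  have := @reverse_shift_sum_le _ (fun h => r h `^ p) n s (fun h => powR_ge0 _ _) => h.
  apply: (le_trans h); apply: (@sum_ord_le _ (fun h => r h `^ p)) => // h'; exact: powR_ge0.
}
rewrite (le_trans (ler_sum _ (fun s _ => row s))) // sumr_const card_ord -mulr_natr -/G.
by rewrite le_eqVlt; apply/orP; left; apply/eqP; ring.
Qed.

End mixing_lln.

(** * The complex exponential *)

Section complex_exponential.
Local Open Scope complex_scope.
Variable R : realType.
Implicit Types z u : R[i].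

Definition cexp z : R[i] := (expR (complex.Re z))%:C * cis (complex.Im z).

Lemma cmR (x : R) : cm x%:C = `|x|.
Proof. by rewrite cmE /= expr0n /= addr0 sqrtr_sqr. Qed.

Lemma cm0 : cm (0 : R[i]) = 0.
Proof. by rewrite cmE /= expr0n /= addr0 sqrtr0. Qed.

Lemma Re_cexp z : complex.Re (cexp z) = expR (complex.Re z) * cos (complex.Im z).
Proof. by rewrite /cexp ReM /= mul0r subr0. Qed.

Lemma Im_cexp z : complex.Im (cexp z) = expR (complex.Re z) * sin (complex.Im z).
Proof. by rewrite /cexp ImM /= mul0r addr0. Qed.

Lemma real_complexM (x y : R) : (x * y)%:C = x%:C * y%:C.
Proof. by apply: complex_ext => /=; ring. Qed.

Lemma cmC z u : cm (z - u) = cm (u - z).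
Proof. by rewrite -cmN opprB. Qed.

Lemma cexpD z u : cexp (z + u) = cexp z * cexp u.
Proof.
case: z => a b; case: u => a' b'; rewrite /cexp [complex.Re _]/= [complex.Im _]/= expRD cisD.
by rewrite real_complexM mulrACA.
Qed.

Lemma cexp0 : cexp 0 = 1. Proof. by rewrite /cexp /= expR0 cis0 mulr1. Qed.

Lemma cexp_sum (I : Type) (s : seq I) (f : I -> R[i]) :
  cexp (\sum_(i <- s) f i) = \prod_(i <- s) cexp (f i).
Proof.
elim: s => [|i s IH]; first by rewrite !big_nil cexp0.
by rewrite !big_cons cexpD IH.
Qed.

Lemma cm_cexp z : cm (cexp z) = expR (complex.Re z).
Proof. by rewrite /cexp cmM cm_cis mulr1 cmR ger0_norm // expR_ge0. Qed.

Lemma cm_cexp_le1 z : complex.Re z <= 0 -> cm (cexp z) <= 1.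
Proof. by move=> z0; rewrite cm_cexp -[leRHS]expR0 ler_expR. Qed.

Let expR_lip (a b : R) : a <= 0 -> b <= 0 -> `|expR a - expR b| <= `|a - b|.
Proof.
wlog ba : a b / b <= a.
  move=> h a0 b0; have [|/ltW ab] := leP b a; first by move=> ba; exact: h.
  by rewrite distrC [leRHS]distrC; exact: h.
move=> a0 _; rewrite !ger0_norm ?subr_ge0 ?ler_expR //.
have -> : expR a - expR b = expR a * (1 - expR (- (a - b))).
  by rewrite mulrBr mulr1 -expRD; congr (_ - expR _); ring.
rewrite (le_trans _ (onem_expRN_le (a - b))) // ler_piMl //.
  by rewrite subr_ge0 expRN_le1 // subr_ge0.
by rewrite -[leRHS]expR0 ler_expR.
Qed.

(** On the left half-plane both exponentials lie in the unit disc; the moduli cost 1 and the phases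
    2, hence the constant 3. *)
Lemma cexp_lip z u : complex.Re z <= 0 -> complex.Re u <= 0 ->
  cm (cexp z - cexp u) <= 3 * cm (z - u).
Proof.
move=> z0 u0; pose ez := expR (complex.Re z); pose eu := expR (complex.Re u).
have -> : cexp z - cexp u = (ez - eu)%:C * cis (complex.Im z) +
    eu%:C * (cis (complex.Im u) * (cis (complex.Im z - complex.Im u) - 1)).
  rewrite mulrBr -cisD [complex.Im u + _]addrC subrK mulr1 /cexp -/ez -/eu.
  have -> : (ez - eu)%:C = ez%:C - eu%:C by apply: complex_ext => //=; rewrite subr0.
  by ring.
have eu1 : `|eu| <= 1 by rewrite ger0_norm ?expR_ge0 // -[leRHS]expR0 ler_expR.
have h1 := Re_le_cm (z - u); have h2 := Im_le_cm (z - u).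
rewrite ReB in h1; rewrite ImB in h2.
rewrite (le_trans (cmD _ _)) // !cmM !cm_cis !cmR mulr1 mul1r.
apply: (@le_trans _ _ (cm (z - u) + 2 * cm (z - u))); last by lra.
apply: lerD; first exact: le_trans (expR_lip z0 u0) h1.
rewrite (@le_trans _ _ (1 * cm (cis (complex.Im z - complex.Im u) - 1))) //.
  by rewrite ler_wpM2r // cm_ge0.
by rewrite mul1r (le_trans (cm_cisB1_le _)) // ler_wpM2l.
Qed.

Let expR_second (a : R) : 0 <= a -> `|expR (- a) - 1 + a| <= a ^+ 2.
Proof.
move=> a0.
have := @derive_comparison R (fun x => expR (- x) - 1 + x) (fun x => 1 - expR (- x)) (fun x => x ^+ 2 / 2) (fun x => x) 0 a a0.
rewrite oppr0 expR0 subrr addr0 expr0n /= mul0r !subr0; move=> h; apply: le_trans (h _ _ _) _.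
- move=> x; apply: (is_derive_eq (isdD (isdB (isd_expR (isdN (isd_id x))) (isd_cst 1 x)) (isd_id x))).
  by ring.
- move=> x; rewrite (_ : (fun y => _) = (fun y : R => 2^-1 * (y * y))); last first.
    by apply/funext => y; rewrite expr2 mulrC.
  by apply: (is_derive_eq (isdZ _ (isdM (isd_id x) (isd_id x)))); lra.
- move=> x /andP[x0 _]; rewrite ger0_norm ?onem_expRN_le // subr_ge0; exact: expRN_le1.
- by have := sqr_ge0 a; lra.
Qed.

Lemma cm_sqr z : cm z ^+ 2 = complex.Re z ^+ 2 + complex.Im z ^+ 2.
Proof. by rewrite cmE sqr_sqrtr // addr_ge0 ?sqr_ge0. Qed.

(** With z = a + i b the remainder splits, up to sign, into e^(-a) (e^(-ib) - 1 + i b), e^(-a) - 1 +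
    a and i b (1 - e^(-a)), of sizes 2 b^2, a^2 and a |b|. *)
Lemma cexp_second z : 0 <= complex.Re z -> cm (1 - cexp (- z) - z) <= 4 * cm z ^+ 2.
Proof.
move=> a0; rewrite cm_sqr; set a := complex.Re z in a0 *; set b := complex.Im z.
have zE : z = a +i* b by exact: complex_ext.
clearbody a b; rewrite zE.
have -> : 1 - cexp (- (a +i* b)) - (a +i* b) =
    - ((expR (- a))%:C * (cis (- b) - (1 +i* - b)) + (expR (- a) - 1 + a)%:C +
       0 +i* (b * (1 - expR (- a)))).
  by rewrite /cexp; apply: complex_ext => /=; ring.
rewrite cmN (le_trans (cmD _ _)) // (@le_trans _ _ (2 * b ^+ 2 + a ^+ 2 + (a ^+ 2 + b ^+ 2))) //; last first.
  by have := sqr_ge0 a; have := sqr_ge0 b; lra.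
apply: lerD.
  apply: (le_trans (cmD _ _)); apply: lerD; last by rewrite cmR expR_second.
  rewrite cmM cmR ger0_norm ?expR_ge0 // -(sqrrN b) (@le_trans _ _ (1 * cm (cis (- b) - (1 +i* - b)))) //.
    by rewrite ler_wpM2r ?cm_ge0 ?expRN_le1.
  by rewrite mul1r cm_cis_sub1i.
rewrite cmE /= expr0n /= add0r sqrtr_sqr normrM (@le_trans _ _ (`|b| * a)) //.
  rewrite ler_wpM2l // ger0_norm ?onem_expRN_le // subr_ge0; exact: expRN_le1.
have := sqr_ge0 (a - `|b|); rewrite sqrrB -[b ^+ 2]real_normK ?num_real //.
have := mulr_ge0 a0 (normr_ge0 b); set x := `|b|; rewrite [x * a]mulrC; lra.
Qed.

End complex_exponential.

Section convergence_in_mean.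
Context d (T : measurableType d) (R : realType) (P : probability T R).

(** Through [|x| <= e + x^2 / e], with [e] fixed before [n] grows. *)
Lemma cvg_mean_of_cvg_mean_square (X : nat -> T -> R) :
  (forall n, measurable_fun setT (X n)) ->
  (forall n, P.-integrable setT (EFin \o (fun w => X n w ^+ 2))) ->
  (fun n => \int[P]_w X n w ^+ 2) @ \oo --> (0 : R) ->
  (forall n, P.-integrable setT (EFin \o (fun w => `|X n w|))) /\
  (fun n => \int[P]_w `|X n w|) @ \oo --> (0 : R).
Proof.
move=> mX IX X0.
have le e x : 0 < e -> `|x| <= e + e^-1 * x ^+ 2 :> R.
  move=> e0; have [xe|ex] := leP `|x| e; first by rewrite (le_trans xe) // lerDl mulr_ge0 ?sqr_ge0 ?invr_ge0 ?(ltW e0).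
  rewrite -[leLHS]add0r lerD ?(ltW e0) // ler_pdivlMl // -[x ^+ 2]real_normK ?num_real // expr2.
  by rewrite ler_wpM2r // ltW.
have I e n : 0 < e -> P.-integrable setT (EFin \o (fun w => e + e^-1 * X n w ^+ 2)).
  by move=> e0; apply: rintD => //; [apply: bmf_int; exact: bmf_cst|exact: rintZ].
have IX1 n : P.-integrable setT (EFin \o (fun w => `|X n w|)).
  apply: (rint_le measurableT _ _ (I 1 n ltr01)); first exact: measurableT_comp.
  by move=> w _; rewrite normr_id le.
split=> //; apply/cvgrPdist_lt => e e0.
have e2 : 0 < e / 2 by lra.
have ee : 0 < (e / 2) ^+ 2 by rewrite exprn_gt0.
apply: filterS (cvgr_lt _ X0 _ ee) => n h.
rewrite sub0r normrN ger0_norm; last by apply: Rintegral_ge0.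
apply: (@le_lt_trans _ _ (e / 2 + (e / 2)^-1 * \int[P]_w X n w ^+ 2)).
  rewrite -RintegralZl // -[X in X + _](Rintegral_cstT P) -RintegralD //; last 2 first.
    by apply: bmf_int; exact: bmf_cst.
    exact: rintZ.
  by apply: le_Rintegral => //; [exact: I|move=> w _; exact: le].
suff : (e / 2)^-1 * \int[P]_w X n w ^+ 2 < e / 2 by lra.
by rewrite ltr_pdivrMl // -expr2.
Qed.

(* Truncating at level [n] reduces to bounded variables, where independence gives the product. *)
Lemma integral_indep_prod (U V : T -> R) :
  measurable_fun setT U -> measurable_fun setT V ->
  (forall w, 0 <= U w) -> (forall w, 0 <= V w) ->
  (forall x y : R, fine (P ([set w | x < U w] `&` [set w | y < V w])) =
    fine (P [set w | x < U w]) * fine (P [set w | y < V w])) ->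
  P.-integrable setT (EFin \o U) -> P.-integrable setT (EFin \o V) ->
  fine (\int[P]_w (U w * V w)%:E) = (\int[P]_w U w) * (\int[P]_w V w).
Proof.
move=> mU mV U0 V0 indep IU IV.
pose mn n (X : T -> R) (w : T) : R := Num.min (X w) n.+1%:R.
have bm n (X : T -> R) : measurable_fun setT X -> (forall w, 0 <= X w) -> bmf (mn n X).
  move=> mX X0; split; first exact: measurable_minr.
  by exists n.+1%:R => w; rewrite /mn ger0_norm ?ge_min ?lexx ?orbT // le_min X0 ler0n.
have mn0 n (X : T -> R) w : 0 <= X w -> 0 <= mn n X w by move=> X0; rewrite /mn le_min X0 ler0n.
have mnX n (X : T -> R) w : mn n X w <= X w by rewrite /mn ge_min lexx.
have prodE n : \int[P]_w (mn n U w * mn n V w) = (\int[P]_w mn n U w) * (\int[P]_w mn n V w).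
  have mix0 x y : `|fine (P ([set w | x < U w] `&` [set w | y < V w])) -
    fine (P [set w | x < U w]) * fine (P [set w | y < V w])| <= 0 by rewrite indep subrr normr0.
  have := cov_min_le mU mV U0 V0 mix0 (ltr0Sn R n).
  by rewrite mulr0 normr_le0 subr_eq0 => /eqP.
have mn_cvg (X : T -> R) w : (fun n => mn n X w) @ \oo --> X w.
  apply: cvg_near_cst; near=> n; rewrite /mn min_l //.
  near: n; exists (Num.truncn (X w)) => // n /= nx.
  by rewrite ltW // (lt_le_trans (truncnS_gt _)) // ler_nat ltnS.
have lim1 (X : T -> R) : measurable_fun setT X -> (forall w, 0 <= X w) -> P.-integrable setT (EFin \o X) ->
    (fun n => \int[P]_w mn n X w) @ \oo --> \int[P]_w X w.
  move=> mX X0 IX; have [] // := @Rintegral_dct _ _ _ P _ measurableT (fun n => mn n X) X X.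
    by move=> n; case: (bm n X mX X0).
  by apply: nearW => n w _; rewrite ger0_norm ?mn0.
have limP := cvgM (lim1 U mU U0 IU) (lim1 V mV V0 IV).
pose g n w : \bar R := (mn n U w * mn n V w)%:E.
have mg n : measurable_fun setT (g n).
  by apply/measurable_EFinP; case: (bmfM (bm n U mU U0) (bm n V mV V0)).
have g0 n w : setT w -> (0 <= g n w)%E by move=> _; rewrite lee_fin mulr_ge0 ?mn0.
have gnd w : setT w -> {homo g^~ w : n m / (n <= m)%N >-> (n <= m)%E}.
  move=> _ n m nm; rewrite lee_fin ler_pM ?mn0 // /mn le_min !ge_min lexx /= ler_nat ltnS nm orbT //.
have glim w : limn (g^~ w) = (U w * V w)%:E.
  apply: cvg_lim => //; apply: cvg_EFin; first exact: nearW.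
  by apply: cvgM; exact: mn_cvg.
have := cvg_monotone_convergence measurableT mg g0 gnd.
rewrite (_ : (fun x => limn (g^~ x)) = (fun w => (U w * V w)%:E)); last exact/funext.
move=> h.
have gE n : (\int[P]_(x in setT) g n x)%E = ((\int[P]_w mn n U w) * (\int[P]_w mn n V w))%:E.
  rewrite -prodE /Rintegral fineK //; apply: integrable_fin_num => //.
  by apply: (bmf_int P (f := fun w => mn n U w * mn n V w)); exact: bmfM (bm n U mU U0) (bm n V mV V0).
have h2 : (fun n => (\int[P]_(x in setT) g n x)%E) @ \oo --> ((\int[P]_w U w) * (\int[P]_w V w))%:E.
  under eq_fun do rewrite gE.
  by apply: cvg_EFin; [exact: nearW|exact: limP].
by rewrite (cvg_unique (@ereal_hausdorff R) (h P) h2).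
Unshelve. all: by end_near.
Qed.

End convergence_in_mean.

Lemma cvgn_sum (R : realType) (I : Type) (r : seq I) (u : I -> nat -> R) (l : I -> R) :
  (forall i, u i @ \oo --> l i) ->
  (fun n => \sum_(i <- r) u i n) @ \oo --> \sum_(i <- r) l i.
Proof.
move=> ul; elim: r => [|i r IH].
  by rewrite big_nil; apply: (cvgn_ext _ (@cvg_cst _ 0 _ _ _)) => n; rewrite big_nil.
rewrite big_cons; apply: (cvgn_ext _ (cvgD (ul i) IH)) => n; by rewrite big_cons.
Qed.

(** * The stochastic volatility model *)

Section stochastic_volatility.
Context d (T : measurableType d) (R : realType) (P : probability T R).
Variables (s Z : int -> int -> T -> R) (p : nat) (alpha delta eps : R) (rate : nat -> R) (a : nat -> R).
Hypotheses (ms : forall i t, measurable_fun setT (s i t)) (mZ : forall i t, measurable_fun setT (Z i t)).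
Hypothesis s0 : forall i t w, 0 <= s i t w.
Hypothesis stat : strictly_stationary P s.
Hypothesis indep : iid_indep_of P Z s.
Hypotheses (alpha04 : 0 < alpha < 4) (alpha2 : alpha != 2).
Hypothesis RV : regularly_varying P (Z 0 0) alpha.
Hypothesis delta0 : 0 < delta.
Hypothesis mixing : strongly_mixing_rate P s p rate.
Hypothesis summable : cvg (series (fun h => rate h `^ (delta / (2 + delta))) @ \oo).
Hypothesis eps0 : 0 < eps.
Hypothesis moment : (\int[P]_w ((s 0 0 w) `^ (2 * Num.max (2 + delta) (alpha + eps)))%:E < +oo)%E.
Hypothesis na : (fun n => n%:R * fine (P [set w | a n < `|s 0 0 w * Z 0 0 w|])) @ \oo --> (1 : R).

Let mpre (X : T -> R) B : measurable_fun setT X -> measurable B -> measurable (X @^-1` B).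
Proof. by move=> mX mB; rewrite -[X in measurable X]setTI; exact: mX. Qed.

Let cyl_pm i t (B : set R) : measurable B -> path_measurable [set f : int -> int -> R | B (f i t)].
Proof. by move=> mB; apply: sub_sigma_algebra; exists i, t, B. Qed.

Let pmT : path_measurable (setT : set (int -> int -> R)).
Proof. exact: (@measurableT _ (g_sigma_algebraType (@cylinders R))). Qed.

Lemma s_law i t B : measurable B -> P (s i t @^-1` B) = P (s 0 0 @^-1` B).
Proof.
move=> mB; have := stat i t (cyl_pm 0 0 mB); rewrite /path => e.
transitivity (P ((fun w i' t' => s (i' + i) (t' + t) w) @^-1` [set f | B (f 0 0)])).
  by congr (P _); apply/seteqP; split => w /=; rewrite !add0r.
by rewrite -e.
Qed.

Lemma Z_law i t B : measurable B -> fine (P (Z i t @^-1` B)) = fine (P (Z 0 0 @^-1` B)).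
Proof.
move=> mB; have := @indep [:: (i, t)] (fun=> B) isT (fun=> mB) setT pmT.
rewrite big_seq1 preimage_setT setIT probability_setT mulr1 => <-.
congr (fine (P _)); apply/seteqP; split => w /=.
  by move=> h k; rewrite /= inE => /eqP ->.
by move=> /(_ (i, t)); apply; rewrite /= inE.
Qed.

(** The events decided by the whole volatility field, on which the innovations are conditioned. *)
Let S : set (set T) := [set E | exists2 A, path_measurable A & E = Defs.path s @^-1` A].

Let S_meas : S `<=` measurable.
Proof.
move=> _ [A pA ->].
(* The sets with measurable preimage form a sigma-algebra containing the cylinders, so [pA] may be
   instantiated at it. *)
pose G := [set A : set (int -> int -> R) | measurable (Defs.path s @^-1` A)].
suff : G A by [].
apply: (pA G); split; last first.
  by move=> _ [i [t [B [mB ->]]]]; exact: (mpre (ms i t) mB).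
split.
- by rewrite /G /= preimage_set0.
- move=> B GB; rewrite /G /= setTD preimage_setC; exact: measurableC.
- by move=> F GF; rewrite /G /= preimage_bigcup; apply: bigcup_measurable => k _; exact: GF.
Qed.

Let S_setI : setI_closed S.
Proof.
move=> _ _ [A pA ->] [B pB ->]; exists (A `&` B); last by rewrite preimage_setI.
exact: (@measurableI _ (g_sigma_algebraType (@cylinders R))).
Qed.

Let S_setT : S setT. Proof. by exists setT. Qed.

Let s_S i t : measurable_fun [set: g_sigma_algebraType S] (s i t : g_sigma_algebraType S -> R).
Proof.
move=> _ B mB; rewrite setTI; apply: sub_sigma_algebra.
by exists [set f | B (f i t)]; [exact: cyl_pm|].
Qed.

Let indepS (l : seq (int * int)) (B : int * int -> set R) E : uniq l ->
  (forall k, measurable (B k)) -> S E ->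
  fine (P ((\bigcap_(k in [set k | k \in l]) (Z k.1 k.2 @^-1` B k)) `&` E)) =
  (\prod_(k <- l) fine (P (Z k.1 k.2 @^-1` B k))) * fine (P E).
Proof.
move=> ul mB [A pA ->]; rewrite (indep ul mB pA); congr (_ * _).
by apply: eq_bigr => k _; rewrite Z_law.
Qed.

Let indep00 A B : measurable A -> measurable B ->
  fine (P (Z 0 0 @^-1` B `&` s 0 0 @^-1` A)) = fine (P (Z 0 0 @^-1` B)) * fine (P (s 0 0 @^-1` A)).
Proof.
move=> mA mB; have := @indep [:: (0, 0)] (fun=> B) isT (fun=> mB) _ (cyl_pm 0 0 mA).
rewrite big_seq1 => <-; congr (fine (P (_ `&` _))); apply/seteqP; split => w /=.
  by move=> h k; rewrite /= inE => /eqP ->.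
by move=> /(_ (0, 0)); apply; rewrite /= inE.
Qed.

(** The moment assumption has order [2 * top], and all orders from 0 to [2 * top] follow from it. *)
Let top := Num.max (2 + delta) (alpha + eps).
Let top2 : 2 + delta <= top. Proof. by rewrite le_max lexx. Qed.
Let topa : alpha + eps <= top. Proof. by rewrite le_max lexx orbT. Qed.

Let s_moment r : 0 <= r <= 2 * top -> P.-integrable setT (EFin \o (fun w => s 0 0 w `^ r)).
Proof.
move=> /andP[r0 r1].
have m0 : measurable_fun setT (fun w => s 0 0 w `^ (2 * top)) by exact: measurable_fun_powR.
have I0 : P.-integrable setT (EFin \o (fun w => s 0 0 w `^ (2 * top))).
  apply/integrableP; split; first exact/measurable_EFinP.
  have := moment; congr (_ < _)%E; apply: eq_integral => w _ /=.
  by rewrite ger0_norm // powR_ge0.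
apply: (rint_le measurableT (g := fun w => 1 + s 0 0 w `^ (2 * top))).
- exact: measurable_fun_powR.
- move=> w _; rewrite ger0_norm ?powR_ge0 //.
  have [s1|s1] := leP (s 0 0 w) 1.
    rewrite -[leLHS]addr0 lerD ?powR_ge0 // -[leRHS](powRr0 (s 0 0 w)).
    have [->|sn] := eqVneq (s 0 0 w) 0.
      have [->|rn] := eqVneq r 0; first exact: lexx.
      by rewrite powR0 // powR_ge0.
    by apply: ger_powR => //; rewrite lt_neqAle eq_sym sn s0.
  by rewrite -[leLHS]add0r lerD //; apply: ler_powR => //; exact: ltW.
- by apply: rintD => //; apply: bmf_int; exact: bmf_cst.
Qed.

Let s_moment_law (f : R -> R) i t : measurable_fun setT f ->
  P.-integrable setT (EFin \o (fun w => f (s 0 0 w))) ->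
  P.-integrable setT (EFin \o (fun w => f (s i t w))) /\
  \int[P]_w f (s i t w) = \int[P]_w f (s 0 0 w).
Proof.
move=> mf I0; have [] := same_law_integral (ms 0 0) (ms i t) (fun B mB => esym (s_law i t mB)) mf I0.
by move=> I1 ->.
Qed.

Let beta := alpha / 2.
Let b n := a n ^+ 2.

(* A Potter exponent small enough for all moment and index constraints. *)
Let exponent : exists e : R, [/\ 0 < e < beta, beta + e < 1 \/ (1 < beta - e /\ beta + e < 2),
  alpha + 2 * e <= 2 * top & (1 < beta -> 1 < beta - e)].
Proof.
case/andP: alpha04 => a0 a4; have e0 := eps0; have tp := topa; rewrite /beta.
have [ha|ha|ha] := ltgtP alpha 2; last by have := alpha2; rewrite ha eqxx.
- exists (Num.min (alpha / 2) (1 - alpha / 2) / 2).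
  by have [h|h] := leP (alpha / 2) (1 - alpha / 2); split; [lra|left; lra|lra|lra|lra|left; lra|lra|lra].
- exists (Num.min (alpha / 2 - 1) (2 - alpha / 2) / 2).
  by have [h|h] := leP (alpha / 2 - 1) (2 - alpha / 2); split; [lra|right; lra|lra|lra|lra|right; lra|lra|lra].
Qed.

Let pow_square (x r : R) : 0 <= x -> (x ^+ 2) `^ r = x `^ (2 * r).
Proof. by move=> x0; rewrite -powR_mulrn // -powRrM. Qed.

Let mix_fun (f : R -> R) i : measurable_fun setT f -> (1 <= i <= p)%N -> forall (t h : nat) (x y : R),
  `|fine (P ([set w | x < f (s i%:Z t.+1%:Z w)] `&` [set w | y < f (s i%:Z (t + h).+1%:Z w)])) -
    fine (P [set w | x < f (s i%:Z t.+1%:Z w)]) * fine (P [set w | y < f (s i%:Z (t + h).+1%:Z w)])| <= rate h.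
Proof.
move=> mf ip t h x y; have [_ mx] := mixing.
have mB z : measurable [set v : R | z < f v] by exact: gt_measurable.
apply: (mx t.+1) => //; apply: sub_sigma_algebra.
- by exists i%:Z, t.+1%:Z, [set v | x < f v]; rewrite !lez_nat ip /= lez_nat leqnn.
- exists i%:Z, (t + h).+1%:Z, [set v | y < f v]; rewrite !lez_nat ip; split => //.
  by split => //=; rewrite lez_nat addSn.
Qed.

Let gam := delta / (2 + delta).

Let rate_ge0 h : 0 <= rate h. Proof. by case: mixing. Qed.

Let rate_pow_cvg r : 0 < r -> (fun h => rate h `^ r) @ \oo --> (0 : R).
Proof.
move=> r0; have d0 := delta0; have g0 : 0 < gam by rewrite divr_gt0 // addr_gt0.
have c0 := cvg_series_cvg_0 summable.
apply/cvgrPdist_lt => e e0.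
have e1 : 0 < e `^ (gam / r) by rewrite powR_gt0.
apply: filterS ((cvgrPdist_lt _ _).1 c0 _ e1) => h.
rewrite !sub0r !normrN !ger0_norm ?powR_ge0 // -/gam => hh.
have -> : rate h `^ r = (rate h `^ gam) `^ (r / gam) by rewrite -powRrM mulrC divfK // gt_eqF.
have -> : e = (e `^ (gam / r)) `^ (r / gam).
  by rewrite -powRrM mulrA divfK ?gt_eqF // divff ?gt_eqF // powRr1 // ltW.
by rewrite gt0_ltr_powR ?nnegrE ?powR_ge0 // divr_gt0.
Qed.

(** The common pattern of the two laws of large numbers: [f] is a power of the volatility and [u]
    the normalization. The last condition quantifies over [C] so that the constant of the variance
    bound need not be named. *)
Let scaled_variance (f : R -> R) i q (u : nat -> R) : measurable_fun setT f ->
  (forall x, 0 <= x -> 0 <= f x) -> (1 <= i <= p)%N -> 2 < q ->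
  P.-integrable setT (EFin \o (fun w => f (s 0 0 w))) ->
  P.-integrable setT (EFin \o (fun w => f (s 0 0 w) `^ q)) ->
  (forall C : R, (fun n => u n ^+ 2 * (C * n%:R * \sum_(h < n) rate h `^ (1 - 2 / q))) @ \oo --> (0 : R)) ->
  (forall n, P.-integrable setT (EFin \o (fun w => `|u n * \sum_(t < n) (f (s i%:Z t.+1%:Z w) - \int[P]_w f (s 0 0 w))|))) /\
  (fun n => \int[P]_w `|u n * \sum_(t < n) (f (s i%:Z t.+1%:Z w) - \int[P]_w f (s 0 0 w))|) @ \oo --> (0 : R).
Proof.
move=> mf f0 ip q2 If Ifq uC.
have mV t : measurable_fun setT (fun w => f (s i%:Z t.+1%:Z w)) by exact: measurableT_comp.
have V0 t w : 0 <= f (s i%:Z t.+1%:Z w) by exact: f0.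
have same t B : measurable B ->
    P ((fun w => f (s i%:Z t.+1%:Z w)) @^-1` B) = P ((fun w => f (s i%:Z 1%:Z w)) @^-1` B).
  move=> mB; have mfB : measurable (f @^-1` B) by rewrite -[X in measurable X]setTI; exact: mf.
  by have := s_law i%:Z t.+1%:Z mfB; rewrite -(s_law i%:Z 1%:Z mfB).
have mfq : measurable_fun setT (fun x => f x `^ q) by exact: measurable_fun_powR.
have [IV1 EV1] := s_moment_law i%:Z 1%:Z mf If.
have [IVq EVq] := s_moment_law i%:Z 1%:Z mfq Ifq.
have var := mixing_variance mV V0 same rate_ge0 (mix_fun mf ip) q2 IVq.
rewrite EV1 in var; set mu := \int[P]_w f (s 0 0 w) in var *.
have sqE n w : (u n * \sum_(t < n) (f (s i%:Z t.+1%:Z w) - mu)) ^+ 2 =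
    u n ^+ 2 * (\sum_(t < n) (f (s i%:Z t.+1%:Z w) - mu)) ^+ 2 by rewrite exprMn.
have Isq n : P.-integrable setT (EFin \o (fun w => (u n * \sum_(t < n) (f (s i%:Z t.+1%:Z w) - mu)) ^+ 2)).
  rewrite (_ : (fun w => _) = (fun w => u n ^+ 2 * (\sum_(t < n) (f (s i%:Z t.+1%:Z w) - mu)) ^+ 2)).
    by apply: rintZ => //; exact: (var n).1.
  by apply/funext => w; exact: sqE.
apply: cvg_mean_of_cvg_mean_square => //.
  move=> n; apply: measurable_funM => //; apply: measurable_sum => t.
  by apply: measurable_funB.
set C := 2 * (1 + _) in var.
apply: (squeeze_cvgr _ (@cvg_cst _ 0 _ _ _) (uC C)).
apply: nearW => n; rewrite Rintegral_ge0 /=; last by move=> w _; exact: sqr_ge0.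
under eq_Rintegral do rewrite sqE.
rewrite RintegralZl; [|exact: measurableT|exact: (var n).1].
by apply: ler_wpM2l; [exact: sqr_ge0|exact: (var n).2].
Qed.

(** The order q = 2 (alpha + eps) / alpha exceeds 2, and the q-th moment of sigma^alpha is the
    moment of sigma of order 2 (alpha + eps). Normalized by n^2, the variance bound is a Cesaro mean
    of the terms rate^(1 - 2/q), which tend to 0. *)
Lemma lln_alpha i : (1 <= i <= p)%N ->
  (forall n, P.-integrable setT (EFin \o (fun w => `|n%:R^-1 * \sum_(t < n) (s i%:Z t.+1%:Z w `^ alpha - \int[P]_w s 0 0 w `^ alpha)|))) /\
  (fun n => \int[P]_w `|n%:R^-1 * \sum_(t < n) (s i%:Z t.+1%:Z w `^ alpha - \int[P]_w s 0 0 w `^ alpha)|)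
    @ \oo --> (0 : R).
Proof.
case/andP: alpha04 => a0 a4; have e0 := eps0; have tp := topa.
move=> ip; pose q := 2 * (alpha + eps) / alpha.
have q2 : 2 < q by rewrite /q ltr_pdivlMr // mulrDr ltrDl mulr_gt0.
have p0 : 0 < 1 - 2 / q by rewrite subr_gt0 ltr_pdivrMr ?mul1r //; lra.
apply: (@scaled_variance (fun x => x `^ alpha) i q (fun n => n%:R^-1)) => //.
- by move=> x _; exact: powR_ge0.
- by apply: s_moment; apply/andP; split; lra.
- rewrite (_ : (fun w => _) = (fun w => s 0 0 w `^ (2 * (alpha + eps)))).
    by apply: s_moment; apply/andP; split; lra.
  by apply/funext => w; rewrite -powRrM /q; congr (_ `^ _); field; rewrite gt_eqF.
- move=> C; have ces := cesaro (rate_pow_cvg p0).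
  rewrite -[X in _ --> X](mulr0 C) -cvg_shiftS.
  apply: (cvgn_ext _ (cvgM (@cvg_cst _ C _ _ _) ces)) => n.
  rewrite -[LHS]/(C * arithmetic_mean _ n) /arithmetic_mean /series /= big_mkord expr2.
  by field; rewrite addrC natr1 pnatr_eq0.
Qed.


(** With q = 2 + delta the exponent 1 - 2/q is delta / (2 + delta), so the powers of the rate are
    summable, the variance is O(n), and n / (b n)^2 tends to 0. *)
Lemma lln_square i : (1 <= i <= p)%N -> (fun n => n%:R / b n ^+ 2) @ \oo --> (0 : R) ->
  (forall n, P.-integrable setT (EFin \o (fun w => `|(b n)^-1 * \sum_(t < n) (s i%:Z t.+1%:Z w ^+ 2 - \int[P]_w s 0 0 w ^+ 2)|))) /\
  (fun n => \int[P]_w `|(b n)^-1 * \sum_(t < n) (s i%:Z t.+1%:Z w ^+ 2 - \int[P]_w s 0 0 w ^+ 2)|)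
    @ \oo --> (0 : R).
Proof.
have d0 := delta0; have tp := top2.
move=> ip nb; pose q := 2 + delta.
have q2 : 2 < q by rewrite /q; lra.
have pE : 1 - 2 / q = gam by rewrite /gam /q; field; rewrite gt_eqF // addr_gt0.
have I2 : P.-integrable setT (EFin \o (fun w => s 0 0 w ^+ 2)).
  have : P.-integrable setT (EFin \o (fun w => s 0 0 w `^ 2)) by apply: s_moment; apply/andP; split; lra.
  by congr (P.-integrable _ (EFin \o _)); apply/funext => w; rewrite powR_mulrn.
apply: (@scaled_variance (fun x => x ^+ 2) i q (fun n => (b n)^-1)) => //.
- by move=> x _; exact: sqr_ge0.
- rewrite (_ : (fun w => _) = (fun w => s 0 0 w `^ (2 * (2 + delta)))).
    by apply: s_moment; apply/andP; split; lra.
  by apply/funext => w; rewrite pow_square.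
- move=> C; rewrite pE.
  have h0 h : 0 <= rate h `^ gam by exact: powR_ge0.
  have nd : nondecreasing_seq (series (fun h => rate h `^ gam)) by exact: nondecreasing_series.
  have bound n : \sum_(h < n) rate h `^ gam <= limn (series (fun h => rate h `^ gam)).
    by have := nondecreasing_cvgn_le nd summable n; rewrite /series /= big_mkord.
  set L := limn _ in bound.
  have lim : (fun n => n%:R / b n ^+ 2 * `|C| * L) @ \oo --> (0 : R).
    rewrite -[X in _ --> X](mul0r L) -[X in _ --> X * L](mul0r `|C|).
    by apply: cvgM; [apply: cvgM => //; exact: cvg_cst|exact: cvg_cst].
  apply/norm_cvg0P; apply: (squeeze_cvgr _ (@cvg_cst _ 0 _ _ _) lim).
  apply: nearW => n; rewrite normr_ge0 /=.
  have S0 : 0 <= \sum_(h < n) rate h `^ gam by apply: sumr_ge0.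
  have q0 : 0 <= n%:R / b n ^+ 2 by rewrite divr_ge0 ?ler0n ?sqr_ge0.
  set Sn := \sum_(h < n) _ in S0 *.
  have -> : (b n)^-1 ^+ 2 * (C * n%:R * Sn) = (n%:R / b n ^+ 2 * Sn) * C by rewrite exprVn; ring.
  by rewrite normrM (ger0_norm (mulr_ge0 q0 S0)) mulrAC ler_wpM2l ?bound // mulr_ge0.
Qed.

Let W w := Z 0 0 w ^+ 2.
Let mW : measurable_fun setT W. Proof. exact: measurable_funX. Qed.
Let W0 w : 0 <= W w. Proof. exact: sqr_ge0. Qed.
Let mcen := centering P W beta.

Local Open Scope complex_scope.

Let chf_limit : exists kappa e c0 C : R,
  [/\ 0 < kappa, 0 < c0, 0 < C, 0 < e < beta & beta + e <= top] /\
  [/\ (forall v, (fun n => cm (n%:R%:C * (1 - scaled_chf P W beta b v n) - kappa%:C * stable_exponent beta c0 v)) @ \oo --> (0 : R)),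
      (\forall n \near \oo, forall v,
        cm (n%:R%:C * (1 - scaled_chf P W beta b v n)) <= C * (1 + growth beta e `|v| + v ^+ 2)),
      0 < \int[P]_w s 0 0 w `^ alpha,
      (1 < beta -> (fun n => n%:R / b n ^+ 2) @ \oo --> (0 : R)) &
      (1 < beta -> P.-integrable setT (EFin \o W))].
Proof.
have [e [ebeta brange ea e1]] := exponent.
have Ig : P.-integrable setT (EFin \o (fun w => growth (alpha / 2) e (s 0 0 w ^+ 2))).
  have bE : alpha / 2 = beta by [].
  case/andP: ebeta => e0 eb; have := alpha04 => /andP[a0 _]; have ap := topa; have ep := eps0.
  rewrite (_ : (fun w => _) = (fun w => s 0 0 w `^ (2 * (alpha / 2 + e)) + s 0 0 w `^ (2 * (alpha / 2 - e)))); last first.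
    by apply/funext => w; rewrite /growth !pow_square.
  by apply: rintD => //; apply: s_moment; rewrite bE /beta in eb *; apply/andP; split; lra.
have [kappa kappa0 [m0 [b_oo bH]]] := normalization (ms 0 0) (mZ 0 0) (s0 0 0) indep00 RV na ebeta Ig.
have Hpos := square_tail_gt0 (mZ 0 0) RV.
have HRV := square_tail_RV (mZ 0 0) RV.
have [c0 c00 [lim [C C0 dom]]] := scaled_chf_expansion mW W0 Hpos HRV b_oo bH kappa0 ebeta brange.
exists kappa, e, c0, C; split.
  by case/andP: ebeta => e0 eb; split => //; first exact/andP; rewrite /beta; lra.
split; [exact: lim|exact: dom| | |].
- move: m0; congr (_ < _); apply: eq_Rintegral => w _; rewrite pow_square //.
  by congr (_ `^ _); field.
- by move=> /e1 h; exact: (index_lt2_ratio mW Hpos HRV b_oo bH kappa0 ebeta brange h).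
- by move=> /e1 h; exact: (centering_integrable mW W0 Hpos HRV b_oo bH kappa0 ebeta brange h).
Qed.

(** Space-time points with both coordinates starting at 1, whereas ordinals and the range of [t]
    start at 0. *)
Let idx n : seq (int * int) :=
  [seq ((nat_of_ord i).+1%:Z, t.+1%:Z) | i <- index_enum 'I_p, t <- index_iota 0 n].

Let idx_uniq n : uniq (idx n).
Proof.
apply: allpairs_uniq; [exact: index_enum_uniq|exact: iota_uniq|].
by move=> [i t] [j u] _ _ /= [] /val_inj -> ->.
Qed.

Let idx_big (V : Type) (x : V) (op : Monoid.law x) n (F : int * int -> V) :
  \big[op/x]_(k <- idx n) F k = \big[op/x]_(i < p) \big[op/x]_(t < n) F ((nat_of_ord i).+1%:Z, t.+1%:Z).
Proof.
rewrite /idx big_allpairs_dep; apply: eq_bigr => i _.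
by rewrite big_mkord.
Qed.

(** * Convergence of the joint characteristic function *)

Section fixed_argument.
Variables (kappa e c0 C : R).
Hypotheses (kappa0 : 0 < kappa) (c00 : 0 < c0) (C0 : 0 < C) (be0 : 0 < e < beta) (be1 : beta + e <= top).
Let q v n := scaled_chf P W beta b v n.
Let K v := kappa%:C * stable_exponent beta c0 v.
Hypothesis lim : forall v, (fun n => cm (n%:R%:C * (1 - q v n) - K v)) @ \oo --> (0 : R).
Hypothesis dom : \forall n \near \oo, forall v, cm (n%:R%:C * (1 - q v n)) <= C * (1 + growth beta e `|v| + v ^+ 2).

Let beta0 : 0 < beta. Proof. by rewrite /beta divr_gt0 //; case/andP: alpha04. Qed.

Let Re_K v : 0 <= complex.Re (K v).
Proof. by rewrite /K ReM /= mul0r subr0 !mulr_ge0 ?powR_ge0 ?(ltW kappa0) ?(ltW c00). Qed.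

(** The exponent is homogeneous of degree beta, so a factor sigma^2 in the argument comes out as
    sigma^alpha; this is how the averages of sigma^alpha arise. *)
Let K_homog v x : 0 <= x -> K (v * x ^+ 2) = (x `^ alpha)%:C * K v.
Proof.
move=> x0; have bE : 2 * beta = alpha by rewrite /beta; field.
have e1 : `|v * x ^+ 2| `^ beta = x `^ alpha * `|v| `^ beta.
  by rewrite normrM (ger0_norm (sqr_ge0 x)) powRM ?normr_ge0 ?sqr_ge0 // pow_square // bE mulrC.
have e2 : Num.sg (v * x ^+ 2) * (x `^ alpha) = Num.sg v * (x `^ alpha).
  have [->|xn] := eqVneq x 0; last by rewrite sgrM (@gtr0_sg _ (x ^+ 2)) ?mulr1 // exprn_gt0 // lt_neqAle eq_sym xn.
  by rewrite powR0 ?mulr0 // gt_eqF //; case/andP: alpha04.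
apply: complex_ext; rewrite /K /stable_exponent /= e1; first by ring.
by rewrite [Num.sg _ * (_ * _)]mulrA e2; ring.
Qed.

Let mq v n : measurable_fun setT (fun x : R => complex.Re (q (v * x ^+ 2) n)) /\
  measurable_fun setT (fun x : R => complex.Im (q (v * x ^+ 2) n)).
Proof.
have m (x : R) (w : T) : measurable_fun [set: R * T] (fun r => v * r.1 ^+ 2 / b n * W r.2 - v * r.1 ^+ 2 / b n * centering P W beta).
  have m1 : measurable_fun [set: R * T] (fun r => v * r.1 ^+ 2 / b n).
    apply: measurable_funM => //; apply: measurable_funM => //; apply: measurable_funX.
    exact: measurable_fst.
  apply: measurable_funB; apply: measurable_funM => //.
  exact: (measurableT_comp mW measurable_snd).
split.
- have h : measurable_fun setT (fun x : R => \int[P]_w cos (v * x ^+ 2 / b n * W w - v * x ^+ 2 / b n * centering P W beta)).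
    apply: measurable_Rintegral_param; first by case: (bmf_cos (m 0 point)).
    by exists 1 => x w; rewrite ler_norml cos_geN1 cos_le1.
  exact: h.
- have h : measurable_fun setT (fun x : R => \int[P]_w sin (v * x ^+ 2 / b n * W w - v * x ^+ 2 / b n * centering P W beta)).
    apply: measurable_Rintegral_param; first by case: (bmf_sin (m 0 point)).
    by exists 1 => x w; rewrite ler_norml sin_geN1 sin_le1.
  exact: h.
Qed.

Let cm_q v n : cm (q v n) <= 1.
Proof.
apply: cm_cE_le1; last by move=> w; rewrite cm_cis.
by apply: cbmf_cis; apply: measurable_funB => //; exact: measurable_funM.
Qed.

Let q_bmf v n i t : cbmf (fun w => q (v * s i t w ^+ 2) n).
Proof.
have [m1 m2] := mq v n; split; split.
- exact: measurableT_comp m1 (ms i t).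
- by exists 1 => w; rewrite (le_trans (Re_le_cm _)).
- exact: measurableT_comp m2 (ms i t).
- by exists 1 => w; rewrite (le_trans (Im_le_cm _)).
Qed.

(** The proxy for the conditional factor [q (v * x ^+ 2) n]; products over time become exponentials
    of empirical means of sigma^alpha. *)
Let ex v n (x : R) : R[i] := cexp (- ((n%:R^-1 * x `^ alpha)%:C * K v)).

Let Re_ex v n x : complex.Re (- ((n%:R^-1 * x `^ alpha)%:C * K v)) <= 0.
Proof.
rewrite (_ : complex.Re _ = - (n%:R^-1 * x `^ alpha * complex.Re (K v))); last first.
  by case: (K v) => y z /=; ring.
by rewrite oppr_le0 !mulr_ge0 ?invr_ge0 ?ler0n ?powR_ge0.
Qed.

Let cm_ex v n x : cm (ex v n x) <= 1. Proof. exact: cm_cexp_le1. Qed.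

Let mex v n : measurable_fun setT (fun x => complex.Re (ex v n x)) /\
  measurable_fun setT (fun x => complex.Im (ex v n x)).
Proof.
have m1 (r : R) : measurable_fun setT (fun x : R => n%:R^-1 * x `^ alpha * r).
  by apply: measurable_funM => //; apply: measurable_funM => //; exact: measurable_powR.
have e1 x : complex.Re (- ((n%:R^-1 * x `^ alpha)%:C * K v)) = n%:R^-1 * x `^ alpha * - complex.Re (K v).
  by case: (K v) => y z /=; ring.
have e2 x : complex.Im (- ((n%:R^-1 * x `^ alpha)%:C * K v)) = n%:R^-1 * x `^ alpha * - complex.Im (K v).
  by case: (K v) => y z /=; ring.
have m2 : measurable_fun setT (fun x : R => expR (n%:R^-1 * x `^ alpha * - complex.Re (K v))).
  exact: (measurableT_comp (@measurable_expR R)).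
split.
- rewrite (_ : (fun x => _) = (fun x => expR (n%:R^-1 * x `^ alpha * - complex.Re (K v)) * cos (n%:R^-1 * x `^ alpha * - complex.Im (K v)))).
    by apply: measurable_funM => //; case: (bmf_cos (m1 (- complex.Im (K v)))).
  by apply/funext => x; rewrite /ex Re_cexp e1 e2.
- rewrite (_ : (fun x => _) = (fun x => expR (n%:R^-1 * x `^ alpha * - complex.Re (K v)) * sin (n%:R^-1 * x `^ alpha * - complex.Im (K v)))).
    by apply: measurable_funM => //; case: (bmf_sin (m1 (- complex.Im (K v)))).
  by apply/funext => x; rewrite /ex Im_cexp e1 e2.
Qed.

Let ex_bmf v n i t : cbmf (fun w => ex v n (s i t w)).
Proof.
have [m1 m2] := mex v n; split; split.
- exact: measurableT_comp m1 (ms i t).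
- by exists 1 => w; rewrite (le_trans (Re_le_cm _)).
- exact: measurableT_comp m2 (ms i t).
- by exists 1 => w; rewrite (le_trans (Im_le_cm _)).
Qed.

(** Comparable with the modulus of the difference, but made of absolute values of measurable
    components. *)
Let gap v n (x : R) : R := `|complex.Re (q (v * x ^+ 2) n - ex v n x)| + `|complex.Im (q (v * x ^+ 2) n - ex v n x)|.

Let mgap v n : measurable_fun setT (gap v n).
Proof.
have [m1 m2] := mq v n; have [m3 m4] := mex v n.
rewrite (_ : gap v n = (fun x => `|complex.Re (q (v * x ^+ 2) n) - complex.Re (ex v n x)| +
   `|complex.Im (q (v * x ^+ 2) n) - complex.Im (ex v n x)|)); last first.
  by apply/funext => x; rewrite /gap ReB ImB.
by apply: measurable_funD; apply: measurableT_comp => //; exact: measurable_funB.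
Qed.

Let gap_cm v n x : cm (q (v * x ^+ 2) n - ex v n x) <= gap v n x <= 2 * cm (q (v * x ^+ 2) n - ex v n x).
Proof. by rewrite cm_le mulr_natl mulr2n lerD ?Re_le_cm ?Im_le_cm. Qed.

(** The first estimate tends to 0 for fixed [x], its last term being the second-order remainder of
    the exponential; the second provides the majorant for dominated convergence. *)
Let gap_le v n x : 0 <= x -> (0 < n)%N -> n%:R * gap v n x <=
  2 * (cm (n%:R%:C * (1 - q (v * x ^+ 2) n) - K (v * x ^+ 2)) + n%:R^-1 * (4 * cm (K (v * x ^+ 2)) ^+ 2)) /\
  n%:R * gap v n x <= 2 * (cm (n%:R%:C * (1 - q (v * x ^+ 2) n)) + 3 * (x `^ alpha * cm (K v))).
Proof.
move=> x0 n0; have /andP[_ g2] := gap_cm v n x.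
have nn : n%:R != 0 :> R by rewrite pnatr_eq0 -lt0n.
pose u := (n%:R^-1 * x `^ alpha)%:C * K v.
have uE : n%:R%:C * u = K (v * x ^+ 2) by rewrite K_homog // /u mulrA -real_complexM mulVKf.
have cmn : cm (n%:R%:C : R[i]) = n%:R by rewrite cmR ger0_norm ?ler0n.
have exE : ex v n x = cexp (- u) by [].
have Ru : 0 <= complex.Re u by have := Re_ex v n x; rewrite -/u; case: (u) => y z /=; rewrite oppr_le0.
have cu : n%:R * cm u = cm (K (v * x ^+ 2)) by rewrite -uE cmM cmn.
have gn : n%:R * gap v n x <= 2 * cm (n%:R%:C * (q (v * x ^+ 2) n - ex v n x)).
  by rewrite cmM cmn mulrCA ler_wpM2l ?ler0n.
split; apply: (le_trans gn); apply: ler_wpM2l => //.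
- rewrite (_ : n%:R%:C * _ = n%:R%:C * (1 - cexp (- u) - u) - (n%:R%:C * (1 - q (v * x ^+ 2) n) - K (v * x ^+ 2))); last first.
    by rewrite -uE exE; ring.
  rewrite (le_trans (cmB _ _)) // addrC lerD2l cmM cmn.
  rewrite (le_trans (ler_wpM2l (ler0n _ n) (cexp_second Ru))) // -cu.
  by rewrite le_eqVlt; apply/orP; left; apply/eqP; field.
- rewrite (_ : n%:R%:C * _ = n%:R%:C * (cexp 0 - cexp (- u)) - n%:R%:C * (1 - q (v * x ^+ 2) n)); last first.
    by rewrite cexp0 exE; ring.
  rewrite (le_trans (cmB _ _)) // addrC lerD2l cmM cmn.
  have h : cm (cexp 0 - cexp (- u)) <= 3 * cm (0 - - u).
    by apply: cexp_lip => //; exact: Re_ex.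
  rewrite (le_trans (ler_wpM2l (ler0n _ n) h)) // opprK add0r mulrCA cu K_homog // cmM cmR ger0_norm ?powR_ge0 //.
Qed.

(** Dominated convergence under the law of the volatility. The majorant involves sigma to the powers
    2 (beta + e), 2 (beta - e), 4 and alpha, all of order at most [2 * top]. *)
Let gap_mean v : (forall n, P.-integrable setT (EFin \o (fun w => gap v n (s 0 0 w)))) /\
  (fun n => n%:R * \int[P]_w gap v n (s 0 0 w)) @ \oo --> (0 : R).
Proof.
have a04 := alpha04; have t2 := top2; have ta := topa; have ep := eps0; have d0 := delta0.
have b1' := be1; have bb := beta0; have C0' := ltW C0; case/andP: be0 => e0 eb.
have Igap n : P.-integrable setT (EFin \o (fun w => gap v n (s 0 0 w))).
  apply: bmf_int; split; first exact: measurableT_comp (mgap v n) (ms 0 0).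
  exists 4 => w; have /andP[_] := gap_cm v n (s 0 0 w).
  rewrite ger0_norm ?addr_ge0 // => /le_trans; apply.
  rewrite (_ : 4 = 2 * (1 + 1)); last by ring.
  by rewrite ler_wpM2l // (le_trans (cmB _ _)) // lerD ?cm_q ?cm_ex.
split => //.
pose G (x : R) := 2 * (C * (1 + growth beta e (`|v| * x ^+ 2) + (v * x ^+ 2) ^+ 2) + 3 * (x `^ alpha * cm (K v))).
have IG : P.-integrable setT (EFin \o (fun w => G (s 0 0 w))).
{
  have gE w : growth beta e (`|v| * s 0 0 w ^+ 2) = `|v| `^ (beta + e) * s 0 0 w `^ (2 * (beta + e)) +
      `|v| `^ (beta - e) * s 0 0 w `^ (2 * (beta - e)).
    have pm r : (`|v| * s 0 0 w ^+ 2) `^ r = `|v| `^ r * s 0 0 w `^ (2 * r).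
      by rewrite powRM ?sqr_ge0 // pow_square.
    by rewrite /growth !pm.
  have sE w : (v * s 0 0 w ^+ 2) ^+ 2 = v ^+ 2 * s 0 0 w `^ 4.
    by rewrite exprMn powR_mulrn // -exprM.
  rewrite (_ : (fun w => _) = (fun w => 2 * (C * (1 + (`|v| `^ (beta + e) * s 0 0 w `^ (2 * (beta + e)) +
      `|v| `^ (beta - e) * s 0 0 w `^ (2 * (beta - e))) + v ^+ 2 * s 0 0 w `^ 4) + (3 * cm (K v)) * s 0 0 w `^ alpha))); last first.
    by apply/funext => w; rewrite /G gE sE; ring.
  have I1 : P.-integrable setT (EFin \o (fun _ : T => 1)) by apply: bmf_int; exact: bmf_cst.
  have mo r : 0 <= r <= 2 * top -> P.-integrable setT (EFin \o (fun w => s 0 0 w `^ r)) by exact: s_moment.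
  have r1 : 0 <= 2 * (beta + e) <= 2 * top by apply/andP; split; lra.
  have r2 : 0 <= 2 * (beta - e) <= 2 * top by apply/andP; split; lra.
  have r3 : (0 : R) <= 4 <= 2 * top by rewrite ler0n /=; lra.
  have r4 : 0 <= alpha <= 2 * top by apply/andP; split; lra.
  apply: rintZ => //; apply: rintD => //; last by apply: rintZ => //; exact: mo.
  apply: rintZ => //; apply: rintD => //; last by apply: rintZ => //; exact: mo.
  by apply: rintD => //; apply: rintD => //; apply: rintZ => //; exact: mo.
}
have [] := @Rintegral_dct _ _ _ P _ measurableT (fun n w => n%:R * gap v n (s 0 0 w)) (fun=> 0) (fun w => G (s 0 0 w)).
- by move=> n; apply: measurable_funM => //; exact: measurableT_comp (mgap v n) (ms 0 0).
- exact: measurable_cst.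
- move=> w _; set x := s 0 0 w.
  have l2 : (fun n => 2 * (cm (n%:R%:C * (1 - q (v * x ^+ 2) n) - K (v * x ^+ 2)) + n%:R^-1 * (4 * cm (K (v * x ^+ 2)) ^+ 2))) @ \oo --> (0 : R).
    have -> : 0 = 2 * (0 + 0 * (4 * cm (K (v * x ^+ 2)) ^+ 2)) :> R by rewrite mul0r addr0 mulr0.
    apply: cvgM; first exact: cvg_cst.
    apply: cvgD; first exact: lim.
    apply: cvgM; last exact: cvg_cst.
    by rewrite -cvg_shiftS; exact: cvg_harmonic.
  apply: (squeeze_cvgr _ (@cvg_cst _ 0 _ _ _) l2); exists 1%N => // n /= n0.
  have [h _] := gap_le v (s0 0 0 w) n0.
  by rewrite h mulr_ge0 ?ler0n // addr_ge0.
- exact: IG.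
- have [N _ hN] := dom; exists N.+1 => // n /= Nn w _.
  have n0 : (0 < n)%N by exact: leq_trans Nn.
  have [_ h] := gap_le v (s0 0 0 w) n0.
  rewrite ger0_norm; last by rewrite mulr_ge0 ?ler0n // addr_ge0.
  apply: (le_trans h); apply: ler_wpM2l => //; apply: lerD => //.
  apply: (le_trans (hN n (ltnW Nn) _)).
  by rewrite normrM (ger0_norm (sqr_ge0 _)).
- move=> _; rewrite Rintegral_cstT; apply: cvgn_ext => n.
  by rewrite RintegralZl.
Qed.

(** Telescoping over the p n factors; by stationarity each row contributes [n] times a single mean
    gap. *)
Let product_gap (th : int -> R) :
  (fun n => cm (cE P (fun w => \prod_(k <- idx n) q (th k.1 * s k.1 k.2 w ^+ 2) n) -
                cE P (fun w => \prod_(k <- idx n) ex (th k.1) n (s k.1 k.2 w)))) @ \oo --> (0 : R).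
Proof.
have L : (fun n => 2 * \sum_(i < p) n%:R * \int[P]_w gap (th (nat_of_ord i).+1%:Z) n (s 0 0 w)) @ \oo --> (0 : R).
  rewrite -[X in _ --> X](mulr0 2); apply: cvgM; first exact: cvg_cst.
  rewrite -[X in _ --> X](@big1_eq _ 0 +%R 'I_p (index_enum 'I_p) xpredT).
  by apply: cvgn_sum => i; have [] := gap_mean (th (nat_of_ord i).+1%:Z).
apply: (squeeze_cvgr _ (@cvg_cst _ 0 _ _ _) L); apply: nearW => n; rewrite cm_ge0 /=.
have mg v : measurable_fun setT (gap v n) by exact: mgap.
have law v i t := s_moment_law i t (mg v) ((gap_mean v).1 n).
have Is : P.-integrable setT (EFin \o (fun w => \sum_(k <- idx n) gap (th k.1) n (s k.1 k.2 w))).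
  by apply: rint_sum => // k; exact: (law _ _ _).1.
apply: (@le_trans _ _ (2 * \int[P]_w \sum_(k <- idx n) gap (th k.1) n (s k.1 k.2 w))).
{ apply: cm_cE_dist => //.
  - by apply: cbmf_prod => k; exact: q_bmf.
  - by apply: cbmf_prod => k; exact: ex_bmf.
  - move=> w; apply: (le_trans (cm_prodB _ _ _)) => [k|k|].
    + exact: cm_q.
    + exact: cm_ex.
    + by apply: ler_sum => k _; have /andP[] := gap_cm (th k.1) n (s k.1 k.2 w). }
rewrite ler_wpM2l // Rintegral_sum //; last by move=> k; exact: (law _ _ _).1.
rewrite idx_big; apply: ler_sum => i _.
rewrite (eq_bigr (fun=> \int[P]_w gap (th (nat_of_ord i).+1%:Z) n (s 0 0 w))); last first.
  by move=> t _; exact: (law _ _ _).2.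
by rewrite sumr_const card_ord -[_ *+ n]mulr_natl.
Qed.

Let salpha := \int[P]_w s 0 0 w `^ alpha.
Hypothesis sa0 : 0 < salpha.

Let sum_exponent (th : int -> R) n w : (0 < n)%N ->
  \prod_(k <- idx n) ex (th k.1) n (s k.1 k.2 w) =
  cexp (\sum_(i < p) - ((n%:R^-1 * \sum_(t < n) s (nat_of_ord i).+1%:Z t.+1%:Z w `^ alpha)%:C * K (th (nat_of_ord i).+1%:Z))).
Proof.
move=> n0; rewrite /ex -cexp_sum idx_big; congr cexp; apply: eq_bigr => i _ /=.
have RCD (I : Type) (r : seq I) (f : I -> R) : (\sum_(j <- r) f j)%:C = \sum_(j <- r) (f j)%:C.
  by elim: r => [|j r IH]; rewrite ?big_nil ?big_cons -?IH; apply: complex_ext => //=; rewrite addr0.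
by rewrite mulr_sumr RCD sumrN -mulr_suml.
Qed.

(** The exponents stay in the left half-plane, where the exponential is Lipschitz, so mean
    convergence of the averages of sigma^alpha passes to the exponentials. *)
Let exponential_limit (th : int -> R) :
  (fun n => cm (cE P (fun w => \prod_(k <- idx n) ex (th k.1) n (s k.1 k.2 w)) -
                \prod_(i < p) cexp (- (salpha%:C * K (th (nat_of_ord i).+1%:Z))))) @ \oo --> (0 : R).
Proof.
pose X (i : 'I_p) n w := n%:R^-1 * \sum_(t < n) (s (nat_of_ord i).+1%:Z t.+1%:Z w `^ alpha - salpha).
have ip (i : 'I_p) : (1 <= (nat_of_ord i).+1 <= p)%N by rewrite ltn_ord.
have lln i := lln_alpha (ip i).
have L : (fun n => 2 * \sum_(i < p) (3 * cm (K (th (nat_of_ord i).+1%:Z))) * \int[P]_w `|X i n w|) @ \oo --> (0 : R).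
  rewrite -[X in _ --> X](mulr0 2); apply: cvgM; first exact: cvg_cst.
  rewrite -[X in _ --> X](@big1_eq _ 0 +%R 'I_p (index_enum 'I_p) xpredT).
  apply: cvgn_sum => i; rewrite -[X in _ --> X](mulr0 (3 * cm (K (th (nat_of_ord i).+1%:Z)))).
  by apply: cvgM; [exact: cvg_cst|exact: (lln i).2].
apply: (squeeze_cvgr _ (@cvg_cst _ 0 _ _ _) L); exists 1%N => // n /= n0; rewrite cm_ge0 /=.
have nn : n%:R != 0 :> R by rewrite pnatr_eq0 -lt0n.
rewrite -cexp_sum -[X in cm (_ - X)](cE_cst P).
have Is : P.-integrable setT (EFin \o (fun w => \sum_(i < p) (3 * cm (K (th (nat_of_ord i).+1%:Z))) * `|X i n w|)).
  by apply: rint_sum => // i; apply: rintZ => //; exact: (lln i).1.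
apply: (@le_trans _ _ (2 * \int[P]_w \sum_(i < p) (3 * cm (K (th (nat_of_ord i).+1%:Z))) * `|X i n w|)); last first.
  rewrite ler_wpM2l // Rintegral_sum //; last by move=> i; apply: rintZ => //; exact: (lln i).1.
  by apply: ler_sum => i _; rewrite RintegralZl //; exact: (lln i).1.
apply: cm_cE_dist => //.
- by apply: cbmf_prod => k; exact: ex_bmf.
- exact: cbmf_cst.
- move=> w; rewrite sum_exponent //.
  have ReS (r : 'I_p -> R) : (forall i, 0 <= r i) ->
      complex.Re (\sum_(i < p) - ((r i)%:C * K (th (nat_of_ord i).+1%:Z))) <= 0.
    move=> r0; elim/big_ind: _ => [|x y hx hy|i _]; first exact: lexx.
      by move: x y hx hy => [x1 x2] [y1 y2] /=; lra.
    move: (Re_K (th (nat_of_ord i).+1%:Z)); move: (K (th (nat_of_ord i).+1%:Z)) => [y1 y2] /= y0.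
    by rewrite mul0r subr0 oppr_le0 mulr_ge0.
  have R1 := ReS (fun i => n%:R^-1 * \sum_(t < n) s (nat_of_ord i).+1%:Z t.+1%:Z w `^ alpha)
    (fun i => mulr_ge0 (etrans (invr_ge0 _) (ler0n _ n)) (sumr_ge0 _ (fun t _ => powR_ge0 _ _))).
  have R2 := ReS (fun=> salpha) (fun=> ltW sa0).
  apply: (le_trans (cexp_lip R1 R2)).
  rewrite -sumrB; apply: (le_trans (ler_wpM2l _ (cm_sum _ _))) => //.
  rewrite mulr_sumr; apply: ler_sum => i _.
  rewrite (_ : _ - _ = - ((X i n w)%:C * K (th (nat_of_ord i).+1%:Z))); last first.
    have -> : X i n w = n%:R^-1 * (\sum_(t < n) s (nat_of_ord i).+1%:Z t.+1%:Z w `^ alpha) - salpha.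
      by rewrite /X sumrB sumr_const card_ord mulrBr -[salpha *+ n]mulr_natl mulKf.
    have -> (x y : R) : (x - y)%:C = x%:C - y%:C by apply: complex_ext => //=; rewrite subr0.
    by ring.
  by rewrite cmN cmM cmR le_eqVlt; apply/orP; left; apply/eqP; ring.
Qed.

Hypothesis nb2 : 1 < beta -> (fun n => n%:R / b n ^+ 2) @ \oo --> (0 : R).
Hypothesis IW : 1 < beta -> P.-integrable setT (EFin \o W).

Let Y n (i : int) w := (b n)^-1 * (\sum_(1 <= t < n.+1) (s i t%:Z w * Z i t%:Z w) ^+ 2 -
  (if alpha < 2 then 0 else n%:R * fine (\int[P]_w ((s 0 0 w * Z 0 0 w) ^+ 2)%:E))).

(** The contribution of one observation, centred by its conditional mean given the volatility. *)
Let es (th : int -> R) n (k : int * int) w z :=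
  th k.1 * s k.1 k.2 w ^+ 2 / b n * z ^+ 2 - th k.1 * s k.1 k.2 w ^+ 2 / b n * mcen.

Let ms2 : measurable_fun setT (fun w => s 0 0 w ^+ 2).
Proof. exact: measurable_funX. Qed.

Let s_square : P.-integrable setT (EFin \o (fun w => s 0 0 w ^+ 2)).
Proof.
have t2 := top2; have d0 := delta0.
have : P.-integrable setT (EFin \o (fun w => s 0 0 w `^ 2)) by apply: s_moment; apply/andP; split; lra.
by congr (P.-integrable _ (EFin \o _)); apply/funext => w; rewrite powR_mulrn.
Qed.

(** By independence E X^2 = E sigma^2 E Z^2, so exchanging conditional for unconditional centring
    leaves a sum of centred sigma^2. *)
Let es_sum (th : int -> R) n w :
  \sum_(k <- idx n) es th n k w (Z k.1 k.2 w) + \sum_(i < p) th (nat_of_ord i).+1%:Z * mcen *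
    ((b n)^-1 * \sum_(t < n) (s (nat_of_ord i).+1%:Z t.+1%:Z w ^+ 2 - \int[P]_w s 0 0 w ^+ 2)) =
  \sum_(i < p) th (nat_of_ord i).+1%:Z * Y n (nat_of_ord i).+1%:Z w.
Proof.
have cE : (if alpha < 2 then 0 else n%:R * fine (\int[P]_w ((s 0 0 w * Z 0 0 w) ^+ 2)%:E)) =
    n%:R * (\int[P]_w s 0 0 w ^+ 2 * mcen).
{
  rewrite /mcen /centering /beta; have [a2|a2] := ltP alpha 2.
    by rewrite ifT ?mulr0 //; lra.
  have b1 : 1 < beta.
    have : 2 < alpha by rewrite lt_neqAle eq_sym a2 andbT; exact: alpha2.
    by rewrite /beta; lra.
  rewrite ifF; last by apply/negbTE; rewrite -leNgt; lra.
  congr (_ * _); rewrite -(integral_indep_prod ms2 mW _ _ _ _ (IW b1)) //.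
  - by congr fine; apply: eq_integral => w' _; rewrite exprMn.
  - by move=> w'; exact: sqr_ge0.
  - move=> x y; rewrite setIC [RHS]mulrC.
    apply: (@indep00 [set u : R | x < u ^+ 2] [set u : R | y < u ^+ 2]); apply: gt_measurable;
      by apply: measurable_funX; exact: measurable_id.
}
rewrite idx_big -big_split /=; apply: eq_bigr => i _; rewrite /Y cE big_add1 big_mkord /es /=.
set x := th _; set E2 := \int[P]_w' s 0 0 w' ^+ 2.
pose Si t := s (nat_of_ord i).+1%:Z t.+1%:Z w; pose Zi t := Z (nat_of_ord i).+1%:Z t.+1%:Z w.
have -> : \sum_(t < n) (x * Si t ^+ 2 / b n * Zi t ^+ 2 - x * Si t ^+ 2 / b n * mcen) =
    x / b n * \sum_(t < n) (Si t * Zi t) ^+ 2 - x / b n * mcen * \sum_(t < n) Si t ^+ 2.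
  by rewrite !mulr_sumr -sumrB; apply: eq_bigr => t _; ring.
have -> : \sum_(t < n) (Si t ^+ 2 - E2) = \sum_(t < n) Si t ^+ 2 - n%:R * E2.
  by rewrite sumrB sumr_const card_ord -[_ *+ n]mulr_natl.
by ring.
Qed.

Let conditioned (th : int -> R) n :
  cE P (fun w => cis (\sum_(k <- idx n) es th n k w (Z k.1 k.2 w))) =
  cE P (fun w => \prod_(k <- idx n) q (th k.1 * s k.1 k.2 w ^+ 2) n).
Proof.
have mes k : measurable_fun [set: g_sigma_algebraType S * R] (fun r => es th n k r.1 r.2).
  have m1 : measurable_fun [set: g_sigma_algebraType S * R] (fun r => th k.1 * s k.1 k.2 r.1 ^+ 2 / b n).
    apply: measurable_funM => //; apply: measurable_funM => //; apply: measurable_funX.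
    by apply: (measurableT_comp (s_S k.1 k.2)).
  apply: measurable_funB; apply: measurable_funM => //.
  by apply: measurable_funX; exact: measurable_snd.
have mZk (k : int * int) : measurable_fun setT (Z k.1 k.2) by exact: mZ.
have := @conditional_chf _ _ _ P _ (fun k => Z k.1 k.2) S mZk S_meas S_setI S_setT indepS _ mes (idx n) (fun=> 1) (idx_uniq n) (@cbmf_cst _ _ R 1).
under [X in X = _ -> _]eq_cE => w do rewrite mul1r -cis_sum.
move=> ->; apply: eq_cE => w; rewrite mul1r; apply: eq_bigr => k _.
rewrite /q /scaled_chf -/mcen.
pose v := th k.1 * s k.1 k.2 w ^+ 2.
pose F (x : R) := v / b n * x ^+ 2 - v / b n * mcen.
have mF : measurable_fun setT F.
  by apply: measurable_funB => //; apply: measurable_funM => //.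
have Zlaw B : measurable B -> P (Z k.1 k.2 @^-1` B) = P (Z 0 0 @^-1` B).
  move=> mB; rewrite -[LHS]fineK ?fin_num_measure //; last exact: mpre.
  by rewrite -[RHS]fineK ?fin_num_measure ?Z_law //; exact: mpre.
have [bc1 _] := bmf_cos mF; have [bs1 _] := bmf_sin mF.
apply: complex_ext => /=.
- have [] := same_law_integral (mZ k.1 k.2) (mZ 0 0) Zlaw bc1; last by [].
  by apply: bmf_int; apply: bmf_cos; exact: measurableT_comp.
- have [] := same_law_integral (mZ k.1 k.2) (mZ 0 0) Zlaw bs1; last by [].
  by apply: bmf_int; apply: bmf_sin; exact: measurableT_comp.
Qed.

(** The correction term is 0 for beta < 1; otherwise the law of large numbers for sigma^2 makes it
    vanish in mean, and exp(i x) - 1 is at most 2 |x| in modulus. *)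
Let centering_gap (th : int -> R) :
  (fun n => cm (cE P (fun w => cis (\sum_(i < p) th (nat_of_ord i).+1%:Z * Y n (nat_of_ord i).+1%:Z w)) -
                cE P (fun w => cis (\sum_(k <- idx n) es th n k w (Z k.1 k.2 w))))) @ \oo --> (0 : R).
Proof.
have [b1|b1] := boolP (beta < 1).
  apply: (cvgn_ext _ (@cvg_cst _ 0 _ _ _)) => n.
  rewrite (@eq_cE _ _ _ _ _ (fun w => cis (\sum_(k <- idx n) es th n k w (Z k.1 k.2 w)))).
    by rewrite subrr cm0.
  move=> w; rewrite -es_sum [X in _ + X]big1 ?addr0 // => i _.
  by rewrite /mcen /centering b1 mulr0 mul0r.
have bgt1 : 1 < beta.
  rewrite lt_neqAle leNgt b1 andbT; apply/eqP => e1; have := alpha2.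
  have -> : alpha = 2 * beta by rewrite /beta; field.
  by rewrite -e1 mulr1 eqxx.
pose X (i : 'I_p) n w := (b n)^-1 * \sum_(t < n) (s (nat_of_ord i).+1%:Z t.+1%:Z w ^+ 2 - \int[P]_w s 0 0 w ^+ 2).
have ip (i : 'I_p) : (1 <= (nat_of_ord i).+1 <= p)%N by rewrite ltn_ord.
have lln i := lln_square (ip i) (nb2 bgt1).
pose co (i : 'I_p) := th (nat_of_ord i).+1%:Z * mcen.
have L : (fun n => 2 * \sum_(i < p) (2 * `|co i|) * \int[P]_w `|X i n w|) @ \oo --> (0 : R).
  rewrite -[X in _ --> X](mulr0 2); apply: cvgM; first exact: cvg_cst.
  rewrite -[X in _ --> X](@big1_eq _ 0 +%R 'I_p (index_enum 'I_p) xpredT).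
  apply: cvgn_sum => i; rewrite -[X in _ --> X](mulr0 (2 * `|co i|)).
  by apply: cvgM; [exact: cvg_cst|exact: (lln i).2].
apply: (squeeze_cvgr _ (@cvg_cst _ 0 _ _ _) L); apply: nearW => n; apply/andP; split; first exact: cm_ge0.
have Is : P.-integrable setT (EFin \o (fun w => \sum_(i < p) (2 * `|co i|) * `|X i n w|)).
  by apply: rint_sum => // i; apply: rintZ => //; exact: (lln i).1.
apply: (@le_trans _ _ (2 * \int[P]_w \sum_(i < p) (2 * `|co i|) * `|X i n w|)); last first.
  rewrite ler_wpM2l // Rintegral_sum //; last by move=> i; apply: rintZ => //; exact: (lln i).1.
  by apply: ler_sum => i _; rewrite RintegralZl //; exact: (lln i).1.
have mes : measurable_fun setT (fun w => \sum_(k <- idx n) es th n k w (Z k.1 k.2 w)).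
  apply: measurable_sum => k; rewrite /es; have mk := ms k.1 k.2; have mZk := mZ k.1 k.2.
  have m1 : measurable_fun setT (fun w => th k.1 * s k.1 k.2 w ^+ 2 / b n).
    by apply: measurable_funM => //; apply: measurable_funM => //; exact: measurable_funX.
  by apply: measurable_funB; apply: measurable_funM => //; exact: measurable_funX.
have mX i : measurable_fun setT (X i n).
  apply: measurable_funM => //; apply: measurable_sum => t.
  by apply: measurable_funB => //; apply: measurable_funX; exact: ms.
apply: cm_cE_dist => //.
- apply: cbmf_cis; rewrite (_ : (fun w => _) = (fun w => \sum_(k <- idx n) es th n k w (Z k.1 k.2 w) + \sum_(i < p) co i * X i n w)).
    by apply: measurable_funD => //; apply: measurable_sum => i; exact: measurable_funM.
  by apply/funext => w; rewrite es_sum.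
- exact: cbmf_cis.
- move=> w; rewrite -es_sum cisD -/(X _ n w).
  set x := \sum_(k <- idx n) _; rewrite (_ : _ - cis x = cis x * (cis (\sum_(i < p) co i * X i n w) - 1)); last by ring.
  rewrite cmM cm_cis mul1r (le_trans (cm_cisB1_le _)) //.
  rewrite (le_trans (ler_wpM2l _ (ler_norm_sum _ _ _))) // mulr_sumr.
  by apply: ler_sum => i _; rewrite normrM mulrA.
Qed.

Let th_chf (th : int -> R) :
  (fun n => cm (cE P (fun w => cis (\sum_(i < p) th (nat_of_ord i).+1%:Z * Y n (nat_of_ord i).+1%:Z w)) -
                \prod_(i < p) cexp (- (salpha%:C * K (th (nat_of_ord i).+1%:Z))))) @ \oo --> (0 : R).
Proof.
have L : (fun n => cm (cE P (fun w => cis (\sum_(i < p) th (nat_of_ord i).+1%:Z * Y n (nat_of_ord i).+1%:Z w)) -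
                cE P (fun w => cis (\sum_(k <- idx n) es th n k w (Z k.1 k.2 w)))) +
   cm (cE P (fun w => \prod_(k <- idx n) q (th k.1 * s k.1 k.2 w ^+ 2) n) -
                cE P (fun w => \prod_(k <- idx n) ex (th k.1) n (s k.1 k.2 w))) +
   cm (cE P (fun w => \prod_(k <- idx n) ex (th k.1) n (s k.1 k.2 w)) -
                \prod_(i < p) cexp (- (salpha%:C * K (th (nat_of_ord i).+1%:Z))))) @ \oo --> (0 : R).
  rewrite -[X in _ --> X]addr0 -[X in _ --> X + _]addr0.
  apply: cvgD; last exact: exponential_limit.
  by apply: cvgD; [exact: centering_gap|exact: product_gap].
apply: (squeeze_cvgr _ (@cvg_cst _ 0 _ _ _) L); apply: nearW => n; apply/andP; split; first exact: cm_ge0.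
rewrite conditioned.
set A := cE P _; set B := cE P _; set D := cE P _; set E := \prod_(i < p) _.
rewrite (_ : A - E = (A - B) + (B - D) + (D - E)); last by ring.
by rewrite (le_trans (cmD _ _)) // lerD2r (le_trans (cmD _ _)).
Qed.

Lemma chf_limit_fixed : exists2 c : R, 0 < c & forall th : int -> R,
  (fun n => cm (cE P (fun w => cis (\sum_(i < p) th (nat_of_ord i).+1%:Z * Y n (nat_of_ord i).+1%:Z w)) -
                \prod_(i < p) cexp (- stable_exponent beta c (th (nat_of_ord i).+1%:Z)))) @ \oo --> (0 : R).
Proof.
exists (salpha * (kappa * c0)); first by rewrite !mulr_gt0.
move=> th; have e1 v : cexp (- (salpha%:C * K v)) = cexp (- stable_exponent beta (salpha * (kappa * c0)) v).
  by congr cexp; congr (- _); apply: complex_ext; rewrite /K /stable_exponent /=; ring.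
have := th_chf th; apply: cvgn_ext => n.
by under [X in cm (_ - X) = _]eq_bigr do rewrite e1.
Qed.

End fixed_argument.

Lemma joint_chf_convergence : exists2 c : R, 0 < c & forall th : int -> R,
  (fun n => cm (cE P (fun w => cis (\sum_(i < p) th (nat_of_ord i).+1%:Z *
      ((a n ^+ 2)^-1 * (\sum_(1 <= t < n.+1) (s (nat_of_ord i).+1%:Z t%:Z w * Z (nat_of_ord i).+1%:Z t%:Z w) ^+ 2 -
       (if alpha < 2 then 0 else n%:R * fine (\int[P]_w ((s 0 0 w * Z 0 0 w) ^+ 2)%:E)))))) -
    \prod_(i < p) cexp (- stable_exponent (alpha / 2) c (th (nat_of_ord i).+1%:Z)))) @ \oo --> (0 : R).
Proof.
have [kappa [e [c0 [C [[k0 c00 C0 ebeta be1] [lim dom sa0 nb2 IW]]]]]] := chf_limit.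
exact: (chf_limit_fixed k0 c00 C0 ebeta be1 lim dom sa0 nb2 IW).
Qed.

End stochastic_volatility.

(** * Tightness and existence of the stable law *)

Section tightness.
Context d (T : measurableType d) (R : realType) (P : probability T R).
Let leb : {sigma_finite_measure set (measurableTypeR R) -> \bar R} := @lebesgue_measure R.

(** For u nonzero the integral is 1 - sin(u) / u, which is at least 1/2 once |u| > 2. *)
Let integral_1mcos (u : R) :
  leb.-integrable `[0, 1] (EFin \o (fun t => 1 - cos (t * u))) /\
  2^-1 * (2 < `|u|)%R%:R <= \int[leb]_(t in `[0, 1]) (1 - cos (t * u)).
Proof.
have c1 : continuous (fun t : R => 1 - cos (t * u)).
  move=> t; apply: continuousB; first exact: cvg_cst.
  apply: (@continuous_comp _ _ _ (fun t : R => t * u) cos); last exact: continuous_cos.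
  by apply: mulrr_continuous.
have [u2|u2] := ltP 2 `|u|; last first.
  split.
    apply: continuous_compact_integrable; first exact: segment_compact.
    exact: continuous_subspaceT.
  rewrite mulr0; apply: Rintegral_ge0 => t _; rewrite subr_ge0; exact: cos_le1.
have u0 : u != 0 by rewrite -normr_gt0; lra.
have [] := @FTC_is_derive R (fun t => 1 - cos (t * u)) (fun t => t - u^-1 * sin (t * u)) 0 1 ltr01.
- move=> t _.
  apply: (is_derive_eq (isdB (isd_id t) (isdZ u^-1 (isd_sin (isdMr u (isd_id t)))))).
  by field.
- by move=> t _; exact: c1.
- move=> It ->; split => //; rewrite mul0r sin0 mulr0 subrr subr0 mul1r mulr1.
  have : `|u^-1 * sin u| <= 2^-1.
    rewrite normrM normfV -[leRHS]mulr1 ler_pM //; last by rewrite ler_norml sin_geN1 sin_le1.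
    by rewrite lef_pV2 ?posrE // ?(ltW u2) //; lra.
  by rewrite ler_norml; lra.
Qed.

(* Levy's truncation inequality, from averaging [1 - cos (t u)] over [0 <= t <= 1]. *)
Lemma tail_le_chf (y : T -> R) (c : R) : measurable_fun setT y -> 0 < c ->
  leb.-integrable `[0, 1] (EFin \o (fun t => 1 - \int[P]_w cos (t * c * y w))) /\
  fine (P [set w | 2 / c < `|y w|]) <= 2 * \int[leb]_(t in `[0, 1]) (1 - \int[P]_w cos (t * c * y w)).
Proof.
move=> my c0.
pose g (p : R * T) : R := 1 - cos (p.1 * c * y p.2).
have mg : measurable_fun [set: measurableTypeR R * T] g.
  have m1 : measurable_fun [set: measurableTypeR R * T] (fun p => p.1 * c * y p.2).
    apply: measurable_funM; first by apply: measurable_funM => //; exact: measurable_fst.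
    by apply: (measurableT_comp my); exact: measurable_snd.
  by have [] := bmfB (bmf_cst _ 1) (bmf_cos m1).
have g0 p : 0 <= g p by rewrite subr_ge0 cos_le1.
have mI : measurable (`[0, 1]%classic : set (measurableTypeR R)) by exact: measurable_itv.
pose f (p : measurableTypeR R * T) : \bar R := ((\1_(`[0, 1]%classic : set R) p.1 : R) * g p)%:E.
have mf : measurable_fun setT f.
  apply/measurable_EFinP; apply: measurable_funM => //.
  have mi : measurable_fun [set: measurableTypeR R] (\1_(`[0, 1]%classic : set R) : measurableTypeR R -> R).
    exact: measurable_indic.
  by apply: (measurableT_comp mi); exact: measurable_fst.
have f0 p : (0 <= f p)%E by rewrite lee_fin mulr_ge0.
have fub := @fubini_tonelli _ _ _ _ R leb P f mf f0.
have inner t : (\int[P]_w f (t, w))%E =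
    ((EFin \o (fun t => 1 - \int[P]_w cos (t * c * y w))) \_ `[0, 1]) t.
{ have bc : bmf (fun w => cos (t * c * y w)) by apply: bmf_cos; exact: measurable_funM.
  rewrite patchE /f /= indicE; case: ifPn => ti; rewrite ?ti ?(negbTE ti) /=; last first.
    by apply: integral0_eq => w _; rewrite mul0r.
  under eq_integral do rewrite mul1r.
  have Ig : P.-integrable setT (EFin \o (fun w => 1 - cos (t * c * y w))).
    by apply: bmf_int; apply: bmfB => //; exact: bmf_cst.
  rewrite -(Rintegral_cstT P 1) -RintegralB //; [|by apply: bmf_int; exact: bmf_cst|exact: bmf_int].
  by rewrite /Rintegral fineK //; exact: integrable_fin_num.
}
have lower : (2^-1%:E * P [set w | (2 / c < `|y w|)%R] <= \int[leb]_t \int[P]_w f (t, w))%E.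
{ rewrite fub.
  have mA : measurable [set w | 2 / c < `|y w|] by apply: gt_measurable; exact: measurableT_comp.
  rewrite -[X in P X]setIT -integral_indic // -ge0_integralZl //.
  2: by apply/measurable_EFinP; exact: measurable_indic.
  apply: ge0_le_integral => //.
  - apply/measurable_EFinP; apply: measurable_funM => //; exact: measurable_indic.
  - exact: (measurable_fun_fubini_tonelli_G (m1 := leb) _ mf f0).
  - move=> w _.
    have [I1 h1] := integral_1mcos (c * y w).
    have -> : (\int[leb]_t f (t, w))%E = (\int[leb]_(t in `[0, 1]) (1 - cos (t * (c * y w))))%:E.
      rewrite /Rintegral fineK; last exact: integrable_fin_num.
      rewrite [RHS]integral_mkcond; apply: eq_integral => t _.
      rewrite patchE /f indicE /g /=; case: ifPn => ti; rewrite ?ti ?(negbTE ti) /= ?mul0r // mul1r mulrA //.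
    rewrite -EFinM lee_fin (le_trans _ h1) // ler_wpM2l // indicE.
    rewrite normrM (gtr0_norm c0) (_ : (w \in _) = (2 / c < `|y w|)); last by apply/idP/idP; rewrite inE.
    by rewrite ltr_pdivrMr // mulrC.
}
have fin : (\int[leb]_t \int[P]_w f (t, w) < +oo)%E.
{ have mG := measurable_fun_fubini_tonelli_F (m2 := P) _ mf f0.
  apply: (@le_lt_trans _ _ (\int[leb]_(t in `[0%R, 1%R]) (cst 2%:E) t)%E); last first.
    by rewrite integral_cst // /leb /= lebesgue_measure_itv /= lte01 -EFinD -EFinM ltry.
  rewrite [leRHS]integral_mkcond; apply: ge0_le_integral => //.
  - by move=> t _; apply: integral_ge0.
  - apply/measurable_restrict => //; exact: measurable_cst.
  - move=> t _; rewrite inner !patchE; case: ifP => // _ /=; rewrite lee_fin.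
    rewrite lerBlDr -lerBlDl.
    suff : - 1 <= \int[P]_w cos (t * c * y w) by lra.
    rewrite -(Rintegral_cstT P (-1)); apply: le_Rintegral => //.
    + by apply: bmf_int; exact: bmf_cst.
    + by apply: bmf_int; apply: bmf_cos; exact: measurable_funM.
    + by move=> w _; exact: cos_geN1.
}
have eqI : (\int[leb]_t \int[P]_w f (t, w) =
    \int[leb]_(t in `[0%R, 1%R]) ((EFin \o (fun t => 1 - \int[P]_w cos (t * c * y w))%R) t))%E.
  by rewrite [RHS]integral_mkcond; apply: eq_integral => t _; rewrite inner.
have h0 t : 0 <= 1 - \int[P]_w cos (t * c * y w).
{ rewrite subr_ge0 -[leRHS](Rintegral_cstT P); apply: le_Rintegral => //.
  - by apply: bmf_int; apply: bmf_cos; exact: measurable_funM.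
  - by apply: bmf_int; exact: bmf_cst.
}
have Ih : leb.-integrable `[0, 1] (EFin \o (fun t => 1 - \int[P]_w cos (t * c * y w))).
{ apply/integrableP; split.
    apply: (@measurable_funS _ _ _ _ setT) => //.
    have mG := measurable_fun_fubini_tonelli_F (m2 := P) _ mf f0.
    apply/measurable_EFinP; apply: measurable_funB => //.
    apply: (@measurable_Rintegral_param _ (measurableTypeR R) _ T R P (fun (t : R) w => cos (t * c * y w))).
      have m1 : measurable_fun [set: measurableTypeR R * T] (fun p => p.1 * c * y p.2).
        apply: measurable_funM; first by apply: measurable_funM => //; exact: measurable_fst.
        by apply: (measurableT_comp my); exact: measurable_snd.
      by have [] := bmf_cos m1.
    by exists 1 => t w; rewrite ler_norml cos_geN1 cos_le1.
  under eq_integral do rewrite gee0_abs ?lee_fin //.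
  by rewrite -eqI.
}
split => //.
rewrite -ler_pdivrMl //.
rewrite eqI -[X in (_ <= X)%E]fineK in lower; last exact: integrable_fin_num.
have fP : P [set w | 2 / c < `|y w|] \is a fin_num.
  by apply: fin_num_measure; apply: gt_measurable; exact: measurableT_comp.
by rewrite -(fineK fP) -EFinM lee_fin in lower.
Qed.

(** Continuity at 0 makes the average of 1 - phi over the scale c = r / 2 at most e / 4, and
    dominated convergence adds another e / 4 for large [n]; the truncation inequality doubles the
    sum. *)
Lemma tight_of_chf (Y : nat -> T -> R) (phi : R -> R) (e : R) :
  (forall n, measurable_fun setT (Y n)) ->
  (forall t, (fun n => \int[P]_w cos (t * Y n w)) @ \oo --> phi t) ->
  phi 0 = 1 -> {for 0, continuous phi} -> 0 < e ->
  exists2 A, 0 < A & \forall n \near \oo, fine (P [set w | A < `|Y n w|]) <= e.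
Proof.
move=> mY lim phi0 cphi e0.
have [r r0 hr] : exists2 r : R, 0 < r & forall t, `|t| < r -> `|1 - phi t| <= e / 4.
  move/cvgrPdist_le : cphi => /(_ (e / 4)); rewrite phi0 => /(_ ltac:(lra)).
  by move=> /nbhs_ballP[r r0 h]; exists r => // t tr; apply: h; rewrite /ball /= sub0r normrN.
pose c := r / 2; have c0 : 0 < c by rewrite /c; lra.
exists (2 / c); first exact: divr_gt0.
have mp (y : T -> R) : measurable_fun setT y ->
    measurable_fun [set: measurableTypeR R] (fun t : R => \int[P]_w cos (t * c * y w)).
{ move=> my.
  apply: (@measurable_Rintegral_param _ (measurableTypeR R) _ T R P (fun (t : R) w => cos (t * c * y w))).
    have m1 : measurable_fun [set: measurableTypeR R * T] (fun p => p.1 * c * y p.2).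
      apply: measurable_funM; first by apply: measurable_funM => //; exact: measurable_fst.
      by apply: (measurableT_comp my); exact: measurable_snd.
    by have [] := bmf_cos m1.
  by exists 1 => t w; rewrite ler_norml cos_geN1 cos_le1.
}
have mI : measurable (`[0, 1]%classic : set (measurableTypeR R)) by exact: measurable_itv.
have I2 k : leb.-integrable `[0, 1] (EFin \o (fun=> k : R)).
  by apply: continuous_compact_integrable; [exact: segment_compact|apply: continuous_subspaceT; exact: cst_continuous].
have ic k : \int[leb]_(t in `[0, 1]) (k : R) = k.
  by rewrite Rintegral_cst // /leb /= lebesgue_measure_itv /= lte01 sube0 /= mulr1.
have [] := @Rintegral_dct _ (measurableTypeR R) R leb `[0, 1] mI
  (fun n t => 1 - \int[P]_w cos (t * c * Y n w)) (fun t => 1 - phi (t * c)) (fun=> 2).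
- move=> n; apply: measurable_funTS; apply: measurable_funB => //; exact: mp.
- apply: measurable_funTS; apply: measurable_funB => //.
  apply: (@measurable_fun_cvg _ (measurableTypeR R) _ _ (fun n (t : R) => \int[P]_w cos (t * c * Y n w))).
    by move=> n; exact: mp.
  by move=> t _; exact: lim.
- by move=> t _; apply: cvgB; [exact: cvg_cst|exact: lim].
- exact: I2.
- apply: nearW => n t _; rewrite (le_trans (ler_normB _ _)) // normr1.
  suff : `|\int[P]_w cos (t * c * Y n w)| <= 1 by lra.
  rewrite -[leRHS](Rintegral_cstT P); apply: norm_Rintegral_le => //.
  + by apply: bmf_int; apply: bmf_cos; exact: measurable_funM.
  + by apply: bmf_int; exact: bmf_cst.
  + by move=> w _; rewrite ler_norml cos_geN1 cos_le1.
- move=> Iphi cv.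
  have le4 : \int[leb]_(t in `[0, 1]) (1 - phi (t * c)) <= e / 4.
    rewrite -(ic (e / 4)); apply: le_Rintegral => // t; rewrite /= in_itv /= => /andP[t0 t1].
    rewrite (le_trans (ler_norm _)) // hr // normrM (ger0_norm t0) (gtr0_norm c0).
    by rewrite (@le_lt_trans _ _ (1 * c)) ?ler_wpM2r ?(ltW c0) // /c; lra.
  move/cvgrPdist_le : cv => /(_ (e / 4) ltac:(lra)); apply: filterS => n.
  have [_ h] := tail_le_chf (mY n) c0.
  by rewrite ler_norml; lra.
Qed.

End tightness.

(** * From distribution functions to a limit law *)

Section abel_sum.
Variables (R : realType) (f : R -> R) (x : nat -> R).

(* Abel-transformed Riemann-Stieltjes sum of [f dG] over the points [x 0 <= ... <= x m]. *)
Definition abel_sum (m : nat) (G : R -> R) : R :=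
  f (x m) * G (x m) - \sum_(j < m) G (x j) * (f (x j.+1) - f (x j)).

Lemma abel_sumS m G : abel_sum m.+1 G = abel_sum m G + f (x m.+1) * (G (x m.+1) - G (x m)).
Proof. by rewrite /abel_sum big_ord_recr /=; ring. Qed.

Variables (e M : R).
Hypothesis ndx : forall j, x j <= x j.+1.
Hypothesis e0 : 0 <= e.
Hypothesis fe : forall j y, x j <= y <= x j.+1 -> `|f y - f (x j.+1)| <= e.
Hypothesis fM : forall y, `|f y| <= M.

(** For the distribution function of the point mass at [y] the sum telescopes to the value of [f] at
    the first grid point not below [y], or to 0 when [y] lies beyond the grid. *)
Lemma abel_sum_point m (y : R) :
  `|f y - abel_sum m (fun c => (y <= c)%R%:R)| <= e + 2 * M * ((y <= x 0%N)%R%:R + (x m < y)%R%:R).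
Proof.
have x0m k : x 0%N <= x k by elim: k => // k IH; exact: le_trans IH (ndx k).
have c : if y <= x 0%N then (abel_sum m (fun c => (y <= c)%R%:R) = f (x 0%N) : Prop)
  else if y <= x m then (`|f y - abel_sum m (fun c => (y <= c)%R%:R)| <= e : Prop)
  else (abel_sum m (fun c => (y <= c)%R%:R) = 0 : Prop).
{ elim: m => [|m IH].
    by rewrite /abel_sum big_ord0 subr0; case: leP => // _; rewrite ?mulr1 ?mulr0.
  rewrite abel_sumS; move: IH; case: (leP y (x 0%N)) => y0.
    by rewrite !(le_trans y0) ?x0m // => ->; rewrite subrr mulr0 addr0.
  case: (leP y (x m)) => ym.
    by rewrite (le_trans ym (ndx m)) subrr mulr0 addr0.
  move=> ->; rewrite add0r subr0; case: leP => yS; last by rewrite mulr0.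
  by rewrite mulr1 fe // (ltW ym).
}
have M2 z z' : `|f z - f z'| <= 2 * M.
  by rewrite (le_trans (ler_normB _ _)) // mulr_natl mulr2n lerD.
have M0 : 0 <= M := le_trans (normr_ge0 _) (fM 0).
move: c; case: (leP y (x 0%N)) => y0 /=.
  move=> ->; rewrite (le_trans (M2 _ _)) // (le_gtF (le_trans y0 (x0m m))).
  by rewrite addr0 mulr1 lerDr.
case: (leP y (x m)) => ym; first by rewrite addr0 mulr0 addr0.
move=> ->; rewrite subr0 (_ : (0 + true%:R : R) = 1) ?add0r // mulr1.
by have h := e0; apply: le_trans (fM _) _; lra.
Qed.

Lemma abel_sum_mean d (T : measurableType d) (P : probability T R) (Y : T -> R) m :
  measurable_fun setT Y -> measurable_fun setT f ->
  `|\int[P]_w f (Y w) - abel_sum m (fun c => fine (P [set w | Y w <= c]))| <=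
  e + 2 * M * (fine (P [set w | Y w <= x 0%N]) + (1 - fine (P [set w | Y w <= x m]))).
Proof.
move=> mY mf.
have mA c : measurable [set w | Y w <= c].
  by rewrite -[X in measurable X]setTI; apply: measurable_fun_le => //; exact: measurable_cst.
pose ind c w : R := (Y w <= c)%R%:R.
have indE0 c : ind c = \1_[set w | Y w <= c].
  apply/funext => w; rewrite /ind indicE; congr (_%:R); congr nat_of_bool.
  by apply/idP/idP; rewrite inE.
have bi c : bmf (ind c) by rewrite indE0; exact: bmf_indic.
have Ii c : P.-integrable setT (EFin \o ind c) by exact: bmf_int.
have Ei c : \int[P]_w ind c w = fine (P [set w | Y w <= c]) by rewrite indE0 Rintegral_indicT.
have -> : abel_sum m (fun c => fine (P [set w | Y w <= c])) =
    \int[P]_w abel_sum m (fun c => ind c w).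
  have Ij j k : P.-integrable setT (EFin \o (fun w => ind (x j) w * k)).
    by under eq_fun do rewrite mulrC; exact: rintZ.
  rewrite /abel_sum RintegralB //; [|exact: rintZ|exact: rint_sum].
  rewrite RintegralZl // Rintegral_sum // Ei; congr (_ - _); apply: eq_bigr => j _.
  by rewrite RintegralZr // Ei.
have <- : \int[P]_w (e + 2 * M * (ind (x 0%N) w + (1 - ind (x m) w))) =
    e + 2 * M * (fine (P [set w | Y w <= x 0%N]) + (1 - fine (P [set w | Y w <= x m]))).
  rewrite RintegralD //.
  2: by apply: bmf_int; exact: bmf_cst.
  2: by apply: bmf_int; apply: bmfM; [exact: bmf_cst|apply: bmfD => //; apply: bmfB => //; exact: bmf_cst].
  rewrite Rintegral_cstT; congr (_ + _).
  have I1 : P.-integrable setT (EFin \o (fun w => 1 - ind (x m) w)).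
    by apply: bmf_int; apply: bmfB => //; exact: bmf_cst.
  rewrite RintegralZl //; last exact: rintD.
  rewrite RintegralD // Ei; congr (_ * (_ + _)).
  rewrite RintegralB //; last by apply: bmf_int; exact: bmf_cst.
  by rewrite Rintegral_cstT Ei.
have bS : bmf (fun w => abel_sum m (fun c => ind c w)).
  apply: bmfB; first by apply: bmfM => //; exact: bmf_cst.
  by apply: bmf_sum => j; apply: bmfM => //; exact: bmf_cst.
apply: dist_Rintegral_le => //.
- by apply: bmf_int; split; [exact: measurableT_comp|exists M].
- exact: bmf_int.
- apply: bmf_int; apply: bmfD; first exact: bmf_cst.
  apply: bmfM; first exact: bmf_cst.
  by apply: bmfD => //; apply: bmfB => //; exact: bmf_cst.
- move=> w _; apply: le_trans (abel_sum_point m (Y w)) _.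
  by rewrite /ind; case: (leP (Y w) (x m)) => _; rewrite ?subrr ?subr0.
Qed.

(** Compares a limit of distribution functions with its right-continuous version, which may differ
    from it at grid points. There the differences are at most the increments of [G] to the next grid
    point, whose total is at most 1. *)
Lemma abel_sum_dist (G G' : R -> R) m : (forall c, 0 <= G c <= 1) ->
  (forall c, G c <= G' c <= 1) -> (forall j, G' (x j) <= G (x j.+1)) ->
  `|abel_sum m G' - abel_sum m G| <= M * (1 - G (x m)) + e.
Proof.
move=> G01 GG' G'x.
have : `|abel_sum m G' - abel_sum m G - f (x m) * (G' (x m) - G (x m))| <= e * (G (x m) - G (x 0%N)).
{ elim: m => [|m IH].
    by rewrite /abel_sum !big_ord0 subrr mulr0 (_ : _ - _ = 0) ?normr0 //; ring.
  rewrite !abel_sumS.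
  rewrite (_ : _ - _ = (abel_sum m G' - abel_sum m G - f (x m) * (G' (x m) - G (x m))) +
    (f (x m) - f (x m.+1)) * (G' (x m) - G (x m))); last by ring.
  rewrite (le_trans (ler_normD _ _)) //.
  rewrite (_ : e * _ = e * (G (x m) - G (x 0%N)) + e * (G (x m.+1) - G (x m))); last by ring.
  apply: lerD => //; rewrite normrM ler_pM //; first by rewrite fe // lexx ndx.
  by have /andP[h1 _] := GG' (x m); rewrite ger0_norm ?subr_ge0 // lerB.
}
have h : `|f (x m) * (G' (x m) - G (x m))| <= M * (1 - G (x m)).
  have /andP[h1 h2] := GG' (x m).
  by rewrite normrM ler_pM // ger0_norm ?subr_ge0 // lerB.
have h3 : e * (G (x m) - G (x 0%N)) <= e.
  have /andP[_ h1] := G01 (x m); have /andP[h2 _] := G01 (x 0%N).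
  by rewrite ler_piMr //; lra.
move: h; rewrite !ler_norml => /andP[h4 h5] /andP[h6 h7]; apply/andP; split; lra.
Qed.

End abel_sum.

Section helly.
Context d (T : measurableType d) (R : realType) (P : probability T R).
Variable Y : nat -> T -> R.
Hypothesis mY : forall n, measurable_fun setT (Y n).
Hypothesis tight : forall e : R, 0 < e ->
  exists2 A, 0 < A & \forall n \near \oo, fine (P [set w | A < `|Y n w|]) <= e.

Let G n c := fine (P [set w | Y n w <= c]).

Let mG n c : measurable [set w | Y n w <= c].
Proof.
by rewrite -[X in measurable X]setTI; apply: measurable_fun_le => //; exact: measurable_cst.
Qed.

Let G01 n c : 0 <= G n c <= 1.
Proof.
rewrite fine_ge0 //=; rewrite -lee_fin fineK ?probability_le1 //.
exact: fin_num_measure.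
Qed.

Let G_nd n : {homo G n : x y / x <= y}.
Proof.
move=> x y xy; rewrite fine_le ?fin_num_measure // le_measure ?inE // => w /= h.
exact: le_trans h xy.
Qed.

(* A limit point of the distribution functions along an ultrafilter refining
   convergence to infinity; its right-continuous version is a distribution function. *)
Lemma law_of_tight_sequence : exists mu : probability (measurableTypeR R) R,
  forall (f : R -> R) (K M L : R), (forall x, `|f x| <= M) ->
  (forall x y, `|f x - f y| <= K * `|x - y|) -> measurable_fun setT f ->
  (fun n => \int[P]_w f (Y n w)) @ \oo --> L -> \int[mu]_x f x = L.
Proof.
have [U [UU ooU]] := ultraFilterLemma (@eventually_filter).
have [F hF] : exists F : R -> R, forall c, G n c @[n --> U] --> F c.
  suff h : forall c, exists l : R, (fun n => G n c) @ U --> l.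
    by have [F hF] := choice h; exists F.
  (* Along an ultrafilter a cluster point is a limit: otherwise the complement of one of its
     neighbourhoods would have its preimage in [U]. *)
  move=> c; have [|l [_ cl]] := @segment_compact R 0 1 ((fun n => G n c) @ U) _.
    rewrite /fmap /= (_ : _ @^-1` _ = setT); first exact: filterT.
    by rewrite -subTset => n _ /=; rewrite in_itv /=.
  exists l => B lB; have [//|h] := in_ultra_setVsetC ((fun n => G n c) @^-1` B) UU.
  by have [z [? ?]] := cl (~` B) B h lB.
have F01 c : 0 <= F c <= 1.
  apply/andP; split.
    by apply: (ler_cvg_to (@cvg_cst _ 0 _ _ _) (hF c)); apply: filterE => n; have /andP[] := G01 n c.
  have c1 : (fun _ : nat => 1 : R) @ U --> (1 : R) by exact: cvg_cst.
  by apply: (ler_cvg_to (hF c) c1); apply: filterE => n; have /andP[] := G01 n c.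
have F_nd : {homo F : x y / x <= y}.
  by move=> x y xy; apply: (ler_cvg_to (hF x) (hF y)); apply: filterE => n; exact: G_nd.
pose Ft c := inf [set F y | y in [set y | c < y]].
have infF c : has_inf [set F y | y in [set y | c < y]].
  split; first by exists (F (c + 1)), (c + 1) => //=; rewrite ltrDl.
  by exists 0 => _ [y _ <-]; have /andP[] := F01 y.
have Ft_le c y : c < y -> Ft c <= F y.
  by move=> cy; apply: ge_inf; [have [] := infF c|exists y].
have F_le c : F c <= Ft c.
  apply: lb_le_inf; first by have [] := infF c.
  by move=> _ [y /= cy <-]; apply: F_nd; exact: ltW.
have Ft_nd : {homo Ft : x y / x <= y}.
  move=> x y xy; apply: lb_le_inf; first by have [] := infF y.
  by move=> _ [z /= yz <-]; apply: Ft_le; exact: le_lt_trans xy yz.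
have Ft_rc x : Ft @ x^'+ --> Ft x.
  apply/cvgrPdist_le => e e0.
  have [_ [y /= xy <-] hy] := inf_adherent e0 (infF x).
  near=> z.
  have xz : x < z by near: z; exact: nbhs_right_gt.
  have zy : z < y by near: z; exact: nbhs_right_lt.
  have h1 := Ft_nd _ _ (ltW xz); have h2 := Ft_le _ _ zy.
  by rewrite distrC ger0_norm ?subr_ge0 // -/(Ft x) in hy *; lra.
(* The margin 2 leaves room to pass from [Ft (- B)] to [F] at a strictly larger point that is still
   below minus the tightness level. *)
have tails e : 0 < e -> exists2 A, 0 < A & forall B, A <= B -> Ft (- B) <= e /\ 1 - F B <= e.
{ move=> e0; have [A A0 hA] := tight e0.
  have hU : \forall n \near U, fine (P [set w | A < `|Y n w|]) <= e by exact: ooU.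
  have mA n : measurable [set w | A < `|Y n w|] by apply: gt_measurable; exact: measurableT_comp.
  exists (A + 2); first lra.
  move=> B AB; split.
    apply: (le_trans (Ft_le _ (- (A + 1)) _)); first lra.
    have ce : (fun _ : nat => e) @ U --> e by exact: cvg_cst.
    apply: (ler_cvg_to (hF _) ce); apply: filterS hU => n; apply: le_trans.
    rewrite fine_le ?fin_num_measure // le_measure ?inE // => w /= h.
    have := ler_norm (- Y n w); rewrite normrN; lra.
  have ce : (fun _ : nat => e) @ U --> e by exact: cvg_cst.
  have c1 : (fun n => 1 - G n B) @ U --> 1 - F B by apply: cvgB; [exact: cvg_cst|exact: hF].
  apply: (ler_cvg_to c1 ce).
  apply: filterS hU => n; apply: le_trans; rewrite /=.
  have -> : 1 - G n B = fine (P (~` [set w | Y n w <= B])).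
    by rewrite probability_setC //= fineB ?fin_num_measure.
  have mC : measurable (~` [set w | Y n w <= B]) by exact: measurableC.
  rewrite fine_le ?fin_num_measure // le_measure ?inE // => w /negP; rewrite -ltNge /= => h.
  by apply: lt_le_trans (ler_norm _); lra.
}
have Ft01 c : 0 <= Ft c <= 1.
  have /andP[h1 _] := F01 c; have /andP[_ h2] := F01 (c + 1).
  have h3 := F_le c; have h4 : Ft c <= F (c + 1) by apply: Ft_le; lra.
  by apply/andP; split; lra.
have FtNy : Ft @ -oo --> (0 : R).
  apply/cvgrPdist_le => e e0; have [A A0 hA] := tails _ e0.
  exists (- A); split; first exact: num_real.
  move=> z zA; have [h _] := hA (- z) ltac:(lra); rewrite opprK in h.
  by have /andP[h1 _] := Ft01 z; rewrite sub0r normrN ger0_norm.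
have Fty : Ft @ +oo --> (1 : R).
  apply/cvgrPdist_le => e e0; have [A A0 hA] := tails _ e0.
  exists A; split; first exact: num_real.
  move=> z zA; have [_ h] := hA z (ltW zA); have := F_le z.
  by have /andP[_ h1] := Ft01 z; rewrite ger0_norm ?subr_ge0 //; lra.
pose C1 := isCumulative.Build R _ R Ft Ft_nd Ft_rc.
pose C2 := isCumulativeBounded.Build R 0 1 Ft FtNy Fty.
pose Fc : cumulativeBounded (0 : R) (1 : R) := HB.pack Ft C1 C2.
pose mu : probability (measurableTypeR R) R := lebesgue_stieltjes_measure Fc.
have muE c : fine (mu [set x | x <= c]) = Ft c.
  have := cdf_lebesgue_stieltjes_id Fc c.
  rewrite /cdf /distribution /pushforward /= => h.
  rewrite (_ : [set x | x <= c] = `]-oo, c]%classic); last by apply/seteqP; split => x; rewrite /= in_itv.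
  by have := congr1 fine h.
exists mu => f K M L fM fK mf lim.
have M0 : 0 <= M := le_trans (normr_ge0 _) (fM 0).
have K0 : 0 <= K by have := le_trans (normr_ge0 _) (fK 1 0); rewrite subr0 normr1 mulr1.
(* Three comparisons are made on a grid where [f] oscillates by at most e: the sequence with the sum
   for [F] and [mu] with the sum for [Ft], at e + 4 M e each, and the two sums with each other, at e
   + M e. *)
suff h : forall e, 0 < e -> `|\int[mu]_x f x - L| <= (3 + 9 * M) * e.
  apply/eqP; rewrite -subr_eq0 -normr_le0; apply/ler_addgt0Pl => e e0; rewrite addr0.
  apply: le_trans (h (e / (3 + 9 * M)) _) _; first by apply: divr_gt0 => //; lra.
  by rewrite mulrC divfK //; lra.
move=> e e0; have [A A0 hA] := tails _ e0.
pose h := e / (K + 1); have h0 : 0 < h by apply: divr_gt0 => //; lra.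
pose x j := - A + j%:R * h.
pose m := (Num.truncn (2 * A / h)).+1.
have xm : A <= x m.
  rewrite /x; suff : 2 * A <= m%:R * h by lra.
  by rewrite -ler_pdivrMr // ltW // truncnS_gt.
have xS j : x j.+1 = x j + h by rewrite /x mulrSr mulrDl mul1r addrA.
have ndx j : x j <= x j.+1 by rewrite xS lerDl ltW.
have fe j y : x j <= y <= x j.+1 -> `|f y - f (x j.+1)| <= e.
  rewrite xS => /andP[h1 h2]; apply: le_trans (fK _ _) _.
  apply: (@le_trans _ _ (K * h)).
    by rewrite ler_wpM2l // ler_norml; apply/andP; split; lra.
  by rewrite /h mulrA ler_pdivrMr; [|lra]; rewrite mulrC ler_wpM2l ?(ltW e0) //; lra.
have e0' := ltW e0.
have [hA1 hA2] := hA A (lexx _); have [_ hA3] := hA _ xm.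
have x0 : x 0%N = - A by rewrite /x mul0r addr0.
have FA : F (- A) <= e by apply: le_trans (F_le _) hA1.
have d1 : `|L - abel_sum f x m F| <= e + 2 * M * (F (x 0%N) + (1 - F (x m))).
{ have c1 : (fun n => \int[P]_w f (Y n w) - abel_sum f x m (G n)) @ U --> L - abel_sum f x m F.
    apply: cvgB; first by apply: cvg_trans lim; exact: cvg_app.
    apply: cvgB; first by apply: cvgM; [exact: cvg_cst|exact: hF].
    have c0 k : (fun n => \sum_(j < k) G n (x j) * (f (x j.+1) - f (x j))) @ U -->
        \sum_(j < k) F (x j) * (f (x j.+1) - f (x j)).
    {
      elim: k => [|k IH].
        by under eq_fun do rewrite big_ord0; rewrite big_ord0; exact: cvg_cst.
      under eq_fun do rewrite big_ord_recr /=; rewrite big_ord_recr /=.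
      by apply: cvgD => //; apply: cvgM; [exact: hF|exact: cvg_cst].
    }
    exact: c0.
  have c2 : (fun n => e + 2 * M * (G n (x 0%N) + (1 - G n (x m)))) @ U -->
      e + 2 * M * (F (x 0%N) + (1 - F (x m))).
    apply: cvgD; first exact: cvg_cst.
    apply: cvgM; first exact: cvg_cst.
    apply: cvgD; first exact: hF.
    by apply: cvgB; [exact: cvg_cst|exact: hF].
  apply: (ler_cvg_to (cvg_norm c1) c2); apply: filterE => n.
  exact: (abel_sum_mean ndx e0' fe fM P m (mY n) mf).
}
have d2 : `|abel_sum f x m Ft - abel_sum f x m F| <= M * (1 - F (x m)) + e.
  apply: (abel_sum_dist ndx e0' fe fM m F01).
    by move=> c; rewrite F_le; have /andP[_ ->] := Ft01 c.
  by move=> j; apply: Ft_le; rewrite xS ltrDl.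
have d3 := abel_sum_mean ndx e0' fe fM mu m (@measurable_id _ (measurableTypeR R) setT) mf.
have eG : (fun c => fine (mu [set x | x <= c])) = Ft by apply/funext => c; exact: muE.
rewrite /= eG !muE in d3.
have b1 : 2 * M * (F (x 0%N) + (1 - F (x m))) <= 4 * M * e.
  rewrite x0 (_ : 4 * M * e = 2 * M * (2 * e)); last by ring.
  by rewrite ler_wpM2l //; [lra|lra].
have b2 : 2 * M * (Ft (x 0%N) + (1 - Ft (x m))) <= 4 * M * e.
  rewrite x0 (_ : 4 * M * e = 2 * M * (2 * e)); last by ring.
  by have h1 := F_le (x m); apply: ler_wpM2l; lra.
have b3 : M * (1 - F (x m)) <= M * e by rewrite ler_wpM2l.
move: d1 d2 d3; rewrite !ler_norml => /andP[? ?] /andP[? ?] /andP[? ?].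
by apply/andP; split; lra.
Unshelve. all: by end_near.
Qed.

End helly.

(** * Independent copies of a law *)

Section iid_copies.
Variables (R : realType) (mu : probability (measurableTypeR R) R).

(** Induction by products with [mu]. Coordinates are indexed by all naturals so that their type does
    not vary with [n]; only the first [n] are constrained. *)
Let iid_copies_nat (n : nat) :
  exists (d : measure_display) (T : measurableType d) (Q : probability T R) (xi : nat -> T -> R),
    (forall i, measurable_fun setT (xi i)) /\
    forall B : nat -> set R, (forall i, measurable (B i)) ->
    fine (Q (\bigcap_(i in `I_n) (xi i @^-1` B i))) = \prod_(i < n) fine (mu (B i)).
Proof.
elim: n => [|n [d [T [Q [xi [mxi hxi]]]]]].
  exists _, (measurableTypeR R), mu, (fun _ _ => 0); split=> [i|B mB]; first exact: measurable_cst.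
  by rewrite big_ord0 II0 bigcap_set0 probability_setT.
exists _, (T * measurableTypeR R)%type, (Q \x mu)%E,
  (fun i p => if (i < n)%N then xi i p.1 else p.2); split=> [i|B mB].
  by case: (i < n)%N; [apply: (measurableT_comp (mxi i)); exact: measurable_fst|exact: measurable_snd].
have mC : measurable (\bigcap_(i in `I_n) (xi i @^-1` B i)).
  apply: fin_bigcap_measurable => [|i _]; first exact: finite_II.
  by rewrite -[X in measurable X]setTI; exact: mxi.
rewrite (_ : \bigcap_(i in _) _ = (\bigcap_(i in `I_n) (xi i @^-1` B i)) `*` B n); last first.
  apply/seteqP; split => -[w z] /=.
    move=> h; split; last by have := h n (ltnSn n); rewrite /= ltnn.
    by move=> i /= iN; have := h i (ltnW iN : (i < n.+1)%N); rewrite /= iN.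
  move=> [h1 h2] i /=; rewrite ltnS leq_eqVlt => /predU1P[->|iN]; first by rewrite ltnn.
  by rewrite iN; exact: h1.
have h := @product_measure1E _ _ T (measurableTypeR R) R Q mu _ (B n) mC (mB n).
transitivity (fine (Q (\bigcap_(i in `I_n) (xi i @^-1` B i)) * mu (B n))%E); first by congr fine; exact: h.
rewrite fineM ?fin_num_measure //; last exact: mB.
by rewrite hxi // big_ord_recr.
Qed.

Lemma iid_copies (p : nat) :
  exists (d : measure_display) (T : measurableType d) (Q : probability T R) (xi : 'I_p -> T -> R),
    (forall i, measurable_fun setT (xi i)) /\
    forall B : 'I_p -> set R, (forall i, measurable (B i)) ->
    fine (Q (\bigcap_(i in setT) (xi i @^-1` B i))) = \prod_(i < p) fine (mu (B i)).
Proof.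
have [d [T [Q [xi [mxi hxi]]]]] := iid_copies_nat p.
exists d, T, Q, (fun i => xi i); split=> [i|B mB]; first exact: mxi.
pose B' k := if insub k is Some i then B i else setT.
have B'E (i : 'I_p) : B' i = B i by rewrite /B' valK.
have mB' k : measurable (B' k) by rewrite /B'; case: insubP.
rewrite -(eq_bigr _ (fun i _ => congr1 (fun A => fine (mu A)) (B'E i))) -hxi //.
congr (fine (Q _)); apply/seteqP; split => w h k /=.
  by move=> kp; have := h (Ordinal kp) I; rewrite /= -B'E.
by move=> _; have := h k (ltn_ord k); rewrite /= B'E.
Qed.

End iid_copies.

Section independent_family.
Context d (T : measurableType d) (R : realType) (Q : probability T R).
Variables (mu : probability (measurableTypeR R) R) (p : nat) (xi : 'I_p -> T -> R).
Hypothesis mxi : forall i, measurable_fun setT (xi i).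
Hypothesis hxi : forall B : 'I_p -> set R, (forall i, measurable (B i)) ->
  fine (Q (\bigcap_(i in setT) (xi i @^-1` B i))) = \prod_(i < p) fine (mu (B i)).

Lemma iid_marginal i (B : set R) : measurable B -> Q (xi i @^-1` B) = mu B.
Proof.
move=> mB; have mxB : measurable (xi i @^-1` B) by rewrite -[X in measurable X]setTI; exact: mxi.
rewrite -[LHS]fineK ?fin_num_measure // -[RHS]fineK ?fin_num_measure //; congr EFin.
pose B' j := if j == i then B else setT.
have mB' j : measurable (B' j) by rewrite /B'; case: ifP.
have := hxi mB'; rewrite (bigD1 i) //= {2}/B' eqxx big1 ?mulr1; last first.
  by move=> j ji; rewrite /B' (negbTE ji) probability_setT.
move=> <-; congr (fine (Q _)); apply/seteqP; split => w /=.
  by move=> h j _ /=; rewrite /B'; case: eqP => // ->.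
by move=> /(_ i I); rewrite /= /B' eqxx.
Qed.

Lemma iid_integral i (f : R -> R) : bmf (f : measurableTypeR R -> R) ->
  \int[Q]_w f (xi i w) = \int[mu]_x f x.
Proof.
move=> bf; have If : mu.-integrable setT (EFin \o f) by exact: bmf_int.
have [mf [M fM]] := bf.
have Ifx : Q.-integrable (xi i @^-1` setT) (EFin \o f \o xi i).
  by rewrite preimage_setT; apply: bmf_int; split; [exact: measurableT_comp|exists M].
have mEf : measurable_fun [set: measurableTypeR R] (EFin \o f) by exact/measurable_EFinP.
have := @integral_pushforward _ _ _ (measurableTypeR R) R (xi i) (mxi i) Q setT _ mEf Ifx measurableT.
rewrite preimage_setT /Rintegral => h; congr fine; rewrite -[LHS]h.
apply: eq_measure_integral; first exact: mxi.
by move=> mx A mA _; have h1 := iid_marginal i mA; exact: h1.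
Qed.

(** The conditioning lemma with the trivial pi-system [[set setT]], where it reduces to
    factorization by independence. *)
Lemma iid_joint_chf (th : 'I_p -> R) :
  cE Q (fun w => cis (\sum_(i < p) th i * xi i w)) =
  \prod_(i < p) cE Q (fun w => cis (th i * xi i w)).
Proof.
have mpre i B : measurable B -> measurable (xi i @^-1` B).
  by move=> mB; rewrite -[X in measurable X]setTI; exact: mxi.
have indep (l : seq 'I_p) (B : 'I_p -> set R) (E : set T) : uniq l ->
    (forall k, measurable (B k)) -> [set setT] E ->
    fine (Q (\bigcap_(k in [set k | k \in l]) (xi k @^-1` B k) `&` E)) =
    (\prod_(k <- l) fine (Q (xi k @^-1` B k))) * fine (Q E).
{ move=> ul mB ->; rewrite setIT probability_setT mulr1.
  pose B' k := if k \in l then B k else setT.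
  have mB' k : measurable (B' k) by rewrite /B'; case: ifP.
  rewrite (_ : \bigcap_(k in _) _ = \bigcap_(k in setT) (xi k @^-1` B' k)); last first.
    apply/seteqP; split => w h k /=.
      by move=> _; rewrite /B'; case: ifPn => // kl; exact: h.
    by move=> kl; have := h k I; rewrite /= /B' kl.
  rewrite (hxi mB') (big_uniq _ ul) [RHS]big_mkcond /=; apply: eq_bigr => k _.
  rewrite /B'; case: ifP => _; first by rewrite iid_marginal.
  by rewrite probability_setT.
}
have Sm : [set setT] `<=` @measurable _ T by move=> _ ->.
have SI : setI_closed [set [set: T]] by move=> _ _ -> ->; rewrite setIT.
have := @conditional_chf _ T R Q _ xi [set setT] mxi Sm SI erefl indep
  (fun i _ z => th i * z) _ (index_enum 'I_p) (fun=> 1) (index_enum_uniq _) (cbmf_cst _ _).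
move=> h.
transitivity (cE Q (fun w => 1 * \prod_(k <- index_enum 'I_p) cis (th k * xi k w))).
  by apply: eq_cE => w; rewrite mul1r cis_sum.
rewrite h; first by rewrite cE_cst mul1r.
move=> k; apply: measurable_funM; first exact: measurable_cst.
exact: measurable_snd.
Qed.

End independent_family.

(** * Trigonometric approximation and weak convergence *)

Section trigonometric_polynomials.
Variables (R : realType) (I : finType).
Implicit Types (g h : (I -> R) -> R) (x : I -> R).

(** A term packs amplitude [u.1.1], frequency vector [u.1.2] and shift [u.2]. Shifts let cosines
    stand for sines as well, and product-to-sum formulas then close the class under
    multiplication. *)
Definition phase (u : R * (I -> R) * R) x := \sum_i u.1.2 i * x i + u.2.

Definition trig_sum (s : seq (R * (I -> R) * R)) x := \sum_(u <- s) u.1.1 * cos (phase u x).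

Definition trig_poly g := exists s, forall x, g x = trig_sum s x.

Lemma trig_poly_ext g h : g =1 h -> trig_poly g -> trig_poly h.
Proof. by move=> gh [s gs]; exists s => x; rewrite -gh. Qed.

Lemma trig_poly_cst (c : R) : trig_poly (fun=> c).
Proof.
exists [:: (c, fun=> 0, 0)] => x; rewrite /trig_sum big_seq1 /phase big1 /= => [|i _]; last by rewrite mul0r.
by rewrite addr0 cos0 mulr1.
Qed.

Lemma trig_polyD g h : trig_poly g -> trig_poly h -> trig_poly (fun x => g x + h x).
Proof. by move=> [s gs] [t ht]; exists (s ++ t) => x; rewrite /trig_sum big_cat -/(trig_sum _ _) -gs -/(trig_sum _ _) -ht. Qed.

Lemma trig_polyM g h : trig_poly g -> trig_poly h -> trig_poly (fun x => g x * h x).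
Proof.
move=> [s gs] [t ht].
exists ([seq (2^-1 * (u.1.1 * v.1.1), fun i => u.1.2 i + v.1.2 i, u.2 + v.2) | u <- s, v <- t] ++
        [seq (2^-1 * (u.1.1 * v.1.1), fun i => u.1.2 i - v.1.2 i, u.2 - v.2) | u <- s, v <- t]) => x.
rewrite gs ht /trig_sum big_cat !big_allpairs_dep /= big_distrlr /= -big_split /=.
apply: eq_bigr => u _; rewrite -big_split /=; apply: eq_bigr => v _.
have -> : phase (2^-1 * (u.1.1 * v.1.1), fun i => u.1.2 i + v.1.2 i, u.2 + v.2) x = phase u x + phase v x.
  rewrite /phase /= addrACA -big_split /=; congr (_ + _); apply: eq_bigr => i _; exact: mulrDl.
have -> : phase (2^-1 * (u.1.1 * v.1.1), fun i => u.1.2 i - v.1.2 i, u.2 - v.2) x = phase u x - phase v x.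
  rewrite /phase /= opprD addrACA -sumrN -big_split /=; congr (_ + _); apply: eq_bigr => i _.
  by rewrite mulrBl.
by rewrite (cosD (phase u x) (phase v x)) (cosB (phase u x) (phase v x)); field.
Qed.

Lemma trig_poly_sum (J : Type) (s : seq J) (g : J -> (I -> R) -> R) :
  (forall j, trig_poly (g j)) -> trig_poly (fun x => \sum_(j <- s) g j x).
Proof.
move=> tg; elim: s => [|j s IH].
  by apply: trig_poly_ext (trig_poly_cst 0) => x; rewrite big_nil.
by apply: trig_poly_ext (trig_polyD (tg j) IH) => x; rewrite big_cons.
Qed.

Lemma trig_poly_prod (J : Type) (s : seq J) (g : J -> (I -> R) -> R) :
  (forall j, trig_poly (g j)) -> trig_poly (fun x => \prod_(j <- s) g j x).
Proof.
move=> tg; elim: s => [|j s IH].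
  by apply: trig_poly_ext (trig_poly_cst 1) => x; rewrite big_nil.
by apply: trig_poly_ext (trig_polyM (tg j) IH) => x; rewrite big_cons.
Qed.

Lemma trig_poly_sin (i : I) (c : R) : trig_poly (fun x => sin (c * x i)).
Proof.
exists [:: (1, fun j => if j == i then c else 0, - (pi / 2))] => x.
rewrite /trig_sum big_seq1 /phase (bigD1 i) //= eqxx big1 => [|j /negbTE ->]; last by rewrite mul0r.
by rewrite addr0 mul1r cosB cos_pihalf sin_pihalf mulr0 add0r mulr1.
Qed.

Lemma trig_poly_meas d (T : measurableType d) g (X : I -> T -> R) : trig_poly g ->
  (forall i, measurable_fun setT (X i)) -> bmf (fun w => g (X ^~ w)).
Proof.
move=> [s gs] mX; have -> : (fun w => g (X ^~ w)) = (fun w => trig_sum s (X ^~ w)).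
  by apply/funext => w; exact: gs.
apply: bmf_sum => u; apply: bmfM; first exact: bmf_cst.
apply: bmf_cos; apply: measurable_funD; last exact: measurable_cst.
by apply: measurable_sum => i; apply: measurable_funM.
Qed.

End trigonometric_polynomials.

(** * Bernstein polynomials *)

Section bernstein.
Variable R : realType.

(* The Bernstein basis polynomial [C(n, k) x^k (1 - x)^(n - k)], by Pascal's rule. *)
Fixpoint bern (n k : nat) (x : R) : R :=
  if n is n'.+1 then
    x * (if k is k'.+1 then bern n' k' x else 0) + (1 - x) * bern n' k x
  else (k == 0%N)%:R.

Lemma bern_ge0 n k x : 0 <= x <= 1 -> 0 <= bern n k x.
Proof.
move=> /andP[x0 x1]; elim: n k => [|n IH] k /=; first exact: ler0n.
by apply: addr_ge0; apply: mulr_ge0; rewrite ?subr_ge0 //; case: k.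
Qed.

Lemma bern_gt n k x : (n < k)%N -> bern n k x = 0.
Proof.
elim: n k => [|n IH] [|k] //= nk; by rewrite !IH ?mulr0 ?addr0 // ltnW.
Qed.

Lemma bern_sumS n (g : nat -> R) x :
  \sum_(k < n.+2) g k * bern n.+1 k x =
  x * \sum_(k < n.+1) g k.+1 * bern n k x + (1 - x) * \sum_(k < n.+1) g k * bern n k x.
Proof.
rewrite /=; under eq_bigr do rewrite mulrDr.
rewrite big_split /=; congr (_ + _).
  rewrite big_ord_recl /= !mulr0 add0r mulr_sumr; apply: eq_bigr => k _ /=.
  by rewrite mulrCA.
rewrite big_ord_recr /= bern_gt // !mulr0 addr0 mulr_sumr; apply: eq_bigr => k _.
by rewrite mulrCA.
Qed.

Lemma bern_sum1 n x : \sum_(k < n.+1) bern n k x = 1.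
Proof.
suff : \sum_(k < n.+1) 1 * bern n k x = 1 by under eq_bigr do rewrite mul1r.
elim: n => [|n IH]; first by rewrite big_ord1 mul1r.
rewrite (bern_sumS n (fun=> 1)) IH; ring.
Qed.

(** Second moment of a binomial variable about an arbitrary point: squared bias plus variance. The
    free centre [c] lets the induction absorb the shift of [k]. *)
Lemma bern_square n c x :
  \sum_(k < n.+1) (k%:R - c) ^+ 2 * bern n k x = (n%:R * x - c) ^+ 2 + n%:R * (x * (1 - x)).
Proof.
elim: n c => [|n IH] c; first by rewrite big_ord1 /=; ring.
rewrite (bern_sumS n (fun k => (k%:R - c) ^+ 2)) IH.
have -> : \sum_(k < n.+1) (k.+1%:R - c) ^+ 2 * bern n k x = \sum_(k < n.+1) (k%:R - (c - 1)) ^+ 2 * bern n k x.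
  by apply: eq_bigr => k _; rewrite -natr1 opprB addrA addrAC.
by rewrite IH -[n.+1%:R]natr1; ring.
Qed.

Lemma trig_poly_bern (I : finType) n k (u : (I -> R) -> R) : trig_poly u ->
  trig_poly (fun x => bern n k (u x)).
Proof.
move=> tu; elim: n k => [|n IH] k /=; first exact: trig_poly_cst.
apply: trig_polyD; apply: trig_polyM => //.
  by case: k => [|k]; [exact: trig_poly_cst|exact: IH].
apply: trig_poly_ext (trig_polyD (trig_poly_cst _ 1) (trig_polyM (trig_poly_cst _ (-1)) tu)) => x.
by rewrite mulN1r.
Qed.

Section multivariate.
Variables (I : finType) (n : nat) (u : I -> R).
Hypothesis u01 : forall i, 0 <= u i <= 1.

Definition bern_weight (k : {ffun I -> 'I_n.+1}) : R := \prod_i bern n (k i) (u i).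

Lemma bern_weight_ge0 k : 0 <= bern_weight k.
Proof. by apply: prodr_ge0 => i _; exact: bern_ge0. Qed.

Lemma bern_weight_sum1 : \sum_k bern_weight k = 1.
Proof. by rewrite -(bigA_distr_bigA (fun i (k : 'I_n.+1) => bern n k (u i))) big1 // => i _; exact: bern_sum1. Qed.

(** The weights are products, so the coordinates other than [i] sum to 1 and leave the binomial
    variance n u (1 - u). *)
Lemma bern_weight_square i :
  \sum_(k : {ffun I -> 'I_n.+1}) ((k i)%:R - n%:R * u i) ^+ 2 * bern_weight k <= n%:R / 4.
Proof.
pose F j (k : 'I_n.+1) := (if j == i then (k%:R - n%:R * u i) ^+ 2 else 1) * bern n k (u j).
have -> : \sum_(k : {ffun I -> 'I_n.+1}) ((k i)%:R - n%:R * u i) ^+ 2 * bern_weight k = \sum_(k : {ffun I -> 'I_n.+1}) \prod_j F j (k j).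
  apply: eq_bigr => k _; rewrite /F big_split /=; congr (_ * _).
  by rewrite (bigD1 i) //= eqxx big1 ?mulr1 // => j /negbTE ->.
rewrite -bigA_distr_bigA (bigD1 i) //= [X in _ * X]big1 ?mulr1; last first.
  by move=> j /negbTE ji; rewrite /F ji; under eq_bigr do rewrite mul1r; exact: bern_sum1.
rewrite /F eqxx bern_square subrr expr0n /= add0r ler_wpM2l //.
by have := sqr_ge0 (u i - 2^-1); rewrite sqrrB; lra.
Qed.

(** Chebyshev's argument: nodes near n u contribute [e], and the squared deviation pays for the
    distant ones. *)
Lemma bern_approx (F : {ffun I -> 'I_n.+1} -> R) (y e C : R) : 0 <= C ->
  (forall k, `|F k - y| <= e + C * \sum_i ((k i)%:R - n%:R * u i) ^+ 2) ->
  `|\sum_k F k * bern_weight k - y| <= e + C * (#|I|%:R * (n%:R / 4)).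
Proof.
move=> C0 hF.
have yE : y = \sum_k y * bern_weight k by rewrite -mulr_sumr bern_weight_sum1 mulr1.
rewrite {1}yE -sumrB.
rewrite (le_trans (ler_norm_sum _ _ _)) //.
apply: (@le_trans _ _ (\sum_(k : {ffun I -> 'I_n.+1}) (e + C * \sum_i ((k i)%:R - n%:R * u i) ^+ 2) * bern_weight k)).
  apply: ler_sum => k _; rewrite -mulrBl normrM (ger0_norm (bern_weight_ge0 k)).
  by rewrite ler_wpM2r ?bern_weight_ge0.
under eq_bigr do rewrite mulrDl -mulrA mulr_suml.
rewrite big_split /= -mulr_sumr bern_weight_sum1 mulr1 lerD2l -mulr_sumr ler_wpM2l //.
rewrite exchange_big /= (@le_trans _ _ (\sum_(i : I) n%:R / 4)) //.
  by apply: ler_sum => i _; exact: bern_weight_square.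
by rewrite sumr_const -[leLHS]mulr_natl.
Qed.

Lemma bern_bound (F : {ffun I -> 'I_n.+1} -> R) (M : R) : (forall k, `|F k| <= M) ->
  `|\sum_k F k * bern_weight k| <= M.
Proof.
move=> FM; rewrite (le_trans (ler_norm_sum _ _ _)) // -[leRHS]mulr1 -bern_weight_sum1 mulr_sumr.
apply: ler_sum => k _; rewrite normrM (ger0_norm (bern_weight_ge0 k)).
by rewrite ler_wpM2r ?bern_weight_ge0.
Qed.

End multivariate.
End bernstein.

Section trigonometric_approximation.
Variables (R : realType) (p : nat) (f : 'rV[R]_p -> R).
Hypothesis cf : continuous f.

(** Compactness of the cube. Only [v] is confined to it; [v'] may lie outside. *)
Lemma unif_continuous_cube (B e : R) : 0 < e -> exists2 h : R, 0 < h &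
  forall v v' : 'rV[R]_p, (forall i, `|v ord0 i| <= B) -> (forall i, `|v ord0 i - v' ord0 i| < h) ->
  `|f v - f v'| <= e.
Proof.
move=> e0; pose K := [set v : 'rV[R]_p | forall i, `[- B, B]%classic (v ord0 i)].
have cK : compact K by apply: (@rV_compact R p (fun=> `[- B, B]%classic)) => i; exact: segment_compact.
have /compact_near_coveringP/(_ R (0^'+)%classic
  (fun h v => forall v' : 'rV[R]_p, (forall i, `|v ord0 i - v' ord0 i| < h) -> `|f v - f v'| <= e) _) := cK.
case.
- move=> v _; have e2 : 0 < e / 2 by lra.
  have cv : f @ v --> f v by exact: cf.
  move/cvgrPdist_le : cv => /(_ _ e2)/nbhs_ballP[r /= r0 hr].
  have r2 : 0 < r / 2 by lra.
  exists (ball v (r / 2), [set h | h < r / 2]).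
    split => /=; first exact: nbhsx_ballx.
    exact: nbhs_right_lt.
  move=> [v1 h] /= [bv1 hh] v' hv'.
  have h1 : `|f v - f v1| <= e / 2.
    by apply: hr; apply: le_ball bv1; lra.
  have h2 : `|f v - f v'| <= e / 2.
    apply: hr; rewrite [r]splitr; apply: ball_triangle bv1 _; split=> // i j.
    by rewrite /ball /= ord1; exact: lt_trans (hv' j) hh.
  by rewrite (le_trans (ler_distD (f v) _ _)) // [`|f v1 - _|]distrC; lra.
- move=> h0 /= h00 hK; exists (h0 / 2) => /=; first lra.
  move=> v v' vB vv'; apply: (hK (h0 / 2)) => //.
  + by rewrite /ball /= sub0r normrN gtr0_norm; lra.
  + lra.
  + by move=> i; rewrite /= in_itv /= -ler_norml.
Qed.

Lemma trig_approx (M A e : R) : (forall v, `|f v| <= M) -> 0 < A -> 0 < e ->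
  exists q : ('I_p -> R) -> R, trig_poly q /\ (forall x, `|q x| <= M) /\
    forall x, (forall i, `|x i| <= A) -> `|q x - f (\row_i x i)| <= e.
Proof.
move=> fM A0 e0; have M0 : 0 <= M := le_trans (normr_ge0 _) (fM 0).
have e3 : 0 < e / 3 by lra.
have [h h0 fh] := unif_continuous_cube A e3.
(* On the cube of half-side A the map B sin(x / B) moves each coordinate by at most x^2 / B, which
   this choice keeps below h. *)
pose B := A + 2 * A ^+ 2 / h.
have B0 : 0 < B.
  by have := divr_ge0 (mulr_ge0 (ler0n R 2) (sqr_ge0 A)) (ltW h0); rewrite /B; lra.
have [h' h'0 fh'] := unif_continuous_cube B e3.
(* A node of the grid on [-B, B] differs from its target by h' or more only if |k - n u| >= n h' /
   (2 B); the trivial error 2 M is then at most [C n] times the squared deviation. *)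
pose C (n : nat) := 2 * M * (2 * B / (n%:R * h')) ^+ 2.
have C0 n : 0 <= C n by rewrite /C; apply: mulr_ge0; [lra|exact: sqr_ge0].
have [n n0 Cn] : exists2 n, (0 < n)%N & C n * (#|'I_p|%:R * (n%:R / 4)) <= e / 3.
{ pose D := 2 * M * (2 * B / h') ^+ 2 * (p%:R / 4).
  have D0 : 0 <= D.
    apply: mulr_ge0; last by apply: divr_ge0.
    by apply: mulr_ge0; [lra|exact: sqr_ge0].
  exists (Num.truncn (D / (e / 3))).+1 => //; set n := _.+1.
  have n0 : (0 : R) < n%:R by rewrite ltr0n.
  have -> : C n * (#|'I_p|%:R * (n%:R / 4)) = D / n%:R.
    by rewrite /C /D card_ord; field; rewrite !gt_eqF.
  by rewrite ler_pdivrMr // mulrC -ler_pdivrMr // ltW // truncnS_gt. }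
have n0R : (0 : R) < n%:R by rewrite ltr0n.
pose u (x : 'I_p -> R) i := (1 + sin (B^-1 * x i)) / 2.
have u01 x i : 0 <= u x i <= 1.
  by have := sin_geN1 (B^-1 * x i); have := sin_le1 (B^-1 * x i); rewrite /u; lra.
pose F (k : {ffun 'I_p -> 'I_n.+1}) := f (\row_i (B * (2 * (k i)%:R / n%:R - 1))).
exists (fun x => \sum_k F k * bern_weight (u x) k); split; last split.
- apply: trig_poly_sum => k; apply: trig_polyM; first exact: trig_poly_cst.
  apply: trig_poly_prod => i; apply: trig_poly_bern.
  apply: trig_polyM; last exact: trig_poly_cst.
  by apply: trig_polyD; [exact: trig_poly_cst|exact: trig_poly_sin].
- by move=> x; apply: bern_bound => k; [exact: u01|exact: fM].
- move=> x xA; pose y := f (\row_i (B * sin (B^-1 * x i))).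
  have xy : `|y - f (\row_i x i)| <= e / 3.
  { rewrite distrC; apply: fh => i; rewrite !mxE //.
    have -> : x i - B * sin (B^-1 * x i) = - (B * (sin (B^-1 * x i) - B^-1 * x i)).
      by field; rewrite gt_eqF.
    rewrite normrN normrM (gtr0_norm B0) (@le_lt_trans _ _ (B * (B^-1 * x i) ^+ 2)) //.
      by rewrite ler_wpM2l ?(ltW B0) // norm_sinB_le.
    have -> : B * (B^-1 * x i) ^+ 2 = x i ^+ 2 / B by field; rewrite gt_eqF.
    rewrite ltr_pdivrMr // -real_normK ?num_real //.
    apply: (@le_lt_trans _ _ (A ^+ 2)); first by rewrite ler_sqr ?nnegrE // ltW.
    rewrite /B mulrDr [h * (_ / h)]mulrC divfK ?gt_eqF //.
    by have := exprn_gt0 2 A0; have := mulr_gt0 h0 A0; lra.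
  }
  suff qy : `|\sum_k F k * bern_weight (u x) k - y| <= e / 3 + C n * (#|'I_p|%:R * (n%:R / 4)).
    by rewrite (le_trans (ler_distD y _ _)) //; lra.
  apply: (bern_approx (u01 x) (C0 n)) => k.
  have S0 : 0 <= \sum_i ((k i)%:R - n%:R * u x i) ^+ 2 by apply: sumr_ge0 => i _; exact: sqr_ge0.
  have gap i : (\row_i (B * sin (B^-1 * x i))) ord0 i - (\row_i (B * (2 * (k i)%:R / n%:R - 1))) ord0 i =
      - (2 * B / n%:R * ((k i)%:R - n%:R * u x i)).
    by rewrite !mxE /u; field; rewrite gt_eqF.
  have [small|/existsNP[i /negP]] := pselect (forall i, `|2 * B / n%:R * ((k i)%:R - n%:R * u x i)| < h').
  { rewrite distrC (@le_trans _ _ (e / 3)) //; last by rewrite lerDl; exact: mulr_ge0 (C0 n) S0.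
    apply: fh' => i; last by rewrite gap normrN.
    rewrite mxE normrM (gtr0_norm B0) ler_piMr ?(ltW B0) //.
    by rewrite ler_norml sin_geN1 sin_le1. }
  rewrite -leNgt => big.
  rewrite (@le_trans _ _ (2 * M)) //.
    by rewrite (le_trans (ler_normB _ _)) // mulr_natl mulr2n lerD ?fM.
  rewrite (@le_trans _ _ (C n * ((k i)%:R - n%:R * u x i) ^+ 2)) //; last first.
    rewrite (@le_trans _ _ (C n * \sum_i ((k i)%:R - n%:R * u x i) ^+ 2)) //; last by lra.
    by rewrite ler_wpM2l // (bigD1 i) //= lerDl sumr_ge0 // => j _; exact: sqr_ge0.
  have -> : C n * ((k i)%:R - n%:R * u x i) ^+ 2 =
      2 * M * (`|2 * B / n%:R * ((k i)%:R - n%:R * u x i)| ^+ 2 / h' ^+ 2).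
    by rewrite real_normK ?num_real // /C; field; rewrite !gt_eqF.
  rewrite ler_peMr //; first by lra.
  by rewrite ler_pdivlMr ?exprn_gt0 // mul1r ler_sqr ?nnegrE // ltW.
Qed.

(** A pointwise limit of trigonometric polynomials in the coordinates, which are plainly
    measurable. *)
Lemma measurable_row d (T : measurableType d) (X : 'I_p -> T -> R) (M : R) :
  (forall v, `|f v| <= M) -> (forall i, measurable_fun setT (X i)) ->
  measurable_fun setT (fun w => f (\row_i X i w)).
Proof.
move=> fM mX.
have [q hq] := choice (fun n : nat => trig_approx fM (ltr0Sn R n) (divr_gt0 ltr01 (ltr0Sn R n))).
apply: (@measurable_fun_cvg _ _ _ _ (fun n w => q n (X ^~ w))).
  by move=> n; have [tq _] := hq n; have [] := trig_poly_meas tq mX.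
move=> w _; apply/cvgrPdist_le => e e0.
near=> n; rewrite distrC; have [_ [_ hn]] := hq n; apply: le_trans (hn _ _) _.
  move=> i; apply: (@le_trans _ _ (\sum_j `|X j w|)).
    by rewrite (bigD1 i) //= lerDl sumr_ge0.
  by near: n; exists (Num.truncn (\sum_j `|X j w|)) => // n /= hn'; rewrite ltW // (lt_le_trans (truncnS_gt _)) // ler_nat ltnS.
rewrite ler_pdivrMr // -ler_pdivrMl // mulr1.
near: n; exists (Num.truncn e^-1) => // n /= hn'; rewrite ltW // (lt_le_trans (truncnS_gt _)) // ler_nat ltnS //.
Unshelve. all: by end_near.
Qed.

End trigonometric_approximation.

(** * From characteristic functions to convergence in distribution *)

Section weak_convergence.
Context d (T : measurableType d) d' (T' : measurableType d') (R : realType).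
Variables (P : probability T R) (Q : probability T' R) (p : nat).
Variables (Y : nat -> 'I_p -> T -> R) (xi : 'I_p -> T' -> R).
Hypothesis mY : forall n i, measurable_fun setT (Y n i).
Hypothesis mxi : forall i, measurable_fun setT (xi i).
Hypothesis chf : forall th : 'I_p -> R,
  (fun n => cm (cE P (fun w => cis (\sum_i th i * Y n i w)) -
    cE Q (fun w => cis (\sum_i th i * xi i w)))) @ \oo --> (0 : R).
Hypothesis tightY : forall i (e : R), 0 < e ->
  exists2 A, 0 < A & \forall n \near \oo, fine (P [set w | A < `|Y n i w|]) <= e.
Hypothesis tightxi : forall i (e : R), 0 < e ->
  exists2 A, 0 < A & fine (Q [set w | A < `|xi i w|]) <= e.

Let measurable_linear d0 (U : measurableType d0) (X : 'I_p -> U -> R) (th : 'I_p -> R) :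
  (forall i, measurable_fun setT (X i)) -> measurable_fun setT (fun w => \sum_i th i * X i w).
Proof. by move=> mX; apply: measurable_sum => i; apply: measurable_funM. Qed.

Let trig_poly_cvg (q : ('I_p -> R) -> R) : trig_poly q ->
  (fun n => \int[P]_w q (fun i => Y n i w)) @ \oo --> \int[Q]_w q (fun i => xi i w).
Proof.
have cos_phase d0 (U : measurableType d0) (V : probability U R) (X : 'I_p -> U -> R) u :
    (forall i, measurable_fun setT (X i)) ->
    \int[V]_w cos (phase u (fun i => X i w)) =
    cos u.2 * complex.Re (cE V (fun w => cis (\sum_i u.1.2 i * X i w))) -
    sin u.2 * complex.Im (cE V (fun w => cis (\sum_i u.1.2 i * X i w))).
{ move=> mX; have mL := measurable_linear u.1.2 mX.
  rewrite /= -!RintegralZl //; [|by apply: bmf_int; exact: bmf_sin|by apply: bmf_int; exact: bmf_cos].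
  rewrite -RintegralB //; [|by apply: rintZ => //; apply: bmf_int; exact: bmf_cos|by apply: rintZ => //; apply: bmf_int; exact: bmf_sin].
  by apply: eq_Rintegral => w _; rewrite /phase cosD mulrC [sin u.2 * _]mulrC.
}
have trig_mean d0 (U : measurableType d0) (V : probability U R) (X : 'I_p -> U -> R) s :
    (forall i, measurable_fun setT (X i)) ->
    \int[V]_w trig_sum s (fun i => X i w) =
    \sum_(u <- s) u.1.1 * \int[V]_w cos (phase u (fun i => X i w)).
{ move=> mX; have Ic u : V.-integrable setT (EFin \o (fun w => cos (phase u (fun i => X i w)))).
    apply: bmf_int; apply: bmf_cos; apply: measurable_funD => //.
    exact: measurable_linear.
  rewrite /trig_sum Rintegral_sum //; last by move=> u; exact: rintZ.
  by apply: eq_bigr => u _; rewrite RintegralZl.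
}
have part (g : R[i] -> R) (th : 'I_p -> R) : (forall z u, `|g z - g u| <= cm (z - u)) ->
    (fun n => g (cE P (fun w => cis (\sum_i th i * Y n i w)))) @ \oo -->
    g (cE Q (fun w => cis (\sum_i th i * xi i w))).
{ move=> hg; apply/cvgrPdist_le => e e0.
  have /cvgrPdist_le/(_ _ e0) := chf th; apply: filterS => n.
  rewrite sub0r normrN ger0_norm ?cm_ge0 // => h; rewrite distrC; exact: le_trans (hg _ _) h.
}
move=> [s qs].
rewrite (_ : (fun n => _) = (fun n => \sum_(u <- s) u.1.1 * \int[P]_w cos (phase u (fun i => Y n i w)))); last first.
  by apply/funext => n; rewrite -trig_mean //; apply: eq_Rintegral => w _; exact: qs.
rewrite (_ : Rintegral _ _ _ = \sum_(u <- s) u.1.1 * \int[Q]_w cos (phase u (fun i => xi i w))); last first.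
  by rewrite -trig_mean //; apply: eq_Rintegral => w _; exact: qs.
apply: cvgn_sum => u; apply: cvgM; first exact: cvg_cst.
rewrite (cos_phase _ _ _ _ _ mxi) (_ : (fun n => _) = (fun n =>
    cos u.2 * complex.Re (cE P (fun w => cis (\sum_i u.1.2 i * Y n i w))) -
    sin u.2 * complex.Im (cE P (fun w => cis (\sum_i u.1.2 i * Y n i w))))); last first.
  by apply/funext => n; rewrite cos_phase.
apply: cvgB; (apply: cvgM; first exact: cvg_cst).
- by apply: (part (@complex.Re R)) => z z'; rewrite -ReB; exact: Re_le_cm.
- by apply: (part (@complex.Im R)) => z z'; rewrite -ImB; exact: Im_le_cm.
Qed.

Let approx_mean d0 (U : measurableType d0) (V : probability U R) (X : 'I_p -> U -> R)
    (f : 'rV[R]_p -> R) (q : ('I_p -> R) -> R) (M A e : R) :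
  (forall i, measurable_fun setT (X i)) ->
  measurable_fun setT (fun w => f (\row_i X i w)) -> bmf (fun w => q (fun i => X i w)) ->
  0 <= e -> (forall v, `|f v| <= M) -> (forall x, `|q x| <= M) ->
  (forall x, (forall i, `|x i| <= A) -> `|q x - f (\row_i x i)| <= e) ->
  `|\int[V]_w q (fun i => X i w) - \int[V]_w f (\row_i X i w)| <=
  e + 2 * M * \sum_i fine (V [set w | A < `|X i w|]).
Proof.
move=> mX mf bq e0 fM qM qf.
have M0 : 0 <= M := le_trans (normr_ge0 _) (fM 0).
have mA i : measurable [set w | A < `|X i w|] by apply: gt_measurable; exact: measurableT_comp.
pose h w : R := e + 2 * M * \sum_i \1_[set w | A < `|X i w|] w.
have bS : bmf (fun w => \sum_i (\1_[set w | A < `|X i w|] w : R)).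
  by apply: bmf_sum => i; exact: bmf_indic.
have bh : bmf h by apply: bmfD; [exact: bmf_cst|apply: bmfM => //; exact: bmf_cst].
have -> : e + 2 * M * \sum_i fine (V [set w | A < `|X i w|]) = \int[V]_w h w.
  rewrite /h RintegralD //.
  2: by apply: bmf_int; exact: bmf_cst.
  2: by apply: bmf_int; apply: bmfM => //; exact: bmf_cst.
  rewrite Rintegral_cstT RintegralZl //; last exact: bmf_int.
  rewrite Rintegral_sum //; last by move=> i; apply: bmf_int; exact: bmf_indic.
  by congr (_ + _ * _); apply: eq_bigr => i _; rewrite Rintegral_indicT.
apply: dist_Rintegral_le => //; try exact: bmf_int.
  by apply: bmf_int; split => //; exists M.
move=> w _; rewrite /h.
have [small|/existsNP[i /negP]] := pselect (forall i, `|X i w| <= A).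
  apply: le_trans (qf _ small) _; rewrite lerDl mulr_ge0 // ?mulr_ge0 //.
  by apply: sumr_ge0 => i _; rewrite indicE ler0n.
rewrite -ltNge => big; rewrite (@le_trans _ _ (2 * M)) //.
  by rewrite (le_trans (ler_normB _ _)) // mulr_natl mulr2n lerD.
apply: (@le_trans _ _ (e + 2 * M * 1)); first by lra.
rewrite lerD2l ler_wpM2l ?mulr_ge0 // (bigD1 i) //= indicE mem_set //=.
by rewrite lerDl sumr_ge0 // => j _; rewrite indicE ler0n.
Qed.

Lemma weak_cvg (f : 'rV[R]_p -> R) : continuous f -> (exists M, forall v, `|f v| <= M) ->
  (fun n => \int[P]_w f (\row_i Y n i w)) @ \oo --> \int[Q]_w f (\row_i xi i w).
Proof.
move=> cf [M fM]; have M0 : 0 <= M := le_trans (normr_ge0 _) (fM 0).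
apply/cvgrPdist_le => eps eps0.
(* The approximation costs e (1 + 2 M p) on each side, and the convergence for the trigonometric
   polynomial costs e. *)
pose e := eps / (3 + 4 * M * p%:R).
have k0 : 0 < 3 + 4 * M * p%:R by have := mulr_ge0 M0 (ler0n R p); lra.
have e0 : 0 < e by apply: divr_gt0.
have [A1 hA1] := choice (fun i => let: ex_intro2 A A0 h := tightY i e0 in ex_intro (fun A => 0 < A /\ \forall n \near \oo, fine (P [set w | A < `|Y n i w|]) <= e) A (conj A0 h)).
have [A2 hA2] := choice (fun i => let: ex_intro2 A A0 h := tightxi i e0 in ex_intro (fun A => 0 < A /\ fine (Q [set w | A < `|xi i w|]) <= e) A (conj A0 h)).
pose A := 1 + \sum_i (A1 i + A2 i).
have s0 (i : 'I_p) : 0 <= A1 i + A2 i by have [? _] := hA1 i; have [? _] := hA2 i; lra.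
have A0 : 0 < A by rewrite /A ltr_wpDr ?ltr01 // sumr_ge0.
have AA i : A1 i <= A /\ A2 i <= A.
  have h : A1 i + A2 i <= \sum_i (A1 i + A2 i).
    by rewrite (bigD1 i) //= lerDl sumr_ge0 // => j _; exact: s0.
  by have [? _] := hA1 i; have [? _] := hA2 i; rewrite /A; split; lra.
have [q [tq [qM qf]]] := trig_approx cf fM A0 e0.
have tail d0 (U : measurableType d0) (V : probability U R) (X : U -> R) (B : R) :
    measurable_fun setT X -> B <= A -> fine (V [set w | B < `|X w|]) <= e ->
    fine (V [set w | A < `|X w|]) <= e.
  move=> mX BA; apply: le_trans.
  have mC C : measurable [set w | C < `|X w|] by apply: gt_measurable; exact: measurableT_comp.
  by rewrite fine_le ?fin_num_measure // le_measure ?inE // => w /= h; exact: le_lt_trans BA h.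
have bd (g : 'I_p -> R) : (forall i, g i <= e) -> e + 2 * M * \sum_i g i <= e * (1 + 2 * M * p%:R).
  move=> ge; rewrite (_ : e * _ = e + 2 * M * (p%:R * e)); last by ring.
  rewrite lerD2l ler_wpM2l ?mulr_ge0 //.
  rewrite (@le_trans _ _ (\sum_(i < p) e)) //; first by apply: ler_sum.
  by rewrite sumr_const card_ord mulr_natl.
have bY n : (forall i, fine (P [set w | A1 i < `|Y n i w|]) <= e) ->
    `|\int[P]_w q (fun i => Y n i w) - \int[P]_w f (\row_i Y n i w)| <= e * (1 + 2 * M * p%:R).
{ move=> h; apply: le_trans (approx_mean _ _ _ _ (ltW e0) fM qM qf) _ => //.
  - exact: measurable_row fM _.
  - exact: trig_poly_meas.
  - by apply: bd => i; apply: tail (h i) => //; have [] := AA i.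
}
have bxi : `|\int[Q]_w q (fun i => xi i w) - \int[Q]_w f (\row_i xi i w)| <= e * (1 + 2 * M * p%:R).
{ apply: le_trans (approx_mean _ _ _ _ (ltW e0) fM qM qf) _ => //.
  - exact: measurable_row fM _.
  - exact: trig_poly_meas.
  - by apply: bd => i; have [_ h] := hA2 i; apply: tail h => //; have [] := AA i.
}
have /cvgrPdist_le/(_ _ e0) := trig_poly_cvg tq.
have hY : \forall n \near \oo, forall i, fine (P [set w | A1 i < `|Y n i w|]) <= e.
  by apply: filter_forall => i; have [] := hA1 i.
apply: filterS2 hY => n /bY h1 h2.
have eE : eps = e * (3 + 4 * M * p%:R) by rewrite /e divfK // gt_eqF.
rewrite eE.
have -> : e * (3 + 4 * M * p%:R) = e * (1 + 2 * M * p%:R) + (e + e * (1 + 2 * M * p%:R)) by ring.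
move: h1 h2 bxi; rewrite !ler_norml => /andP[? ?] /andP[? ?] /andP[? ?].
by apply/andP; split; lra.
Qed.

End weak_convergence.

Section iid_limit.
Context d (T : measurableType d) (R : realType) (P : probability T R).
Variables (p : nat) (Y : nat -> 'I_p -> T -> R) (phi : R -> R[i]).
Hypothesis p0 : (0 < p)%N.
Hypothesis mY : forall n i, measurable_fun setT (Y n i).
Hypothesis phi0 : phi 0 = 1.
Hypothesis cphi : {for 0, continuous (fun t => complex.Re (phi t))}.
Hypothesis chf : forall th : 'I_p -> R,
  (fun n => cm (cE P (fun w => cis (\sum_i th i * Y n i w)) - \prod_i phi (th i))) @ \oo --> (0 : R).

(** Frequencies vanish off coordinate [i], where [phi 0 = 1] trivializes the other factors. *)
Let marginal_chf i t : (fun n => cm (cE P (fun w => cis (t * Y n i w)) - phi t)) @ \oo --> (0 : R).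
Proof.
apply: (cvgn_ext _ (chf (fun j => if j == i then t else 0))) => n; congr cm; congr (_ - _).
  apply: eq_cE => w; congr cis; rewrite (bigD1 i) //= eqxx big1 ?addr0 // => j /negbTE ->.
  by rewrite mul0r.
by rewrite (bigD1 i) //= eqxx big1 ?mulr1 // => j /negbTE ->.
Qed.

Let marginal_cvg (g : R[i] -> R) i t : (forall z u, `|g z - g u| <= cm (z - u)) ->
  (fun n => g (cE P (fun w => cis (t * Y n i w)))) @ \oo --> g (phi t).
Proof.
move=> hg; apply/cvgrPdist_le => e e0.
have /cvgrPdist_le/(_ _ e0) := marginal_chf i t; apply: filterS => n.
rewrite sub0r normrN ger0_norm ?cm_ge0 // => h; rewrite distrC; exact: le_trans (hg _ _) h.
Qed.

Let Re_lip (z u : R[i]) : `|complex.Re z - complex.Re u| <= cm (z - u).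
Proof. by rewrite -ReB; exact: Re_le_cm. Qed.

Let Im_lip (z u : R[i]) : `|complex.Im z - complex.Im u| <= cm (z - u).
Proof. by rewrite -ImB; exact: Im_le_cm. Qed.

Let Re_phi0 : complex.Re (phi 0) = 1. Proof. by rewrite phi0. Qed.

Let tight i (e : R) : 0 < e ->
  exists2 A, 0 < A & \forall n \near \oo, fine (P [set w | A < `|Y n i w|]) <= e.
Proof.
apply: (tight_of_chf (fun n => mY n i) _ Re_phi0 cphi) => t.
exact: marginal_cvg.
Qed.

(** The common law is built from one coordinate, which exists since [p] is positive. Sines and
    cosines are bounded and Lipschitz, so its characteristic function is [phi], and independent
    copies then have the limiting joint one. *)
Lemma weak_cvg_iid :
  exists (d' : measure_display) (T' : measurableType d') (Q : probability T' R) (xi : 'I_p -> T' -> R),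
    [/\ forall i, measurable_fun setT (xi i),
     forall B : 'I_p -> set R, (forall i, measurable (B i)) ->
       fine (Q (\bigcap_(i in setT) (xi i @^-1` B i))) = \prod_(i < p) fine (Q (xi i @^-1` B i)),
     forall i t, cE Q (fun w => cis (t * xi i w)) = phi t &
     forall f : 'rV[R]_p -> R, continuous f -> (exists M, forall v, `|f v| <= M) ->
       (fun n => \int[P]_w f (\row_i Y n i w)) @ \oo --> \int[Q]_w f (\row_i xi i w)].
Proof.
pose i0 := Ordinal p0.
have [mu hmu] := law_of_tight_sequence (fun n => mY n i0) (tight i0).
have mlin t : measurable_fun setT (fun x : R => t * x) by exact: measurable_funM.
have mu_chf t : \int[mu]_x cos (t * x) = complex.Re (phi t) /\ \int[mu]_x sin (t * x) = complex.Im (phi t).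
{ split.
  - apply: (hmu (fun x => cos (t * x)) `|t| 1).
    + by move=> x; rewrite ler_norml cos_geN1 cos_le1.
    + by move=> x y; rewrite (le_trans (cos_lip _ _)) // -mulrBr normrM.
    + by have [] := bmf_cos (mlin t).
    + exact: (@marginal_cvg (@complex.Re R) i0 t Re_lip).
  - apply: (hmu (fun x => sin (t * x)) `|t| 1).
    + by move=> x; rewrite ler_norml sin_geN1 sin_le1.
    + by move=> x y; rewrite (le_trans (sin_lip _ _)) // -mulrBr normrM.
    + by have [] := bmf_sin (mlin t).
    + exact: (@marginal_cvg (@complex.Im R) i0 t Im_lip).
}
have [d' [T' [Q [xi [mxi hxi]]]]] := iid_copies mu p.
have xi_chf i t : cE Q (fun w => cis (t * xi i w)) = phi t.
  have [h1 h2] := mu_chf t; apply: complex_ext => /=.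
    by rewrite (iid_integral mxi hxi i (f := fun x => cos (t * x))) //; exact: bmf_cos.
  by rewrite (iid_integral mxi hxi i (f := fun x => sin (t * x))) //; exact: bmf_sin.
exists d', T', Q, xi; split=> //.
  by move=> B mB; rewrite hxi //; apply: eq_bigr => i _; rewrite (iid_marginal mxi hxi).
apply: weak_cvg => //.
- move=> th; rewrite (iid_joint_chf mxi hxi) (eq_bigr _ (fun i _ => xi_chf i (th i))).
  exact: chf.
- move=> i e e0.
  have cQ t : (fun _ : nat => \int[Q]_w cos (t * xi i w)) @ \oo --> complex.Re (phi t).
    by rewrite -(xi_chf i) /=; exact: cvg_cst.
  (* Tightness of a single law, read as tightness of a constant sequence. *)
  have [A A0 [N _ hN]] := tight_of_chf (fun _ : nat => mxi i) cQ Re_phi0 cphi e0.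
  by exists A => //; exact: (hN N (leqnn N)).
Qed.

End iid_limit.

(** * The stable characteristic function and the conclusion *)

Section stable_characteristic_function.
Local Open Scope complex_scope.
Variables (R : realType) (beta c : R).
Hypotheses (beta0 : 0 < beta) (c0 : 0 < c).

Let phi t : R[i] := cexp (- stable_exponent beta c t).

Lemma stable_chfE t :
  let th := 0 * t + c * (Num.sg t * `|t| `^ beta) * tan (pi * beta / 2) in
  phi t = (expR (- c * `|t| `^ beta) * cos th) +i* (expR (- c * `|t| `^ beta) * sin th).
Proof. by apply: complex_ext; rewrite /phi ?Re_cexp ?Im_cexp /= mul0r add0r opprK mulNr. Qed.

Lemma stable_chf0 : phi 0 = 1.
Proof. by rewrite /phi stable_exponent0 // oppr0 cexp0. Qed.

(** The exponent is O(|t|^beta) and the exponential is 3-Lipschitz on the left half-plane, which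
    gives the constant [D] and a Holder modulus at 0. *)
Lemma stable_chf_continuous : {for 0, continuous (fun t => complex.Re (phi t))}.
Proof.
pose D := 3 * (c * (1 + `|tan (pi * beta / 2)|)).
have D0 : 0 < D by rewrite !mulr_gt0 // ltr_wpDr.
have bd t : `|complex.Re (phi 0) - complex.Re (phi t)| <= D * `|t| `^ beta.
  rewrite -ReB (le_trans (Re_le_cm _)) // cmC stable_chf0 -cexp0 (le_trans (cexp_lip _ _)) //.
    by rewrite /= oppr_le0 mulr_ge0 ?powR_ge0 // ltW.
  rewrite subr0 cmN /D -mulrA ler_wpM2l // (le_trans (cm_le _)) //= normrN.
  rewrite [leRHS](_ : _ = c * `|t| `^ beta + c * `|t| `^ beta * `|tan (pi * beta / 2)|); last by ring.
  rewrite lerD //; first by rewrite ger0_norm // mulr_ge0 ?powR_ge0 // ltW.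
  rewrite !normrM (gtr0_norm c0) (ger0_norm (powR_ge0 _ _)) ler_wpM2r // ler_wpM2l ?(ltW c0) //.
  by rewrite ler_piMl ?powR_ge0 // normr_sg lern1 leq_b1.
apply/cvgrPdist_le => e e0; have eD : 0 < e / D by exact: divr_gt0.
apply/nbhs_ballP; exists ((e / D) `^ beta^-1) => /=; first exact: powR_gt0.
move=> t; rewrite /ball /= sub0r normrN => /ltW h.
apply: le_trans (bd t) _; rewrite mulrC -ler_pdivlMr //.
apply: (@le_trans _ _ (((e / D) `^ beta^-1) `^ beta)).
  by apply: ge0_ler_powR; rewrite ?nnegrE ?powR_ge0 // ltW.
by rewrite -powRrM mulVf ?gt_eqF // powRr1 // ltW.
Qed.

End stable_characteristic_function.

Unset Implicit Arguments.

Theorem theorem3p2 (d : measure_display) (T : measurableType d) (R : realType)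
  (P : probability T R) (Z sigma : int -> int -> {RV P >-> R}) (p : nat)
  (alpha delta eps : R) (rate : nat -> R) (a : nat -> R) :
  (* standing assumptions of the stochastic volatility model *)
  (forall i t w, 0 <= sigma i t w) ->
  strictly_stationary P (fun i t => sigma i t) ->
  ergodic P (fun i t => sigma i t) ->
  iid_indep_of P (fun i t => Z i t) (fun i t => sigma i t) ->
  (0 < p)%N ->
  (* (1) *)
  0 < alpha < 4 -> alpha != 2 ->
  regularly_varying P (Z 0 0) alpha ->
  (* (2) *)
  0 < delta ->
  strongly_mixing_rate P (fun i t => sigma i t) p rate ->
  cvg (series (fun h => rate h `^ (delta / (2 + delta))) @ \oo) ->
  (* (3) *)
  0 < eps ->
  (\int[P]_w ((sigma 0 0 w) `^ (2 * Num.max (2 + delta) (alpha + eps)))%:E < +oo)%E ->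
  (* normalizing sequence *)
  (fun n => n%:R * fine (P [set w | a n < `|sigma 0 0 w * Z 0 0 w|])) @ \oo --> (1 : R) ->
  let X := fun i t w => sigma i t w * Z i t w in
  let S := fun (i : int) (n : nat) w => \sum_(1 <= t < n.+1) (X i t%:Z w) ^+ 2 in
  let c := fun n : nat =>
    if alpha < 2 then 0 else n%:R * fine (\int[P]_w ((X 0 0 w) ^+ 2)%:E) in
  exists (d' : measure_display) (T' : measurableType d') (Q : probability T' R)
         (xi : 'I_p -> T' -> R),
    iid_stable_right Q xi (alpha / 2) /\
    cvg_in_distribution P Q
      (fun n w => \row_(i < p) ((a n ^+ 2)^-1 * (S (i.+1)%:Z n w - c n))) xi.
Proof.
move=> s0 stat _ indep p0 alpha04 alpha2 RV delta0 mixing summable eps0 moment na X S c.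
have [kappa kappa0 chf] := joint_chf_convergence
  (fun i t => measurable_funPT (sigma i t)) (fun i t => measurable_funPT (Z i t))
  s0 stat indep alpha04 alpha2 RV delta0 mixing summable eps0 moment na.
have beta0 : 0 < alpha / 2 by case/andP: alpha04 => ? _; rewrite divr_gt0.
pose Y n (i : 'I_p) w := (a n ^+ 2)^-1 * (S (i.+1)%:Z n w - c n).
have mY n i : measurable_fun setT (Y n i).
  apply: measurable_funM => //; apply: measurable_funB => //.
  by apply: measurable_sum => t; apply: measurable_funX; exact: measurable_funM.
pose phi t := cexp (- stable_exponent (alpha / 2) kappa t).
have chfY (th : 'I_p -> R) :
    (fun n => cm (cE P (fun w => cis (\sum_i th i * Y n i w)) - \prod_i phi (th i))) @ \oo --> (0 : R).
  (* Extends the frequencies to integers: the predecessor undoes the shift from ordinals to rows 1,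
     ..., p, and the value 0 off this range is a default. *)
  pose th' (z : int) := if insub (absz z).-1 is Some i then th i else 0.
  have th'E (i : 'I_p) : th' i.+1%:Z = th i by rewrite /th' /= valK.
  apply: (cvgn_ext _ (chf th')) => n; congr (cm (_ - _)).
    by apply: eq_cE => w; congr cis; apply: eq_bigr => i _; rewrite th'E.
  by apply: eq_bigr => i _; rewrite th'E.
have [d' [T' [Q [xi [mxi hxi xi_chf xi_cvg]]]]] :=
  weak_cvg_iid p0 mY (stable_chf0 kappa beta0) (stable_chf_continuous beta0 kappa0) chfY.
exists d', T', Q, xi; split; last exact: xi_cvg.
split=> //; split=> //; exists kappa, 0; split=> // i t /=.
by have := xi_chf i t; rewrite stable_chfE => -[].
Qed.
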